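(* 1. For any real idempotent window ${\sf h}\,\sharp\,{\sf h}={\sf h}=\overline{\sf h}\in\mathcal S(\Xi)\setminus\{0\}$ and each $f\in\mathfrak A$ one has $$\|f\|_{\mathfrak A}=\sup\big\{\|(r\rtimes T)[M_{\sf h}(f)]\|_{\mathbb B(\mathcal H)}\;\big|\;(r,T,\mathcal H)\text{ covariant representation of }(\mathcal A,\Theta,\Xi,\kappa)\big\}.$$ 2. Moreover, for any faithful representation $\rho:\mathcal A\to\mathbb B(\mathcal K)$ (and any such ${\sf h}$ and $f$) one has $$\|f\|_{\mathfrak A}=\|\rho_{(M,{\sf h})}(f)\|_{\mathbb B[L^2(\Xi;\mathcal K)]}.$$
   Context: Setting. $(\Xi,[\![\cdot,\cdot]\!])$ is a real symplectic vector space of finite dimension $2n$, and $\Theta$ is a strongly continuous action of the additive group $\Xi$ by automorphisms of a (possibly non-commutative) $C^*$-algebra $\mathcal A$. $dX$ denotes the Lebesgue measure on $\Xi$ normalized so that the symplectic Fourier transform $(\mathcal F{\sf f})(X)=\int_\Xi e^{-i[\![X,Y]\!]}{\sf f}(Y)dY$ is unitary in $L^2(\Xi)$ (in symplectic coordinates, $(2\pi)^{-n}$ times the usual Lebesgue measure). Smooth vectors. $\mathcal A^\infty:=\{f\in\mathcal A\mid X\mapsto\Theta_X(f)\in\mathcal A\text{ is }C^\infty\}$, a Fréchet $^*$-algebra with seminorms $|f|^k_{\mathcal A}=\sum_{|\alpha|=k}\frac1{\alpha!}\|\partial_X^\alpha[\Theta_X(f)]_{X=0}\|_{\mathcal A}$,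 $k\in\mathbb N$. Rieffel quantization. On $\mathcal A^\infty$ one has the product $f\#g:=2^{2n}\int_\Xi\int_\Xi e^{2i[\![Y,Z]\!]}\,\Theta_Y(f)\,\Theta_Z(g)\,dYdZ$, an oscillatory integral (the limit as $\varepsilon\to0$ of the same integral with the integrand multiplied by $\chi(\varepsilon Y,\varepsilon Z)$, with $\chi\in C_c^\infty(\Xi\times\Xi)$, $\chi(0,0)=1$), and the involution $^*$ of $\mathcal A$. The vector space $\mathcal A^\infty$ with $(\#,{}^* )$ is denoted $\mathfrak A^\infty$. The $C^*$-norm $\|\cdot\|_{\mathfrak A}$ on $\mathfrak A^\infty$ is Rieffel's: $\|f\|_{\mathfrak A}$ is the operator norm of $(L_fG)(X)=2^{2n}\int_\Xi\int_\Xi e^{2i[\![Y,Z]\!]}\Theta_{X+Y}(f)\,G(X+Z)\,dZ\,dY$ (integrate first in $Z$) acting on the $\mathcal A$-valued Schwartz space $\mathcal S(\Xi;\mathcal A)$ with the right Hilbert $\mathcal A$-module norm $\|G\|=\|\int_\Xi G(X)^*G(X)dX\|_{\mathcal A}^{1/2}$. The completion of $\mathfrak A^\infty$ is the $C^*$-algebra $\mathfrak A$. The product $\sharp$. On the Schwartz space $\mathcal S(\Xi)$: $({\sf h}\,\sharp\,{\sf k})(X)=2^{2n}\int_\Xi\int_\Xi e^{2i[\![Y,Z]\!]}{\sf h}(X-Y){\sf k}(X-Z)\,dYdZ$. Twisted crossed product. $\kappa(X,Y):=\exp(-\frac i2[\![X,Y]\!])$. On $L^1(\Xi;\mathcal A)$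 put $\|F\|_1=\int_\Xi\|F(X)\|_{\mathcal A}dX$, $F^\diamond(X):=F(-X)^*$ and $(F_1\diamond F_2)(X):=\int_\Xi\kappa(X,Y)\,\Theta_{(Y-X)/2}[F_1(Y)]\,\Theta_{Y/2}[F_2(X-Y)]\,dY$. This is a Banach $^*$-algebra, and $\mathcal A\rtimes_\Theta^\kappa\Xi$ is its enveloping $C^*$-algebra. Covariant representations (all representations of $C^*$-algebras $\mathcal A$ here are non-degenerate). A covariant representation $(r,T,\mathcal H)$ of $(\mathcal A,\Theta,\Xi,\kappa)$ consists of a representation $r:\mathcal A\to\mathbb B(\mathcal H)$ and a strongly continuous map $T$ from $\Xi$ to the unitary operators of $\mathcal H$ with $T(X)T(Y)=\kappa(Y,X)T(X+Y)$ and $T(Y)r(g)T(-Y)=r[\Theta_Y(g)]$ for all $X,Y\in\Xi$, $g\in\mathcal A$. It induces $r\rtimes T:\mathcal A\rtimes_\Theta^\kappa\Xi\to\mathbb B(\mathcal H)$ given by $(r\rtimes T)(G)=\int_\Xi r\{\Theta_{X/2}[G(X)]\}T(X)\,dX$ for $G\in L^1(\Xi;\mathcal A)$. Localized modulation maps. If ${\sf h}\,\sharp\,{\sf h}={\sf h}=\overline{\sf h}\in\mathcal S(\Xi)\setminus\{0\}$, the map $[M_{\sf h}(f)](X)=\int_\Xi e^{-i[\![X,Y]\!]}{\sf h}(Y)\Theta_Y(f)\,dY$, $f\in\mathfrak A^\infty$, extends to an injective $C^*$-morphism $M_{\sf h}:\mathfrak A\to\mathcal A\rtimes_\Theta^\kappa\Xi$.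 Induced representations. Given a representation $\rho:\mathcal A\to\mathbb B(\mathcal K)$, put $\mathcal H:=L^2(\Xi;\mathcal K)$, $[r_\rho(f)\Phi](X):=\rho[\Theta_X(f)][\Phi(X)]$ and $[T(Y)\Phi](X):=\kappa(Y,X)\Phi(X+Y)$. Then $(r_\rho,T,\mathcal H)$ is a covariant representation, and $\rho_{(M,{\sf h})}:=(r_\rho\rtimes T)\circ M_{\sf h}:\mathfrak A\to\mathbb B[L^2(\Xi;\mathcal K)]$. *)

(* Defs.v *)
From HB Require Import structures.
From mathcomp Require Import all_boot all_order all_algebra.
From mathcomp Require Import complex.
From mathcomp Require Import all_classical all_reals all_analysis.
Set Implicit Arguments.
Unset Strict Implicit.
Unset Printing Implicit Defensive.
Import Order.TTheory GRing.Theory Num.Theory.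
Import numFieldNormedType.Exports.
Local Open Scope classical_set_scope.
Local Open Scope ring_scope.

Section measurable_rV.
Context {d} {T : sigmaRingType d} (n : nat).

Let coord (i : 'I_n) (v : 'rV[T]_n) : T := v ord0 i.

Let rV_set0 : g_sigma_preimage coord set0.
Proof. exact: sigma_algebra0. Qed.

Let rV_setC A : g_sigma_preimage coord A -> g_sigma_preimage coord (~` A).
Proof. exact: sigma_algebraC. Qed.

Let rV_bigcup (F : (set 'rV[T]_n)^nat) :
  (forall i, g_sigma_preimage coord (F i)) ->
  g_sigma_preimage coord (\bigcup_i F i).
Proof. exact: sigma_algebra_bigcup. Qed.

HB.instance Definition _ := @isMeasurable.Build (measure_tuple_display d)
  'rV[T]_n (g_sigma_preimage coord) rV_set0 rV_setC rV_bigcup.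

Lemma measurable_coord_rV (i : 'I_n) :
  measurable_fun [set: 'rV[T]_n] (fun v : 'rV[T]_n => v ord0 i).
Proof.
move=> _ Y mY; rewrite setTI; apply: sub_sigma_algebra => /=.
rewrite -bigcup_seq/=; exists i => /=; first by rewrite mem_index_enum.
by exists Y => //; rewrite setTI.
Qed.

End measurable_rV.

Section lebesgue_rV.
Context {R : realType}.

Definition cons_rV n (p : measurableTypeR R * 'rV[R]_n) : 'rV[R]_n.+1 := row_mx (p.1 : R)%:M p.2.
Definition uncons_rV n (v : 'rV[R]_n.+1) : measurableTypeR R * 'rV[R]_n :=
  (v ord0 ord0, \row_j v ord0 (lift ord0 j)).

Lemma cons_rVK n : cancel (@cons_rV n) (@uncons_rV n).
Proof.
move=> [x v]; congr pair; last first.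
  apply/rowP => j; rewrite mxE /cons_rV/=.
  have -> : lift ord0 j = rshift 1 j by apply: val_inj.
  exact: (@row_mxEr _ 1 1 n).
rewrite /cons_rV/= (_ : (ord0 : 'I_n.+1) = lshift n (ord0 : 'I_1)).
  by rewrite (@row_mxEl _ 1 1 n) mxE.
exact: ord_inj.
Qed.

Lemma measurable_rVP d (T : measurableType d) n (f : T -> 'rV[R]_n) :
  (forall i, measurable_fun setT (fun x => f x ord0 i)) -> measurable_fun setT f.
Proof.
move=> mf _ Y mY; rewrite setTI.
have := @g_sigma_preimage_comp _ R n 'rV[R]_n (fun i v => v ord0 i) _ f.
move=> /(congr1 (fun S => S (f @^-1` Y))) /= E.
have : preimage_set_system [set: T] f
   (g_sigma_preimage (fun i (v : 'rV[R]_n) => v ord0 i)) (f @^-1` Y).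
  by exists Y => //; rewrite setTI.
rewrite -E; apply: smallest_sub; first exact: sigma_algebra_measurable.
move=> A; rewrite -bigcup_seq => -[i _ [B mB <-]].
exact: (mf i).
Qed.

Lemma measurable_cons_rV n : measurable_fun setT (@cons_rV n).
Proof.
apply: measurable_rVP => i; case: (splitP (i : 'I_(1 + n))) => j ij.
- rewrite (_ : (fun _ => _) = fst) //; apply/funext => -[x v] /=.
  rewrite /cons_rV (_ : i = lshift n j) ?(@row_mxEl _ 1 1 n) ?mxE ?ord1//.
  by apply: ord_inj; rewrite ij ord1.
- rewrite (_ : (fun _ => _) = (fun v : 'rV[R]_n => v ord0 j) \o snd).
    by apply: measurableT_comp => //; exact: measurable_coord_rV.
  apply/funext => -[x v] /=.
  rewrite /cons_rV (_ : i = rshift 1 j) ?(@row_mxEr _ 1 1 n)//.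
  exact: ord_inj.
Qed.

Lemma measurable_uncons_rV n : measurable_fun setT (@uncons_rV n).
Proof.
apply: measurable_fun_pair => /=; first exact: measurable_coord_rV.
apply: measurable_rVP => i.
rewrite (_ : (fun _ => _) = (fun v : 'rV[R]_n.+1 => v ord0 (lift ord0 i))).
  exact: measurable_coord_rV.
by apply/funext => v; rewrite mxE.
Qed.

Section cons_measure.
Local Open Scope ereal_scope.
Variables (n : nat) (mu : {sigma_finite_measure set 'rV[R]_n -> \bar R}).

Let leb : {sigma_finite_measure set (measurableTypeR R) -> \bar R} :=
  @lebesgue_measure R.

Definition cons_measure : set 'rV[R]_n.+1 -> \bar R :=
  pushforward (leb \x mu) (@cons_rV n).

Let nu := measure_function_pushforward__canonical__measure_function_Measure
  (leb \x mu) (@measurable_cons_rV n).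

HB.instance Definition _ := isMeasure.Build _ _ _ cons_measure
  (measure0 nu) (@measure_ge0 _ _ _ nu) (@measure_semi_sigma_additive _ _ _ nu).

Let cons_measure_sigma_finite : sigma_finite setT cons_measure.
Proof.
have /sigma_finiteP[F [TF ndF Foo]] := sigma_finiteT leb.
have /sigma_finiteP[G [TG ndG Goo]] := sigma_finiteT mu.
have FGm k : measurable (F k `*` G k).
  by have [? _] := Foo k; have [? _] := Goo k; exact: measurableX.
exists (fun k => @uncons_rV n @^-1` (F k `*` G k)).
  rewrite predeqE => v; split=> // _.
  have [i _ Fi] : (\bigcup_i F i) (uncons_rV v).1 by rewrite -TF.
  have [j _ Gj] : (\bigcup_i G i) (uncons_rV v).2 by rewrite -TG.
  exists (maxn i j) => //; split.
    by move: Fi; exact/subsetPset/ndF/leq_maxl.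
  by move: Gj; exact/subsetPset/ndG/leq_maxr.
move=> k; split.
  by rewrite -[X in measurable X]setTI; exact: measurable_uncons_rV.
have [mF Fk] := Foo k; have [mG Gk] := Goo k.
rewrite /cons_measure /pushforward -comp_preimage.
rewrite (_ : _ \o _ = id) ?preimage_id; last first.
  by apply/funext => p /=; rewrite cons_rVK.
by rewrite product_measure1E// lte_mul_pinfty// ge0_fin_numE.
Qed.

HB.instance Definition _ := Measure_isSigmaFinite.Build _ _ _ cons_measure
  cons_measure_sigma_finite.

End cons_measure.

Fixpoint lebesgue_rV n : {sigma_finite_measure set 'rV[R]_n -> \bar R} :=
  if n is n'.+1 then cons_measure (lebesgue_rV n') else \d_(0 : 'rV[R]_0).

End lebesgue_rV.

Section vector_valued.
Context {R : realType}.

Definition rnorm (V : normedModType R[i]) (v : V) : R := complex.Re `|v|.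

(* e^{it} *)
Definition cis (t : R) : R[i] := (cos t +i* sin t)%C.

Section bochner.
Context d (T : measurableType d) (mu : {measure set T -> \bar R})
  (V : normedModType R[i]).

Record step_fun := StepFun {
  step_size : nat;
  step_set : 'I_step_size -> set T;
  step_val : 'I_step_size -> V;
  step_measurable : forall i, measurable (step_set i);
  step_finite : forall i, (mu (step_set i) < +oo)%E }.

Definition step_eval (s : step_fun) (x : T) : V :=
  \sum_(i < step_size s) ((\1_(step_set i) x : R)%:C)%C *: step_val i.

Definition step_int (s : step_fun) : V :=
  \sum_(i < step_size s) ((fine (mu (step_set i)))%:C)%C *: step_val i.

Definition ae_cvg (s : nat -> step_fun) (F : T -> V) :=
  {ae mu, forall x, step_eval (s k) x @[k --> \oo] --> F x}.

Definition strongly_measurable (F : T -> V) := exists s, ae_cvg s F.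

Definition bochner_approx (s : nat -> step_fun) (F : T -> V) :=
  ae_cvg s F /\
  (\int[mu]_x (rnorm (F x - step_eval (s k) x))%:E @[k --> \oo] --> 0)%E.

Definition bochner_integrable (F : T -> V) := exists s, bochner_approx s F.

(* the Bochner integral; 0 if F is not integrable *)
Definition bint (F : T -> V) : V :=
  xget 0 [set v | exists2 s, bochner_approx s F &
                    step_int (s k) @[k --> \oo] --> v].

End bochner.

(* The library's derivatives need the same field on both sides, whereas V is
   complex and the variable is real. *)
Section smooth.
Context {m : nat} {V : normedModType R[i]}.
Implicit Types (F : 'rV[R]_m -> V) (X : 'rV[R]_m) (i : 'I_m).

Definition diff_quot i F X (t : R) : V :=
  ((t^-1)%:C)%C *: (F (X + t *: delta_mx 0 i) - F X).

Definition pderiv i F X : V := lim (diff_quot i F X @ 0^').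

Definition pderivs (s : seq 'I_m) F : 'rV[R]_m -> V := foldr pderiv F s.

Definition smooth F :=
  (forall s, continuous (pderivs s F)) /\
  (forall s i X, cvg (diff_quot i (pderivs s F) X @ 0^')).

Definition schwartz F :=
  smooth F /\
  forall s (k : nat), exists C : R,
    forall X, (1 + `|X|) ^+ k * rnorm (pderivs s F X) <= C.

End smooth.
End vector_valued.
Arguments bint {R d T} mu {V}.

(* Not necessarily unital, which excludes the library's algebra structures. *)
Record cstarAlgebra (R : realType) := CStarAlgebra {
  cstar_sort :> completeNormedModType R[i];
  cmul : cstar_sort -> cstar_sort -> cstar_sort;
  cstar : cstar_sort -> cstar_sort;
  cmulA : associative cmul;
  cmulDl : left_distributive cmul +%R;
  cmulDr : right_distributive cmul +%R;
  cmulZl : forall a x y, cmul (a *: x) y = a *: cmul x y;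
  cmulZr : forall a x y, cmul x (a *: y) = a *: cmul x y;
  cstarD : forall x y, cstar (x + y) = cstar x + cstar y;
  cstarZ : forall a x, cstar (a *: x) = a^* *: cstar x;
  cstarK : involutive cstar;
  cstarM : forall x y, cstar (cmul x y) = cmul (cstar y) (cstar x);
  cnormM : forall x y, `|cmul x y| <= `|x| * `|y|;
  cnormC : forall x, `|cmul (cstar x) x| = `|x| ^+ 2 }.

Record hilbertSpace (R : realType) := HilbertSpace {
  hilbert_sort :> completeNormedModType R[i];
  ip : hilbert_sort -> hilbert_sort -> R[i];
  ipDr : forall x y z, ip x (y + z) = ip x y + ip x z;
  ipZr : forall a x y, ip x (a *: y) = a * ip x y;
  ip_conj : forall x y, ip y x = (ip x y)^*;
  ip_norm : forall x, ip x x = `|x| ^+ 2 }.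

Section representations.
Context {R : realType}.

Definition is_cstar_morphism (A B : cstarAlgebra R) (phi : A -> B) :=
  [/\ linear phi,
      forall x y, phi (cmul x y) = cmul (phi x) (phi y) &
      forall x, phi (cstar x) = cstar (phi x)].

Definition bounded_operator (H : hilbertSpace R) (T : H -> H) :=
  linear T /\ continuous T.

Definition is_adjoint (H : hilbertSpace R) (S T : H -> H) :=
  forall x y, ip (S x) y = ip x (T y).

Definition opnorm (H : hilbertSpace R) (T : H -> H) : \bar R :=
  ereal_sup [set (rnorm (T x))%:E | x in [set x | rnorm x <= 1]].

Definition unitary_operator (H : hilbertSpace R) (U : H -> H) :=
  [/\ linear U, forall x y, ip (U x) (U y) = ip x y &
      forall y, exists x, U x = y].

Definition is_star_rep (A : cstarAlgebra R) (H : hilbertSpace R)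
    (r : A -> H -> H) :=
  [/\ forall f, bounded_operator (r f),
      forall (a : R[i]) f g x, r (a *: f + g) x = a *: r f x + r g x,
      forall f g x, r (cmul f g) x = r f (r g x) &
      forall f, is_adjoint (r (cstar f)) (r f)].

Definition nondegenerate (A : cstarAlgebra R) (H : hilbertSpace R)
    (r : A -> H -> H) :=
  closure (range (fun s : seq (A * H) => \sum_(p <- s) r p.1 p.2)) = setT.

Definition is_representation (A : cstarAlgebra R) (H : hilbertSpace R)
    (r : A -> H -> H) := is_star_rep r /\ nondegenerate r.

End representations.

Section rieffel.
Context {R : realType} {n : nat} (Omega : 'M[R]_(2 * n)).
Local Notation Xi := 'rV[R]_(2 * n).

(* A 2n-dimensional symplectic space, written in an arbitrary linear basis:
   Omega is the matrix of the form, not necessarily the standard one. *)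
Definition symplectic := Omega^T = - Omega /\ Omega \in unitmx.

Definition sform (X Y : Xi) : R := (X *m Omega *m Y^T) 0 0.

Definition kappa (X Y : Xi) : R[i] := cis (- (sform X Y / 2)).

Definition dX_factor : R := (2 * pi) ^- n * Num.sqrt (\det Omega).

Lemma dX_factor_ge0 : 0 <= dX_factor.
Proof.
by rewrite mulr_ge0 ?sqrtr_ge0 // invr_ge0 exprn_ge0 // mulr_ge0 ?pi_ge0.
Qed.

(* The matrix of the form in a symplectic basis has determinant 1, so passing
   from symplectic coordinates to those of Omega turns the Lebesgue measure
   into (\det Omega)^{1/2} times the Lebesgue measure. *)
Definition dX : {measure set Xi -> \bar R} :=
  mscale (NngNum dX_factor_ge0) (lebesgue_rV (2 * n)).

Definition sharp (h k : Xi -> R[i]^o) (X : Xi) : R[i]^o :=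
  2 ^+ (2 * n) *:
  bint dX (fun Y => bint dX (fun Z =>
    cis (2 * sform Y Z) *: (h (X - Y) * k (X - Z) : R[i]^o))).

Definition is_window (h : Xi -> R[i]^o) :=
  [/\ schwartz h, sharp h h = h, forall X, (h X)^* = h X & h <> (fun=> 0)].

Definition is_cutoff (chi : 'rV[R]_(2 * n + 2 * n) -> R[i]^o) :=
  [/\ smooth chi, exists r : R, forall Z, r < `|Z| -> chi Z = 0 & chi 0 = 1].

Section action.
Context (A : cstarAlgebra R) (Theta : Xi -> A -> A).

Definition is_action :=
  [/\ forall X, is_cstar_morphism (Theta X),
      forall f, Theta 0 f = f,
      forall X Y f, Theta (X + Y) f = Theta X (Theta Y f) &
      forall f, continuous (Theta ^~ f)].

Definition smooth_vector (f : A) := smooth (Theta ^~ f).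

(* The outer limit is the oscillatory integral; it does not depend on chi. *)
Definition rieffel_prod (f g : A) : A :=
  xget 0 [set p | forall chi, is_cutoff chi ->
    2 ^+ (2 * n) *:
    bint dX (fun Y => bint dX (fun Z =>
      (chi (row_mx (e *: Y) (e *: Z)) * cis (2 * sform Y Z)) *:
      cmul (Theta Y f) (Theta Z g))) @[e --> (0 : R)^'] --> p].

Definition rieffel_op (f : A) (G : Xi -> A) (X : Xi) : A :=
  2 ^+ (2 * n) *:
  bint dX (fun Y => bint dX (fun Z =>
    cis (2 * sform Y Z) *: cmul (Theta (X + Y) f) (G (X + Z)))).

Definition module_norm (G : Xi -> A) : R :=
  Num.sqrt (rnorm (bint dX (fun X => cmul (cstar (G X)) (G X)))).

Definition rieffel_norm (f : A) : \bar R :=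
  ereal_sup [set (module_norm (rieffel_op f G))%:E |
             G in [set G | schwartz G /\ module_norm G <= 1]].

(* (B, iota) is the completion of the smooth vectors, with the Rieffel
   product and norm. Values of iota elsewhere are irrelevant. *)
Definition is_rieffel_algebra (B : cstarAlgebra R) (iota : A -> B) :=
  [/\ forall (a : R[i]) f g, smooth_vector f -> smooth_vector g ->
        iota (a *: f + g) = a *: iota f + iota g,
      forall f g, smooth_vector f -> smooth_vector g ->
        iota (rieffel_prod f g) = cmul (iota f) (iota g),
      forall f, smooth_vector f -> iota (cstar f) = cstar (iota f),
      forall f, smooth_vector f -> (rnorm (iota f))%:E = rieffel_norm f &
      closure (iota @` smooth_vector) = setT].

Local Notation L1 := (@bochner_integrable R _ Xi dX A).

Definition conv (F1 F2 : Xi -> A) (X : Xi) : A :=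
  bint dX (fun Y => kappa X Y *:
    cmul (Theta (2^-1 *: (Y - X)) (F1 Y)) (Theta (2^-1 *: Y) (F2 (X - Y)))).

Definition conv_star (F : Xi -> A) (X : Xi) : A := cstar (F (- X)).

(* Elements of L^1(Xi; A) are represented by functions, so that a map on L^1
   has to be compatible with equality almost everywhere. *)
Definition L1_rep (H : hilbertSpace R) (psi : (Xi -> A) -> H -> H) :=
  [/\ forall F, L1 F -> bounded_operator (psi F),
      forall F G, L1 F -> L1 G -> {ae dX, forall X, F X = G X} -> psi F = psi G,
      forall (a : R[i]) F G x, L1 F -> L1 G ->
        psi (fun X => a *: F X + G X) x = a *: psi F x + psi G x,
      forall F G x, L1 F -> L1 G -> psi (conv F G) x = psi F (psi G x) &
      forall F, L1 F -> is_adjoint (psi (conv_star F)) (psi F)].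

Definition L1_morphism (C : cstarAlgebra R) (j : (Xi -> A) -> C) :=
  [/\ forall F G, L1 F -> L1 G -> {ae dX, forall X, F X = G X} -> j F = j G,
      forall (a : R[i]) F G, L1 F -> L1 G ->
        j (fun X => a *: F X + G X) = a *: j F + j G,
      forall F G, L1 F -> L1 G -> j (conv F G) = cmul (j F) (j G) &
      forall F, L1 F -> j (conv_star F) = cstar (j F)].

Definition enveloping_norm (F : Xi -> A) : \bar R :=
  ereal_sup [set x | exists (H : hilbertSpace R) (psi : (Xi -> A) -> H -> H),
                       L1_rep psi /\ x = opnorm (psi F)].

(* (C, j) is the enveloping C*-algebra of L^1(Xi; A). *)
Definition is_crossed_product (C : cstarAlgebra R) (j : (Xi -> A) -> C) :=
  [/\ L1_morphism j,
      forall F, L1 F -> (rnorm (j F))%:E = enveloping_norm F &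
      closure (j @` L1) = setT].

Definition is_covariant (H : hilbertSpace R) (r : A -> H -> H)
    (T : Xi -> H -> H) :=
  [/\ is_representation r,
      forall X, unitary_operator (T X),
      forall x, continuous (T ^~ x),
      forall X Y x, T X (T Y x) = kappa Y X *: T (X + Y) x &
      forall Y g x, T Y (r g (T (- Y) x)) = r (Theta Y g) x].

(* psi is the extension of the representation r x| T of L^1 to its enveloping
   C*-algebra; the integral is taken in the strong operator sense. *)
Definition is_integrated_form (C : cstarAlgebra R) (j : (Xi -> A) -> C)
    (H : hilbertSpace R) (r : A -> H -> H) (T : Xi -> H -> H)
    (psi : C -> H -> H) :=
  is_star_rep psi /\
  forall G x, L1 G ->
    psi (j G) x = bint dX (fun X => r (Theta (2^-1 *: X) (G X)) (T X x)).

Definition modulation (h : Xi -> R[i]^o) (f : A) (X : Xi) : A :=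
  bint dX (fun Y => (cis (- sform X Y) * h Y) *: Theta Y f).

(* M is determined by these conditions, since *-morphisms of C*-algebras are
   continuous; its injectivity is not assumed. *)
Definition is_modulation_map (B C : cstarAlgebra R) (iota : A -> B)
    (j : (Xi -> A) -> C) (h : Xi -> R[i]^o) (M : B -> C) :=
  is_cstar_morphism M /\
  forall f, smooth_vector f -> M (iota f) = j (modulation h f).

Section induced.
Context (K H : hilbertSpace R) (cls : (Xi -> K) -> H).

Definition square_integrable (Phi : Xi -> K) :=
  strongly_measurable dX Phi /\
  (\int[dX]_X ((rnorm (Phi X)) ^+ 2)%:E < +oo)%E.

(* H is L^2(Xi; K) and cls maps a function to its class. *)
Definition is_L2 :=
  [/\ forall (a : R[i]) Phi Psi,
        square_integrable Phi -> square_integrable Psi ->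
        cls (fun X => a *: Phi X + Psi X) = a *: cls Phi + cls Psi,
      forall Phi Psi, square_integrable Phi -> square_integrable Psi ->
        ip (cls Phi) (cls Psi) = bint dX (fun X => ip (Phi X) (Psi X) : R[i]^o) &
      forall x, exists2 Phi, square_integrable Phi & cls Phi = x].

Definition is_induced (rho : A -> K -> K) (r : A -> H -> H) (T : Xi -> H -> H) :=
  forall Phi, square_integrable Phi ->
    (forall f, r f (cls Phi) = cls (fun X => rho (Theta X f) (Phi X))) /\
    (forall Y, T Y (cls Phi) = cls (fun X => kappa Y X *: Phi (X + Y))).

End induced.
End action.
End rieffel.

(* Main.v *)
(* *-representations and *-morphisms of C*-algebras are contractive, so only the
   lower bounds on the norms are at stake, and for these it is enough that M
   followed by a family of representations psi_i of the crossed product is jointly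
   injective on B. Each psi_i comes with vectors xi_i(G), for G : Xi -> A
   continuous with integrable decay, such that <xi_i(F), xi_i(G)> is
   om_i(int F^* G) for a bounded functional om_i of A, and such that the norm of
   int G^* G is determined by the norms of the xi_i(G). With k0 a nonzero constant
   and h^ the symplectic Fourier transform of h, Fourier inversion gives, for
   f smooth and G Schwartz,
     k0 int kappa(Y, Z) Theta_{Z + Y/2}((M_h f)(Y)) G((Z + Y)/2) dY
       = int h^(Y) kappa(Y, Z) (L_f G)((Z + Y)/2) dY,
   where the left-hand side is the action of M_h f on the frame of the xi_i.
   Suppose that psi_i (M b) = 0 for all i and that f_l -> b. Twisting G by the
   modulations, with which L_f commutes, turns the right-hand sides, tested against
   another xi_i, into the Fourier transforms of functions of Y; these tend to 0, so
   by inversion the vectors xi_i of L_{f_l} G tend to 0 after translation by any Y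
   such that h^(Y) <> 0. Such a Y exists since h # h = h <> 0. Hence L_{f_l} G -> 0
   in module norm, so the Rieffel norm of b vanishes.
   In the second part the xi_v(G) are the classes of X |-> rho(G(X)) v, with
   |v| <= 1. In the first part the om_i are the states of A, which exist in
   abundance by Hahn-Banach, and the Hilbert space of om is the completion of the
   continuous functions with integrable decay for the form om(int F^* G); it carries
   a covariant representation, whose integrated form is multiplicative by Fubini. *)
From HB Require Import structures.
From mathcomp Require Import all_boot all_order all_algebra.
From mathcomp Require Import complex.
From mathcomp Require Import all_classical all_reals all_analysis.
From mathcomp Require Import measurable_realfun ring lra.
Require Import Defs.
Set Implicit Arguments.
Unset Strict Implicit.
Unset Printing Implicit Defensive.
Import Order.TTheory GRing.Theory Num.Theory.
Import numFieldNormedType.Exports.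
Local Open Scope classical_set_scope.
Local Open Scope ring_scope.

Arguments rnorm {R V} v.

(** An element b of the completion need not come from a smooth vector, and no operator L_b on
    A-valued functions is at hand for it; hence the detour through limits of smooth vectors. The
    vectors built from L_{f_l} G converge because |L_f G| is at most the Rieffel norm of f times
    |G|; their limit is orthogonal to every term of the sequence, hence to itself. That joint
    injectivity determines the norm is shown without spectra, from square roots obtained by an
    iteration in the unitization.

    The halved arguments reconcile two phases: the Rieffel product carries e^{2i[Y,Z]} and kappa
    carries e^{-i[Y,Z]/2}, and halving both variables divides the form by 4. The constant k0 is that
    of Fourier inversion and is not computed: if it were 0, Parseval's identity for the real
    function h would give h^ = 0 almost everywhere, hence h = h # h = 0.

    For the frame, integrals are dominated by the weight (1 + |X|)^{-4n}, which Peetre's inequality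
    makes stable under translations; Fubini's theorem for such continuous integrands follows from
    Riemann sums. *)

Section linear_lemmas.
Context {K : pzRingType} {V W : lmodType K} {f : V -> W} (lf : linear f).

Lemma lin0 : f 0 = 0.
Proof. by have := lf (-1) 0 0; rewrite scaler0 addr0 scaleN1r addNr. Qed.
Lemma linZ a x : f (a *: x) = a *: f x.
Proof. by rewrite -[a *: x]addr0 lf lin0 addr0. Qed.
Lemma linD x y : f (x + y) = f x + f y.
Proof. by rewrite -[x]scale1r lf !scale1r. Qed.
Lemma linN x : f (- x) = - f x.
Proof. by rewrite -scaleN1r linZ scaleN1r. Qed.
Lemma linB x y : f (x - y) = f x - f y.
Proof. by rewrite linD linN. Qed.
Lemma lin_sum I (r : seq I) (P : pred I) (F : I -> V) :
  f (\sum_(i <- r | P i) F i) = \sum_(i <- r | P i) f (F i).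
Proof. by elim/big_rec2: _ => [|i x y _ <-]; rewrite ?lin0// linD. Qed.

End linear_lemmas.

(** * Real-valued norms and convergence in complex normed spaces *)

Section rnorm.
Context {R : realType}.
Implicit Types (V : normedModType R[i]).

Lemma normr_rnorm V (v : V) : `|v| = ((rnorm v)%:C)%C.
Proof. by rewrite /rnorm RRe_real// ger0_real. Qed.

Lemma rnorm_ge0 V (v : V) : 0 <= rnorm v.
Proof. by rewrite -ler0c -normr_rnorm. Qed.

Lemma rnorm0 V : rnorm (0 : V) = 0.
Proof. by rewrite /rnorm normr0. Qed.

Lemma rnorm_eq0 V (v : V) : (rnorm v == 0) = (v == 0).
Proof. by rewrite -(@normr_eq0 _ _ v) normr_rnorm eq_complex/= eqxx andbT. Qed.

Lemma rnormD V (v w : V) : rnorm (v + w) <= rnorm v + rnorm w.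
Proof. by rewrite -lecR raddfD/= -!normr_rnorm ler_normD. Qed.

Lemma rnormN V (v : V) : rnorm (- v) = rnorm v.
Proof. by rewrite /rnorm normrN. Qed.

Lemma rnormB V (v w : V) : rnorm (v - w) = rnorm (w - v).
Proof. by rewrite -opprB rnormN. Qed.

Lemma rnormZ V (a : R[i]) (v : V) : rnorm (a *: v) = rnorm (a : R[i]^o) * rnorm v.
Proof. by apply: complexI; rewrite rmorphM/= -!normr_rnorm normrZ. Qed.

Lemma rnormcE (a : R[i]) : rnorm (a : R[i]^o) = Num.sqrt (complex.Re a ^+ 2 + complex.Im a ^+ 2).
Proof. by rewrite /rnorm normc_def. Qed.

Lemma rnorm_real (t : R) : rnorm ((t%:C)%C : R[i]^o) = `|t|.
Proof. by rewrite rnormcE/= expr0n addr0 sqrtr_sqr. Qed.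

Lemma rnormZr V (t : R) (v : V) : rnorm ((t%:C)%C *: v) = `|t| * rnorm v.
Proof. by rewrite rnormZ rnorm_real. Qed.

Lemma rnormcM (a b : R[i]) : rnorm (a * b : R[i]^o) = rnorm (a : R[i]^o) * rnorm (b : R[i]^o).
Proof. exact: rnormZ. Qed.

Lemma rnorm_conj (a : R[i]) : rnorm (a^* : R[i]^o) = rnorm (a : R[i]^o).
Proof. by rewrite !rnormcE; case: a => a b /=; rewrite sqrrN. Qed.

Lemma rnorm_cis (t : R) : rnorm (cis t : R[i]^o) = 1.
Proof. by rewrite rnormcE/= cos2Dsin2 sqrtr1. Qed.

Lemma ler_Re_rnorm (a : R[i]) : `|complex.Re a| <= rnorm (a : R[i]^o).
Proof. by rewrite rnormcE -sqrtr_sqr ler_wsqrtr// lerDl sqr_ge0. Qed.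

Lemma ler_Im_rnorm (a : R[i]) : `|complex.Im a| <= rnorm (a : R[i]^o).
Proof. by rewrite rnormcE -sqrtr_sqr ler_wsqrtr// lerDr sqr_ge0. Qed.

Lemma rnorm_ReIm (a : R[i]) : rnorm (a : R[i]^o) <= `|complex.Re a| + `|complex.Im a|.
Proof.
rewrite rnormcE -[leRHS]ger0_norm ?addr_ge0// -sqrtr_sqr ler_wsqrtr//.
by rewrite sqrrD !real_normK ?num_real// lerD2r lerDl mulrn_wge0// mulr_ge0.
Qed.

Lemma ler_rnormB V (v w : V) : rnorm v - rnorm w <= rnorm (v - w).
Proof. by rewrite lerBlDr (le_trans _ (rnormD _ _))// subrK. Qed.

Lemma ler_dist_rnorm V (v w : V) : `|rnorm v - rnorm w| <= rnorm (v - w).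
Proof. by rewrite ler_norml ler_rnormB andbT lerNl opprB rnormB ler_rnormB. Qed.

Lemma rnorm_sum V I (s : seq I) (P : pred I) (F : I -> V) :
  rnorm (\sum_(i <- s | P i) F i) <= \sum_(i <- s | P i) rnorm (F i).
Proof.
elim/big_rec2: _ => [|i x v _ ih]; first by rewrite rnorm0.
by rewrite (le_trans (rnormD _ _))// lerD2l.
Qed.

Section cvg.
Context {V : normedModType R[i]}.

Lemma cvg_rnormP T (F : set_system T) {FF : Filter F} (f : T -> V) (l : V) :
  f x @[x --> F] --> l <->
  (forall e : R, 0 < e -> \forall x \near F, rnorm (f x - l) <= e).
Proof.
split=> [/cvgrPdist_le fl e e0|fl].
  have /fl : 0 < (e%:C)%C by rewrite ltcR.
  apply: filterS => x; rewrite normr_rnorm lecR rnormB; exact.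
apply/cvgrPdist_le => e e0.
have e0' : 0 < complex.Re e by move: e0; rewrite ltcE => /andP[].
have -> : e = ((complex.Re e)%:C)%C by rewrite RRe_real// gtr0_real.
by apply: filterS (fl _ e0') => x; rewrite normr_rnorm lecR rnormB.
Qed.

Lemma cvg_rnorm0P T (F : set_system T) {FF : Filter F} (f : T -> V) (l : V) :
  f x @[x --> F] --> l <-> rnorm (f x - l) @[x --> F] --> (0 : R).
Proof.
split=> [/cvg_rnormP fl|/cvgrPdist_le fl].
  apply/cvgrPdist_le => e /fl; apply: filterS => x.
  by rewrite sub0r normrN ger0_norm// rnorm_ge0.
apply/cvg_rnormP => e /fl; apply: filterS => x.
by rewrite sub0r normrN ger0_norm// rnorm_ge0.
Qed.

Lemma cvg_seq_rnormP (u : nat -> V) (l : V) :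
  u k @[k --> \oo] --> l <->
  (forall e : R, 0 < e -> exists K, forall k, (K <= k)%N -> rnorm (u k - l) <= e).
Proof.
split=> [/cvg_rnormP h e /h[K _ hK]|h].
  by exists K => k Kk; exact: hK.
by apply/cvg_rnormP => e /h[K hK]; exists K.
Qed.

Lemma cvg_rnorm T (F : set_system T) {FF : Filter F} (f : T -> V) (l : V) :
  f x @[x --> F] --> l -> rnorm (f x) @[x --> F] --> rnorm l.
Proof.
move=> /cvg_rnormP h; apply/cvgrPdist_le => e /h; apply: filterS => x.
rewrite distrC; exact/le_trans/ler_dist_rnorm.
Qed.

Lemma cvg_squeeze_rnorm T (F : set_system T) {FF : Filter F} (f : T -> V) (l : V)
    (g : T -> R) :
  (forall x, rnorm (f x - l) <= g x) -> g x @[x --> F] --> (0 : R) ->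
  f x @[x --> F] --> l.
Proof.
move=> fg /cvgrPdist_le g0; apply/cvg_rnormP => e /g0; apply: filterS => x.
rewrite sub0r normrN; apply: le_trans; rewrite (le_trans (fg x))//.
exact: ler_norm.
Qed.

Lemma rnorm_cvg_le T (F : set_system T) {FF : ProperFilter F} (f : T -> V) (l : V) (C : R) :
  (\forall x \near F, rnorm (f x) <= C) -> f x @[x --> F] --> l -> rnorm l <= C.
Proof.
move=> fC /cvg_rnorm fl; have : cvg ((rnorm (f x)) @[x --> F]) by apply/cvg_ex; exists (rnorm l).
by move=> /limr_le -/(_ _ fC); rewrite (cvg_lim _ fl).
Qed.

Lemma cvg_uniq T (F : set_system T) {FF : ProperFilter F} (f : T -> V) (l l' : V) :
  f x @[x --> F] --> l -> f x @[x --> F] --> l' -> l = l'.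
Proof. by move=> h h'; apply: norm_cvg_unique h h'. Qed.

End cvg.

Lemma cvgZc T (F : set_system T) {FF : Filter F} (V : normedModType R[i])
    (a : T -> R[i]) (f : T -> V) (a0 : R[i]) (l : V) :
  (a x : R[i]^o) @[x --> F] --> (a0 : R[i]^o) -> f x @[x --> F] --> l ->
  a x *: f x @[x --> F] --> a0 *: l.
Proof. by move=> ha hf; exact: (@cvgZ _ _ _ _ FF a f a0 l). Qed.

Lemma cvg_complexP T (F : set_system T) {FF : Filter F} (f : T -> R[i]) (l : R[i]) :
  (f x : R[i]^o) @[x --> F] --> (l : R[i]^o) <->
  (complex.Re (f x) @[x --> F] --> complex.Re l) /\
  (complex.Im (f x) @[x --> F] --> complex.Im l).
Proof.
split=> [/(@cvg_rnormP R[i]^o) h|[/cvgrPdist_le h1 /cvgrPdist_le h2]].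
  split; apply/cvgrPdist_le => e /h; apply: filterS => x.
    by apply: le_trans; rewrite distrC -[_ - _]raddfB ler_Re_rnorm.
  by apply: le_trans; rewrite distrC -[_ - _]raddfB ler_Im_rnorm.
apply/(@cvg_rnormP R[i]^o) => e e0.
have e20 : 0 < e / 2 by rewrite divr_gt0.
near=> x; rewrite (le_trans (rnorm_ReIm _))// (splitr e) !raddfB/=.
by rewrite lerD// distrC; near: x; [exact: h1|exact: h2].
Unshelve. all: by end_near. Qed.

(** Real and imaginary parts are 1-Lipschitz, so completeness is inherited from the real line. *)
Lemma cauchy_complex_cvg (u : nat -> R[i]) :
  (forall e : R, 0 < e -> exists K, forall k m, (K <= k)%N -> (K <= m)%N ->
     rnorm (u k - u m : R[i]^o) <= e) ->
  exists l : R[i], (u k : R[i]^o) @[k --> \oo] --> (l : R[i]^o).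
Proof.
move=> h.
have H (p : R[i] -> R) : (forall a b, `|p a - p b| <= rnorm (a - b : R[i]^o)) ->
    cvg (p (u k) @[k --> \oo]).
  move=> hp; apply/cauchy_cvgP/cauchyP => e e0.
  have /h[K hK] : 0 < e / 2 by rewrite divr_gt0.
  exists (p (u K)); exists K => // k /= Kk.
  rewrite /ball/= (le_lt_trans (hp _ _))// (le_lt_trans (hK _ _ _ _))//.
  by rewrite ltr_pdivrMr// mulr_natr mulr2n ltrDl.
have h1 : cvg (complex.Re (u k) @[k --> \oo]).
  by apply: H => a b; rewrite -[_ - _]raddfB ler_Re_rnorm.
have h2 : cvg (complex.Im (u k) @[k --> \oo]).
  by apply: H => a b; rewrite -[_ - _]raddfB ler_Im_rnorm.
exists (Complex (lim (complex.Re (u k) @[k --> \oo])) (lim (complex.Im (u k) @[k --> \oo]))).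
by apply/cvg_complexP.
Qed.

Lemma cauchy_seq_cvg (V : completeNormedModType R[i]) (u : nat -> V) :
  (forall e : R, 0 < e -> exists K, forall k m, (K <= k)%N -> (K <= m)%N ->
     rnorm (u k - u m) <= e) -> cvg (u k @[k --> \oo]).
Proof.
move=> h; apply/cauchy_cvgP/cauchyP => e e0.
have e0' : 0 < complex.Re e by move: e0; rewrite ltcE => /andP[].
have eE : e = ((complex.Re e)%:C)%C by rewrite RRe_real// gtr0_real.
have /h[K hK] : 0 < complex.Re e / 2 by rewrite divr_gt0.
exists (u K); exists K => // k /= Kk.
rewrite -ball_normE/= eE normr_rnorm ltcR (le_lt_trans (hK _ _ _ _))//.
by rewrite ltr_pdivrMr// mulr_natr mulr2n ltrDl.
Qed.

End rnorm.

(** * The character [cis] *)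

Section cis.
Context {R : realType}.

Lemma cisD (s t : R) : cis (s + t) = cis s * cis t.
Proof. by rewrite /cis cosD sinD; simpc; rewrite [sin s * _ + _]addrC. Qed.

Lemma cis0 : cis (0 : R) = 1.
Proof. by rewrite /cis cos0 sin0. Qed.

Lemma cisN (t : R) : cis (- t) = (cis t)^*.
Proof. by rewrite /cis cosN sinN. Qed.

Lemma continuous_cis (f : R -> R) : continuous f -> continuous (fun t => cis (f t) : R[i]^o).
Proof.
move=> cf t; apply/cvg_complexP => /=; split.
  by apply: continuous_comp; [exact: cf|exact: continuous_cos].
by apply: continuous_comp; [exact: cf|exact: continuous_sin].
Qed.

(** The mean value theorem is used for cosine and sine separately and the two errors are added,
    whence the constant 2. *)
Lemma ler_cisB (s t : R) : rnorm (cis s - cis t : R[i]^o) <= 2 * `|s - t|.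
Proof.
have L (f f' : R -> R) (x y : R) : (forall z : R, @is_derive R R R z 1 f (f' z)) ->
    (forall z, `|f' z| <= 1) -> `|f x - f y| <= `|x - y|.
  move=> df bf; wlog xy : x y / y <= x.
    by move=> H; case/orP: (le_total x y) => [xy|/H//]; rewrite distrC (distrC x) H.
  have [c _ ->] := @MVT_segment _ f f' y x xy (fun z _ => df z)
    (derivable_within_continuous (fun z _ => @ex_derive _ _ _ _ _ _ _ (df z))).
  by rewrite normrM ler_piMl.
rewrite (le_trans (rnorm_ReIm _))//= mulr2n mulrDl mul1r lerD//.
  apply: (L cos (fun z => - sin z)) => z.
  by rewrite normrN ler_norml sin_geN1 sin_le1.
apply: (L sin cos) => z.
by rewrite ler_norml cos_geN1 cos_le1.
Qed.

End cis.

(** * Elementary computations in a $C^*$-algebra *)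

Section cstar.
Context {R : realType} {A : cstarAlgebra R}.
Implicit Types (a b c : A).

Lemma cmul0l a : cmul 0 a = 0.
Proof. by apply: (addIr (cmul 0 a)); rewrite -cmulDl !add0r. Qed.
Lemma cmul0r a : cmul a 0 = 0.
Proof. by apply: (addIr (cmul a 0)); rewrite -cmulDr !add0r. Qed.
Lemma cmulNl a b : cmul (- a) b = - cmul a b.
Proof. by apply: (addIr (cmul a b)); rewrite -cmulDl !addNr cmul0l. Qed.
Lemma cmulNr a b : cmul a (- b) = - cmul a b.
Proof. by apply: (addIr (cmul a b)); rewrite -cmulDr !addNr cmul0r. Qed.
Lemma cmulBl a b c : cmul (a - b) c = cmul a c - cmul b c.
Proof. by rewrite cmulDl cmulNl. Qed.
Lemma cmulBr a b c : cmul a (b - c) = cmul a b - cmul a c.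
Proof. by rewrite cmulDr cmulNr. Qed.
Lemma cstar0 : cstar (0 : A) = 0.
Proof. by apply: (addIr (cstar 0)); rewrite -cstarD !add0r. Qed.
Lemma cstarN a : cstar (- a) = - cstar a.
Proof. by apply: (addIr (cstar a)); rewrite -cstarD !addNr cstar0. Qed.
Lemma cstarB a b : cstar (a - b) = cstar a - cstar b.
Proof. by rewrite cstarD cstarN. Qed.

Lemma rnormM_le a b : rnorm (cmul a b) <= rnorm a * rnorm b.
Proof. by rewrite -lecR rmorphM/= -!normr_rnorm cnormM. Qed.
Lemma rnormC a : rnorm (cmul (cstar a) a) = rnorm a ^+ 2.
Proof. by apply: complexI; rewrite rmorphXn/= -!normr_rnorm cnormC. Qed.

(** The $C^*$-identity gives |b|^2 = |b^* b| <= |b^*| |b|, so |b| <= |b^*|; this is used for a and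
    for its adjoint. *)
Lemma rnorm_star a : rnorm (cstar a) = rnorm a.
Proof.
have H b : rnorm b <= rnorm (cstar b).
  have [->|b0] := eqVneq (rnorm b) 0; first exact: rnorm_ge0.
  have bp : 0 < rnorm b by rewrite lt_def b0 rnorm_ge0.
  by rewrite -(ler_pM2r bp) -expr2 -rnormC rnormM_le.
by apply/eqP; rewrite eq_le H andbT -{2}(cstarK a) H.
Qed.

Lemma rnormC' a : rnorm (cmul a (cstar a)) = rnorm a ^+ 2.
Proof. by rewrite -{1}(cstarK a) rnormC rnorm_star. Qed.

Lemma cvg_cmul T (F : set_system T) {FF : Filter F} (f g : T -> A) a b :
  f x @[x --> F] --> a -> g x @[x --> F] --> b ->
  cmul (f x) (g x) @[x --> F] --> cmul a b.
Proof.
move=> fa gb.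
apply: (cvg_squeeze_rnorm (g := fun x => rnorm (f x - a) * rnorm (g x) + rnorm a * rnorm (g x - b))).
  move=> x; rewrite -[cmul (f x) _ - _](subrKA (cmul a (g x))) -cmulBl -cmulBr.
  by rewrite (le_trans (rnormD _ _))// lerD// rnormM_le.
have -> : 0 = 0 * rnorm b + rnorm a * 0 :> R by rewrite mul0r mulr0 addr0.
apply: cvgD; apply: cvgM.
- exact/cvg_rnorm0P.
- exact: cvg_rnorm.
- exact: cvg_cst.
- exact/cvg_rnorm0P.
Qed.

Lemma cvg_cstar T (F : set_system T) {FF : Filter F} (f : T -> A) a :
  f x @[x --> F] --> a -> cstar (f x) @[x --> F] --> cstar a.
Proof.
by move=> /cvg_rnorm0P fa; apply/cvg_rnorm0P; under eq_fun do rewrite -cstarB rnorm_star.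
Qed.

End cstar.

(** * The unitization *)

Definition unz (R : realType) (A : cstarAlgebra R) := (R[i]^o * A)%type.

Section unz.
Context {R : realType} {A : cstarAlgebra R}.
Local Notation U := (unz A).
Implicit Types (x y z : U).

HB.instance Definition _ := GRing.Lmodule.copy U (R[i]^o * A)%type.

Definition umul x y : U := (x.1 * y.1, x.1 *: y.2 + y.1 *: x.2 + cmul x.2 y.2).
Definition ustar x : U := (x.1^*, cstar x.2).
Definition uone : U := (1, 0).

Let umulA : associative umul.
Proof.
move=> [x a] [y b] [z c]; rewrite /umul/=; congr pair; first exact: mulrA.
rewrite !scalerDr !scalerA !cmulDl !cmulDr !cmulZl !cmulZr !cmulA.
by rewrite [z * x]mulrC [z * y]mulrC [LHS](AC (4*3) (1*(2*4*6)*(3*5*7)))/=.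
Qed.
Let umul1l : left_id uone umul.
Proof. by move=> [x a]; rewrite /umul/= mul1r scaler0 cmul0l !addr0 scale1r. Qed.
Let umul1r : right_id uone umul.
Proof. by move=> [x a]; rewrite /umul/= mulr1 scaler0 cmul0r add0r addr0 scale1r. Qed.
Let umulDl : left_distributive umul +%R.
Proof.
move=> [x a] [y b] [z c]; rewrite /umul/=; congr pair; first exact: mulrDl.
by rewrite scalerDl scalerDr cmulDl [LHS](AC (2*2*2) ((1*3*5)*(2*4*6))).
Qed.
Let umulDr : right_distributive umul +%R.
Proof.
move=> [x a] [y b] [z c]; rewrite /umul/=; congr pair; first exact: mulrDr.
by rewrite scalerDl scalerDr cmulDr [LHS](AC (2*2*2) ((1*3*5)*(2*4*6))).
Qed.

Let uone_neq0 : uone != 0 :> U.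
Proof. by rewrite xpair_eqE oner_eq0. Qed.

HB.instance Definition _ := GRing.Zmodule_isNzRing.Build U umulA umul1l umul1r umulDl umulDr uone_neq0.

Let uscaleAl (t : R[i]) x y : t *: (x * y) = (t *: x) * y.
Proof.
case: x y => [x a] [y b]; congr pair => /=; first exact: mulrA.
by rewrite !scalerDr !scalerA cmulZl [t * y]mulrC.
Qed.
Let uscaleAr (t : R[i]) x y : t *: (x * y) = x * (t *: y).
Proof.
case: x y => [x a] [y b]; congr pair => /=; first by rewrite [t *: _]mulrCA.
by rewrite !scalerDr !scalerA cmulZr [t * x]mulrC.
Qed.
HB.instance Definition _ := GRing.Lmodule_isLalgebra.Build R[i] U uscaleAl.
HB.instance Definition _ := GRing.Lalgebra_isAlgebra.Build R[i] U uscaleAr.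

Definition ucst (t : R[i]) : U := t%:A.
Definition uin (a : A) : U := (0, a).
(** Left multiplication of [A] by the elements of its unitization; the $C^*$-norm of the unitization
    is read off this action. *)
Definition uact x (v : A) : A := x.1 *: v + cmul x.2 v.

Lemma ustarK : involutive ustar.
Proof. by move=> [x a]; rewrite /ustar/= conjCK cstarK. Qed.
Lemma ustarD x y : ustar (x + y) = ustar x + ustar y.
Proof. by case: x y => [x a] [y b]; congr pair; rewrite ?cstarD ?rmorphD. Qed.
Lemma ustarZ (t : R[i]) x : ustar (t *: x) = t^* *: ustar x.
Proof. by case: x => [x a]; congr pair; rewrite ?cstarZ//= rmorphM. Qed.
Lemma ustarN x : ustar (- x) = - ustar x.
Proof. by rewrite -scaleN1r ustarZ rmorphN1 scaleN1r. Qed.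
Lemma ustarB x y : ustar (x - y) = ustar x - ustar y.
Proof. by rewrite ustarD ustarN. Qed.
Lemma ustarM x y : ustar (x * y) = ustar y * ustar x.
Proof.
case: x y => [x a] [y b]; congr pair; first by rewrite rmorphM mulrC.
by rewrite /= !cstarD !cstarZ cstarM [X in X + _]addrC.
Qed.
Lemma ustar1 : ustar 1 = 1.
Proof. by congr pair; rewrite ?cstar0 ?rmorph1. Qed.
Lemma ustar0 : ustar 0 = 0.
Proof. by congr pair; rewrite ?cstar0 ?rmorph0. Qed.

Lemma uactM x y v : uact (x * y) v = uact x (uact y v).
Proof.
case: x y => [x a] [y b]; rewrite /uact/=.
by rewrite !cmulDl !cmulDr scalerDr !scalerA !cmulZl cmulZr cmulA !addrA.
Qed.
Lemma uactD x y v : uact (x + y) v = uact x v + uact y v.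
Proof. by rewrite /uact/= scalerDl cmulDl addrACA. Qed.
Lemma uactZ t x v : uact (t *: x) v = t *: uact x v.
Proof. by rewrite /uact/= cmulZl scalerDr scalerA. Qed.
Lemma uact1 v : uact 1 v = v.
Proof. by rewrite /uact/= cmul0l addr0 scale1r. Qed.
Lemma uact_star x v : cmul (cstar (uact x v)) (uact x v) = cmul (cstar v) (uact (ustar x * x) v).
Proof.
rewrite uactM /uact/= cstarD cstarZ cstarM !cmulDl !cmulDr !cmulZl !cmulZr !cmulA.
by rewrite cmulDr cmulZr !cmulA scalerDr.
Qed.

(* [nb x t] says that the C*-norm of [x], i.e. the largest of the norm of left
   multiplication by [x] and of the modulus of the scalar part, is at most [t]. *)
Definition nb x (t : R) :=
  rnorm (x.1 : R[i]^o) <= t /\ forall v, rnorm (uact x v) <= t * rnorm v.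

Lemma nb_ge0 x t : nb x t -> 0 <= t.
Proof. by case=> h _; rewrite (le_trans _ h)// rnorm_ge0. Qed.
Lemma nb_le x s t : s <= t -> nb x s -> nb x t.
Proof.
move=> st [h1 h2]; split=> [|v]; first exact: le_trans st.
by rewrite (le_trans (h2 v))// ler_wpM2r// rnorm_ge0.
Qed.
Lemma nbD x y s t : nb x s -> nb y t -> nb (x + y) (s + t).
Proof.
move=> [h1 h2] [h3 h4]; split=> [|v]; first by rewrite (le_trans (rnormD _ _))// lerD.
by rewrite uactD (le_trans (rnormD _ _))// mulrDl lerD.
Qed.
Lemma nbM x y s t : nb x s -> nb y t -> nb (x * y) (s * t).
Proof.
move=> [h1 h2] [h3 h4]; split=> [|v].
  by rewrite rnormcM ler_pM// rnorm_ge0.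
rewrite uactM (le_trans (h2 _))// -mulrA ler_wpM2l//.
by rewrite (le_trans _ h1)// rnorm_ge0.
Qed.
Lemma nbZ (a : R[i]) x t : nb x t -> nb (a *: x) (rnorm (a : R[i]^o) * t).
Proof.
move=> [h1 h2]; split=> [|v]; first by rewrite [_.1]/= rnormcM ler_wpM2l// rnorm_ge0.
by rewrite uactZ rnormZ -mulrA ler_wpM2l// rnorm_ge0.
Qed.
Lemma nbZr (a : R) x t : 0 <= a -> nb x t -> nb ((a%:C)%C *: x) (a * t).
Proof. by move=> a0 /(nbZ (a%:C)%C); rewrite rnorm_real ger0_norm. Qed.
Lemma nbN x t : nb x t -> nb (- x) t.
Proof. by move=> /(nbZ (-1)); rewrite scaleN1r rnormN -[1](rmorph1 (real_complex R)) rnorm_real normr1 mul1r. Qed.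
Lemma nb0 t : 0 <= t -> nb 0 t.
Proof.
move=> t0; split=> [|v]; first by rewrite rnorm0.
by rewrite /uact/= scale0r cmul0l addr0 rnorm0 mulr_ge0// rnorm_ge0.
Qed.
Lemma nb1 : nb 1 1.
Proof.
split=> [|v]; last by rewrite uact1 mul1r.
by rewrite -[fst _](rmorph1 (real_complex R)) rnorm_real normr1.
Qed.
Lemma nb_cst (t : R) : 0 <= t -> nb (ucst (t%:C)%C) t.
Proof. by move=> t0; have := nbZr t0 nb1; rewrite mulr1. Qed.
(** Testing the action on v = a^* recovers the norm of a, since |a a^*| = |a|^2. *)
Lemma nb_uin a t : nb (uin a) t <-> rnorm a <= t.
Proof.
split=> [h|h]; last first.
  have t0 : 0 <= t by rewrite (le_trans _ h)// rnorm_ge0.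
  split=> [|v]; first by rewrite rnorm0.
  rewrite /uact/= scale0r add0r (le_trans (rnormM_le _ _))// ler_wpM2r//.
  exact: rnorm_ge0.
have [->|a0] := eqVneq (rnorm a) 0; first exact: nb_ge0 h.
have ap : 0 < rnorm a by rewrite lt_def a0 rnorm_ge0.
case: h => _ /(_ (cstar a)).
by rewrite /uact/= scale0r add0r rnormC' rnorm_star expr2 ler_pM2r.
Qed.
(** The bound on the scalar part matters here: if [A] has a unit e, then 1 - e acts on [A] as 0
    without being 0. *)
Lemma nb0_eq0 x : nb x 0 -> x = 0.
Proof.
case: x => [x a] [/= h1 h2].
have x0 : x = 0 by apply/eqP; rewrite -(@rnorm_eq0 _ R[i]^o) eq_le h1 rnorm_ge0.
have : nb (uin a) 0 by rewrite /uin -x0.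
by rewrite x0 => /nb_uin ha; congr pair; apply/eqP; rewrite -rnorm_eq0 eq_le ha rnorm_ge0.
Qed.
(** Since |xv|^2 = |v^* x^* x v|, a bound t^2 for the action of x^* x bounds the action of x by
    t. *)
Lemma nb_star_sq x t : 0 <= t -> nb (ustar x * x) (t ^+ 2) -> nb x t.
Proof.
move=> t0 [/= h1 h2]; split=> [|v].
  by move: h1; rewrite rnormcM rnorm_conj -expr2 ler_pXn2r// nnegrE// (rnorm_ge0 (_ : R[i]^o)).
rewrite -(@ler_pXn2r _ 2)// ?nnegrE ?mulr_ge0// ?rnorm_ge0//.
rewrite -rnormC uact_star (le_trans (rnormM_le _ _))// rnorm_star exprMn mulrC expr2 mulrA.
by rewrite ler_wpM2r// ?rnorm_ge0.
Qed.
Lemma nb_sq x t : ustar x = x -> 0 <= t -> nb (x * x) (t ^+ 2) -> nb x t.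
Proof. by move=> xx t0; rewrite -{1}xx; exact: nb_star_sq. Qed.

Lemma unz_split x : x = ucst x.1 + uin x.2.
Proof.
case: x => t a; congr pair => /=; first by rewrite /GRing.scale/= mulr1 addr0.
by rewrite scaler0 add0r.
Qed.
Lemma ucstE t x : ucst t * x = t *: x. Proof. by rewrite /ucst -scalerAl mul1r. Qed.
Lemma ucstC t x : ucst t * x = x * ucst t.
Proof. by rewrite ucstE /ucst -scalerAr mulr1. Qed.
Lemma ustar_cst (t : R) : ustar (ucst (t%:C)%C) = ucst (t%:C)%C.
Proof. by rewrite /ucst ustarZ ustar1 conj_Creal// complex_real. Qed.

(** Convergence for the norm encoded by [nb], so that no normed structure has to be built on the
    unitization. *)
Definition ucv (u : nat -> U) x :=
  forall e, 0 < e -> exists K, forall k, (K <= k)%N -> nb (u k - x) e.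

Lemma nb_ex x : exists t, nb x t.
Proof.
exists (rnorm (x.1 : R[i]^o) + rnorm x.2); split=> [|v]; first by rewrite lerDl rnorm_ge0.
by rewrite (le_trans (rnormD _ _))// rnormZ mulrDl lerD// rnormM_le.
Qed.

Lemma ucv_unique u x y : ucv u x -> ucv u y -> x = y.
Proof.
move=> ux uy; apply/eqP; rewrite -subr_eq0; apply/eqP/nb0_eq0.
have H e : 0 < e -> nb (x - y) e.
  move=> e0; have e20 : 0 < e / 2 by rewrite divr_gt0.
  have [K hK] := ux _ e20; have [L hL] := uy _ e20.
  have -> : x - y = - (u (maxn K L) - x) + (u (maxn K L) - y) by rewrite opprB subrKA.
  by rewrite (splitr e); apply: nbD; [apply/nbN/hK/leq_maxl|apply/hL/leq_maxr].
split=> [|v]; apply/ler_addgt0Pr => e e0; rewrite ?mul0r ?add0r.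
  by have [] := H e e0.
have [v0|v0] := eqVneq (rnorm v) 0.
  have [_ /(_ v)] := H 1 ltr01; rewrite v0 mulr0 => h.
  exact: le_trans h (ltW e0).
have vp : 0 < rnorm v by rewrite lt_def v0 rnorm_ge0.
have := H (e / rnorm v); rewrite divr_gt0// => /(_ isT)[_ /(_ v)].
by rewrite divfK.
Qed.

Lemma ucv_cst x : ucv (fun=> x) x.
Proof. by move=> e e0; exists 0%N => k _; rewrite subrr; apply: nb0; exact: ltW. Qed.

Lemma ucvD u w x y : ucv u x -> ucv w y -> ucv (fun k => u k + w k) (x + y).
Proof.
move=> ux wy e e0; have e20 : 0 < e / 2 by rewrite divr_gt0.
have [K hK] := ux _ e20; have [L hL] := wy _ e20.
exists (maxn K L) => k; rewrite geq_max => /andP[Kk Lk].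
by rewrite (splitr e) opprD addrACA; apply: nbD; [exact: hK|exact: hL].
Qed.

Lemma ucvM u w x y : ucv u x -> ucv w y -> ucv (fun k => u k * w k) (x * y).
Proof.
move=> ux wy e e0.
have [s hs] := nb_ex x; have [t ht] := nb_ex y.
have s0 := nb_ge0 hs; have t0 := nb_ge0 ht.
have e1 : 0 < e / (2 * (t + 1)) by rewrite divr_gt0// mulr_gt0// ltr_wpDl.
have e2 : 0 < Num.min 1 (e / (2 * (s + 1))).
  by rewrite lt_min ltr01 divr_gt0// mulr_gt0// ltr_wpDl.
have [K hK] := ux _ e1; have [L hL] := wy _ e2.
exists (maxn K L) => k; rewrite geq_max => /andP[Kk Lk].
have -> : u k * w k - x * y = (u k - x) * (w k - y + y) + x * (w k - y).
  by rewrite subrK mulrBl mulrBr subrKA.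
apply: (@nb_le _ (e / (2 * (t + 1)) * (1 + t) + s * (e / (2 * (s + 1))))).
  have -> : e / (2 * (t + 1)) * (1 + t) = e / 2.
    by field; rewrite gt_eqF// ltr_wpDl.
  rewrite [leRHS]splitr lerD2l mulrA -subr_ge0.
  have -> : e / 2 - s * e / (2 * (s + 1)) = e / (2 * (s + 1)).
    by field; rewrite gt_eqF// ltr_wpDl.
  by rewrite divr_ge0 ?mulr_ge0 ?addr_ge0// ltW.
apply: nbD; apply: nbM => //; first exact: hK.
- apply: nbD => //; apply: nb_le (hL _ Lk); by rewrite ge_min lexx.
- apply: nb_le (hL _ Lk); by rewrite ge_min lexx orbT.
Qed.

Lemma ucv_shift u x : ucv u x -> ucv (fun k => u k.+1) x.
Proof. by move=> ux e /ux[K hK]; exists K => k Kk; apply: hK; exact: leqW. Qed.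

(** From |x^* v|^2 = |v^* x x^* v| <= |v| t |x^* v|, after division by |x^* v|. *)
Lemma nb_star x t : nb x t -> nb (ustar x) t.
Proof.
move=> [h1 h2]; split=> [|v]; first by rewrite rnorm_conj.
have [->|x0] := eqVneq (rnorm (uact (ustar x) v)) 0.
  by rewrite mulr_ge0 ?rnorm_ge0// (le_trans _ h1)// rnorm_ge0.
have xp : 0 < rnorm (uact (ustar x) v) by rewrite lt_def x0 rnorm_ge0.
rewrite -(ler_pM2r xp) -expr2 -rnormC uact_star ustarK uactM.
rewrite (le_trans (rnormM_le _ _))// rnorm_star -mulrA [leRHS]mulrCA.
by rewrite ler_wpM2l ?rnorm_ge0.
Qed.

Lemma ucv_star u x : ucv u x -> ucv (fun k => ustar (u k)) (ustar x).
Proof. by move=> ux e /ux[K hK]; exists K => k /hK /nb_star; rewrite ustarB. Qed.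

Lemma ucv_nb u x t : (forall k, nb (u k) t) -> ucv u x -> nb x t.
Proof.
move=> ut ux; have H e : 0 < e -> nb x (t + e).
  move=> /ux[K /(_ K (leqnn K)) h]; rewrite -(subKr (u K) x).
  exact: nbD (ut K) (nbN h).
split=> [|v]; first by apply/ler_addgt0Pr => e /H[].
have [v0|v0] := eqVneq (rnorm v) 0.
  by have [_ /(_ v)] := H 1 ltr01; rewrite v0 !mulr0.
have vp : 0 < rnorm v by rewrite lt_def v0 rnorm_ge0.
rewrite -ler_pdivrMr//; apply/ler_addgt0Pr => e /H[_ /(_ v)].
by rewrite ler_pdivrMr.
Qed.

(** The scalar parts converge by definition of [nb]; subtracting them leaves a Cauchy sequence in
    [A], where [nb] is the norm. *)
Lemma ucauchy_cvg u :
  (forall e, 0 < e -> exists K, forall k m, (K <= k)%N -> (K <= m)%N -> nb (u k - u m) e) ->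
  exists x, ucv u x.
Proof.
move=> h.
have [l hl] : exists l : R[i], ((u k).1 : R[i]^o) @[k --> \oo] --> (l : R[i]^o).
  apply: cauchy_complex_cvg => e /h[K hK]; exists K => k m Kk Km.
  by have [] := hK k m Kk Km.
have /cvg_ex[a ha] : cvg ((u k).2 @[k --> \oo]).
  apply: cauchy_seq_cvg => e e0; have e20 : 0 < e / 2 by rewrite divr_gt0.
  have [K hK] := h _ e20; exists K => k m Kk Km.
  have hkm := hK k m Kk Km.
  apply/nb_uin; rewrite (splitr e).
  have -> : uin ((u k).2 - (u m).2) = (u k - u m) - ucst (u k - u m).1.
    by rewrite {1}[u k - u m]unz_split [RHS]addrC addKr.
  apply: nbD => //; apply/nbN.
  by have := nbZ (u k - u m).1 nb1; rewrite mulr1; apply: nb_le; have [] := hkm.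
exists (l, a) => e e0; have e20 : 0 < e / 2 by rewrite divr_gt0.
have /cvg_seq_rnormP /(_ _ e20)[K1 hK1] := hl.
have /cvg_seq_rnormP /(_ _ e20)[K2 hK2] := ha.
exists (maxn K1 K2) => k; rewrite geq_max => /andP[k1 k2].
have -> : u k - (l, a) = ucst ((u k).1 - l) + uin ((u k).2 - a).
  by rewrite [LHS]unz_split.
rewrite (splitr e); apply: nbD; last exact/nb_uin/hK2.
by have := nbZ ((u k).1 - l) nb1; rewrite mulr1; apply: nb_le; exact: hK1.
Qed.

(** * Square roots and positivity *)

Local Notation h2 := ((2^-1 : R)%:C)%C.

Fixpoint rbeta n : R := if n is n'.+1 then (1 + rbeta n' ^+ 2) / 2 else 0.
Fixpoint uroot y n : U := if n is n'.+1 then h2 *: (y + uroot y n' * uroot y n') else 0.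

Lemma rbeta01 n : 0 <= rbeta n <= 1.
Proof.
elim: n => [|n /andP[h0 h1]] /=; first by rewrite lexx ler01.
apply/andP; split; first by rewrite divr_ge0 ?addr_ge0 ?sqr_ge0.
by rewrite ler_pdivrMr// mul1r -[2]/(1 + 1) lerD2l expr_le1.
Qed.

Lemma rbeta_nd n m : (n <= m)%N -> rbeta n <= rbeta m.
Proof.
move=> /subnKC <-; elim: (m - n)%N => [|k ih]; first by rewrite addn0.
rewrite addnS (le_trans ih)//=; set b := rbeta _; rewrite -subr_ge0.
have -> : (1 + b ^+ 2) / 2 - b = (1 - b) ^+ 2 / 2 by field.
by rewrite divr_ge0 ?sqr_ge0.
Qed.

Lemma rbeta_cauchy e : 0 < e ->
  exists K, forall k m, (K <= k)%N -> (k <= m)%N -> rbeta m - rbeta k <= e.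
Proof.
move=> e0.
have ub : has_ubound (range rbeta) by exists 1 => _ [n _ <-]; have /andP[] := rbeta01 n.
have hs : has_sup (range rbeta) by split => //; exists (rbeta 0), 0%N.
have [_ [K _ <-] hK] := sup_adherent e0 hs.
exists K => k m Kk km; rewrite lerBlDr addrC.
have /ub_le_sup - /(_ ub) := imageT rbeta m; move=> /le_trans; apply.
by rewrite -lerBlDr (le_trans (ltW hK))// rbeta_nd.
Qed.

Section root.
Variable y : U.
Hypotheses (ys : ustar y = y) (y1 : nb y 1).

Lemma uroot_star n : ustar (uroot y n) = uroot y n.
Proof.
elim: n => [|n ih] /=; first exact: ustar0.
by rewrite ustarZ ustarD ustarM ih ys conj_Creal// complex_real.
Qed.

Lemma uroot_comm z n : z * y = y * z -> z * uroot y n = uroot y n * z.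
Proof.
move=> zy; elim: n => [|n ih] /=; first by rewrite mulr0 mul0r.
by rewrite -scalerAl -scalerAr mulrDr mulrDl zy mulrA ih -mulrA ih mulrA.
Qed.

Lemma uroot_comm2 n m : uroot y n * uroot y m = uroot y m * uroot y n.
Proof. by apply: uroot_comm; rewrite uroot_comm. Qed.

Lemma nb_uroot n : nb (uroot y n) (rbeta n).
Proof.
elim: n => [|n ih] /=; first exact: nb0.
rewrite [_ / 2]mulrC; apply: nbZr => //.
by apply: nbD y1 _; rewrite expr2; exact: nbM.
Qed.

Lemma nb_urootS n : nb (uroot y n.+1 - uroot y n) (rbeta n.+1 - rbeta n).
Proof.
elim: n => [|n ih]; first by rewrite !subr0; exact: nb_uroot.
(* The iterates commute, so the difference of two squares factors; the real iteration factors in the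
   same way. *)
have -> : uroot y n.+2 - uroot y n.+1 =
    h2 *: ((uroot y n.+1 + uroot y n) * (uroot y n.+1 - uroot y n)).
  rewrite {1}[uroot y n.+2]/= {3}[uroot y n.+1]/= -[uroot y n.+1]/(uroot y n.+1).
  rewrite -scalerBr; congr (_ *: _).
  rewrite opprD addrACA subrr add0r mulrDl !mulrBr (uroot_comm2 n.+1 n).
  by rewrite subrKA.
have -> : rbeta n.+2 - rbeta n.+1 = 2^-1 * ((rbeta n.+1 + rbeta n) * (rbeta n.+1 - rbeta n)).
  by rewrite /=; field.
by apply: nbZr => //; apply: nbM => //; apply: nbD; exact: nb_uroot.
Qed.

Lemma nb_urootB n m : (n <= m)%N -> nb (uroot y m - uroot y n) (rbeta m - rbeta n).
Proof.
move=> /subnKC <-; elim: (m - n)%N => [|k ih]; first by rewrite addn0 !subrr; exact: nb0.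
rewrite addnS -[uroot _ _.+1 - _](subrKA (uroot y (n + k))).
rewrite -[rbeta _ - _](subrKA (rbeta (n + k))).
by apply: nbD => //; exact: nb_urootS.
Qed.

(* The iteration [b := (y + b^2) / 2] is dominated in norm by the same iteration
   for [y = 1] in the reals, which increases to [1]; its limit is [1 - sqrt (1 - y)]. *)
Lemma uroot_ex : exists b, [/\ ustar b = b, nb b 1, b + b = y + b * b &
  forall z, z * y = y * z -> z * b = b * z].
Proof.
have [b hb] : exists b, ucv (uroot y) b.
  apply: ucauchy_cvg => e /rbeta_cauchy[K hK]; exists K => k m Kk Km.
  case/orP: (leq_total k m) => km.
    by rewrite -opprB; apply/nbN; apply: nb_le (nb_urootB km); exact: hK.
  by apply: nb_le (nb_urootB km); exact: hK.
exists b; split.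
- apply: ucv_unique (ucv_star hb) _; by under eq_fun do rewrite uroot_star.
- apply: ucv_nb hb => k; apply: nb_le (nb_uroot k); by have /andP[] := rbeta01 k.
- apply: ucv_unique (ucvD (ucv_shift hb) (ucv_shift hb)) _.
  have -> : (fun k => uroot y k.+1 + uroot y k.+1) = (fun k => y + uroot y k * uroot y k).
    apply/funext => k /=; rewrite -scalerDl -rmorphD /=.
    by rewrite -[X in (X + _)%:C%C]mul1r -[X in (_ + X)%:C%C]mul1r -splitr scale1r.
  by apply: ucvD; [exact: ucv_cst|exact: ucvM].
- move=> z zy; apply: ucv_unique (ucvM (ucv_cst z) hb) _.
  by under eq_fun do rewrite (uroot_comm _ zy); exact: ucvM hb (ucv_cst z).
Qed.
End root.

End unz.

Section pos.
Context {R : realType} {A : cstarAlgebra R}.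
Local Notation U := (unz A).
Implicit Types (x y z c d g : U).
Local Notation rs t := (ucst (t%:C)%C : U).
Local Notation "t %:K" := ((t%:C)%C : R[i]) (at level 2, format "t %:K").

Lemma rs0 : rs 0 = 0. Proof. by rewrite /ucst rmorph0 scale0r. Qed.
Lemma rs1 : rs 1 = 1. Proof. by rewrite /ucst rmorph1 scale1r. Qed.
Lemma rsD (s t : R) : rs (s + t) = rs s + rs t.
Proof. by rewrite /ucst rmorphD scalerDl. Qed.
Lemma rsB (s t : R) : rs (s - t) = rs s - rs t.
Proof. by rewrite /ucst rmorphB scalerBl. Qed.
Lemma rsM (s t : R) : rs (s * t) = s%:K *: rs t.
Proof. by rewrite /ucst rmorphM scalerA. Qed.
Lemma rsMM (s t : R) : rs (s * t) = rs s * rs t.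
Proof. by rewrite rsM ucstE. Qed.
Lemma ustarZr (t : R) x : ustar (t%:K *: x) = t%:K *: ustar x.
Proof. by rewrite ustarZ conj_Creal// complex_real. Qed.
Lemma scalerC2 (s t : R) x y : (s%:K *: x) * (t%:K *: y) = (s * t)%:K *: (x * y).
Proof. by rewrite -scalerAl -scalerAr scalerA rmorphM. Qed.
Lemma half2 x : (2^-1 : R)%:K *: (x + x) = x.
Proof.
rewrite scalerDr -scalerDl -rmorphD/=.
have -> : 2^-1 + 2^-1 = 1 :> R by field.
by rewrite rmorph1 scale1r.
Qed.

(** With u = c + i d, commutation gives u^* u = u u^* = r^2. Hence |u| <= r, and c is the mean of u
    and u^*. *)
Lemma nb_sumsq c d (r : R) : ustar c = c -> ustar d = d -> c * d = d * c -> 0 <= r ->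
  c * c + d * d = rs (r ^+ 2) -> nb c r.
Proof.
move=> cs ds cd r0 E.
pose u := c + 'i *: d.
have us : ustar u = c - 'i *: d by rewrite ustarD ustarZ cs ds conjCi scaleNr.
have uu : ustar u * u = rs (r ^+ 2).
  rewrite us mulrBl !mulrDr -!scalerAl -!scalerAr scalerA mulCii -E cd scaleN1r.
  by rewrite opprD opprK addrA addrK.
have uu' : u * ustar u = rs (r ^+ 2).
  rewrite us mulrDl !mulrBr -!scalerAl -!scalerAr scalerA mulCii -E cd scaleN1r.
  by rewrite opprK addrA subrK.
have n1 : nb u r by apply: nb_star_sq => //; rewrite uu; apply: nb_cst; rewrite sqr_ge0.
have n2 : nb (ustar u) r by exact: nb_star.
have -> : c = (2^-1 : R)%:K *: (u + ustar u) by rewrite us addrCA subrr addr0 half2 || rewrite us /u addrACA subrr addr0 half2.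
have -> : r = 2^-1 * (r + r) by field.
by apply: nbZr => //; exact: nbD.
Qed.

(** In spectral terms, |s - x| <= s places the spectrum of x in [0, 2s]. In this form positivity is
    additive at once, without spectral theory. *)
Definition pos x := ustar x = x /\ exists2 s : R, 0 <= s & nb (rs s - x) s.

Lemma onesub_sq b y : b + b = y + b * b -> (1 - b) * (1 - b) = 1 - y.
Proof.
by move=> bb; rewrite mulrBl mul1r mulrBr mulr1 opprB addrACA -opprD bb [y + _]addrC addrKA.
Qed.

(** For y = 1 - x/s, of norm at most 1, the iteration yields b with (1 - b)^2 = x/s; the root is
    sqrt(s) (1 - b). *)
Lemma pos_sqrt x : pos x -> exists g, [/\ ustar g = g, g * g = x, pos g &
  forall z, z * x = x * z -> z * g = g * z].
Proof.
move=> [xs [s s0 hs]]; have [s00|sn] := eqVneq s 0.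
  move: hs; rewrite s00 rs0 sub0r => /nbN/nb0_eq0; rewrite opprK => ->.
  exists 0; split=> [|||z _]; rewrite ?ustar0 ?mulr0 ?mul0r//.
  by split; [exact: ustar0|exists 0 => //; rewrite rs0 subrr; exact: nb0].
have sp : 0 < s by rewrite lt_def sn.
pose y := 1 - s^-1%:K *: x.
have ys : ustar y = y by rewrite ustarB ustar1 ustarZr xs.
have yE : y = s^-1%:K *: (rs s - x) by rewrite scalerBr -rsM mulVf// rs1.
have y1 : nb y 1.
  rewrite yE; have -> : 1 = s^-1 * s by rewrite mulVf.
  by apply: nbZr => //; rewrite invr_ge0.
have [b [bs b1 bb bc]] := uroot_ex ys y1.
have sq0 : 0 <= Num.sqrt s by exact: sqrtr_ge0.
pose g := (Num.sqrt s)%:K *: (1 - b).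
have gg : g * g = x.
  rewrite scalerC2 -expr2 sqr_sqrtr// (onesub_sq bb).
  by rewrite /y subKr scalerA -rmorphM mulfV// rmorph1 scale1r.
have gs : ustar g = g by rewrite ustarZr ustarB ustar1 bs.
exists g; split => //.
  split => //; exists (Num.sqrt s) => //.
  rewrite /g scalerBr opprB addrCA subrr addr0.
  by rewrite -[X in nb _ X]mulr1; exact: nbZr.
move=> z zx; have zy : z * y = y * z.
  by rewrite mulrBr mulrBl mulr1 mul1r -scalerAl -scalerAr zx.
by rewrite /g -scalerAl -scalerAr mulrBr mulrBl mulr1 mul1r bc.
Qed.

(** The element r^2 - g^2 has a square root d commuting with g; since d^2 + g^2 = r^2, the sum of
    two squares bounds d by r. *)
Lemma nb_subsq g (r : R) : ustar g = g -> nb g r -> nb (rs (r ^+ 2) - g * g) (r ^+ 2).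
Proof.
move=> gs gr; have r0 := nb_ge0 gr; have [rz|rn] := eqVneq r 0.
  by move: gr; rewrite rz => /nb0_eq0 ->; rewrite mulr0 subr0 expr0n/= rs0; exact: nb0.
have r2 : r ^+ 2 != 0 by rewrite expf_neq0.
have r20 : 0 <= (r ^+ 2)^-1 by rewrite invr_ge0 sqr_ge0.
pose y := (r ^+ 2)^-1%:K *: (g * g).
have ys : ustar y = y by rewrite ustarZr ustarM gs.
have y1 : nb y 1.
  have -> : 1 = (r ^+ 2)^-1 * (r * r) by rewrite -expr2 mulVf.
  by apply: nbZr => //; exact: nbM.
have [b [bs b1 bb bc]] := uroot_ex ys y1.
pose d := r%:K *: (1 - b).
have ds : ustar d = d by rewrite ustarZr ustarB ustar1 bs.
have dd : d * d = rs (r ^+ 2) - g * g.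
  rewrite scalerC2 -expr2 (onesub_sq bb).
  rewrite scalerBr /y scalerA -rmorphM mulfV// rmorph1 scale1r.
  by rewrite /ucst.
have dr : nb d r.
  apply: (@nb_sumsq d g) => //; last by rewrite dd subrK.
  have gb : g * b = b * g by apply: bc; rewrite /y -scalerAl -scalerAr mulrA.
  by rewrite /d -scalerAl -scalerAr mulrBl mulrBr mulr1 mul1r gb.
by rewrite -dd expr2; exact: nbM.
Qed.

Lemma pos_sq g : ustar g = g -> pos (g * g).
Proof.
move=> gs; split; first by rewrite ustarM gs.
by have [t ht] := nb_ex g; exists (t ^+ 2); [exact: sqr_ge0|exact: nb_subsq].
Qed.

(** The witness s in the definition of positivity may thus be replaced by any bound of the norm. *)
Lemma pos_nb x t : pos x -> nb x t -> nb (rs t - x) t.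
Proof.
move=> /pos_sqrt[g [gs <- _ _]] h; have t0 := nb_ge0 h.
rewrite -{1 2}[t]sqr_sqrtr//; apply: nb_subsq => //.
by apply: nb_sq; rewrite ?sqrtr_ge0// sqr_sqrtr.
Qed.

Lemma pos_of_nb x t : ustar x = x -> nb x t -> pos (rs t - x).
Proof.
move=> xs h; split; first by rewrite ustarB ustar_cst xs.
by exists t; [exact: nb_ge0 h|rewrite subKr].
Qed.

Lemma posD x y : pos x -> pos y -> pos (x + y).
Proof.
move=> [xs [s s0 hs]] [ys [t t0 ht]]; split; first by rewrite ustarD xs ys.
by exists (s + t); rewrite ?addr_ge0// rsD opprD addrACA; exact: nbD.
Qed.

Lemma posZ (t : R) x : 0 <= t -> pos x -> pos (t%:K *: x).
Proof.
move=> t0 [xs [s s0 hs]]; split; first by rewrite ustarZr xs.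
by exists (t * s); rewrite ?mulr_ge0// rsM -scalerBr; exact: nbZr.
Qed.

Lemma pos_cst (t : R) : 0 <= t -> pos (rs t).
Proof. by move=> t0; split; [exact: ustar_cst|exists t; rewrite ?subrr//; exact: nb0]. Qed.

Lemma pos_sq_le c (r : R) : ustar c = c -> 0 <= r -> pos (rs (r ^+ 2) - c * c) -> nb c r.
Proof.
move=> cs r0 /pos_sqrt[e [es ee _ ec]].
apply: (@nb_sumsq c e) => //; last by rewrite ee addrC subrK.
by apply: ec; rewrite mulrBr mulrBl ucstC mulrA.
Qed.

Lemma pos_le x t : 0 <= t -> pos x -> pos (rs t - x) -> nb x t.
Proof.
move=> t0 /pos_sqrt[g [gs <- _ _]] h; rewrite -[t]sqr_sqrtr// expr2.
suff H : nb g (Num.sqrt t) by exact: nbM.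
by apply: pos_sq_le; rewrite ?sqrtr_ge0// sqr_sqrtr.
Qed.

Lemma pos_le2 x y t : pos x -> pos y -> nb (x + y) t -> nb x t.
Proof.
move=> px py h; apply: pos_le => //; first exact: nb_ge0 h.
have -> : rs t - x = (rs t - (x + y)) + y by rewrite opprD addrA subrK.
by apply: posD => //; apply: pos_of_nb => //; case: (posD px py).
Qed.

(* Kaplansky: [|h| - h] is shown to vanish by means of [v = c (|h| - h)], for
   which both [v v^*] and [- v^* v] are positive. *)
Lemma pos_star_mul c : pos (ustar c * c).
Proof.
pose h := ustar c * c.
have hs : ustar h = h by rewrite ustarM ustarK.
(* Here [n0] is |h|, [q] is a square root of |h|, and [n] below is twice the negative part of h. *)
have [n0 [n0s n0n0 pn0 n0c]] := pos_sqrt (pos_sq hs).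
have [q [qs qq _ qc]] := pos_sqrt pn0.
have hn0 : h * n0 = n0 * h by apply: n0c; rewrite mulrA.
pose n := n0 - h.
have ns : ustar n = n by rewrite ustarB n0s hs.
have n0n : n0 * n = n * n0 by rewrite mulrBr mulrBl hn0.
have hn : h * n = - (n0 * n) by rewrite !mulrBr n0n0 hn0 opprB.
have qn : q * n = n * q by apply/esym/qc; rewrite n0n.
pose a := (q * n) * (q * n).
have qns : ustar (q * n) = q * n by rewrite ustarM ns qs qn.
have pa : pos a by exact: pos_sq.
pose v := c * n.
have vv : ustar v * v = - a.
  rewrite ustarM ns mulrA -[n * _ * c]mulrA -/h -mulrA hn mulrN; congr (- _).
  by rewrite mulrA -n0n /a [RHS]mulrA -[q * n * q]mulrA -qn mulrA qq.
(* With [x1] and [x2] the real and imaginary parts of v, one has v v^* + v^* v = 2 x1^2 + 2 x2^2,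
   while v^* v = - a. *)
have pm : pos (v * ustar v).
  pose x1 := (2^-1 : R)%:K *: (v + ustar v).
  pose x2 := ((2^-1 : R)%:K * - 'i) *: (v - ustar v).
  have s1 : ustar x1 = x1 by rewrite ustarZr ustarD ustarK addrC.
  have s2 : ustar x2 = x2.
    rewrite ustarZ ustarB ustarK rmorphM rmorphN/= conjCi opprK.
    by rewrite conj_Creal ?complex_real// -[ustar v - v]opprB scalerN -scaleNr /x2 mulrN.
  have -> : v * ustar v = (x1 * x1 + x1 * x1) + (x2 * x2 + x2 * x2) + a.
    have E1 : x1 * x1 + x2 * x2 = (2^-1 : R)%:K *: (v * ustar v + ustar v * v).
      rewrite scalerC2 -scalerAl -scalerAr scalerA.
      rewrite [X in _ + X *: _](_ : _ = - (2^-1 * 2^-1)%:K); last first.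
        by rewrite mulrACA mulrNN mulCii mulrN1 rmorphM.
      rewrite scaleNr -scalerBr rmorphM -scalerA; congr (_ *: _).
      rewrite -[RHS]half2; congr (_ *: _).
      rewrite !mulrDl !mulrDr !mulrN !mulNr opprK !opprD !opprK.
      by rewrite [LHS](AC ((2*2)*(2*2)) (((1*5)*(4*8))*((2*6)*(3*7))))/= !subrr !add0r addrACA.
    by rewrite addrACA E1 -scalerDr half2 vv subrK.
  by do !apply: posD => //; exact: pos_sq.
have step (s : R) : 0 <= s -> nb a s -> nb a (3 / 4 * s).
  move=> s0 as_.
  have vs : nb v (Num.sqrt s).
    by apply: nb_star_sq; rewrite ?sqrtr_ge0// sqr_sqrtr// vv; exact: nbN.
  have ms : nb (v * ustar v) s.
    by rewrite -[s]sqr_sqrtr// expr2; apply: nbM => //; exact: nb_star.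
  have := nbM (nbM (nb_star vs) (pos_nb pm ms)) vs.
  have -> : ustar v * (rs s - v * ustar v) * v = - (s%:K *: a + a * a).
    rewrite mulrBr mulrBl -ucstC ucstE -scalerAl vv [ustar v * (_ * _)]mulrA vv.
    by rewrite -mulrA vv mulrNN scalerN opprD.
  rewrite [Num.sqrt s * s * _]mulrAC -[Num.sqrt s * _]expr2 sqr_sqrtr// => /nbN; rewrite opprK => /pos_of_nb.
  have [as1 _] := pa.
  rewrite ustarD ustarZr ustarM as1 => /(_ erefl) H.
  have H2 : nb (a + rs (s / 2)) (5 / 4 * s).
    apply: pos_sq_le; rewrite ?ustarD ?as1 ?ustar_cst ?mulr_ge0//.
    have -> : rs ((5 / 4 * s) ^+ 2) - (a + rs (s / 2)) * (a + rs (s / 2)) =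
       (rs (s * s) - (s%:K *: a + a * a)) + rs (5 / 16 * s ^+ 2).
      have -> : (a + rs (s / 2)) * (a + rs (s / 2)) = rs ((s / 2) ^+ 2) + (s%:K *: a + a * a).
        rewrite mulrDl !mulrDr -ucstC -rsMM -expr2 !ucstE.
        rewrite [LHS](AC (2*2) (4*((2*3)*1)))/= -scalerDl -rmorphD/=.
        by rewrite -splitr.
      by rewrite opprD addrA -rsB [RHS]addrAC -rsD; congr (rs _ - _); field.
    by apply: posD => //; apply: pos_cst; rewrite mulr_ge0// sqr_ge0.
  apply: pos_le => //; first by rewrite mulr_ge0.
  have -> : rs (3 / 4 * s) - a = rs (5 / 4 * s) - (a + rs (s / 2)).
    by rewrite [a + _]addrC opprD addrA -rsB; congr (rs _ - _); field.
  apply: pos_of_nb H2; by rewrite ustarD as1 ustar_cst.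
have a0 : a = 0.
  have [t ht] := nb_ex a; have t0 := nb_ge0 ht.
  have H k : nb a ((3 / 4) ^+ k * t).
    elim: k => [|k ih]; first by rewrite expr0 mul1r.
    by rewrite exprS -mulrA; apply: step => //; rewrite mulr_ge0// exprn_ge0.
  apply: (@ucv_unique _ _ (fun=> 0)); last exact: ucv_cst.
  move=> e e0.
  have : ((3 / 4) ^+ k * t : R) @[k --> \oo] --> (0 * t : R).
    apply: cvgMl; apply: cvg_expr; rewrite ger0_norm// ltr_pdivrMr// mul1r ltr_nat//.
  rewrite mul0r => /cvgrPdist_le/(_ _ e0)[K _ hK]; exists K => k Kk.
  rewrite sub0r; apply/nbN; apply: nb_le (H k).
  have := hK _ Kk; rewrite sub0r normrN; apply: le_trans; exact: ler_norm.
have qn0 : q * n = 0.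
  by apply: nb0_eq0; apply: nb_sq => //; rewrite expr0n/= -/a a0; exact: nb0.
have n0n0' : n0 * n = 0 by rewrite -qq -mulrA qn0 mulr0.
have nz : n = 0.
  apply: nb0_eq0; apply: nb_sq => //; rewrite expr0n/= {1}/n mulrBl hn n0n0' oppr0 subr0; exact: nb0.
by rewrite -/h -[h](subrK n0) -opprB -/n nz oppr0 add0r.
Qed.

Lemma uinM (a b : A) : uin a * uin b = uin (cmul a b).
Proof. by congr pair; rewrite /= ?mulr0// !scale0r !add0r. Qed.
Lemma uinD (a b : A) : uin (a + b) = uin a + uin b.
Proof. by congr pair; rewrite /= addr0. Qed.
Lemma uinN (a : A) : uin (- a) = - uin a.
Proof. by congr pair; rewrite /= oppr0. Qed.
Lemma uinZ (t : R[i]) (a : A) : uin (t *: a) = t *: uin a.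
Proof. by congr pair; rewrite /= scaler0. Qed.
Lemma ustar_uin (a : A) : ustar (uin a) = uin (cstar a).
Proof. by congr pair; rewrite /= conjC0. Qed.
Lemma uin_inj : injective (@uin R A).
Proof. by move=> a b []. Qed.
Lemma uinE x : x.1 = 0 -> x = uin x.2.
Proof. by case: x => t a /= ->. Qed.
Lemma usub_uin1 x : x.1 = 1 -> exists a, 1 - x = uin a.
Proof. by move=> x1; exists (1 - x).2; apply: uinE; rewrite /= x1 subrr. Qed.

Lemma pos_conj c x : pos x -> ustar c = c -> pos (c * x * c).
Proof.
move=> /pos_sqrt[g [gs <- _ _]] cs; have -> : c * (g * g) * c = ustar (g * c) * (g * c).
  by rewrite ustarM gs cs !mulrA.
exact: pos_star_mul.
Qed.

Lemma pos_cstar_mul (a : A) : pos (uin (cmul (cstar a) a)).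
Proof. by rewrite -uinM -ustar_uin; exact: pos_star_mul. Qed.

Lemma pos_sqrt_uin (a : A) : pos (uin a) -> exists g : A, [/\ cstar g = g, cmul g g = a,
  pos (uin g) & forall z, z * uin a = uin a * z -> z * uin g = uin g * z].
Proof.
move=> /pos_sqrt[g [gs gg pg gc]].
have g1 : g = uin g.2.
  apply: uinE; have /(congr1 fst)/= /eqP := gg; rewrite mulf_eq0 orbb => /eqP //.
exists g.2; rewrite -g1; split => //; apply: uin_inj.
  by rewrite -ustar_uin -g1.
by rewrite -uinM -g1.
Qed.

(** The scalar part t of the root satisfies 2t = t^2 and |t| <= 1, so t = 0 and the root lies in
    [A]. *)
Lemma uroot_uin (a : A) : cstar a = a -> rnorm a <= 1 ->
  exists b, [/\ cstar b = b, b + b = a + cmul b b & forall z : A, cmul z a = cmul a z -> cmul z b = cmul b z].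
Proof.
move=> as_ a1.
have s : ustar (uin a) = uin a by rewrite ustar_uin as_.
have /(uroot_ex s)[b [bs [b1 _] bb bc]] : nb (uin a) 1 by exact/nb_uin.
have b0 : b = uin b.2.
  apply: uinE; have /(congr1 fst)/= /eqP := bb.
  rewrite add0r -mulr2n -mulr_natl -subr_eq0 -mulrBl mulf_eq0 => /orP[|/eqP//].
  rewrite subr_eq0 => /eqP b2; move: b1; rewrite -b2.
  by rewrite -(rmorph_nat (real_complex R)) rnorm_real ger0_norm// leNgt ltr1n.
exists b.2; split => [||z zy].
- by apply: uin_inj; rewrite -ustar_uin -b0.
- by apply: uin_inj; rewrite !uinD -uinM -b0.
- by apply: uin_inj; rewrite -!uinM -b0; apply: bc; rewrite !uinM zy.
Qed.

(** Let c be the sum of the b b^* divided by t, and E = 1 - a. For each b in the list, |E b|^2 = |E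
    b b^* E| is at most t |E c E|, the other summands being positive, and |E c| <= 2/N. *)
Lemma approx_unit (bs : seq A) (e : R) : 0 < e -> exists a : A,
  (forall v, rnorm (v - cmul a v) <= rnorm v) /\
  (forall b, b \in bs -> rnorm (b - cmul a b) <= e).
Proof.
move=> e0.
pose S (s : seq A) : U := \sum_(b <- s) uin b * ustar (uin b).
have pS s : pos (S s).
  rewrite /S; elim/big_rec : _ => [|b x _ px]; first by rewrite -rs0; exact: pos_cst.
  by apply: posD => //; rewrite -{1}[uin b]ustarK; exact: pos_star_mul.
have [t0 ht0] := nb_ex (S bs); pose t := t0 + 1.
have t00 := nb_ge0 ht0.
have tp : 0 < t by rewrite ltr_wpDl.
have ht : nb (S bs) t by apply: nb_le ht0; rewrite lerDl.
pose c := t^-1%:K *: S bs.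
have cs : ustar c = c by rewrite ustarZr; case: (pS bs) => ->.
have tV0 : 0 <= t^-1 by rewrite invr_ge0 ltW.
have c1 : nb (1 - c) 1.
  rewrite -rs1; apply: pos_nb; first exact: posZ.
  by rewrite -[X in nb _ X](@mulVf _ t) ?gt_eqF//; exact: nbZr.
have pc : pos c by exact: posZ.
have S1 s : (S s).1 = 0.
  by rewrite /S; elim/big_rec : _ => [//|b x _ /= ->]; rewrite mul0r addr0.
have [N [N0 hN]] : exists N, (0 < N)%N /\ t * (2 / N%:R) <= e ^+ 2.
  have x0 : 0 <= 2 * t / e ^+ 2 by rewrite divr_ge0 ?sqr_ge0// mulr_ge0// ltW.
  exists (Num.bound (2 * t / e ^+ 2)).+1; split => //.
  rewrite mulrA [t * 2]mulrC ler_pdivrMr// [e ^+ 2 * _]mulrC -ler_pdivrMr ?exprn_gt0//.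
  by rewrite (le_trans (ltW (archi_boundP x0)))// ler_nat.
have NE : N%:R = \sum_(j < N) 1 :> R by rewrite sumr_const card_ord.
have Np : 0 < N%:R :> R by rewrite ltr0n.
(* An average of powers of 1 - c instead of a resolvent: its norm is at most 1, its scalar part is
   1, and its product with c telescopes to (1 - (1 - c)^N)/N. *)
pose E : U := N%:R^-1%:K *: \sum_(j < N) (1 - c) ^+ j.
have n1c j : nb ((1 - c) ^+ j) 1.
  elim: j => [|j ih]; first exact: nb1.
  by rewrite exprS -[X in nb _ X]mulr1; exact: nbM.
have Es : ustar E = E.
  rewrite ustarZr; congr (_ *: _).
  have us j : ustar ((1 - c) ^+ j) = (1 - c) ^+ j.
    by elim: j => [|j ih]; [exact: ustar1|rewrite exprSr ustarM ih ustarB ustar1 cs -exprS -exprSr].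
  elim/big_rec : _ => [|j x _ xs]; first exact: ustar0.
  by rewrite ustarD xs us.
have E1 : nb E 1.
  have -> : 1 = N%:R^-1 * N%:R :> R by rewrite mulVf ?gt_eqF.
  apply: nbZr; first by rewrite invr_ge0 ltW.
  rewrite [X in nb _ X]NE.
  apply: (big_ind2 (fun x t => nb x t)) => [|x s y t' hx hy|j _]; [exact: nb0|exact: nbD|exact: n1c].
have Ec : nb (E * c) (2 / N%:R).
  rewrite /E -scalerAl mulrC.
  have -> : (\sum_(j < N) (1 - c) ^+ j) * c = 1 - (1 - c) ^+ N.
    have cc j : c * (1 - c) ^+ j = (1 - c) ^+ j * c.
      by apply: commrX; rewrite /GRing.comm mulrBr mulrBl mulr1 mul1r.
    rewrite -[RHS]opprB subrX1 [1 - c - 1]addrAC subrr add0r mulNr opprK mulr_suml mulr_sumr.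
    by apply: eq_bigr => j _; rewrite cc.
  apply: nbZr; first by rewrite invr_ge0 ltW.
  by rewrite (_ : 2 = 1 + 1)//; apply: nbD; [exact: nb1|exact/nbN/n1c].
have c10 : (1 - c).1 = 1 by rewrite /c /= S1 scaler0 subr0.
have En : E.1 = 1.
  rewrite /E /=.
  have -> : (\sum_(j < N) (1 - c) ^+ j).1 = (N%:R : R)%:K :> R[i].
    rewrite NE rmorph_sum /=.
    apply: (big_ind2 (fun (x : U) (t : R[i]) => x.1 = t)) => [//|x s y t' /= <- <-//|j _].
    elim: (nat_of_ord j) => [|k ih]; first by rewrite expr0 rmorph1.
    by rewrite exprS -[LHS]/((1 - c).1 * ((1 - c) ^+ k).1) ih c10 rmorph1 mulr1.
  by rewrite /GRing.scale/= -rmorphM/= mulVf ?rmorph1// gt_eqF.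
have [a aE] := usub_uin1 En.
have act v : v - cmul a v = uact E v.
  have -> : E = 1 - uin a by rewrite -aE subKr.
  by rewrite /uact/= subr0 scale1r sub0r cmulNl.
exists a; split => [v|b bbs]; first by rewrite act; case: E1 => _ /(_ v); rewrite mul1r.
rewrite act -(@ler_pXn2r _ 2)// ?nnegrE ?rnorm_ge0 ?(ltW e0)// (le_trans _ hN)//.
have -> : uact E b = (E * uin b).2 by rewrite /uact/= addr0 || rewrite /uact /= scale0r addr0.
have Eb : E * uin b = uin (E * uin b).2 by apply: uinE; rewrite /= mulr0.
rewrite -rnormC'; apply/nb_uin; rewrite -uinM -ustar_uin -Eb ustarM Es mulrA -[E * _ * _]mulrA.
apply: (@pos_le2 _ (E * (S (rem b bs)) * E)).
- by apply: pos_conj => //; rewrite -{1}[uin b]ustarK; exact: pos_star_mul.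
- exact: pos_conj.
- rewrite -mulrDl -mulrDr.
  have -> : uin b * ustar (uin b) + S (rem b bs) = t%:K *: c.
    rewrite scalerA -rmorphM/= mulfV ?gt_eqF// rmorph1 scale1r /S.
    by rewrite [RHS](perm_big _ (perm_to_rem bbs)) big_cons.
  have scal (x z y : U) s : x * (s *: y) * z = s *: (x * y * z) by rewrite -scalerAr -scalerAl.
  rewrite scal; apply: nbZr; first exact: ltW.
  by rewrite -[X in nb _ X]mulr1; exact: nbM.
Qed.

End pos.

(** * Contractivity of morphisms *)

Section morphisms.
Context {R : realType}.

(** For a self-adjoint a of norm 1 the iteration provides b with (1 - b)^2 = 1 - a^2. Applying phi
    gives phi(a)^2 + (1 - phi(b))^2 = 1 in the unitization, so |phi(a)| <= 1. The general case
    follows from the $C^*$-identity. *)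
Lemma morphism_contractive (A B : cstarAlgebra R) (phi : A -> B) :
  is_cstar_morphism phi -> forall a, rnorm (phi a) <= rnorm a.
Proof.
move=> [lphi Mphi sphi].
have Z t a : phi (t *: a) = t *: phi a by exact: linZ.
have D a b : phi (a + b) = phi a + phi b by exact: linD.
have H a : cstar a = a -> rnorm (phi a) <= rnorm a.
  move=> as_; have [a0|a0] := eqVneq (rnorm a) 0.
    have /eqP -> : a == 0 by rewrite -rnorm_eq0 a0.
    by rewrite (lin0 lphi) !rnorm0.
  have ap : 0 < rnorm a by rewrite lt_def a0 rnorm_ge0.
  pose a' := ((rnorm a)^-1%:C)%C *: a.
  have a's : cstar a' = a' by rewrite cstarZ as_ conj_Creal// complex_real.
  have a'1 : rnorm a' = 1 by rewrite rnormZr ger0_norm ?invr_ge0 ?rnorm_ge0// mulVf.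
  have [||b [bs bb bc]] := @uroot_uin R A (cmul a' a').
  - by rewrite cstarM a's.
  - by rewrite (le_trans (rnormM_le _ _))// a'1 mulr1.
  have : nb (uin (phi a')) 1.
    apply: (@nb_sumsq _ _ _ (1 - uin (phi b))) => //.
    - by rewrite ustar_uin -sphi a's.
    - by rewrite ustarB ustar1 ustar_uin -sphi bs.
    - by rewrite mulrBr mulrBl mulr1 mul1r !uinM -!Mphi bc// cmulA.
    - rewrite (@onesub_sq _ _ _ (uin (phi (cmul a' a')))).
        by rewrite expr1n rs1 uinM Mphi addrC subrK.
      by rewrite uinM -Mphi -!uinD -!D bb.
  move=> /nb_uin; rewrite Z rnormZr ger0_norm ?invr_ge0 ?rnorm_ge0//.
  by rewrite mulrC ler_pdivrMr// mul1r.
move=> a; rewrite -(@ler_pXn2r _ 2)// ?nnegrE ?rnorm_ge0//.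
by rewrite -!rnormC -sphi -Mphi H// cstarM cstarK.
Qed.

End morphisms.

(** * Representations on Hilbert spaces *)

Section hilbert.
Context {R : realType}.

(* The discriminant argument behind the Cauchy-Schwarz inequality. *)
Lemma disc_le (p q : R) (z : R[i]) : 0 <= p -> 0 <= q ->
  (forall t : R[i], 0 <= p + 2 * complex.Re (t * z) + rnorm (t : R[i]^o) ^+ 2 * q) ->
  rnorm (z : R[i]^o) ^+ 2 <= p * q.
Proof.
move=> p0 q0 h; set m := rnorm _.
have m0 : 0 <= m by exact: rnorm_ge0.
have zz : z * z^* = ((m ^+ 2)%:C)%C by rewrite rmorphXn/= -normr_rnorm normCK.
have H (s : R) : 0 <= p - 2 * s * m ^+ 2 + s ^+ 2 * m ^+ 2 * q.
  have := h (- (s%:C)%C * z^*).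
  have -> : - (s%:C)%C * z^* * z = - ((s * m ^+ 2)%:C)%C.
    by rewrite -mulrA [z^* * z]mulrC zz mulNr -rmorphM.
  rewrite rnormcM rnorm_conj rnormN rnorm_real exprMn real_normK ?num_real//=.
  by rewrite mulrN mulrA.
have [q00|qn] := eqVneq q 0; last first.
  have qp : 0 < q by rewrite lt_def qn.
  have := H q^-1; have -> : p - 2 * q^-1 * m ^+ 2 + q^-1 ^+ 2 * m ^+ 2 * q = p - m ^+ 2 / q.
    by field.
  by rewrite subr_ge0 ler_pdivrMr.
rewrite q00 mulr0; have [->|mn] := eqVneq m 0; first by rewrite expr0n.
have mp : 0 < m ^+ 2 by rewrite exprn_gt0// lt_def mn.
have := H ((p + 1) / m ^+ 2); rewrite q00 mulr0 addr0.
have -> : p - 2 * ((p + 1) / m ^+ 2) * m ^+ 2 = - p - 2 by field; rewrite mn.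
by move=> h1; exfalso; lra.
Qed.

Variable H : hilbertSpace R.
Implicit Types x y z : H.

Lemma ipDl x y z : ip (x + y) z = ip x z + ip y z.
Proof. by rewrite ip_conj ipDr rmorphD/= -!ip_conj. Qed.
Lemma ipZl (a : R[i]) x y : ip (a *: x) y = a^* * ip x y.
Proof. by rewrite ip_conj ipZr rmorphM/= -ip_conj. Qed.
Lemma ip0r x : ip x 0 = 0.
Proof. by rewrite -(scale0r (0 : H)) ipZr mul0r. Qed.
Lemma ip0l x : ip 0 x = 0.
Proof. by rewrite ip_conj ip0r conjC0. Qed.
Lemma ipNr x y : ip x (- y) = - ip x y.
Proof. by rewrite -scaleN1r ipZr mulN1r. Qed.
Lemma ipNl x y : ip (- x) y = - ip x y.
Proof. by rewrite ip_conj ipNr rmorphN/= -ip_conj. Qed.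
Lemma ipBr x y z : ip x (y - z) = ip x y - ip x z.
Proof. by rewrite ipDr ipNr. Qed.
Lemma ipBl x y z : ip (x - y) z = ip x z - ip y z.
Proof. by rewrite ipDl ipNl. Qed.

Lemma ip_rnorm x : ip x x = ((rnorm x ^+ 2)%:C)%C.
Proof. by rewrite ip_norm normr_rnorm rmorphXn. Qed.

Lemma Re_ip x : complex.Re (ip x x) = rnorm x ^+ 2.
Proof. by rewrite ip_rnorm. Qed.

Lemma ip_CS x y : rnorm (ip x y : R[i]^o) <= rnorm x * rnorm y.
Proof.
rewrite -(@ler_pXn2r _ 2)// ?nnegrE ?mulr_ge0 ?rnorm_ge0//.
rewrite exprMn; apply: disc_le; rewrite ?sqr_ge0// => t.
suff <- : complex.Re (ip (x + t *: y) (x + t *: y)) = rnorm x ^+ 2 + 2 * complex.Re (t * ip x y) + rnorm (t : R[i]^o) ^+ 2 * rnorm y ^+ 2.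
  by rewrite Re_ip sqr_ge0.
rewrite ipDl !ipDr ipZr !raddfD/= Re_ip -addrA -addrA; congr (_ + _).
rewrite addrA; congr (_ + _); last by rewrite Re_ip rnormZ exprMn.
rewrite [ip (_ *: _) _]ip_conj ipZr; case: (t * ip x y) => a b /=; by rewrite mulr2n mulrDl mul1r.
Qed.

Lemma rnorm_le_ip x (C : R) : 0 <= C ->
  (forall y, rnorm (ip y x : R[i]^o) <= C * rnorm y) -> rnorm x <= C.
Proof.
move=> C0 /(_ x); rewrite ip_rnorm rnorm_real ger0_norm ?sqr_ge0// expr2.
have [->//|x0] := eqVneq (rnorm x) 0.
by rewrite ler_pM2r// lt_def x0 rnorm_ge0.
Qed.

Lemma cvg_ip T (F : set_system T) {FF : Filter F} (f : T -> H) x y :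
  f t @[t --> F] --> y -> (ip x (f t) : R[i]^o) @[t --> F] --> (ip x y : R[i]^o).
Proof.
move=> fy; apply: (@cvg_squeeze_rnorm R R[i]^o _ _ _ _ _ (fun t => rnorm x * rnorm (f t - y))).
  by move=> t; rewrite -ipBr ip_CS.
by rewrite -[X in _ --> X](mulr0 (rnorm x)); apply: cvgMr; exact/cvg_rnorm0P.
Qed.

End hilbert.

Section representation.
Context {R : realType} {A : cstarAlgebra R} {H : hilbertSpace R} (r : A -> H -> H).
Hypothesis hr : is_star_rep r.

Lemma rep_lin a : linear (r a). Proof. by case: hr => /(_ a)[]. Qed.
Lemma repD a b x : r (a + b) x = r a x + r b x.
Proof. by case: hr => _ h _ _; rewrite -[a]scale1r h !scale1r. Qed.
Lemma rep0 x : r 0 x = 0.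
Proof. by apply: (addIr (r 0 x)); rewrite -repD !add0r. Qed.
Lemma repZ t a x : r (t *: a) x = t *: r a x.
Proof. by case: hr => _ h _ _; rewrite -[t *: a]addr0 h rep0 addr0. Qed.
Lemma repN a x : r (- a) x = - r a x.
Proof. by rewrite -scaleN1r repZ scaleN1r. Qed.
Lemma repB a b x : r (a - b) x = r a x - r b x.
Proof. by rewrite repD repN. Qed.
Lemma repM a b x : r (cmul a b) x = r a (r b x).
Proof. by case: hr. Qed.
Lemma rep_adj a x y : ip (r (cstar a) x) y = ip x (r a y).
Proof. by case: hr => _ _ _ /(_ a). Qed.
Lemma rep_adj' a x y : ip (r a x) y = ip x (r (cstar a) y).
Proof. by rewrite -rep_adj cstarK. Qed.

Lemma rep_norm_sq a x : ((rnorm (r a x) ^+ 2)%:C)%C = ip x (r (cmul (cstar a) a) x).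
Proof. by rewrite repM -rep_adj' ip_rnorm. Qed.

(** For c of norm 1 and b with (1 - b)^2 = 1 - c^* c, one has |x|^2 - |c x|^2 = |(1 - b) x|^2 >=
    0. *)
Lemma rep_contractive a x : rnorm (r a x) <= rnorm a * rnorm x.
Proof.
have [a0|a0] := eqVneq (rnorm a) 0.
  have /eqP -> : a == 0 by rewrite -rnorm_eq0 a0.
  by rewrite rep0 !rnorm0 mul0r.
have ap : 0 < rnorm a by rewrite lt_def a0 rnorm_ge0.
pose c := ((rnorm a)^-1%:C)%C *: a.
have c1 : rnorm c = 1 by rewrite rnormZr ger0_norm ?invr_ge0 ?rnorm_ge0// mulVf.
suff : rnorm (r c x) <= rnorm x.
  rewrite repZ rnormZr ger0_norm ?invr_ge0 ?rnorm_ge0//.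
  by rewrite mulrC ler_pdivrMr// mulrC.
rewrite -(@ler_pXn2r _ 2)// ?nnegrE ?rnorm_ge0//.
have [||b [bs bb _]] := @uroot_uin R A (cmul (cstar c) c).
- by rewrite cstarM cstarK.
- by rewrite rnormC c1 expr1n.
have E : cmul (cstar c) c = b + b - cmul b b by rewrite bb addrK.
rewrite -lecR rep_norm_sq E repB repD ipBr ipDr -ip_rnorm.
have -> : ip x (r (cmul b b) x) = ip (r b x) (r b x) by rewrite repM -rep_adj bs.
have -> : ip x (r b x) + ip x (r b x) - ip (r b x) (r b x) =
    ip x x - ip (x - r b x) (x - r b x).
  have bx : ip (r b x) x = ip x (r b x) by rewrite rep_adj' bs.
  by rewrite ipBl !ipBr bx; ring.
by rewrite lerBlDr lerDl [ip (_ - _) _]ip_rnorm ler0c sqr_ge0.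
Qed.

(* [ip (r x v) v <= 0] on vectors, so [p = |x|] gives [r (p + x) = 0]. *)
Lemma rep_neg_part (b c x p q : A) (t : R) : 0 <= t -> (forall y, rnorm (r b y) <= t * rnorm y) ->
  c = cmul (cstar b) b -> cstar c = c -> x = cmul c c - ((t ^+ 2)%:C)%C *: c -> cstar x = x ->
  cstar p = p -> cmul p p = cmul x x -> cstar q = q -> cmul q q = p -> cmul p x = cmul x p ->
  forall v, r (p + x) v = 0.
Proof.
move=> t0 bt cE cs xE xs ps pp qs qq px.
pose s := t ^+ 2.
have cb v : ip v (r c v) = ((rnorm (r b v) ^+ 2)%:C)%C by rewrite cE rep_norm_sq.
pose Z := p + x.
have Zs : cstar Z = Z by rewrite cstarD ps xs.
have pge v : 0 <= ip v (r p v).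
  by rewrite -qq repM -rep_adj qs ip_rnorm ler0c sqr_ge0.
have cge v : ip v (r (cmul c c) v) = ((rnorm (r c v) ^+ 2)%:C)%C.
  by rewrite rep_norm_sq cs.
have xle v : ip v (r x v) <= 0.
  rewrite xE repB repZ ipBr ipZr cge cb -rmorphM -rmorphB lecR subr_le0.
  have := ip_CS (r b v) (r b (r c v)); have : ip (r b v) (r b (r c v)) = ip (r c v) (r c v).
    by rewrite rep_adj' -repM -cE -{1}cs -rep_adj'.
  move=> ->; rewrite ip_rnorm rnorm_real ger0_norm ?sqr_ge0// => h.
  have h2 : rnorm (r c v) ^+ 2 <= rnorm (r b v) * (t * rnorm (r c v)).
    by apply: le_trans h _; rewrite ler_wpM2l ?rnorm_ge0.
  have [->|c0] := eqVneq (rnorm (r c v)) 0.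
    by rewrite expr0n mulr_ge0// sqr_ge0.
  have cp : 0 < rnorm (r c v) by rewrite lt_def c0 rnorm_ge0.
  move: h2; rewrite mulrA expr2 ler_pM2r// => h2.
  rewrite -expr2 /s -exprMn ler_pXn2r ?nnegrE ?mulr_ge0 ?rnorm_ge0//.
  by rewrite mulrC.
move=> v; rewrite -/Z.
have E w : ip (r Z w) (r p (r Z w)) = ip (r Z w) (r x (r Z w)).
    apply/eqP; rewrite -subr_eq0 -ipBr -repB -repM.
    have -> : cmul (p - x) Z = 0.
      by rewrite /Z cmulDr !cmulBl pp px subrKA subrr.
    by rewrite rep0 ip0r.
have E0 w : ip (r Z w) (r p (r Z w)) = 0.
    by apply/le_anti; rewrite pge E xle.
have qZ w : r q (r Z w) = 0.
    by apply/eqP; rewrite -rnorm_eq0 -sqrf_eq0 -Re_ip -{1}qs rep_adj -repM qq E0.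
have ZZ w : r Z (r Z w) = 0.
    have -> : r Z (r Z w) = r p (r Z w) + r p (r Z w).
      by rewrite -!repM -repD /Z cmulDl !cmulDr px pp [cmul x p + _]addrC.
    by rewrite -qq repM qZ (lin0 (rep_lin q)) addr0.
  apply/eqP; rewrite -rnorm_eq0 -sqrf_eq0 -Re_ip.
  by rewrite -{1}Zs rep_adj ZZ ip0r.
Qed.

End representation.

Section representation_family.
Context {R : realType} {A : cstarAlgebra R} (I : Type) (H : I -> hilbertSpace R)
  (r : forall i, A -> H i -> H i).
Hypothesis hr : forall i, is_star_rep (@r i).

(* If [s = t^2] bounds [b^* b], then [Z = |x| + x] with [x = c^2 - s c] and
   [c = b^* b] lies in the kernel, so that [s c - c^2 = |x|] is positive. *)
Lemma rep_isometric_family (b : A) (t : R) : (forall a, (forall i x, @r i a x = 0) -> a = 0) ->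
  0 <= t -> (forall i x, rnorm (@r i b x) <= t * rnorm x) -> rnorm b <= t.
Proof.
move=> inj t0 bt; have [c cE] : exists c, c = cmul (cstar b) b by exists (cmul (cstar b) b).
pose s := t ^+ 2.
have s0 : 0 <= s by exact: sqr_ge0.
have cs : cstar c = c by rewrite cE cstarM cstarK.
have [x xE] : exists x, x = cmul c c - (s%:C)%C *: c by exists (cmul c c - (s%:C)%C *: c).
have cx : cmul c x = cmul x c by rewrite xE cmulBr cmulBl cmulZl cmulZr cmulA.
have xs : cstar x = x by rewrite xE cstarB cstarM cs cstarZ cs conj_Creal// complex_real.
have [p [ps pp pos_p pc]] : exists p, [/\ cstar p = p, cmul p p = cmul x x, pos (uin p) &
    forall z, z * uin (cmul x x) = uin (cmul x x) * z -> z * uin p = uin p * z].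
  by apply: pos_sqrt_uin; rewrite -{1}xs; exact: pos_cstar_mul.
have [q [qs qq _ qc]] := pos_sqrt_uin pos_p.
have px : cmul p x = cmul x p.
  by apply: uin_inj; rewrite -!uinM -pc// !uinM cmulA.
have pcc : cmul p c = cmul c p.
  by apply: uin_inj; rewrite -!uinM -pc// !uinM !cmulA cx -!cmulA cx.
have qc' : cmul q c = cmul c q.
  by apply: uin_inj; rewrite -!uinM -qc// !uinM pcc.
pose Z := p + x.
have Zs : cstar Z = Z by rewrite cstarD ps xs.
have Z0 i v : @r i Z v = 0 by exact: (rep_neg_part (hr i) t0 (bt i) cE cs xE xs ps pp qs qq px).
have /eqP := inj _ Z0; rewrite /Z addrC addr_eq0 => /eqP xp.
rewrite -(@ler_pXn2r _ 2)// ?nnegrE ?rnorm_ge0// -rnormC -cE -/s.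
apply/nb_uin.
(* Since q^2 = |x| = s c - c^2, one has (c - s/2)^2 + q^2 = (s/2)^2; the sum of two squares then
   places c within s/2 of s/2. *)
have h : nb (uin c - ucst ((s / 2)%:C)%C) (s / 2).
  apply: (@nb_sumsq _ _ _ (uin q)).
  - by rewrite ustarB ustar_uin cs ustar_cst.
  - by rewrite ustar_uin qs.
  - by rewrite mulrBl mulrBr ucstC !uinM qc'.
  - by rewrite divr_ge0.
  have -> : uin q * uin q = - uin x.
    by rewrite uinM qq xp uinN opprK.
  have -> : uin x = uin c * uin c - (s%:C)%C *: uin c by rewrite xE uinD uinN uinZ uinM.
  set X := uin c; set W := ucst _.
  have -> : (s%:C)%C *: X = W * X + W * X.
    by rewrite -mulrDl -rsD -splitr ucstE.
  rewrite mulrBl !mulrBr -ucstC -/W opprB expr2 rsMM -/W opprB; set Y := W * X.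
  by rewrite [LHS](AC ((2*2)*3) (3*((1*7)*((2*5)*(4*6)))))/= subrr !addNr !addr0.
rewrite -(subrK (ucst ((s / 2)%:C)%C) (uin c)).
rewrite [X in nb _ X]splitr; apply: nbD => //; apply: nb_cst; exact: divr_ge0.
Qed.

End representation_family.

Section representation_single.
Context {R : realType} {A : cstarAlgebra R} {H : hilbertSpace R} (r : A -> H -> H).
Hypothesis hr : is_star_rep r.

Lemma rep_isometric (b : A) (t : R) : (forall a, (forall x, r a x = 0) -> a = 0) ->
  0 <= t -> (forall x, rnorm (r b x) <= t * rnorm x) -> rnorm b <= t.
Proof.
move=> inj t0 bt; apply: (@rep_isometric_family R A unit (fun=> H) (fun=> r)) => // a h.
exact: inj (h tt).
Qed.

End representation_single.

(** * The Bochner integral *)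

(* Completeness of [R[i]] is not an instance in the library. *)
Definition cplt (R : realType) (V : normedModType R[i]) := forall u : nat -> V,
  (forall e : R, 0 < e -> exists K, forall k m, (K <= k)%N -> (K <= m)%N ->
     rnorm (u k - u m) <= e) -> exists l : V, u k @[k --> \oo] --> l.

Lemma cplt_complete (R : realType) (V : completeNormedModType R[i]) : cplt V.
Proof. by move=> u /cauchy_seq_cvg/cvg_ex. Qed.

Lemma cplt_complex (R : realType) : cplt R[i]^o.
Proof. exact: cauchy_complex_cvg. Qed.

Section finite_valued.
Context d (T : measurableType d).

(** A measurable function with finitely many values, factored through a finite type so that no
    measurable structure is put on the target. *)
Definition fval (U : Type) (f : T -> U) := exists (I : finType) (p : T -> I) (v : I -> U),
  (forall i, measurable (p @^-1` [set i])) /\ f = v \o p.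

Lemma fval_cst (U : Type) (u : U) : fval (fun=> u).
Proof.
exists unit, (fun=> tt), (fun=> u); split => // -[].
by rewrite (_ : _ @^-1` _ = setT)// eqEsubset; split.
Qed.

Lemma fval_comp (U W : Type) (g : U -> W) (f : T -> U) : fval f -> fval (g \o f).
Proof. by move=> [I [p [v [mp ->]]]]; exists I, p, (g \o v). Qed.

Lemma fval_pair (U W : Type) (f : T -> U) (g : T -> W) : fval f -> fval g ->
  fval (fun x => (f x, g x)).
Proof.
move=> [I [p [v [mp ->]]]] [J [q [w [mq ->]]]].
exists (I * J)%type, (fun x => (p x, q x)), (fun z => (v z.1, w z.2)); split => // -[i j].
rewrite (_ : _ @^-1` _ = p @^-1` [set i] `&` q @^-1` [set j]); first exact: measurableI.
by apply/seteqP; split => x /= [-> ->].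
Qed.

Lemma fval_comp2 (U W Z : Type) (h : U -> W -> Z) (f : T -> U) (g : T -> W) :
  fval f -> fval g -> fval (fun x => h (f x) (g x)).
Proof. by move=> ff fg; exact: (fval_comp (fun z => h z.1 z.2) (fval_pair ff fg)). Qed.

Lemma fval_set (A : set T) : measurable A -> fval (fun x => `[< A x >]).
Proof.
move=> mA; exists bool, (fun x => `[< A x >]), id; split => // -[].
  by rewrite (_ : _ @^-1` _ = A)//; apply/seteqP; split => x /= /asboolP.
rewrite (_ : _ @^-1` _ = ~` A); first exact: measurableC.
by apply/seteqP; split => x /=; [move=> h /asboolP; rewrite h|exact: asboolF].
Qed.

Lemma fval_ffun (n : nat) (A : 'I_n -> set T) : (forall i, measurable (A i)) ->
  fval (fun x => [ffun i => `[< A i x >]]).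
Proof.
move=> mA; exists {ffun 'I_n -> bool}, (fun x => [ffun i => `[< A i x >]]), id; split => // q.
rewrite (_ : _ @^-1` _ = \bigcap_(i in [set` 'I_n]) (fun x => `[< A i x >]) @^-1` [set q i]).
  apply: fin_bigcap_measurable => // i _.
  case: (q i).
    by rewrite (_ : _ @^-1` _ = A i)//; apply/seteqP; split => x /= /asboolP.
  rewrite (_ : _ @^-1` _ = ~` A i); first exact: measurableC.
  by apply/seteqP; split => x /=; [move=> h /asboolP; rewrite h|exact: asboolF].
apply/seteqP; split => [x /= <- i _ /=|x h /=]; first by rewrite ffunE.
by apply/ffunP => i; rewrite ffunE; exact: (h i).
Qed.

Lemma fval_preimage (U : Type) (f : T -> U) (Y : set U) : fval f -> measurable (f @^-1` Y).
Proof.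
move=> [I [p [v [mp ->]]]].
rewrite (_ : _ @^-1` _ = \bigcup_(i in [set i | Y (v i)]) p @^-1` [set i]).
  by apply: fin_bigcup_measurable => //; exact: finite_finset.
apply/seteqP; split => x /=; first by move=> h; exists (p x).
by move=> [i Yi /= ->].
Qed.

Lemma fval_measurable (R : realType) (f : T -> R) : fval f -> measurable_fun setT f.
Proof. by move=> ff _ Y _; rewrite setTI; exact: fval_preimage. Qed.

Lemma integral_fval (R : realType) (mu : {measure set T -> \bar R}) (I : finType) (p : T -> I) (w : I -> R) :
  (forall i, measurable (p @^-1` [set i])) -> (forall i, 0 <= w i) ->
  (\int[mu]_x (w (p x))%:E = \sum_i (w i)%:E * mu (p @^-1` [set i]))%E.
Proof.
move=> mp w0.
rewrite (eq_integral (fun x => \sum_i (w i * \1_(p @^-1` [set i]) x)%:E)%E); last first.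
  move=> x _; rewrite (bigD1 (p x))//= big1 => [|i /eqP ip].
    by rewrite indicE mem_set// mulr1 adde0.
  by rewrite indicE memNset ?mulr0// => E; apply: ip.
rewrite ge0_integral_sum//.
- apply: eq_bigr => i _; rewrite (integralZl_indic _ (fun=> p @^-1` [set i]))//.
    by rewrite integral_indic// setIT.
  by move=> /lt_geF; rewrite w0.
- move=> i; apply/measurable_EFinP; apply: measurable_funM => //.
- by move=> i x _; rewrite lee_fin mulr_ge0.
Qed.

End finite_valued.
Arguments fval_cst {d T U} u.

Section bochner.
Context {R : realType} d (T : measurableType d) (mu : {measure set T -> \bar R}).

Section steps.
Context {V : normedModType R[i]}.
Local Notation step_fun := (step_fun mu V).
Implicit Types (S : step_fun) (F G : T -> V).

Definition inorm F : \bar R := (\int[mu]_x (rnorm (F x))%:E)%E.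

(** Unlike in [strongly_measurable], convergence holds at every point, and the level sets may have
    infinite measure. Such functions can be composed without discussing null sets. *)
Definition smeas F := exists s : nat -> T -> V,
  (forall k, fval (s k)) /\ forall x, s k x @[k --> \oo] --> F x.

(** A convenient representative of an integrable class: up to a null set every Bochner integrable
    function has this form ([integrable_good]). *)
Definition good F := smeas F /\ (inorm F < +oo)%E.

Arguments inorm F%_R.
Lemma inorm_ge0 F : (0 <= inorm F)%E.
Proof. by apply: integral_ge0 => x _; rewrite lee_fin rnorm_ge0. Qed.

Lemma fval_smeas F : fval F -> smeas F.
Proof. by move=> fF; exists (fun=> F); split => // x; exact: cvg_cst. Qed.

Lemma step_eval_ffun S (x : T) : step_eval S x =
  \sum_(i < step_size S) (if [ffun i => `[< step_set i x >]] i then step_val i else 0).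
Proof.
apply: eq_bigr => i _; rewrite ffunE indicE; have [h|h] := asboolP (step_set i x).
  by rewrite mem_set// scale1r.
by rewrite memNset// scale0r.
Qed.

Lemma fval_step S : fval (step_eval S).
Proof.
have /(fval_comp (fun q : {ffun 'I_(step_size S) -> bool} =>
   \sum_i (if q i then step_val i else 0))) := fval_ffun (@step_measurable _ _ _ _ _ S).
by congr fval; apply/funext => x; rewrite step_eval_ffun.
Qed.

Lemma smeas_rnorm F : smeas F -> measurable_fun setT (rnorm \o F).
Proof.
move=> [s [fs sF]]; apply: (@measurable_fun_cvg _ _ _ _ (fun k => rnorm \o s k)).
  by move=> k; apply: fval_measurable; exact: fval_comp.
by move=> x _; apply: cvg_rnorm; exact: sF.
Qed.

Lemma smeas_ernorm F : smeas F -> measurable_fun setT (fun x => (rnorm (F x))%:E).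
Proof. by move=> mF; apply/measurable_EFinP; exact: smeas_rnorm. Qed.

(** The sets of a step function may overlap. They are refined into the atoms given by the patterns
    of membership, on which both integrals are finite sums. *)
Lemma step_int_le S : (inorm (step_eval S) < +oo)%E /\
  ((rnorm (step_int S))%:E <= inorm (step_eval S))%E.
Proof.
pose n := step_size S; pose Q := {ffun 'I_n -> bool}.
pose pat (x : T) : Q := [ffun i => `[< step_set i x >]].
have mpat (q : Q) : measurable (pat @^-1` [set q]).
  by apply: fval_preimage; exact: fval_ffun (@step_measurable _ _ _ _ _ S).
pose w (q : Q) : V := \sum_i (if q i then step_val i else 0).
have fin (q : Q) i : q i -> (mu (pat @^-1` [set q]) < +oo)%E.
  move=> qi; apply: le_lt_trans (step_finite i); apply: le_measure; rewrite ?inE//.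
    exact: step_measurable.
  by move=> x /= E; move: qi; rewrite -E ffunE => /asboolP.
have E1 : inorm (step_eval S) = (\sum_q (rnorm (w q))%:E * mu (pat @^-1` [set q]))%E.
  rewrite -integral_fval//; last by move=> q; exact: rnorm_ge0.
  by apply: eq_integral => x _; rewrite step_eval_ffun.
have w0 (q : Q) : ~ (mu (pat @^-1` [set q]) < +oo)%E -> w q = 0.
  by move=> h; apply: big1 => i _; case: ifP => // /fin.
have E2 : inorm (step_eval S) = (\sum_q rnorm (w q) * fine (mu (pat @^-1` [set q])))%:E.
  rewrite E1 -sumEFin; apply: eq_bigr => q _.
  have [h|/w0 ->] := pselect (mu (pat @^-1` [set q]) < +oo)%E.
    by rewrite EFinM fineK// ge0_fin_numE.
  by rewrite rnorm0 mul0e mul0r.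
split; first by rewrite E2 ltry.
rewrite E2 lee_fin.
have -> : step_int S = \sum_q ((fine (mu (pat @^-1` [set q])))%:C)%C *: w q.
  rewrite /step_int; under [RHS]eq_bigr do rewrite scaler_sumr.
  rewrite exchange_big /=; apply: eq_bigr => i _.
  have -> : fine (mu (step_set i)) = \sum_(q : Q) (q i)%:R * fine (mu (pat @^-1` [set q])).
    have -> : mu (step_set i) = (\sum_(q : Q) ((q i)%:R : R)%:E * mu (pat @^-1` [set q]))%E.
      rewrite -integral_fval//.
      rewrite -[LHS](_ : \int[mu]_x (\1_(step_set i) x)%:E = _)%E; last first.
        by rewrite integral_indic ?setIT//; exact: step_measurable.
      by apply: eq_integral => x _; rewrite ffunE indicE; congr (_%:E).
    have fin2 (q : Q) : (((q i)%:R : R)%:E * mu (pat @^-1` [set q]))%E = ((q i)%:R * fine (mu (pat @^-1` [set q])))%:E.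
      case qi: (q i); last by rewrite mul0e mul0r.
      by rewrite !mul1e mul1r fineK// ge0_fin_numE//; exact: fin qi.
    by under eq_bigr do rewrite fin2; rewrite sumEFin.
  rewrite rmorph_sum scaler_suml; apply: eq_bigr => q _.
  by case: (q i); rewrite ?mul1r// mul0r rmorph0 scale0r scaler0.
rewrite (le_trans (rnorm_sum _ _ _))//; apply: ler_sum => q _.
by rewrite rnormZr mulrC ger0_norm// fine_ge0.
Qed.

Definition step_lin (a : R[i]) S S' : step_fun :=
  @StepFun _ _ _ _ _ (step_size S + step_size S')
    (fun i => match fintype.split i with inl j => step_set j | inr j => step_set j end)
    (fun i => match fintype.split i with inl j => a *: step_val j | inr j => step_val j end)
    (fun i => match fintype.split i as s return measurable (match s with inl j => step_set j | inr j => step_set j end)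
              with inl j => step_measurable j | inr j => step_measurable j end)
    (fun i => match fintype.split i as s return (mu (match s with inl j => step_set j | inr j => step_set j end) < +oo)%E
              with inl j => step_finite j | inr j => step_finite j end).

Lemma step_eval_lin a S S' x : step_eval (step_lin a S S') x = a *: step_eval S x + step_eval S' x.
Proof.
rewrite /step_eval big_split_ord /= scaler_sumr; congr (_ + _); apply: eq_bigr => i _.
  by rewrite (unsplitK (inl i)) scalerA mulrC -scalerA.
by rewrite (unsplitK (inr i)).
Qed.

Lemma step_int_lin a S S' : step_int (step_lin a S S') = a *: step_int S + step_int S'.
Proof.
rewrite /step_int big_split_ord /= scaler_sumr; congr (_ + _); apply: eq_bigr => i _.
  by rewrite (unsplitK (inl i)) scalerA mulrC -scalerA.
by rewrite (unsplitK (inr i)).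
Qed.

Lemma fval_to_step (f : T -> V) (E : set T) : fval f -> measurable E -> (mu E < +oo)%E ->
  exists S, forall x, step_eval S x = if `[< E x >] then f x else 0.
Proof.
move=> [I [p [v [mp ->]]]] mE fE.
have m (i : 'I_#|I|) : measurable (E `&` p @^-1` [set enum_val i]) by exact: measurableI.
have fi (i : 'I_#|I|) : (mu (E `&` p @^-1` [set enum_val i]) < +oo)%E.
  apply: le_lt_trans fE; apply: le_measure; rewrite ?inE//; exact: subIsetl.
exists (@StepFun _ _ _ _ _ #|I| _ (fun i => v (enum_val i)) m fi) => x.
rewrite /step_eval/=; have [Ex|nEx] := asboolP (E x); last first.
  by apply: big1 => i _; rewrite indicE memNset ?scale0r// => -[].
rewrite (bigD1 (enum_rank (p x)))//= big1 => [|i ix].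
  by rewrite indicE mem_set enum_rankK// scale1r addr0.
rewrite indicE memNset ?scale0r// => -[_ /= E2]; move/eqP: ix; apply.
by rewrite E2 enum_valK.
Qed.

End steps.

Section smeas_comp.
Context {V W : normedModType R[i]}.

Lemma smeas_lin (a : R[i]) (F G : T -> V) : smeas F -> smeas G -> smeas (fun x => a *: F x + G x).
Proof.
move=> [s [fs sF]] [t [ft tG]]; exists (fun k x => a *: s k x + t k x); split => [k|x].
  exact: (fval_comp2 (fun u w => a *: u + w)).
by apply: cvgD; [apply: cvgZc => //; exact: cvg_cst|exact: tG].
Qed.

Lemma smeas_continuous (L : V -> W) (F : T -> V) : continuous L -> smeas F -> smeas (L \o F).
Proof.
move=> cL [s [fs sF]]; exists (fun k => L \o s k); split => [k|x].
  exact: fval_comp.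
by apply: continuous_cvg; [exact: cL|exact: sF].
Qed.

End smeas_comp.
End bochner.
Arguments inorm {R d T} mu {V} F%_R.

Section lower_integral.
Context {R : realType} d (T : measurableType d) (mu : {measure set T -> \bar R}).
Local Open Scope ereal_scope.
Import HBNNSimple.

(* For non-measurable integrands the library's integral is a lower integral. *)
Lemma lint_le (f g : T -> \bar R) : (forall x, 0 <= f x) -> (forall x, f x <= g x) ->
  \int[mu]_x f x <= \int[mu]_x g x.
Proof.
move=> f0 fg; have g0 x : 0 <= g x by exact: le_trans (f0 x) (fg x).
rewrite !ge0_integralTE//; apply: ge_ereal_sup => _ [h hf <-].
by apply: ereal_sup_ubound; exists h => // x; exact: le_trans (hf x) (fg x).
Qed.

Lemma lint_ae_le (f g : T -> \bar R) : (forall x, 0 <= f x) -> (forall x, 0 <= g x) ->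
  {ae mu, forall x, f x <= g x} -> \int[mu]_x f x <= \int[mu]_x g x.
Proof.
move=> f0 g0 [N [mN N0 sub]].
rewrite [leLHS]ge0_integralTE//; apply: ge_ereal_sup => _ [h hf <-].
have mh : measurable_fun setT (fun x => (h x)%:E) by apply/measurable_EFinP.
have h0 x : [set: T] x -> 0 <= (h x)%:E by rewrite lee_fin.
rewrite -integralT_nnsfun (ge0_negligible_integral mN measurableT mh h0 N0).
rewrite integral_mkcond; apply: lint_le => x.
  by apply: erestrict_ge0 => y _; rewrite lee_fin.
rewrite patchE; case: ifPn => // /[!inE] -[_ xN]; apply: le_trans (hf x) _.
by apply: contrapT => h2; apply: xN; exact: sub.
Qed.

Lemma lint_ae_eq (f g : T -> \bar R) : (forall x, 0 <= f x) -> (forall x, 0 <= g x) ->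
  {ae mu, forall x, f x = g x} -> \int[mu]_x f x = \int[mu]_x g x.
Proof.
move=> f0 g0 fg; apply/le_anti/andP; split; apply: lint_ae_le => //;
  by apply: filterS fg => x ->.
Qed.

End lower_integral.

Section bint.
Context {R : realType} d (T : measurableType d) (mu : {measure set T -> \bar R}).

Lemma inorm_le (V W : normedModType R[i]) (F : T -> V) (G : T -> W) :
  (forall x, rnorm (F x) <= rnorm (G x)) -> (inorm mu F <= inorm mu G)%E.
Proof. by move=> h; apply: lint_le => x; rewrite lee_fin ?rnorm_ge0. Qed.

Section one.
Context {V : normedModType R[i]}.
Local Notation step_fun := (step_fun mu V).
Implicit Types (S : step_fun) (F G H : T -> V).

Lemma smeasZ (a : R[i]) F : smeas F -> smeas (fun x => a *: F x).
Proof.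
move=> mF; have := smeas_lin a mF (fval_smeas (fval_cst 0)); congr smeas.
by apply/funext => x; rewrite addr0.
Qed.

Lemma smeasB F G : smeas F -> smeas G -> smeas (F \- G).
Proof.
move=> mF mG; have := smeas_lin (-1) mG mF; congr smeas.
by apply/funext => x; rewrite scaleN1r addrC.
Qed.

Lemma smeas_step S : smeas (step_eval S).
Proof. exact: fval_smeas (fval_step S). Qed.

Lemma inormD F G : smeas F -> smeas G -> (inorm mu (F \+ G) <= inorm mu F + inorm mu G)%E.
Proof.
move=> mF mG; rewrite /inorm -ge0_integralD//; try exact: smeas_ernorm; first last.
- by move=> x _; rewrite lee_fin rnorm_ge0.
- by move=> x _; rewrite lee_fin rnorm_ge0.
apply: lint_le => x; first by rewrite lee_fin rnorm_ge0.
by rewrite -EFinD lee_fin rnormD.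
Qed.

Lemma inormZ (a : R[i]) F : smeas F ->
  inorm mu (fun x => a *: F x) = ((rnorm (a : R[i]^o))%:E * inorm mu F)%E.
Proof.
move=> mF; rewrite /inorm -ge0_integralZl_EFin//.
- by apply: eq_integral => x _; rewrite rnormZ EFinM.
- by move=> x _; rewrite lee_fin rnorm_ge0.
- exact: smeas_ernorm.
- exact: (rnorm_ge0 (a : R[i]^o)).
Qed.

Lemma inormBC F G : inorm mu (F \- G) = inorm mu (G \- F).
Proof. by rewrite /inorm; apply: eq_integral => x _; rewrite /= rnormB. Qed.

Lemma inorm_triangle F G H : smeas F -> smeas G -> smeas H ->
  (inorm mu (F \- H) <= inorm mu (F \- G) + inorm mu (G \- H))%E.
Proof.
move=> mF mG mH; apply: le_trans (inormD (smeasB mF mG) (smeasB mG mH)).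
by apply: inorm_le => x /=; rewrite subrKA.
Qed.

Lemma good_lin (a : R[i]) F G : good mu F -> good mu G -> good mu (fun x => a *: F x + G x).
Proof.
move=> [mF iF] [mG iG]; split; first exact: smeas_lin.
apply: le_lt_trans (inormD (smeasZ a mF) mG) _; rewrite inormZ//.
rewrite lte_add_pinfty// lte_mul_pinfty// lee_fin.
exact: (rnorm_ge0 (a : R[i]^o)).
Qed.

Lemma goodB F G : good mu F -> good mu G -> good mu (F \- G).
Proof.
move=> gF gG; have := good_lin (-1) gG gF; congr good.
by apply/funext => x; rewrite scaleN1r addrC.
Qed.

Lemma good_step S : good mu (step_eval S).
Proof. by split; [exact: smeas_step|case: (step_int_le S)]. Qed.

Lemma step_intB S S' : ((rnorm (step_int S - step_int S'))%:E <= inorm mu (step_eval S \- step_eval S'))%E.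
Proof.
have [_] := step_int_le (step_lin (-1) S' S).
rewrite step_int_lin scaleN1r addrC.
rewrite (_ : step_eval _ = step_eval S \- step_eval S')//.
by apply/funext => x; rewrite step_eval_lin scaleN1r addrC.
Qed.

Lemma integrable_rnorm F : good mu F -> mu.-integrable setT (EFin \o (fun x => rnorm (F x))).
Proof.
move=> [mF iF]; apply/integrableP; split; first exact: smeas_ernorm.
by under eq_integral do rewrite /= ger0_norm ?rnorm_ge0//.
Qed.

Lemma good_dct (F_ : nat -> T -> V) F (g : T -> R) :
  (forall k, smeas (F_ k)) -> smeas F -> (forall x, F_ k x @[k --> \oo] --> F x) ->
  mu.-integrable setT (EFin \o g) -> (forall k x, rnorm (F_ k x) <= g x) ->
  good mu F /\ (inorm mu (F_ k \- F) @[k --> \oo] --> 0%E).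
Proof.
move=> mF_ mF cF ig Fg.
have Fgx x : rnorm (F x) <= g x.
  by apply: rnorm_cvg_le (cF x); exact: nearW.
have gF : good mu F.
  split => //; move/integrableP : ig => [_]; apply: le_lt_trans.
  apply: lint_le => x; rewrite lee_fin ?rnorm_ge0//=.
  by rewrite (le_trans (Fgx x))// ler_norm.
split => //.
have [] := @dominated_convergence _ _ _ mu setT measurableT
   (fun k x => (rnorm ((F_ k \- F) x))%:E) (cst 0%E) (fun x => (2 * g x)%:E).
- by move=> k; apply: smeas_ernorm; exact: smeasB.
- exact: measurable_cst.
- apply: aeW => x _; apply/fine_cvgP; split; first exact: nearW.
  by move/cvg_rnorm0P : (cF x).
- have -> : (fun x => (2 * g x)%:E) = (fun x => 2%:E * (EFin \o g) x)%E by apply/funext => x; rewrite EFinM.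
  exact: integrableZl.
- apply: aeW => x k _ /=; rewrite lee_fin ger0_norm ?rnorm_ge0//.
  by rewrite (le_trans (rnormD _ _))// rnormN mulr2n mulrDl mul1r lerD.
move=> _ _; rewrite integral0; exact.
Qed.

Section exhaustion.
Variable E : nat -> set T.
Hypotheses (mE : forall k, measurable (E k)) (fE : forall k, (mu (E k) < +oo)%E)
  (cE : forall x, exists K, forall k, (K <= k)%N -> E k x).

Lemma good_approx F : good mu F -> exists S : nat -> step_fun, [/\ bochner_approx S F,
  (forall x, step_eval (S k) x @[k --> \oo] --> F x) &
  forall k x, rnorm (step_eval (S k) x) <= 2 * rnorm (F x)].
Proof.
move=> [[s [fs sF]] iF].
have mF : smeas F by exists s.
(* Large values are replaced by 0, which gives domination by 2|F|. The factor 2 leaves room: where F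
   x is not 0, the values are eventually within |F x| of F x, hence kept. *)
pose t k x := if `[< rnorm (s k x) <= 2 * rnorm (F x) >] then s k x else 0.
have ft k : fval (t k).
  apply: (@fval_comp2 _ _ _ _ _ (fun (b : bool) (v : V) => if b then v else 0)) => //.
  apply: fval_set; rewrite -[X in measurable X]setTI.
  have := @measurable_fun_ler _ _ _ setT (rnorm \o s k) (fun x => 2 * rnorm (F x)).
  move=> /(_ _ _ measurableT [set true]) h; apply: h => //.
  - exact: fval_measurable (fval_comp _ (fs k)).
  - by apply: measurable_funM => //; exact: smeas_rnorm.
have [S hS] := choice (fun k => fval_to_step (ft k) (mE k) (fE k)).
have bS k x : rnorm (step_eval (S k) x) <= 2 * rnorm (F x).
  have F0 : 0 <= 2 * rnorm (F x) by rewrite mulr_ge0// rnorm_ge0.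
  by rewrite hS; case: ifP => _; rewrite ?rnorm0// /t; case: asboolP => //; rewrite rnorm0.
have cS x : step_eval (S k) x @[k --> \oo] --> F x.
  have [K hK] := cE x; apply/cvg_seq_rnormP => e e0.
  have [F0|F0] := eqVneq (F x) 0.
    exists 0%N => k _; rewrite F0 subr0; apply: le_trans (bS k x) _.
    by rewrite F0 rnorm0 mulr0 ltW.
  have Fp : 0 < rnorm (F x) by rewrite lt_def rnorm_eq0 F0 rnorm_ge0.
  have /cvg_seq_rnormP/(_ (Num.min e (rnorm (F x)))) := sF x.
  rewrite lt_min e0 Fp => /(_ isT)[L hL]; exists (maxn K L) => k.
  rewrite geq_max => /andP[Kk Lk]; rewrite hS asboolT; last exact: hK.
  have := hL _ Lk; rewrite le_min => /andP[h1 h2].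
  rewrite /t asboolT//= mulr2n mulrDl mul1r.
  by rewrite -[s k x](subrK (F x)) (le_trans (rnormD _ _))// lerD2r.
exists S; split => //; split; first exact: aeW.
have [//||_] := @good_dct (fun k => step_eval (S k)) F (fun x => 2 * rnorm (F x)) _ mF cS _ bS.
- by move=> k; exact: smeas_step.
- have -> : EFin \o (fun x => 2 * rnorm (F x)) = (fun x => 2%:E * (EFin \o (fun x => rnorm (F x))) x)%E by apply/funext => x; rewrite /= EFinM.
  by apply: integrableZl => //; exact: integrable_rnorm.
by under eq_fun do rewrite inormBC.
Qed.

Lemma approx_cauchy F (S S' : nat -> step_fun) : smeas F ->
  bochner_approx S F -> bochner_approx S' F -> forall e, 0 < e ->
  exists K, forall k m, (K <= k)%N -> (K <= m)%N -> rnorm (step_int (S k) - step_int (S' m)) <= e.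
Proof.
move=> mF [_ h1] [_ h2] e e0.
have e20 : 0 < e / 2 by rewrite divr_gt0.
have H (u : nat -> \bar R) : (forall k, 0 <= u k)%E -> u k @[k --> \oo] --> 0%E ->
    exists K, forall k, (K <= k)%N -> (u k <= (e / 2)%:E)%E.
  move=> u0 /fine_cvgP[[K1 _ h3] /cvgrPdist_le/(_ _ e20)[K2 _ h4]].
  exists (maxn K1 K2) => k; rewrite geq_max => /andP[k1 k2].
  have := h4 _ k2; rewrite /= sub0r normrN ger0_norm ?fine_ge0// => h5.
  by rewrite -[u k]fineK ?lee_fin//; exact: h3.
have [|K1 k1] := H _ _ h1; first by move=> k; exact: inorm_ge0.
have [|K2 k2] := H _ _ h2; first by move=> k; exact: inorm_ge0.
exists (maxn K1 K2) => k m; rewrite !geq_max => /andP[Kk _] /andP[_ Km].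
rewrite -lee_fin (le_trans (step_intB _ _))//.
have := inorm_triangle (smeas_step (S k)) mF (smeas_step (S' m)).
move=> /le_trans; apply; rewrite [e in leRHS]splitr EFinD leeD//; last exact: k2.
by rewrite inormBC; exact: k1.
Qed.

Hypothesis cV : cplt V.

(** Any two approximating sequences are compared through [F], so their integrals share one limit and
    the choice made by [xget] is determined. *)
Lemma bint_approx F (S : nat -> step_fun) : smeas F -> bochner_approx S F ->
  step_int (S k) @[k --> \oo] --> bint mu F.
Proof.
move=> mF aS.
have [v Sv] : exists v : V, step_int (S k) @[k --> \oo] --> v.
  by apply: cV => e e0; exact: (approx_cauchy mF aS aS e0).
suff -> : bint mu F = v by [].
apply: xget_unique; first by exists S.
move=> w [S' aS' S'w]; apply/eqP; rewrite -subr_eq0 -rnorm_eq0 eq_le rnorm_ge0 andbT.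
apply/ler_addgt0Pr => e e0; rewrite add0r.
have e30 : 0 < e / 3 by rewrite divr_gt0.
have [K hK] := approx_cauchy mF aS' aS e30.
have /cvg_seq_rnormP/(_ _ e30)[L hL] := Sv.
have /cvg_seq_rnormP/(_ _ e30)[M hM] := S'w.
pose k := maxn K (maxn L M).
have -> : w - v = - (step_int (S' k) - w) + (step_int (S' k) - step_int (S k)) + (step_int (S k) - v).
  by rewrite opprB !subrKA.
have -> : e = e / 3 + e / 3 + e / 3 by field.
rewrite (le_trans (rnormD _ _))// lerD//; last by apply: hL; rewrite /k !leq_max leqnn !orbT.
rewrite (le_trans (rnormD _ _))// lerD//; last by apply: hK; rewrite leq_maxl.
by rewrite rnormN; apply: hM; rewrite /k !leq_max leqnn !orbT.
Qed.

Lemma good_integrable F : good mu F -> bochner_integrable mu F.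
Proof. by move=> /good_approx[S [aS _ _]]; exists S. Qed.

Lemma bint_lin (a : R[i]) F G : good mu F -> good mu G ->
  bint mu (fun x => a *: F x + G x) = a *: bint mu F + bint mu G.
Proof.
move=> gF gG; have [S [aS cS bS]] := good_approx gF; have [S' [aS' cS' bS']] := good_approx gG.
have gL := good_lin a gF gG.
have aL : bochner_approx (fun k => step_lin a (S k) (S' k)) (fun x => a *: F x + G x).
  split.
    apply: aeW => x; under eq_fun do rewrite step_eval_lin.
    by apply: cvgD => //; apply: cvgZc => //; exact: cvg_cst.
  apply: (@squeeze_cvge _ _ _ _ (cst 0%E) _ (fun k => (rnorm (a : R[i]^o))%:E * inorm mu (F \- step_eval (S k)) + inorm mu (G \- step_eval (S' k)))%E).
  - apply: nearW => k; rewrite integral_ge0//=; last by move=> x _; rewrite lee_fin rnorm_ge0.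
    rewrite -inormZ; last by apply: smeasB; [case: gF|exact: smeas_step].
    apply: le_trans (inormD _ _); last 2 first.
    + by apply: smeasZ; apply: smeasB; [case: gF|exact: smeas_step].
    + by apply: smeasB; [case: gG|exact: smeas_step].
    apply: inorm_le => x /=; rewrite step_eval_lin scalerBr opprD addrACA //.
  - exact: cvg_cst.
  - rewrite -[X in _ --> X]adde0 -[X in (X + _)%E](mule0 (rnorm (a : R[i]^o))%:E).
    apply: cvgeD => //; last by case: aS'.
    by apply: cvgeZl => //; case: aS.
apply: cvg_uniq (bint_approx (proj1 gL) aL) _.
under eq_fun do rewrite step_int_lin.
apply: cvgD; last by apply: bint_approx => //; case: gG.
by apply: cvgZc; [exact: cvg_cst|apply: bint_approx => //; case: gF].
Qed.

Lemma bint_le F : good mu F -> ((rnorm (bint mu F))%:E <= inorm mu F)%E.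
Proof.
move=> gF; have [S [aS cS bS]] := good_approx gF.
have iF : inorm mu F \is a fin_num by rewrite ge0_fin_numE ?inorm_ge0//; case: gF.
rewrite -[X in (_ <= X)%E]fineK// lee_fin.
apply/ler_addgt0Pr => e e0.
apply: (@rnorm_cvg_le R V nat \oo _ (fun k => step_int (S k))); last by apply: bint_approx => //; case: gF.
have [_ /fine_cvgP[[K1 _ h3] /cvgrPdist_le/(_ _ e0)[K2 _ h4]]] := aS.
exists (maxn K1 K2) => // k /=; rewrite geq_max => /andP[k1 k2].
rewrite -lee_fin (le_trans (proj2 (step_int_le _)))//.
have mS := smeas_step (S k).
have [mF _] := gF.
have : (inorm mu (step_eval (S k)) <= inorm mu F + inorm mu (F \- step_eval (S k)))%E.
  rewrite inormBC; apply: le_trans (inormD mF (smeasB mS mF)).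
  by apply: inorm_le => x /=; rewrite addrC subrK.
move=> /le_trans; apply; rewrite EFinD fineK// leeD2l//.
have := h4 _ k2; rewrite /= sub0r normrN => /(le_trans (ler_norm _)) h5.
by rewrite -[inorm _ _]fineK ?lee_fin//; exact: h3.
Qed.

Lemma bintB F G : good mu F -> good mu G -> bint mu (F \- G) = bint mu F - bint mu G.
Proof.
move=> gF gG; rewrite [RHS]addrC -scaleN1r -bint_lin//; congr bint.
by apply/funext => x; rewrite scaleN1r addrC.
Qed.

Lemma bint0 : bint mu (fun=> 0 : V) = 0.
Proof.
have g0 : good mu (fun=> 0 : V).
  by split; [exact: fval_smeas (fval_cst 0)|rewrite /inorm rnorm0 integral0 ltry].
have := bint_lin (-1) g0 g0; rewrite [X in _ = X + _]scaleN1r [X in _ = X]addNr.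
by rewrite scaler0 addr0.
Qed.

Lemma bintZ (a : R[i]) F : good mu F -> bint mu (fun x => a *: F x) = a *: bint mu F.
Proof.
have g0 : good mu (fun=> 0 : V).
  by split; [exact: fval_smeas (fval_cst 0)|rewrite /inorm rnorm0 integral0 ltry].
move=> gF; have := bint_lin a gF g0; rewrite bint0 [X in _ = X]addr0 => <-; congr bint.
by apply/funext => x; rewrite addr0.
Qed.

Lemma bint_dct (F_ : nat -> T -> V) F (g : T -> R) :
  (forall k, smeas (F_ k)) -> smeas F -> (forall x, F_ k x @[k --> \oo] --> F x) ->
  mu.-integrable setT (EFin \o g) -> (forall k x, rnorm (F_ k x) <= g x) ->
  bint mu (F_ k) @[k --> \oo] --> bint mu F.
Proof.
move=> mF_ mF cF ig Fg; have [gF h] := good_dct mF_ mF cF ig Fg.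
have gF_ k : good mu (F_ k).
  split => //; move/integrableP : ig => [_]; apply: le_lt_trans.
  apply: lint_le => x; rewrite lee_fin ?rnorm_ge0//=.
  by rewrite (le_trans (Fg k x))// ler_norm.
apply/cvg_seq_rnormP => e e0.
have /fine_cvgP[[K1 _ h3] /cvgrPdist_le/(_ _ e0)[K2 _ h4]] := h.
exists (maxn K1 K2) => k; rewrite geq_max => /andP[k1 k2].
rewrite -bintB// -lee_fin (le_trans (bint_le (goodB (gF_ k) gF)))//.
have := h4 _ k2; rewrite /= sub0r normrN => /(le_trans (ler_norm _)) h5.
by rewrite -[inorm _ _]fineK ?lee_fin//; exact: h3.
Qed.

End exhaustion.

Lemma approx_ae F G (S : nat -> step_fun) : {ae mu, forall x, F x = G x} ->
  bochner_approx S F -> bochner_approx S G.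
Proof.
move=> FG [h1 h2]; split.
  by apply: filterS2 FG h1 => x ->.
apply: cvg_trans h2; apply: near_eq_cvg; apply: nearW => k.
apply: lint_ae_eq => [x|x|]; rewrite ?lee_fin ?rnorm_ge0//.
by apply: filterS FG => x ->.
Qed.

Lemma bint_ae F G : {ae mu, forall x, F x = G x} -> bint mu F = bint mu G.
Proof.
move=> FG; have GF : {ae mu, forall x, G x = F x} by apply: filterS FG.
rewrite /bint; congr xget; apply/seteqP.
by split => v [S aS Sv]; exists S => //; [exact: approx_ae FG aS|exact: approx_ae GF aS].
Qed.

(** Function and approximants are set to 0 on a measurable null set outside which convergence holds;
    the integral is finite because some approximant lies at finite distance. *)
Lemma integrable_good F : bochner_integrable mu F -> exists2 G, good mu G & {ae mu, forall x, F x = G x}.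
Proof.
move=> [S aS].
have [N [mN N0 sub]] := proj1 aS.
pose G x := if `[< N x >] then 0 else F x.
have FG : {ae mu, forall x, F x = G x}.
  exists N; split => // x /= h; apply: contrapT => xN; apply: h.
  by rewrite /G; case: asboolP.
have mG : smeas G.
  exists (fun k x => if `[< N x >] then 0 else step_eval (S k) x); split => [k|x].
    apply: (@fval_comp2 _ _ _ _ _ (fun (b : bool) (v : V) => if b then 0 else v)).
      exact: fval_set.
    exact: fval_step.
  rewrite /G; case: asboolP => xN; first exact: cvg_cst.
  by apply: contrapT => h; apply: xN; exact: sub.
exists G => //; split => //.
have [_ /fine_cvgP[[K _ hK] _]] := approx_ae FG aS.
have := hK K (leqnn K); rewrite ge0_fin_numE; last exact: inorm_ge0.
move=> h.
have : (inorm mu G <= inorm mu (G \- step_eval (S K)) + inorm mu (step_eval (S K)))%E.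
  apply: le_trans (inormD (smeasB mG (smeas_step _)) (smeas_step _)).
  by apply: inorm_le => x /=; rewrite subrK.
move=> /le_lt_trans; apply; rewrite lte_add_pinfty//.
by case: (step_int_le (S K)).
Qed.

End one.

Section two.
Context {V W : normedModType R[i]}.
Variable E : nat -> set T.
Hypotheses (mE : forall k, measurable (E k)) (fE : forall k, (mu (E k) < +oo)%E)
  (cE : forall x, exists K, forall k, (K <= k)%N -> E k x).
Hypotheses (cV : cplt V) (cW : cplt W).
Variables (L : V -> W) (C : R).
Hypotheses (LD : forall x y, L (x + y) = L x + L y)
  (LZ : forall (t : R) x, L ((t%:C)%C *: x) = (t%:C)%C *: L x)
  (LC : forall x, rnorm (L x) <= C * rnorm x).

Let L0 : L 0 = 0.
Proof. by have := LZ 0 0; rewrite rmorph0 !scale0r. Qed.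

Let LB x y : L (x - y) = L x - L y.
Proof. by rewrite LD -(scaleN1r y) -(rmorphN1 (real_complex R)) LZ rmorphN1 scaleN1r. Qed.

Lemma real_bounded_continuous : continuous L.
Proof.
move=> x; apply: (cvg_squeeze_rnorm (g := fun y => C * rnorm (y - x))).
  by move=> y; rewrite -LB.
by rewrite -[X in _ --> X](mulr0 C); apply: cvgMr; apply/cvg_rnorm0P.
Qed.

Lemma good_bounded F : good mu F -> good mu (L \o F).
Proof.
move=> [mF iF]; have mLF := smeas_continuous real_bounded_continuous mF.
split => //; apply: (@le_lt_trans _ _ (inorm mu (fun x => (`|C|%:C)%C *: F x))).
  apply: inorm_le => x /=; rewrite rnormZr (le_trans (LC _))// ler_wpM2r ?rnorm_ge0//.
  by rewrite ger0_norm// ler_norm.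
rewrite inormZ// lte_mul_pinfty// lee_fin; exact: (rnorm_ge0 (_ : R[i]^o)).
Qed.

(* Real-linearity is enough, so that this applies to the involution as well. *)
Lemma bint_bounded F : good mu F -> bint mu (L \o F) = L (bint mu F).
Proof.
move=> gF; have [S [aS cS bS]] := good_approx mE fE cE gF.
have [mF iF] := gF; have [mLF _] := good_bounded gF.
pose LS k : step_fun mu W := @StepFun _ _ _ _ _ (step_size (S k)) (@step_set _ _ _ _ _ (S k)) (fun i => L (step_val i))
  (@step_measurable _ _ _ _ _ (S k)) (@step_finite _ _ _ _ _ (S k)).
have Lsum I (r : seq I) (f : I -> R) (v : I -> V) :
    L (\sum_(i <- r) ((f i)%:C)%C *: v i) = \sum_(i <- r) ((f i)%:C)%C *: L (v i).
  by elim/big_rec2 : _ => [//|i x y _ <-]; rewrite LD LZ.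
have LSe k x : step_eval (LS k) x = L (step_eval (S k) x) by rewrite /step_eval Lsum.
have LSi k : step_int (LS k) = L (step_int (S k)) by rewrite /step_int Lsum.
have aLS : bochner_approx LS (L \o F).
  split.
    apply: aeW => x; under eq_fun do rewrite LSe.
    by apply: continuous_cvg; [exact: real_bounded_continuous|exact: cS].
  apply: (@squeeze_cvge _ _ _ _ (cst 0%E) _ (fun k => (`|C|%:E) * inorm mu (F \- step_eval (S k)))%E).
  - apply: nearW => k; rewrite integral_ge0//=; last by move=> x _; rewrite lee_fin rnorm_ge0.
    have -> : `|C| = rnorm ((`|C|%:C)%C : R[i]^o) by rewrite rnorm_real normr_id.
    rewrite -inormZ; last by apply: smeasB => //; exact: smeas_step.
    apply: inorm_le => x /=; rewrite LSe -LB rnormZr normr_id (le_trans (LC _))// ler_wpM2r ?rnorm_ge0//.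
    by rewrite ler_norm.
  - exact: cvg_cst.
  - rewrite -[X in _ --> X](mule0 `|C|%:E).
    by apply: cvgeZl => //; case: aS.
apply: cvg_uniq (bint_approx cW mLF aLS) _.
under eq_fun do rewrite LSi.
apply: continuous_cvg; first exact: real_bounded_continuous.
exact: bint_approx.
Qed.

End two.
End bint.

(** * Lebesgue measure on row vectors *)

Section affine1.
Context {R : realType}.
Implicit Types a y : R.
Local Notation leb := (@lebesgue_measure R).

Lemma measurable_affine a y : measurable_fun setT ((fun x => a * x + y) : measurableTypeR R -> measurableTypeR R).
Proof. by apply: measurable_funD => //; apply: measurable_funM. Qed.

(** Both sides are measures agreeing on half-open intervals. For negative a the preimage is
    half-open at the other end, with the same length. *)
Lemma lebesgue_affine a y (A : set (measurableTypeR R)) : a != 0 -> measurable A ->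
  leb A = (`|a|%:E * leb ((fun x => (a * x + y)%R) @^-1` A))%E.
Proof.
move=> a0 mA.
pose m := measure_function_pushforward__canonical__measure_function_Measure leb (measurable_affine a y).
pose m' := measure_function_mscale__canonical__measure_function_Measure (NngNum (normr_ge0 a)) m.
have m'E X : m' X = (`|a|%:E * leb ((fun x => (a * x + y)%R) @^-1` X))%E by [].
rewrite -m'E; apply: lebesgue_measure_unique => // _ [[u v] _ <-].
  rewrite m'E.
  have [ap|an|/esym/eqP] := ltgtP 0 a; last by rewrite (negbTE a0).
    rewrite (_ : _ @^-1` _ = `](u - y) / a, (v - y) / a]%classic); last first.
      apply/seteqP; split => x /=; rewrite !in_itv/=.
        by rewrite ltr_pdivrMr// ler_pdivlMr// ltrBlDr lerBrDr mulrC.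
      by rewrite ltr_pdivrMr// ler_pdivlMr// ltrBlDr lerBrDr mulrC.
    rewrite !lebesgue_measure_itv/= !lte_fin ltr_pM2r ?invr_gt0// ltrD2r.
    case: ifP => uv; last by rewrite mule0.
    by rewrite -!EFinB -EFinM gtr0_norm//; congr (_%:E); field.
  rewrite (_ : _ @^-1` _ = `[(v - y) / a, (u - y) / a[%classic); last first.
    apply/seteqP; split => x /=; rewrite !in_itv/=.
      by rewrite ler_ndivrMr// ltr_ndivlMr// lerBrDr ltrBlDr mulrC => /andP[-> ->].
    by rewrite ler_ndivrMr// ltr_ndivlMr// lerBrDr ltrBlDr mulrC => /andP[-> ->].
  rewrite !lebesgue_measure_itv/= !lte_fin ltr_nM2r ?invr_lt0// ltrD2r.
  case: ifP => uv; last by rewrite mule0.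
  by rewrite -!EFinB -EFinM ltr0_norm//; congr (_%:E); field.
Qed.

Lemma integral_oneDsqrV_lty : (\int[leb]_x ((1 + x ^+ 2)^-1)%:E < +oo)%E.
Proof.
pose f (x : R) : \bar R := ((1 + x ^+ 2)^-1)%:E.
have f0 x : (0 <= f x)%E by rewrite lee_fin invr_ge0 addr_ge0// sqr_ge0.
have mf : measurable_fun setT f.
  apply/measurable_EFinP; apply: continuous_measurable_fun; exact: continuous_oneDsqrV.
have H : (\int[leb]_(x in `[0%R, +oo[) f x < +oo)%E by rewrite integral0y_oneDsqr ltry.
have H' : (\int[leb]_(x in `]-oo, 0%R]) f x < +oo)%E.
  have := H; rewrite ge0_integration_by_substitution0//.
  by under eq_integral do rewrite /f sqrrN.
apply: (@le_lt_trans _ _ (\int[leb]_x ((f \_ `[0%R, +oo[) x + (f \_ `]-oo, 0%R]) x))%E).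
  apply: lint_le => // x; rewrite !patchE.
  have [x0|x0] := leP 0 x.
    by rewrite mem_set ?leeDl//=; [case: ifP|rewrite in_itv/= x0].
  by rewrite [in X in (_ <= _ + X)%E]mem_set ?leeDr//=; [case: ifP|rewrite in_itv/= ltW].
rewrite ge0_integralD//; last 4 first.
- by move=> x _; apply: erestrict_ge0.
- by apply/(measurable_restrictT _ _).1 => //; exact: measurable_funTS.
- by move=> x _; apply: erestrict_ge0.
- by apply/(measurable_restrictT _ _).1 => //; exact: measurable_funTS.
by rewrite -!integral_mkcond lte_add_pinfty.
Qed.

End affine1.

Section rV.
Context {R : realType}.
Local Notation leb := (@lebesgue_measure R).

Lemma measurable_affine_rV m (a : R) (Y : 'rV[R]_m) :
  measurable_fun setT (fun X : 'rV[R]_m => a *: X + Y).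
Proof.
apply: measurable_rVP => i; under eq_fun do rewrite !mxE.
by apply: measurable_funD => //; apply: measurable_funM => //; exact: measurable_coord_rV.
Qed.

(** Induction on the dimension: affine maps of this kind act on each factor, and a product measure
    is determined by rectangles. *)
Lemma lebesgue_rV_affine m (a : R) (Y : 'rV[R]_m) (A : set 'rV[R]_m) : a != 0 -> measurable A ->
  lebesgue_rV m A = ((`|a| ^+ m)%:E * lebesgue_rV m ((fun X => (a *: X + Y)%R) @^-1` A))%E.
Proof.
move=> a0; elim: m Y A => [|m ih] Y A mA.
  rewrite expr0 mul1e (_ : (fun X => a *: X + Y) = id) ?preimage_id//.
  by apply/funext => X; apply/rowP => -[].
pose y1 := Y ord0 ord0; pose Ym : 'rV[R]_m := \row_j Y ord0 (lift ord0 j).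
pose Phi (p : measurableTypeR R * 'rV[R]_m) : measurableTypeR R * 'rV[R]_m :=
  (a * p.1 + y1, a *: p.2 + Ym).
have mPhi : measurable_fun setT Phi.
  apply: measurable_fun_pair => /=.
    by apply: measurable_funD => //; apply: measurable_funM.
  by apply: (measurableT_comp (measurable_affine_rV a Ym)).
have mc := @measurable_cons_rV R m.
pose nu := (leb \x lebesgue_rV m)%E.
pose m1 := measure_function_pushforward__canonical__measure_function_Measure nu mPhi.
have s0 : 0 <= `|a| ^+ m.+1 by rewrite exprn_ge0.
pose m2 := measure_function_mscale__canonical__measure_function_Measure (NngNum s0) m1.
have m2E X : m2 X = ((`|a| ^+ m.+1)%:E * nu (Phi @^-1` X))%E by [].
have E : (fun X => a *: X + Y) \o @cons_rV R m = @cons_rV R m \o Phi.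
  apply/funext => -[x X]; apply/rowP => i; rewrite /cons_rV/=.
  case: (splitP (i : 'I_(1 + m))) => k ik.
    rewrite (_ : i = lshift m k); last by apply: ord_inj.
    transitivity (a * (row_mx x%:M X : 'rV[R]_(1 + m)) 0 (lshift m k) + Y 0 (lshift m k)); first by rewrite !mxE.
    rewrite (@row_mxEl _ 1 1 m) [in RHS](@row_mxEl _ 1 1 m) !mxE ord1 eqxx !mulr1n /y1.
    by congr (_ + Y _ _); apply: ord_inj.
  rewrite (_ : i = rshift 1 k); last by apply: ord_inj.
  transitivity (a * (row_mx x%:M X : 'rV[R]_(1 + m)) 0 (rshift 1 k) + Y 0 (rshift 1 k)); first by rewrite !mxE.
  rewrite (@row_mxEr _ 1 1 m) [in RHS](@row_mxEr _ 1 1 m) !mxE.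
  by congr (_ + Y _ _); apply: ord_inj.
have H X : measurable X -> nu X = m2 X.
  apply: product_measure_unique => B C mB mC.
  rewrite m2E.
  rewrite (_ : _ @^-1` _ = ((fun x => a * x + y1) @^-1` B) `*` ((fun X => a *: X + Ym) @^-1` C))//.
  rewrite /nu product_measure1E; last 2 first.
  - rewrite -[X in measurable X]setTI.
    exact: measurable_affine.
  - by rewrite -[X in measurable X]setTI; exact: measurable_affine_rV.
  transitivity ((`|a|%:E * leb ((fun x => (a * x + y1)%R) @^-1` B)) * ((`|a| ^+ m)%:E * lebesgue_rV m ((fun X => (a *: X + Ym)%R) @^-1` C)))%E.
    by rewrite muleACA -EFinM exprS.
  by congr (_ * _)%E; [exact: esym (lebesgue_affine y1 a0 mB)|exact: esym (ih Ym C mC)].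
have -> : lebesgue_rV m.+1 A = nu (@cons_rV R m @^-1` A) by [].
rewrite H; last by rewrite -[X in measurable X]setTI; exact: mc.
rewrite m2E; congr (_ * _)%E.
have -> : Phi @^-1` (@cons_rV R m @^-1` A) = @cons_rV R m @^-1` ((fun X => a *: X + Y) @^-1` A).
  rewrite -[LHS]/((@cons_rV R m \o Phi) @^-1` A) -E; reflexivity.
reflexivity.
Qed.

Lemma rV_norm_le m (X : 'rV[R]_m) (t : R) : 0 <= t ->
  (`|X| <= t) = [forall i, `|X ord0 i| <= t].
Proof.
move=> t0; rewrite /Num.norm/= mx_normrE; apply/idP/forallP => [/bigmax_leP[_ h] i|h].
  exact: (h (ord0, i)).
by apply/bigmax_leP; split => // -[i j] _ /=; rewrite ord1; exact: h.
Qed.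

Lemma ler_rV_coord m (X : 'rV[R]_m) i : `|X ord0 i| <= `|X|.
Proof. by have := rV_norm_le X (normr_ge0 X); rewrite lexx => /esym/forallP/(_ i). Qed.

Lemma measurable_norm_rV m : measurable_fun setT (fun X : 'rV[R]_m => `|X|).
Proof.
rewrite (_ : (fun _ => _) = (fun X : 'rV[R]_m => \big[Num.max/0]_ij `|X ij.1 ij.2|)); last first.
  by apply/funext => X; rewrite /Num.norm/= mx_normrE.
elim: (index_enum _) => [|ij s ih].
  by under eq_fun do rewrite big_nil; exact: measurable_cst.
under eq_fun do rewrite big_cons.
apply: measurable_maxr => //.
apply: measurableT_comp => //; case: ij => i j /=; rewrite ord1; exact: measurable_coord_rV.
Qed.

(** The norm being the maximum of the coordinates, the exponent 2m bounds this by the product of the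
    (1 + x_i^2)^{-1}, which is integrable. *)
Definition wt m (X : 'rV[R]_m) : R := ((1 + `|X|) ^+ (2 * m))^-1.

Lemma wt_base m (X : 'rV[R]_m) : 1 <= 1 + `|X|.
Proof. by rewrite lerDl. Qed.

Lemma wt_gt0 m (X : 'rV[R]_m) : 0 < wt X.
Proof. by rewrite invr_gt0 exprn_gt0// (lt_le_trans ltr01)// wt_base. Qed.

Lemma measurable_wt m : measurable_fun setT (@wt m).
Proof.
rewrite /wt (_ : (fun _ => _) = (fun t : R => (t ^+ (2 * m))^-1) \o (fun X : 'rV[R]_m => 1 + `|X|))//.
(* The maximum with 1 does not change the value, as 1 + |X| >= 1; it makes the outer function
   continuous on the whole line. *)
rewrite (_ : _ \o _ = (fun X : 'rV[R]_m => ((Num.max 1 (1 + `|X|)) ^+ (2 * m))^-1)); last first.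
  by apply/funext => X /=; rewrite max_r// wt_base.
apply: (@measurableT_comp _ _ _ _ _ _ (fun t : R => ((Num.max 1 t) ^+ (2 * m))^-1)).
  apply: continuous_measurable_fun => t; apply: cvgV.
    by rewrite expf_neq0// gt_eqF// lt_max ltr01.
  apply: (@continuous_comp _ _ _ (fun y : R => Num.max 1 y) (fun z : R => z ^+ (2 * m))).
    by apply: continuous_max => //; exact: cvg_cst.
  exact: exprn_continuous.
by apply: measurable_funD => //; exact: measurable_norm_rV.
Qed.

Definition cprod m (X : 'rV[R]_m) : R := \prod_i (1 + X ord0 i ^+ 2)^-1.

Lemma wt_le_cprod m (X : 'rV[R]_m) : wt X <= cprod X.
Proof.
rewrite /wt /cprod exprM -exprVn -[X in _ ^+ X]card_ord -prodr_const; apply: ler_prod => i _.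
rewrite invr_ge0 sqr_ge0/= lef_pV2 ?posrE; last 2 first.
- by rewrite exprn_gt0// (lt_le_trans ltr01)// wt_base.
- by rewrite ltr_pwDl// sqr_ge0.
have h := ler_rV_coord X i.
rewrite sqrrD expr1n mul1r -addrA lerD2l (le_trans (y := `|X| ^+ 2))//.
  by rewrite -(real_normK (num_real (X ord0 i))) lerXn2r ?nnegrE.
by rewrite lerDr mulrn_wge0.
Qed.

Lemma measurable_cprod m : measurable_fun setT (@cprod m).
Proof.
apply: measurable_prod => i _.
apply: (@measurableT_comp _ _ _ _ _ _ (fun t : R => (1 + t ^+ 2)^-1)); last exact: measurable_coord_rV.
by apply: continuous_measurable_fun; exact: continuous_oneDsqrV.
Qed.

Lemma integral_cprod_lty m : (\int[lebesgue_rV m]_X (cprod X)%:E < +oo)%E.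
Proof.
have c0 k (X : 'rV[R]_k) : 0 <= cprod X.
  by apply: prodr_ge0 => i _; rewrite invr_ge0 addr_ge0// sqr_ge0.
elim: m => [|m ih].
  rewrite /lebesgue_rV integral_dirac//; last by apply/measurable_EFinP; exact: measurable_cprod.
  by rewrite diracT mul1e ltry.
have mc := @measurable_cons_rV R m.
rewrite [lebesgue_rV m.+1]/=.
have -> : (\int[cons_measure (lebesgue_rV m)]_X (cprod X)%:E =
    \int[pushforward (leb \x lebesgue_rV m) (@cons_rV R m)]_X (cprod X)%:E)%E by [].
rewrite ge0_integral_pushforward//; last 2 first.
- by apply/measurable_EFinP; exact: measurable_cprod.
- by move=> X _; rewrite lee_fin.
rewrite preimage_setT.
have cE (p : measurableTypeR R * 'rV[R]_m) : cprod (cons_rV p) = (1 + p.1 ^+ 2)^-1 * cprod p.2.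
  rewrite /cprod big_ord_recl; case: p => x X /=.
  have := @cons_rVK R m (x, X); rewrite /uncons_rV => -[h1 h2].
  rewrite h1; congr (_ * _); apply: eq_bigr => i _.
  by have /rowP/(_ i) := h2; rewrite mxE => ->.
have m1 : measurable_fun setT (fun x : measurableTypeR R => (1 + x ^+ 2)^-1 : R).
  by apply: continuous_measurable_fun; exact: continuous_oneDsqrV.
rewrite fubini_tonelli1//=; last 2 first.
- apply/measurable_EFinP.
  have h : measurable_fun setT (fun p : measurableTypeR R * 'rV[R]_m => (1 + p.1 ^+ 2)^-1 * cprod p.2).
    apply: measurable_funM; first exact: (measurableT_comp m1).
    exact: (measurableT_comp (@measurable_cprod m)).
  by move: h; congr measurable_fun; apply/funext => p; rewrite cE.
- by move=> p; rewrite lee_fin.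
rewrite /fubini_F.
under eq_integral => x _.
  under eq_integral => X _ do rewrite /= cE /= EFinM.
  rewrite ge0_integralZl_EFin//; last 3 first.
  + by move=> X _; rewrite lee_fin.
  + by apply/measurable_EFinP; exact: measurable_cprod.
  + by rewrite invr_ge0 addr_ge0// sqr_ge0.
  over.
rewrite ge0_integralZr//.
- have i0 : (0 <= \int[leb]_x ((1 + x ^+ 2)^-1)%:E)%E.
    by apply: integral_ge0 => x _; rewrite lee_fin invr_ge0 addr_ge0// sqr_ge0.
  rewrite lte_mul_pinfty// ge0_fin_numE//; exact: integral_oneDsqrV_lty.
- exact/measurable_EFinP.
- by move=> x _; rewrite lee_fin invr_ge0 addr_ge0// sqr_ge0.
- by apply: integral_ge0 => X _; rewrite lee_fin.
Qed.

End rV.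

(** * Continuous functions with integrable decay *)

Lemma continuous_sumr (K : numFieldType) (W : normedModType K) (T : topologicalType) (I : Type)
    (r : seq I) (f : I -> T -> W) :
  (forall i, continuous (f i)) -> continuous (fun x => \sum_(i <- r) f i x).
Proof.
move=> h x; elim: r => [|i r ih].
  by under eq_fun do rewrite big_nil; exact: cst_continuous.
by under eq_fun do rewrite big_cons; apply: continuousD => //; exact: h.
Qed.

Section sequential.
Context {R : realType} {V : normedModType R[i]}.

(** Dominated convergence concerns sequences; this transfers it to limits along a parameter. *)
Lemma seq_cvg_within (T : pseudoMetricType R) (D : set T) (f : T -> V) (x : T) (l : V) :
  (forall u : nat -> T, (forall k, D (u k)) -> u k @[k --> \oo] --> x ->
     f (u k) @[k --> \oo] --> l) ->
  f y @[y --> within D (nbhs x)] --> l.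
Proof.
move=> h; apply/cvg_rnormP => e e0; apply: contrapT => H.
have [u hu] : {u : nat -> T & forall k, ball x k.+1%:R^-1 (u k) /\ D (u k) /\ ~ rnorm (f (u k) - l) <= e}.
  apply: (@choice _ _ (fun k y => ball x k.+1%:R^-1 y /\ D y /\ ~ rnorm (f y - l) <= e)) => k.
  apply: contrapT => H2; apply: H.
  have k0 : 0 < (k.+1%:R^-1 : R) by rewrite invr_gt0 ltr0n.
  have := nbhsx_ballx x _ k0.
  apply: filterS => y xy Dy; apply: contrapT => H3; apply: H2; by exists y.
have ux : u k @[k --> \oo] --> x.
  apply/cvg_ballP => d d0; near=> k; apply: le_ball (proj1 (hu k)).
  by apply: ltW; near: k; exact: near_infty_natSinv_lt (PosNum d0).
have /cvg_seq_rnormP/(_ _ e0)[K /(_ K (leqnn K)) hK] := h u (fun k => proj1 (proj2 (hu k))) ux.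
by case: (hu K) => _ [_].
Unshelve. all: by end_near. Qed.

End sequential.

Section dense.
Context {R : realType} (m : nat).
Local Notation X_ := 'rV[R]_m.

Definition ratpt (i : nat) : X_ := map_mx ratr (odflt (0 : 'rV[rat]_m) (unpickle i)).

Lemma ratpt_dense (x : X_) e : 0 < e -> exists i, `|x - ratpt i| <= e.
Proof.
move=> e0.
have [q hq] : {q : 'I_m -> rat & forall i, `|x ord0 i - ratr (q i)| <= e}.
  apply: (@choice _ _ (fun i q => `|x ord0 i - ratr q| <= e)) => i.
  have [|q] := @rat_in_itvoo R (x ord0 i - e) (x ord0 i + e).
    by rewrite ltrBlDr -addrA ltrDl addr_gt0.
  rewrite in_itv/= => /andP[h1 h2]; exists q.
  by rewrite distrC ler_norml; apply/andP; split; lra.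
exists (pickle (\row_i q i : 'rV[rat]_m)).
rewrite rV_norm_le ?(ltW e0)//; apply/forallP => i.
by rewrite /ratpt pickleK /= !mxE.
Qed.

(** The nearest among the first k + 1 rational points, with ties resolved in favour of the earlier
    one. These finitely valued maps tend to the identity, so composing with them approximates any
    continuous function, whatever its values. *)
Fixpoint rnd k (x : X_) : X_ := if k is k'.+1 then
  if `|x - ratpt k| < `|x - rnd k' x| then ratpt k else rnd k' x else ratpt 0.

Lemma rnd_le k i (x : X_) : (i <= k)%N -> `|x - rnd k x| <= `|x - ratpt i|.
Proof.
elim: k => [|k ih]; first by rewrite leqn0 => /eqP ->.
rewrite leq_eqVlt => /orP[/eqP -> /=|]; first by case: ltP.
rewrite ltnS => /ih h; rewrite /rnd -/rnd; case: ltP => [h2|_]; last exact: h.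
exact: le_trans (ltW h2) h.
Qed.

Lemma cvg_rnd (x : X_) : rnd k x @[k --> \oo] --> x.
Proof.
apply/cvgrPdist_le => e /(ratpt_dense x)[i hi]; exists i => // k /= ik.
exact: le_trans (rnd_le x ik) hi.
Qed.

Lemma measurable_fun_dist (f g : X_ -> X_) : measurable_fun setT f -> measurable_fun setT g ->
  measurable_fun setT (fun x => `|f x - g x|).
Proof.
move=> mf mg; apply: (measurableT_comp (@measurable_norm_rV R m)).
apply: measurable_rVP => i; under eq_fun do rewrite !mxE.
by apply: measurable_funB; [exact: (measurableT_comp (measurable_coord_rV i) mf)|exact: (measurableT_comp (measurable_coord_rV i) mg)].
Qed.

Lemma fval_rnd k : fval (rnd k).
Proof.
elim: k => [|k ih] /=; first exact: fval_cst.
apply: (@fval_comp2 _ _ _ _ _ (fun (b : bool) (v : X_) => if b then ratpt k.+1 else v)) => //.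
have H (b : X_ -> bool) : measurable [set x | b x] -> fval b.
  move=> /fval_set; congr fval; apply/funext => x /=; exact: asboolb.
apply: H.
have := @measurable_fun_ltr _ _ _ setT (fun x : X_ => `|x - ratpt k.+1|) (fun x => `|x - rnd k x|).
move=> /(_ _ _ measurableT [set true]); rewrite setTI; apply => //.
  by apply: measurable_fun_dist => //; exact: measurable_cst.
by apply: measurable_fun_dist => // _ Y _; rewrite setTI; exact: fval_preimage.
Qed.

Lemma continuous_smeas (V : normedModType R[i]) (F : X_ -> V) : continuous F -> smeas F.
Proof.
move=> cF; exists (fun k => F \o rnd k); split => [k|x]; first exact/fval_comp/fval_rnd.
by apply: continuous_cvg; [exact: cF|exact: cvg_rnd].
Qed.

End dense.

(* The properties of Lebesgue measure that matter: its normalization does not. *)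
Definition haar (R : realType) m (mu : {measure set 'rV[R]_m -> \bar R}) :=
  (\int[mu]_X (wt X)%:E < +oo)%E /\
  forall (a : R) (Y : 'rV[R]_m) (A : set 'rV[R]_m), a != 0 -> measurable A ->
    mu A = ((`|a| ^+ m)%:E * mu ((fun X => (a *: X + Y)%R) @^-1` A))%E.

Section haar.
Context {R : realType} {m : nat} {mu : {measure set 'rV[R]_m -> \bar R}}.
Hypothesis hmu : haar mu.
Local Notation X_ := 'rV[R]_m.

Lemma integrable_wt (C : R) : mu.-integrable setT (EFin \o (fun X : X_ => C * wt X)).
Proof.
have h : mu.-integrable setT (EFin \o (@wt R m)).
  apply/integrableP; split; first by apply/measurable_EFinP; exact: measurable_wt.
  by under eq_integral do rewrite /= gtr0_norm ?wt_gt0//; case: hmu.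
have -> : EFin \o (fun X : X_ => C * wt X) = (fun X => C%:E * (EFin \o (@wt R m)) X)%E by apply/funext => x; rewrite /= EFinM.
exact: integrableZl.
Qed.

Definition cball (k : nat) : set X_ := [set X | `|X| <= k%:R].

Lemma measurable_cball k : measurable (cball k).
Proof.
have := @measurable_fun_ler _ _ _ setT (fun x : X_ => `|x|) (fun=> k%:R).
move=> /(_ _ _ measurableT [set true]); rewrite setTI; apply => //.
exact: measurable_norm_rV.
Qed.

Lemma cball_lty k : (mu (cball k) < +oo)%E.
Proof.
have b0 : 0 <= (1 + k%:R) ^+ (2 * m) :> R by rewrite exprn_ge0.
rewrite -[cball k]setIT -integral_indic//; last exact: measurable_cball.
apply: (@le_lt_trans _ _ (\int[mu]_X ((1 + k%:R) ^+ (2 * m) * wt X)%:E)%E).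
  apply: lint_le => X; rewrite lee_fin ?indicE//.
  case: (boolP (X \in _)) => [/set_mem h|_].
    rewrite /wt -ler_pdivrMr ?mul1r ?invrK ?invr_gt0 ?exprn_gt0 ?(lt_le_trans ltr01 (wt_base X))//.
    by rewrite lerXn2r ?nnegrE ?addr_ge0// lerD2l.
  by rewrite mulr_ge0// ltW// wt_gt0.
have /integrableP[_] := integrable_wt ((1 + k%:R) ^+ (2 * m)).
apply: le_lt_trans; apply: lint_le => X; rewrite ?lee_fin ?mulr_ge0 ?(ltW (wt_gt0 X))//=.
exact: ler_norm.
Qed.

Lemma cball_cover (x : X_) : exists K, forall k, (K <= k)%N -> cball k x.
Proof.
exists (Num.bound `|x|) => k hk; rewrite /cball/= (le_trans (ltW (archi_boundP _)))//.
by rewrite ler_nat.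
Qed.

End haar.

Lemma fval_precomp d d' (T : measurableType d) (T' : measurableType d') (U : Type) (f : T' -> U) (g : T -> T') :
  fval f -> measurable_fun setT g -> fval (f \o g).
Proof.
move=> [I [p [v [mp ->]]]] mg; exists I, (p \o g), v; split => // i.
by rewrite comp_preimage -[X in measurable X]setTI; exact: mg.
Qed.

Lemma smeas_precomp (R : realType) d d' (T : measurableType d) (T' : measurableType d')
    (V : normedModType R[i]) (f : T' -> V) (g : T -> T') :
  smeas f -> measurable_fun setT g -> smeas (f \o g).
Proof.
move=> [s [fs sf]] mg; exists (fun k => s k \o g); split => [k|x]; last exact: sf.
exact: fval_precomp.
Qed.

Section weights.
Context {R : realType} {m : nat}.
Implicit Types X Y : 'rV[R]_m.

Lemma base_gt0 X : 0 < 1 + `|X|.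
Proof. by rewrite (lt_le_trans ltr01)// wt_base. Qed.

Lemma base_ge0 X : 0 <= 1 + `|X|. Proof. exact: ltW (base_gt0 X). Qed.

Lemma peetre X Y : 1 + `|X + Y| <= (1 + `|X|) * (1 + `|Y|).
Proof.
rewrite mulrDl mul1r mulrDr mulr1 -addrA lerD2l (le_trans (ler_normD _ _))//.
by rewrite [leRHS]addrA [`|Y| + _]addrC lerDl mulr_ge0.
Qed.

Lemma wt_peetre X Y : wt X <= (1 + `|Y|) ^+ (2 * m) * wt (X + Y).
Proof.
rewrite /wt ler_pdivlMr ?exprn_gt0 ?base_gt0// mulrC ler_pdivrMr ?exprn_gt0 ?base_gt0//.
by rewrite mulrC -exprMn lerXn2r ?nnegrE ?mulr_ge0 ?base_ge0// peetre.
Qed.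

Lemma wt_near X Y : `|X - Y| <= 1 -> wt X <= 2 ^+ (2 * m) * wt Y.
Proof.
move=> h; have := wt_peetre X (Y - X); rewrite addrCA subrr addr0 => /le_trans; apply.
rewrite ler_wpM2r ?(ltW (wt_gt0 _))// lerXn2r ?nnegrE ?base_ge0//.
by rewrite distrC -[2]/(1 + 1) lerD2l.
Qed.

End weights.

Definition nice (R : realType) m (V : normedModType R[i]) (F : 'rV[R]_m -> V) :=
  continuous F /\ exists C : R, forall X, rnorm (F X) <= C * wt X.

Section haar2.
Context {R : realType} {m : nat} {mu : {measure set 'rV[R]_m -> \bar R}}.
Hypothesis hmu : haar mu.
Local Notation X_ := 'rV[R]_m.
Local Notation bint_lin := (bint_lin (measurable_cball) (cball_lty hmu) (@cball_cover R m)).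
Local Notation bint_approx := (bint_approx).

Lemma wt_good (V : normedModType R[i]) (F : X_ -> V) (C : R) : smeas F ->
  (forall X, rnorm (F X) <= C * wt X) -> good mu F.
Proof.
move=> mF h; split => //.
have /integrableP[_] := integrable_wt hmu C.
apply: le_lt_trans; apply: lint_le => X; rewrite lee_fin ?rnorm_ge0//=.
by rewrite (le_trans (h X))// ler_norm.
Qed.

Lemma nice_good (V : normedModType R[i]) (F : X_ -> V) : nice F -> good mu F.
Proof. by move=> [cF [C h]]; apply: wt_good h; exact: continuous_smeas. Qed.

(** Restricting the parameter to [D] covers both punctured neighbourhoods, for difference quotients,
    and bounds that hold only locally. *)
Lemma bint_cvg (V : normedModType R[i]) (P : pseudoMetricType R) (D : set P) (p0 : P)
    (F : P -> X_ -> V) (L : X_ -> V) (C : R) : cplt V ->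
  (forall p, D p -> smeas (F p)) -> smeas L ->
  (forall X, F p X @[p --> within D (nbhs p0)] --> L X) ->
  (forall p X, D p -> rnorm (F p X) <= C * wt X) ->
  bint mu (F p) @[p --> within D (nbhs p0)] --> bint mu L.
Proof.
move=> cV mF mL FL bF; apply: seq_cvg_within => u Du up.
apply: (bint_dct measurable_cball (cball_lty hmu) (@cball_cover R m) cV _ mL _ (integrable_wt hmu C)).
- by move=> k; exact: mF.
- move=> X; apply: cvg_trans (FL X) => B hB.
  have : (u k @[k --> \oo]) (fun p => D p -> B (F p X)) by apply: up; exact: hB.
  by move=> h; apply: (filterS _ (h : \forall k \near \oo, D (u k) -> B (F (u k) X))) => k; apply; exact: Du.
- by move=> k X; exact: bF.
Qed.

Lemma bint_cont_at (V : normedModType R[i]) (P : pseudoMetricType R) (D : set P) (p0 : P)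
    (F : P -> X_ -> V) (C : R) : cplt V -> nbhs p0 D ->
  (forall p, D p -> smeas (F p)) ->
  (forall X, {for p0, continuous (F ^~ X)}) ->
  (forall p X, D p -> rnorm (F p X) <= C * wt X) ->
  {for p0, continuous (fun p => bint mu (F p))}.
Proof.
move=> cV nD mF cF bF.
have H : bint mu (F p) @[p --> within D (nbhs p0)] --> bint mu (F p0).
  apply: (@bint_cvg V P D p0 F (F p0) C) => //; first exact: mF (nbhs_singleton nD).
  move=> X; apply: cvg_within_filter; exact: cF.
apply/cvg_rnormP => e e0; move/cvg_rnormP : H => /(_ _ e0); rewrite near_withinE => H.
by apply: filterS2 nD H => p Dp; apply.
Qed.

Lemma bint_continuous (V : normedModType R[i]) (P : pseudoMetricType R)
    (F : P -> X_ -> V) (C : R) : cplt V ->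
  (forall p, continuous (F p)) -> (forall X, continuous (F ^~ X)) ->
  (forall p X, rnorm (F p X) <= C * wt X) -> continuous (fun p => bint mu (F p)).
Proof.
move=> cV c1 c2 bF p; apply: (@bint_cont_at V P setT p F C) => //.
- exact: filterT.
- by move=> q _; exact: continuous_smeas.
- by move=> X; exact: c2.
Qed.

Lemma bint_bound (V : normedModType R[i]) (F : X_ -> V) (C : R) : cplt V -> smeas F ->
  (forall X, rnorm (F X) <= C * wt X) ->
  rnorm (bint mu F) <= C * fine (\int[mu]_X (wt X)%:E).
Proof.
move=> cV mF bF; have gF := wt_good mF bF.
have fw : (\int[mu]_X (wt X)%:E)%E \is a fin_num.
  rewrite ge0_fin_numE; first by case: hmu.
  by apply: integral_ge0 => X _; rewrite lee_fin ltW// wt_gt0.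
have := bint_le measurable_cball (cball_lty hmu) (@cball_cover R m) cV gF.
rewrite -lee_fin EFinM fineK// => /le_trans; apply.
have C0 : 0 <= C.
  by have := le_trans (rnorm_ge0 _) (bF 0); rewrite pmulr_lge0// wt_gt0.
rewrite -ge0_integralZl_EFin//; last 2 first.
- by move=> X _; rewrite lee_fin ltW// wt_gt0.
- by apply/measurable_EFinP; exact: measurable_wt.
by apply: lint_le => X; rewrite -?EFinM lee_fin ?rnorm_ge0.
Qed.

Section affine.
Variables (a : R) (Y0 : X_).
Hypothesis a0 : a != 0.
Local Notation tau := (fun X : X_ => a *: X + Y0).
Local Notation s := ((`|a| ^+ m)^-1).

Let ap : 0 < `|a| ^+ m.
Proof. by rewrite exprn_gt0// normr_gt0. Qed.

Let sp : 0 <= s. Proof. by rewrite invr_ge0 ltW. Qed.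

Lemma mu_affine A : measurable A -> mu (tau @^-1` A) = (s%:E * mu A)%E.
Proof.
move=> mA; case: hmu => _ /(_ a Y0 A a0 mA) ->.
by rewrite muleA -EFinM mulVf ?gt_eqF// mul1e.
Qed.

Lemma measurable_tau_pre A : measurable A -> measurable (tau @^-1` A).
Proof. by move=> mA; rewrite -[X in measurable X]setTI; exact: measurable_affine_rV. Qed.

Lemma integral_affine (f : X_ -> \bar R) : measurable_fun setT f -> (forall X, 0 <= f X)%E ->
  (\int[mu]_X f (tau X) = s%:E * \int[mu]_X f X)%E.
Proof.
move=> mf f0; have mt := @measurable_affine_rV R m a Y0.
have := @ge0_integral_pushforward _ _ _ _ _ _ mt mu setT f measurableT mf (fun X _ => f0 X).
rewrite preimage_setT => <-.
rewrite (eq_measure_integral (mscale (NngNum sp) mu)); last first.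
  by move=> A mA _; exact: mu_affine.
by rewrite ge0_integral_mscale//= => X _; exact: f0.
Qed.

Lemma good_affine (V : normedModType R[i]) (F : X_ -> V) : good mu F -> good mu (F \o tau).
Proof.
move=> [mF iF]; split; first by apply: smeas_precomp => //; exact: measurable_affine_rV.
rewrite /inorm (integral_affine (f := fun X => (rnorm (F X))%:E)).
- by rewrite lte_mul_pinfty.
- exact: smeas_ernorm.
- by move=> X; rewrite lee_fin rnorm_ge0.
Qed.

Lemma bint_affine (V : normedModType R[i]) (F : X_ -> V) : cplt V -> good mu F ->
  bint mu (F \o tau) = (s%:C)%C *: bint mu F.
Proof.
move=> cV gF; have [S [aS cS bS]] := good_approx measurable_cball (cball_lty hmu) (@cball_cover R m) gF.
have mt A : (mu A < +oo)%E -> measurable A -> (mu (tau @^-1` A) < +oo)%E.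
  by move=> h mA; rewrite mu_affine// lte_mul_pinfty.
pose TS k : step_fun mu V := @StepFun _ _ _ _ _ (step_size (S k)) (fun i => tau @^-1` (step_set i))
  (fun i => step_val i) (fun i => measurable_tau_pre (step_measurable i))
  (fun i => mt _ (step_finite i) (step_measurable i)).
have TSe k X : step_eval (TS k) X = step_eval (S k) (tau X) by [].
have key (x : \bar R) (v : V) : x \is a fin_num ->
    ((fine (s%:E * x))%:C)%C *: v = (s%:C)%C *: (((fine x)%:C)%C *: v).
  by move=> hx; rewrite fineM// scalerA (rmorphM (real_complex R)).
have TSi k : step_int (TS k) = (s%:C)%C *: step_int (S k).
  rewrite /step_int scaler_sumr; apply: eq_bigr => i _ /=.
  rewrite mu_affine; last exact: step_measurable.
  apply: key; rewrite ge0_fin_numE//; exact: step_finite.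
have mF : smeas F by case: gF.
have aTS : bochner_approx TS (F \o tau).
  split; first by apply: aeW => X; exact: cS.
  have -> : (fun k => (\int[mu]_x (rnorm ((F \o tau) x - step_eval (TS k) x))%:E)%E) =
            (fun k => (s%:E * \int[mu]_x (rnorm (F x - step_eval (S k) x))%:E)%E).
    apply/funext => k; rewrite -integral_affine//.
      exact: (smeas_ernorm (smeasB mF (smeas_step _))).
    by move=> X; rewrite lee_fin rnorm_ge0.
  by rewrite -[X in _ --> X](mule0 s%:E); apply: cvgeZl => //; case: aS.
have gT := good_affine gF.
have h1 := bint_approx cV (proj1 gT) aTS.
have h2 := bint_approx cV mF aS.
apply: cvg_uniq h1 _; under eq_fun do rewrite TSi.
by apply: cvgZc => //; exact: cvg_cst.
Qed.

Lemma ae_affine (P : X_ -> Prop) : {ae mu, forall X, P X} -> {ae mu, forall X, P (tau X)}.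
Proof.
move=> [N [mN N0 sub]]; exists (tau @^-1` N); split; first exact: measurable_tau_pre.
  by rewrite [LHS]mu_affine// N0 mule0.
by move=> X /= h; exact: sub.
Qed.

End affine.

(* Riemann sums along the cells of [rnd]; a single family serves all functions. *)
Lemma riemann : exists (N : nat -> nat) (a : forall k, 'I_(N k) -> R) (y : forall k, 'I_(N k) -> X_),
  (forall k i, 0 <= a k i) /\
  (forall (V : normedModType R[i]) (H : X_ -> V), cplt V -> nice H ->
     \sum_i ((a k i)%:C)%C *: H (y k i) @[k --> \oo] --> bint mu H) /\
  (exists B, forall k, \sum_i a k i * wt (y k i) <= B).
Proof.
have ex k : exists t : {N : nat & ((X_ -> 'I_N) * ('I_N -> X_))%type},
    (forall i, measurable ((projT2 t).1 @^-1` [set i])) /\ rnd k = (projT2 t).2 \o (projT2 t).1.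
  have [I [p [v [mp E]]]] := @fval_rnd R m k.
  exists (existT _ #|I| (enum_rank \o p, v \o enum_val)); split => [i|] /=; last first.
    by rewrite E; apply/funext => x /=; rewrite enum_rankK.
  rewrite (_ : _ @^-1` _ = p @^-1` [set enum_val i])//.
  apply/seteqP; split => x /=; first by move=> <-; rewrite enum_rankK.
  by move=> ->; rewrite enum_valK.
have [t ht] := choice ex.
pose N k := projT1 (t k); pose p k := (projT2 (t k)).1; pose y k := (projT2 (t k)).2.
have mp k i : measurable (p k @^-1` [set i]) by case: (ht k).
have rE k x : rnd k x = y k (p k x) by case: (ht k) => _ ->.
(* Keeping only points within distance 1 of their rounding makes the weights at both comparable, so
   that the step functions are dominated by a multiple of [wt]. *)
pose E k := cball k `&` [set x : X_ | `|x - rnd k x| <= 1].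
have mE k : measurable (E k).
  apply: measurableI; first exact: measurable_cball.
  have := @measurable_fun_ler _ _ _ setT (fun x : X_ => `|x - rnd k x|) (fun=> 1).
  move=> /(_ _ _ measurableT [set true]); rewrite setTI; apply => //.
  by apply: measurable_fun_dist => // _ Y _; rewrite setTI; apply: fval_preimage; exact: fval_rnd.
have fE k : (mu (E k) < +oo)%E.
  apply: le_lt_trans (cball_lty hmu k); apply: le_measure; rewrite ?inE//; last exact: subIsetl.
  exact: measurable_cball.
pose Dc k i := E k `&` p k @^-1` [set i].
have mD k i : measurable (Dc k i) by exact: measurableI.
have fD k i : (mu (Dc k i) < +oo)%E.
  by apply: le_lt_trans (fE k); apply: le_measure; rewrite ?inE//; exact: subIsetl.
pose S (V : normedModType R[i]) (H : X_ -> V) k : step_fun mu V :=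
  @StepFun _ _ _ _ _ (N k) (Dc k) (fun i => H (y k i)) (mD k) (fD k).
have Se V H k x : step_eval (S V H k) x = if `[< E k x >] then H (rnd k x) else 0.
  rewrite /step_eval/=; have [Ex|nEx] := asboolP (E k x); last first.
    by apply: big1 => i _; rewrite indicE memNset ?scale0r// => -[].
  rewrite (bigD1 (p k x))//= big1 => [|i ix].
    by rewrite indicE mem_set// scale1r addr0 rE.
  by rewrite indicE memNset ?scale0r// => -[_ /= E2]; move/eqP: ix; apply.
have Sb (V : normedModType R[i]) (H : X_ -> V) C k x : (forall X, rnorm (H X) <= C * wt X) ->
    rnorm (step_eval (S V H k) x) <= C * 2 ^+ (2 * m) * wt x.
  move=> bH; have C0 : 0 <= C.
    by have := le_trans (rnorm_ge0 _) (bH 0); rewrite pmulr_lge0// wt_gt0.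
  rewrite Se; case: asboolP => [[_ /= h]|_]; last first.
    by rewrite rnorm0 !mulr_ge0// ltW// wt_gt0.
  rewrite (le_trans (bH _))// -mulrA ler_wpM2l//; apply: wt_near.
  by rewrite distrC.
exists N, (fun k i => fine (mu (Dc k i))), y; split; first by move=> k i; exact: fine_ge0.
split; last first.
  exists (fine (\int[mu]_X (2 ^+ (2 * m) * wt X)%:E)) => k.
  (* The uniform bound on the sums comes from the same step functions, built for the weight
     itself. *)
  pose H0 (x : X_) : R[i]^o := ((wt x)%:C)%C.
  have bH0 x : rnorm (H0 x) <= 1 * wt x by rewrite rnorm_real mul1r ger0_norm// ltW// wt_gt0.
  have [_] := step_int_le (S _ H0 k).
  have -> : step_int (S _ H0 k) = ((\sum_i fine (mu (Dc k i)) * wt (y k i))%:C)%C.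
    by rewrite rmorph_sum; apply: eq_bigr => i _ /=; rewrite rmorphM.
  rewrite rnorm_real => h; rewrite (le_trans (ler_norm _))// -lee_fin fineK; last first.
    rewrite ge0_fin_numE; last by apply: integral_ge0 => X _; rewrite lee_fin mulr_ge0// ltW// wt_gt0.
    have /integrableP[_] := integrable_wt hmu (2 ^+ (2 * m)).
    apply: le_lt_trans; apply: lint_le => X; rewrite lee_fin ?mulr_ge0 ?(ltW (wt_gt0 X))//=.
    exact: ler_norm.
  apply: le_trans h _; apply: lint_le => X; rewrite lee_fin ?rnorm_ge0//.
  by have := Sb _ _ 1 k X bH0; rewrite mul1r.
move=> V H cV nH; have [cH [C bH]] := nH.
have mH := continuous_smeas cH.
have cS x : step_eval (S V H k) x @[k --> \oo] --> H x.
  have Hr : H (rnd k x) @[k --> \oo] --> H x by apply: continuous_cvg; [exact: cH|exact: cvg_rnd].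
  have [K1 hK1] := cball_cover x.
  have [K2 hK2] := @ratpt_dense R m x 1 ltr01.
  apply/cvg_seq_rnormP => e e0; have /cvg_seq_rnormP/(_ _ e0)[K3 hK3] := Hr.
  exists (maxn K1 (maxn K2 K3)) => k; rewrite !geq_max => /and3P[k1 k2 k3].
  by rewrite Se asboolT; [exact: hK3|split; [exact: hK1|exact: le_trans (rnd_le x k2) hK2]].
have aS : bochner_approx (S V H) H.
  split; first exact: aeW.
  have [//||_] := @good_dct _ _ _ mu _ (fun k => step_eval (S V H k)) H (fun x => C * 2 ^+ (2 * m) * wt x) _ mH cS (integrable_wt hmu _) _.
  - by move=> k; exact: smeas_step.
  - by move=> k x; exact: Sb.
  by under eq_fun do rewrite inormBC.
have := bint_approx cV mH aS.
by [].
Qed.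

(** Riemann sums in Y commute with the integral in X, and dominated convergence, with the uniform
    bound on the sums of weights, passes to the limit. No product measure is involved. *)
Lemma fubini_nice (V : normedModType R[i]) (F : X_ -> X_ -> V) (C : R) : cplt V ->
  (forall X, continuous (F X)) -> (forall Y, continuous (F ^~ Y)) ->
  (forall X Y, rnorm (F X Y) <= C * (wt X * wt Y)) ->
  bint mu (fun X => bint mu (F X)) = bint mu (fun Y => bint mu (F ^~ Y)).
Proof.
move=> cV c1 c2 bF; pose I := fine (\int[mu]_X (wt X)%:E).
have C0 : 0 <= C.
  by have := le_trans (rnorm_ge0 _) (bF 0 0); rewrite pmulr_lge0// mulr_gt0// wt_gt0.
have n1 X : nice (F X) by split => //; exists (C * wt X) => Y; rewrite -mulrA.
have n2 Y : nice (F ^~ Y) by split => //; exists (C * wt Y) => X; rewrite -mulrA [wt Y * _]mulrC.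
have wt1 (u : X_) : wt u <= 1.
  by rewrite invf_le1 ?exprn_gt0 ?base_gt0// exprn_ege1// wt_base.
have cG : continuous (fun Y => bint mu (F ^~ Y)).
  apply: (@bint_continuous V _ (fun Y X => F X Y) C) => // Y X.
  by rewrite (le_trans (bF _ _))// ler_wpM2l// ler_piMr// ltW// wt_gt0.
have nG : nice (fun Y => bint mu (F ^~ Y)).
  split => //; exists (C * I) => Y; rewrite mulrAC; apply: bint_bound => //.
    exact: continuous_smeas (n2 Y).1.
  by move=> X; rewrite -mulrA [wt Y * _]mulrC.
have [N [a [y [a_ge0 [ha [B hB]]]]]] := riemann.
apply: (@cvg_uniq R V _ \oo _ (fun k => \sum_i ((a k i)%:C)%C *: bint mu (F ^~ (y k i)))); last exact: ha nG.
have E k : \sum_i ((a k i)%:C)%C *: bint mu (F ^~ (y k i)) = bint mu (fun X => \sum_i ((a k i)%:C)%C *: F X (y k i)).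
  have g j : good mu (F ^~ (y k j)) by exact: nice_good.
  suff [_ ->] : good mu (fun X => \sum_i ((a k i)%:C)%C *: F X (y k i)) /\
    bint mu (fun X => \sum_i ((a k i)%:C)%C *: F X (y k i)) = \sum_i ((a k i)%:C)%C *: bint mu (F ^~ (y k i)) by [].
  elim: (index_enum _) => [|i r [ih1 ih2]].
    under eq_fun do rewrite big_nil; rewrite big_nil; split.
      by apply: nice_good; split; [exact: cst_continuous|exists 0 => X; rewrite rnorm0 mul0r].
    exact: (bint0 measurable_cball (cball_lty hmu) (@cball_cover R m)).
  under eq_fun do rewrite big_cons; rewrite big_cons; split; first exact: good_lin.
  by rewrite bint_lin// ih2.
under eq_fun do rewrite E.
apply: (bint_dct measurable_cball (cball_lty hmu) (@cball_cover R m) cV _ _ _ (integrable_wt hmu (C * B))).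
- move=> k; apply: continuous_smeas; apply: continuous_sumr => i X.
  exact: (cvgZc (cvg_cst _) (c2 _ X)).
- apply: continuous_smeas; apply: (@bint_continuous V _ F C) => // X Y.
  by rewrite (le_trans (bF _ _))// ler_wpM2l// ler_piMl// ltW// wt_gt0.
- by move=> X; exact: ha.
- move=> k X; rewrite (le_trans (rnorm_sum _ _ _))//.
  apply: (@le_trans _ _ (\sum_i a k i * (C * (wt X * wt (y k i))))).
    by apply: ler_sum => i _; rewrite rnormZr ger0_norm// ler_wpM2l.
  have -> : \sum_i a k i * (C * (wt X * wt (y k i))) = (C * wt X) * \sum_i a k i * wt (y k i).
    by rewrite mulr_sumr; apply: eq_bigr => i _; ring.
  by rewrite [leRHS]mulrAC ler_wpM2l// mulr_ge0// ltW// wt_gt0.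
Qed.

End haar2.

(** * The mean value inequality for vector-valued functions *)

Section mean_value.
Context {R : realType} {V : normedModType R[i]}.

(** Let c be the supremum of the points up to which the estimate holds. The local bound at c shows
    first that c is such a point and then, if c < b, that a point beyond c is one as well. *)
Lemma local_lipschitz_le (f : R -> V) (a b K : R) : a <= b ->
  (forall c, a <= c <= b -> exists2 d : R, 0 < d &
     forall s, a <= s <= b -> `|s - c| < d -> rnorm (f s - f c) <= K * `|s - c|) ->
  rnorm (f b - f a) <= K * (b - a).
Proof.
move=> ab h; pose P t := rnorm (f t - f a) <= K * (t - a).
pose S := [set t | a <= t <= b /\ P t].
have Sa : S a by split; rewrite ?lexx ?ab// /P !subrr rnorm0 mulr0.
have hS : has_sup S by split; [exists a|exists b => t [/andP[]]].
pose c := sup S.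
have ac : a <= c by exact: ub_le_sup hS.2 _ Sa.
have cb : c <= b by apply: ge_sup => //; [exists a|move=> t [/andP[]]].
have [d d0 hd] := h c (introT andP (conj ac cb)).
have chain s t : a <= s -> s <= t -> t <= b -> P s -> rnorm (f t - f s) <= K * (t - s) -> P t.
  move=> _ _ _ hs hst; rewrite /P.
  have -> : f t - f a = (f t - f s) + (f s - f a) by rewrite addrA subrK.
  rewrite (le_trans (rnormD _ _))// (le_trans (lerD hst hs))//.
  by rewrite -mulrDr addrA subrK.
have Pc : P c.
  have [s [/andP[as_ sb] Ps] cs] := sup_adherent d0 hS.
  have sc : s <= c by exact: (ub_le_sup hS.2 (conj (introT andP (conj as_ sb)) Ps)).
  apply: (chain s c) => //.
  have := hd s; rewrite as_ sb rnormB => /(_ isT).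
  by rewrite distrC ger0_norm ?subr_ge0//; apply; rewrite ltrBlDr -ltrBlDl.
have [cb2|] := ltP c b; last first.
  by move=> bc; have <- : c = b by apply: le_anti; rewrite cb bc.
pose t := Num.min b (c + d / 2).
have ct : c < t by rewrite lt_min cb2/= ltrDl divr_gt0.
have tb : t <= b by rewrite ge_min lexx.
have St : S t.
  split; first by rewrite tb andbT (le_trans ac)// ltW.
  apply: (chain c t) => //; first exact: ltW.
  have := hd t; rewrite (le_trans ac (ltW ct)) tb => /(_ isT).
  rewrite (ger0_norm (_ : 0 <= t - c)); last by rewrite subr_ge0 ltW.
  apply.
  have : t <= c + d / 2 by rewrite ge_min lexx orbT.
  move: (d0); lra.
by have := ub_le_sup hS.2 St; rewrite leNgt ct.
Qed.

Lemma mean_value (f f' : R -> V) (a b M : R) : a <= b ->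
  (forall c, a <= c <= b -> ((t^-1)%:C)%C *: (f (c + t) - f c) @[t --> (0 : R)^'] --> f' c) ->
  (forall c, a <= c <= b -> rnorm (f' c) <= M) -> rnorm (f b - f a) <= M * (b - a).
Proof.
move=> ab df bf; apply/ler_addgt0Pl => e e0.
have [->|ba] := eqVneq b a; first by rewrite !subrr rnorm0 mulr0 addr0 ltW.
have ba0 : 0 < b - a by rewrite subr_gt0 lt_neqAle eq_sym ba.
(* The error e, spread over the interval, leaves the slack e/(b - a) needed to pass from the
   derivative to a local Lipschitz bound. *)
have -> : e + M * (b - a) = (M + e / (b - a)) * (b - a).
  by rewrite mulrDl divfK ?gt_eqF// addrC.
apply: local_lipschitz_le => // c hc.
have e1 : 0 < e / (b - a) by rewrite divr_gt0.
have /cvg_rnormP/(_ _ e1) := df c hc.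
rewrite near_withinE => /nbhs_ballP[d /= d0 hd]; exists d => // s hs sc.
have [->|sc0] := eqVneq s c; first by rewrite !subrr rnorm0 normr0 mulr0.
have s0 : s - c != 0 by rewrite subr_eq0.
have := hd (s - c); rewrite /ball/= sub0r normrN => /(_ sc s0).
rewrite addrCA subrr addr0 => h1.
have h2 : rnorm (((s - c)^-1%:C)%C *: (f s - f c)) <= M + e / (b - a).
  have -> : ((s - c)^-1%:C)%C *: (f s - f c) = f' c + (((s - c)^-1%:C)%C *: (f s - f c) - f' c) by rewrite addrCA subrr addr0.
  by rewrite (le_trans (rnormD _ _))// lerD// bf.
by move: h2; rewrite rnormZr normfV mulrC ler_pdivrMr ?normr_gt0.
Qed.

End mean_value.

Lemma haar_dX (R : realType) n (Omega : 'M[R]_(2 * n)) : haar (dX Omega).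
Proof.
split.
  rewrite /dX ge0_integral_mscale//=.
    rewrite lte_mul_pinfty ?lee_fin ?dX_factor_ge0//; apply: le_lt_trans (@integral_cprod_lty R (2 * n)).
    by apply: lint_le => X; rewrite lee_fin ?wt_le_cprod// ltW// wt_gt0.
    by apply/measurable_EFinP; exact: measurable_wt.
  by move=> X _; rewrite lee_fin ltW// wt_gt0.
move=> a Y A a0 mA.
have E B : dX Omega B = ((dX_factor Omega)%:E * lebesgue_rV (2 * n) B)%E by [].
by rewrite !E (lebesgue_rV_affine Y a0 mA) muleCA.
Qed.

(** * The symplectic form *)

Section form.
Context {R : realType} {n : nat} {Omega : 'M[R]_(2 * n)}.
Hypothesis hOmega : symplectic Omega.
Local Notation Xi := 'rV[R]_(2 * n).
Local Notation sf := (sform Omega).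
Implicit Types X Y Z : Xi.

Lemma sformDl X Y Z : sf (X + Y) Z = sf X Z + sf Y Z.
Proof. by rewrite /sform !mulmxDl mxE. Qed.

Lemma sformDr X Y Z : sf X (Y + Z) = sf X Y + sf X Z.
Proof. by rewrite /sform linearD mulmxDr mxE. Qed.

Lemma sformZl a X Y : sf (a *: X) Y = a * sf X Y.
Proof. by rewrite /sform -!scalemxAl mxE. Qed.

Lemma sformZr a X Y : sf X (a *: Y) = a * sf X Y.
Proof. by rewrite /sform linearZ -scalemxAr mxE. Qed.

Lemma sformNl X Y : sf (- X) Y = - sf X Y.
Proof. by rewrite -scaleN1r sformZl mulN1r. Qed.

Lemma sformNr X Y : sf X (- Y) = - sf X Y.
Proof. by rewrite -scaleN1r sformZr mulN1r. Qed.

Lemma sformBl X Y Z : sf (X - Y) Z = sf X Z - sf Y Z.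
Proof. by rewrite sformDl sformNl. Qed.

Lemma sformBr X Y Z : sf X (Y - Z) = sf X Y - sf X Z.
Proof. by rewrite sformDr sformNr. Qed.

Lemma sformC X Y : sf X Y = - sf Y X.
Proof.
rewrite /sform; have [h _] := hOmega.
have -> : X *m Omega *m Y^T = (Y *m Omega^T *m X^T)^T.
  by rewrite !trmx_mul !trmxK mulmxA.
by rewrite h mxE mulmxN mulNmx mxE.
Qed.

Lemma sformXX X : sf X X = 0.
Proof. by have := sformC X X; lra. Qed.

Definition sform_bound : R := \sum_i \sum_j `|Omega i j|.

Lemma sform_bound_ge0 : 0 <= sform_bound.
Proof. by apply: sumr_ge0 => i _; apply: sumr_ge0. Qed.

Lemma sform_le X Y : `|sf X Y| <= sform_bound * (`|X| * `|Y|).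
Proof.
rewrite /sform mxE (le_trans (ler_norm_sum _ _ _))//.
rewrite /sform_bound exchange_big/= mulr_suml; apply: ler_sum => j _.
rewrite normrM mxE [leRHS]mulrA; apply: ler_pM => //; last by rewrite mxE ler_rV_coord.
rewrite (le_trans (ler_norm_sum _ _ _))// mulr_suml; apply: ler_sum => i _.
by rewrite normrM mulrC ler_wpM2l// ler_rV_coord.
Qed.

Lemma continuous_sform2 (T : topologicalType) (f g : T -> Xi) :
  continuous f -> continuous g -> continuous (fun t => sf (f t) (g t)).
Proof.
move=> cf cg; rewrite /sform.
have -> : (fun t => (f t *m Omega *m (g t)^T) 0 0) = (fun t => \sum_j \sum_i f t 0 i * Omega i j * g t 0 j).
  apply/funext => t; rewrite mxE; apply: eq_bigr => j _.
  by rewrite !mxE mulr_suml; apply: eq_bigr => i _.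
have cc (u : T -> Xi) i : continuous u -> continuous (fun t => u t 0 i).
  by move=> cu t; exact: (continuous_comp (cu t) (@coord_continuous _ _ _ 0 i _)).
apply: (@continuous_sumr _ R^o) => j; apply: (@continuous_sumr _ R^o) => i t.
by apply: cvgM; [apply: cvgM; [exact: cc|exact: cvg_cst]|exact: cc].
Qed.

(** The inverse of [Omega] recovers X from its pairings with the basis vectors, K being the sum of
    the moduli of its entries. This turns factors [Y, e_i] into powers of |Y|. *)
Lemma sform_nondeg : exists2 K : R, 0 <= K &
  forall X t, (forall i, `|sf X (delta_mx 0 i)| <= t) -> `|X| <= K * t.
Proof.
have [_ uO] := hOmega.
exists (\sum_i \sum_j `|(invmx Omega) i j|) => [|X t h].
  by apply: sumr_ge0 => i _; apply: sumr_ge0.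
have sfE i : sf X (delta_mx 0 i) = (X *m Omega) 0 i.
  by rewrite /sform trmx_delta -colE mxE.
have -> : X = X *m Omega *m invmx Omega by rewrite mulmxK.
have [i0 _|n0] := pickP (fun _ : 'I_(2 * n) => true); last first.
  rewrite (_ : _ *m invmx _ = 0) ?normr0; last by apply/rowP => i; have := n0 i.
  by rewrite big1 ?mul0r// => i _; have := n0 i.
have t0 : 0 <= t by rewrite (le_trans _ (h i0)).
rewrite rV_norm_le; last by rewrite mulr_ge0//; apply: sumr_ge0 => i _; apply: sumr_ge0.
apply/forallP => i; rewrite mxE (le_trans (ler_norm_sum _ _ _))// mulr_suml.
apply: ler_sum => j _; rewrite normrM mulrC; apply: ler_pM => //; last by rewrite -sfE.
by rewrite (bigD1 i)//= lerDl sumr_ge0.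
Qed.

End form.

Section continuity.
Context {K : numFieldType} {W : normedModType K} {T : topologicalType}.
Implicit Types f g : T -> W.

Lemma cts_add f g : continuous f -> continuous g -> continuous (fun x => f x + g x).
Proof. by move=> cf cg x; exact: (cvgD (cf x) (cg x)). Qed.

Lemma cts_sub f g : continuous f -> continuous g -> continuous (fun x => f x - g x).
Proof. by move=> cf cg x; exact: (cvgB (cf x) (cg x)). Qed.

Lemma cts_scale (a : K) f : continuous f -> continuous (fun x => a *: f x).
Proof. by move=> cf x; exact: (cvgZ (@cvg_cst _ (a : K^o) _ (nbhs x) _) (cf x)). Qed.

Lemma cts_comp (S : topologicalType) (h : S -> T) f : continuous h -> continuous f -> continuous (fun x => f (h x)).
Proof. by move=> ch cf x; exact: (continuous_comp (ch x) (cf (h x))). Qed.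

Lemma cts_id : continuous (fun x : T => x).
Proof. by move=> x; exact: cvg_id. Qed.

End continuity.

(** * Functions whose derivatives decay polynomially *)

Section decay.
Context {R : realType} {m : nat}.
Local Notation Xi := 'rV[R]_m.
Implicit Types (P : Type) (V W U : normedModType R[i]) (X : Xi).

Lemma cvg_near_eq T (FF : set_system T) {fF : Filter FF} V (f g : T -> V) (l : V) :
  (\forall x \near FF, f x = g x) -> f x @[x --> FF] --> l -> g x @[x --> FF] --> l.
Proof. by move=> fg fl; apply: cvg_trans fl; apply: near_eq_cvg; apply: filterS fg => x ->. Qed.

Definition bd P V (d : nat) (F : P -> Xi -> V) :=
  (forall p, continuous (F p)) /\
  exists C : R, forall p X, (1 + `|X|) ^+ d * rnorm (F p X) <= C.

Definition deriv_of V i (F F' : Xi -> V) :=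
  forall X, diff_quot i F X t @[t --> (0 : R)^'] --> F' X.

(* [k] partial derivatives, all of them [O((1 + |X|)^-d)] uniformly in the parameter. *)
Fixpoint Dc P V k d (F : P -> Xi -> V) := bd d F /\
  if k is k'.+1 then forall i, exists F', (forall p, deriv_of i (F p) (F' p)) /\ Dc k' d F'
  else True.

Lemma Dc_bd P V k d (F : P -> Xi -> V) : Dc k d F -> bd d F.
Proof. by case: k => [|k] []. Qed.

Lemma bd_le P V e d (F : P -> Xi -> V) : (e <= d)%N -> bd d F -> bd e F.
Proof.
move=> ed [cF [C h]]; split => //; exists C => p X; apply: le_trans (h p X).
rewrite ler_wpM2r ?rnorm_ge0//; apply: ler_weXn2l => //; exact: wt_base.
Qed.

Lemma Dc_le P V k l d e (F : P -> Xi -> V) : (k <= l)%N -> (e <= d)%N -> Dc l d F -> Dc k e F.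
Proof.
elim: k l F => [|k ih] [|l] F //= kl ed [bF h]; split; try exact: bd_le ed bF; try by [].
by move=> i; have [F' [dF DF]] := h i; exists F'; split => //; exact: ih DF.
Qed.

Lemma bd_wt P V (F : P -> Xi -> V) : bd (2 * m) F -> exists C : R, forall p X, rnorm (F p X) <= C * wt X.
Proof.
move=> [_ [C h]]; exists C => p X; rewrite /wt ler_pdivlMr ?exprn_gt0 ?base_gt0// mulrC.
exact: h.
Qed.

Lemma bdD P V d (F G : P -> Xi -> V) : bd d F -> bd d G -> bd d (fun p X => F p X + G p X).
Proof.
move=> [cF [C hC]] [cG [D hD]]; split => [p X|]; first by exact: (cvgD (cF p X) (cG p X)).
exists (C + D) => p X; apply: le_trans (lerD (hC p X) (hD p X)).
by rewrite -mulrDr ler_wpM2l ?rnormD// exprn_ge0// base_ge0.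
Qed.

Lemma deriv_ofD V i (F F' G G' : Xi -> V) : deriv_of i F F' -> deriv_of i G G' ->
  deriv_of i (fun X => F X + G X) (fun X => F' X + G' X).
Proof.
move=> dF dG X; apply: cvg_near_eq (cvgD (dF X) (dG X)); apply: nearW => t.
by rewrite /diff_quot -scalerDr opprD addrACA.
Qed.

Lemma DcD P V k d (F G : P -> Xi -> V) : Dc k d F -> Dc k d G -> Dc k d (fun p X => F p X + G p X).
Proof.
elim: k F G => [|k ih] F G /= [bF hF] [bG hG]; split; try exact: bdD; try by [].
move=> i; have [F' [dF DF]] := hF i; have [G' [dG DG]] := hG i.
exists (fun p X => F' p X + G' p X); split; last exact: ih.
by move=> p; exact: deriv_ofD.
Qed.

Lemma cvg_shift V (G : Xi -> V) X i : continuous G ->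
  G (X + t *: delta_mx 0 i) @[t --> (0 : R)^'] --> G X.
Proof.
move=> cG; apply: cvg_within_filter.
have -> : G X = G (X + (0 : R) *: delta_mx 0 i) by rewrite scale0r addr0.
apply: (@continuous_comp _ _ _ (fun t : R => X + t *: delta_mx 0 i) G); last exact: cG.
by apply: cvgD; [exact: cvg_cst|apply: cvgZr_tmp; exact: cvg_id].
Qed.

Lemma continuousZc (T : topologicalType) V (u : T -> R[i]^o) (G : T -> V) :
  continuous u -> continuous G -> continuous (fun x => u x *: G x).
Proof. by move=> cu cG x; exact: (cvgZc (cu x) (cG x)). Qed.

Lemma continuous_affine (a : R) Y : continuous (fun X : Xi => a *: X + Y).
Proof.
apply: cts_add; last exact: cst_continuous.
apply: cts_scale; exact: cts_id.
Qed.

Lemma continuous_translate V (F : Xi -> V) Y : continuous F -> continuous (fun X => F (X + Y)).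
Proof.
move=> cF; apply: (cts_comp _ cF); apply: cts_add; [exact: cts_id|exact: cst_continuous].
Qed.

Lemma continuous_diff_quot V i (F : Xi -> V) t : continuous F -> continuous (diff_quot i F ^~ t).
Proof.
move=> cF; apply: continuousZc; first exact: cst_continuous.
by apply: cts_sub => //; exact: continuous_translate.
Qed.

Section bilinear.
Context {U V W : normedModType R[i]} (op : U -> V -> W).
Hypotheses (opDl : forall u u' v, op (u + u') v = op u v + op u' v)
  (opDr : forall u v v', op u (v + v') = op u v + op u v')
  (opZl : forall (a : R[i]) u v, op (a *: u) v = a *: op u v)
  (opZr : forall (a : R[i]) u v, op u (a *: v) = a *: op u v)
  (opb : forall u v, rnorm (op u v) <= rnorm u * rnorm v).

Let opBl u u' v : op (u - u') v = op u v - op u' v.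
Proof. by rewrite opDl -scaleN1r opZl scaleN1r. Qed.

Let opBr u v v' : op u (v - v') = op u v - op u v'.
Proof. by rewrite opDr -scaleN1r opZr scaleN1r. Qed.

Lemma cvg_op T (FF : set_system T) {_ : Filter FF} (f : T -> U) (g : T -> V) u v :
  f x @[x --> FF] --> u -> g x @[x --> FF] --> v -> op (f x) (g x) @[x --> FF] --> op u v.
Proof.
move=> /cvg_rnorm0P fu /cvg_rnorm0P gv.
apply: (cvg_squeeze_rnorm (g := fun x => rnorm (f x - u) * rnorm (g x - v) + rnorm (f x - u) * rnorm v + rnorm u * rnorm (g x - v))).
  move=> x; have -> : op (f x) (g x) - op u v = op (f x - u) (g x - v) + op (f x - u) v + op u (g x - v).
    by rewrite opBr subrK opBl opBr addrA subrK.
  apply: le_trans (rnormD _ _) _; apply: lerD => //.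
  by apply: le_trans (rnormD _ _) _; apply: lerD.
have -> : 0 = 0 * 0 + 0 * rnorm v + rnorm u * 0 :> R by rewrite !mul0r mulr0 !addr0.
by apply: cvgD; [apply: cvgD; [exact: cvgM|apply: cvgM => //; exact: cvg_cst]|apply: cvgM => //; exact: cvg_cst].
Qed.

Lemma deriv_of_op i (F F' : Xi -> U) (G G' : Xi -> V) : deriv_of i F F' -> deriv_of i G G' ->
  continuous G -> deriv_of i (fun X => op (F X) (G X)) (fun X => op (F' X) (G X) + op (F X) (G' X)).
Proof.
move=> dF dG cG X.
have -> : diff_quot i (fun X => op (F X) (G X)) X =
    fun t => op (diff_quot i F X t) (G (X + t *: delta_mx 0 i)) + op (F X) (diff_quot i G X t).
  apply/funext => t; rewrite /diff_quot opZl opZr -scalerDr opBl opBr.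
  by rewrite addrA subrK.
apply: cvgD; first by apply: cvg_op; [exact: dF|exact: cvg_shift].
by apply: cvg_op; [exact: cvg_cst|exact: dG].
Qed.

Lemma bd_op P d e (F : P -> Xi -> U) (G : P -> Xi -> V) : bd d F -> bd e G ->
  bd (d + e) (fun p X => op (F p X) (G p X)).
Proof.
move=> [cF [C hC]] [cG [D hD]]; split => [p X|]; first by exact: (cvg_op (cF p X) (cG p X)).
exists (C * D) => p X; rewrite exprD.
apply: (@le_trans _ _ (((1 + `|X|) ^+ d * rnorm (F p X)) * ((1 + `|X|) ^+ e * rnorm (G p X)))).
  by rewrite mulrACA ler_wpM2l ?mulr_ge0 ?exprn_ge0 ?base_ge0.
by apply: ler_pM => //; rewrite mulr_ge0 ?rnorm_ge0 ?exprn_ge0 ?base_ge0.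
Qed.

Lemma Dc_op P k d e (F : P -> Xi -> U) (G : P -> Xi -> V) : Dc k d F -> Dc k e G ->
  Dc k (d + e) (fun p X => op (F p X) (G p X)).
Proof.
elim: k F G => [|k ih] F G DF0 DG0.
  by split => //; apply: bd_op; [exact: Dc_bd DF0|exact: Dc_bd DG0].
have [bF hF] := DF0; have [bG hG] := DG0; split; first exact: bd_op.
move=> i; have [F' [dF DF]] := hF i; have [G' [dG DG]] := hG i.
exists (fun p X => op (F' p X) (G p X) + op (F p X) (G' p X)); split.
  by move=> p; apply: deriv_of_op => //; exact: bG.1.
by apply: DcD; apply: ih => //; [exact: Dc_le DG0|exact: Dc_le DF0].
Qed.

End bilinear.

Lemma Dc_cst P V k (v : V) : Dc k 0 (fun (_ : P) (_ : Xi) => v).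
Proof.
elim: k v => [|k ih] v; (split; last try by []).
- by split=> [p|]; [exact: cst_continuous|exists (rnorm v) => p X; rewrite expr0 mul1r].
- by split=> [p|]; [exact: cst_continuous|exists (rnorm v) => p X; rewrite expr0 mul1r].
move=> i; exists (fun _ _ => 0); split; last exact: ih.
move=> _ X; apply: cvg_near_eq (cvg_cst 0); apply: nearW => t.
by rewrite /diff_quot subrr scaler0.
Qed.

Lemma Dc_scale P V k d (F : P -> Xi -> R[i]^o) (G : P -> Xi -> V) e :
  Dc k d F -> Dc k e G -> Dc k (d + e) (fun p X => F p X *: G p X).
Proof.
apply: (@Dc_op R[i]^o V V (fun a v => a *: v)).
- by move=> u u' v; rewrite scalerDl.
- by move=> u u' v; rewrite scalerDr.
- by move=> a u v; rewrite scalerA.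
- by move=> a u v; rewrite !scalerA mulrC.
- by move=> u v; rewrite rnormZ.
Qed.

Section linear_factor.
Variables (lam : Xi -> R) (K : R).
Hypotheses (lamD : forall X Y, lam (X + Y) = lam X + lam Y)
  (lamZ : forall a X, lam (a *: X) = a * lam X)
  (lamK : forall X, `|lam X| <= K * `|X|) (clam : continuous lam).

Lemma continuous_real_complex (T : topologicalType) (f : T -> R) : continuous f ->
  continuous (fun x => ((f x)%:C)%C : R[i]^o).
Proof. by move=> cf x; apply/cvg_complexP; split => /=; [exact: cf|exact: cvg_cst]. Qed.

Lemma bd_lam P V d (F : P -> Xi -> V) : bd d.+1 F -> bd d (fun p X => ((lam X)%:C)%C *: F p X).
Proof.
move=> [cF [C hC]]; split => [p X|].
  exact: (cvgZc (@continuous_real_complex _ lam clam X) (cF p X)).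
exists (`|K| * C) => p X; rewrite rnormZr mulrCA.
apply: (@le_trans _ _ (`|K| * (1 + `|X|) * ((1 + `|X|) ^+ d * rnorm (F p X)))).
  rewrite ler_wpM2r ?mulr_ge0 ?rnorm_ge0 ?exprn_ge0 ?base_ge0//.
  rewrite (le_trans (lamK X))//; apply: (@le_trans _ _ (`|K| * `|X|)).
    by rewrite ler_wpM2r// ler_norm.
  by rewrite ler_wpM2l// lerDr.
by rewrite -mulrA ler_wpM2l// mulrA -exprS.
Qed.

(** A linear factor costs one power of decay, and differentiating it produces only a constant. *)
Lemma Dc_lam P V k d (F : P -> Xi -> V) : Dc k d.+1 F -> Dc k d (fun p X => ((lam X)%:C)%C *: F p X).
Proof.
elim: k F => [|k ih] F DF0; first by split => //; apply: bd_lam; exact: Dc_bd DF0.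
have [bF hF] := DF0; split; first exact: bd_lam.
move=> i; have [F' [dF DF]] := hF i.
exists (fun p X => ((lam X)%:C)%C *: F' p X + ((lam (delta_mx 0 i))%:C)%C *: F p X); split.
  move=> p X.
  have key (s x t y : R[i]) (a b : V) : s * t = 1 ->
      s *: ((x + t * y) *: a - x *: b) = x *: (s *: (a - b)) + y *: a.
    move=> st; rewrite scalerDl addrAC -scalerBr scalerDr !scalerA mulrA st mul1r.
    by rewrite [s * x]mulrC.
  apply: cvg_near_eq (cvgD (cvgZc (cvg_cst _) (dF p X)) (cvgZc (cvg_cst _) (@cvg_shift _ _ X i (bF.1 p)))).
  rewrite near_withinE; apply: nearW => t t0; rewrite /diff_quot lamD lamZ.
  rewrite (rmorphD (real_complex R)) (rmorphM (real_complex R)) key//.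
  by rewrite -(rmorphM (real_complex R)) mulVf.
apply: DcD; first exact: ih.
apply: (Dc_scale (d := 0) (F := fun _ _ => ((lam (delta_mx 0 i))%:C)%C)); first exact: Dc_cst.
exact: Dc_le DF0.
Qed.

End linear_factor.

Lemma Dc_cmul P (A : cstarAlgebra R) k d (F G : P -> Xi -> A) e :
  Dc k d F -> Dc k e G -> Dc k (d + e) (fun p X => cmul (F p X) (G p X)).
Proof.
apply: (@Dc_op A A A (@cmul R A)).
- exact: cmulDl.
- exact: cmulDr.
- exact: cmulZl.
- exact: cmulZr.
- exact: rnormM_le.
Qed.

Lemma Dc_pderivs V (G : Xi -> V) k d s : schwartz G -> Dc k d (fun _ : unit => pderivs s G).
Proof.
move=> [[c1 c2] b].
have B s' : bd d (fun _ : unit => pderivs s' G).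
  by split=> [_|]; [exact: c1|have [C h] := b s' d; exists C => _; exact: h].
elim: k s => [|k ih] s; split; try exact: B; try by [].
by move=> i; exists (fun _ => pderivs (i :: s) G); split; [move=> _ X; exact: c2|exact: ih].
Qed.

Lemma Dc_schwartz V (G : Xi -> V) k d : schwartz G -> Dc k d (fun _ : unit => G).
Proof. exact: (@Dc_pderivs V G k d [::]). Qed.

(** The mean value inequality bounds the quotient by the derivative on a segment of length at most
    1, along which the weights are comparable. The bound is therefore uniform in t and integrable in
    X. *)
Lemma rnorm_diff_quot V i (F F' : Xi -> V) (C : R) X t : deriv_of i F F' ->
  (forall Y, rnorm (F' Y) <= C * wt Y) -> `|t| <= 1 ->
  rnorm (diff_quot i F X t) <= C * 2 ^+ (2 * m) * wt X.
Proof.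
move=> dF bF t1.
have C0 : 0 <= C by have := le_trans (rnorm_ge0 _) (bF 0); rewrite pmulr_lge0// wt_gt0.
have [->|t0] := eqVneq t 0.
  by rewrite /diff_quot invr0 scale0r rnorm0 !mulr_ge0 ?exprn_ge0// ltW// wt_gt0.
rewrite /diff_quot rnormZr normfV mulrC ler_pdivrMr ?normr_gt0//.
pose f s := F (X + s *: delta_mx 0 i); pose f' s := F' (X + s *: delta_mx 0 i).
have df c : ((s^-1)%:C)%C *: (f (c + s) - f c) @[s --> (0 : R)^'] --> f' c.
  apply: cvg_near_eq (dF (X + c *: delta_mx 0 i)); apply: nearW => s.
  by rewrite /diff_quot /f scalerDl addrA.
have bf c : `|c| <= 1 -> rnorm (f' c) <= C * 2 ^+ (2 * m) * wt X.
  move=> c1; rewrite (le_trans (bF _))// -mulrA ler_wpM2l//; apply: wt_near.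
  rewrite addrC addKr normrZ (le_trans _ c1)// ler_piMr// rV_norm_le//; apply/forallP => j.
  by rewrite mxE; case: (_ && _); rewrite ?normr1 ?normr0 ?ler01 ?lexx.
have fE : F X = f 0 by rewrite /f scale0r addr0.
rewrite fE -/(f t); have [tp|tn] := leP 0 t.
  have := @mean_value _ _ f f' 0 t (C * 2 ^+ (2 * m) * wt X) tp (fun c _ => df c).
  rewrite subr0 (ger0_norm tp); apply => c /andP[c0 ct].
  by apply: bf; rewrite ger0_norm// (le_trans ct)// -(ger0_norm tp).
have := @mean_value _ _ f f' t 0 (C * 2 ^+ (2 * m) * wt X) (ltW tn) (fun c _ => df c).
rewrite sub0r rnormB (ltr0_norm tn); apply => c /andP[c0 ct].
by apply: bf; rewrite ler0_norm// (le_trans _ t1)// (ltr0_norm tn) lerN2.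
Qed.

Lemma cvg_bint_diff (mu : {measure set Xi -> \bar R}) V i (F F' : Xi -> V) (C : R) (u : Xi -> R[i]^o) :
  haar mu -> cplt V -> continuous u -> (forall X, rnorm (u X) <= 1) ->
  continuous F -> continuous F' -> deriv_of i F F' -> (forall Y, rnorm (F' Y) <= C * wt Y) ->
  bint mu (fun X => u X *: diff_quot i F X t) @[t --> (0 : R)^'] --> bint mu (fun X => u X *: F' X).
Proof.
move=> hmu cV cu u1 cF cF' dF bF'.
(* The value 0 for |t| > 1 makes the domination valid for every value of the parameter; it does not
   affect the limit. *)
pose f t X := if `|t| <= 1 then u X *: diff_quot i F X t else 0.
have nt : \forall t \near (0 : R)^', `|t| <= 1.
  rewrite near_withinE; apply/nbhs_ballP; exists 1 => //= t.
  by rewrite /ball/= sub0r normrN => /ltW.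
suff : bint mu (f t) @[t --> (0 : R)^'] --> bint mu (fun X => u X *: F' X).
  apply: cvg_near_eq; apply: filterS nt => t t1.
  by congr bint; apply/funext => X; rewrite /f t1.
have cc (G : Xi -> V) : continuous G -> continuous (fun X => u X *: G X).
  exact: continuousZc.
apply: (@bint_cvg _ _ _ hmu V _ _ _ f _ (C * 2 ^+ (2 * m))) => //.
- move=> t _; apply: continuous_smeas; rewrite /f; case: (`|t| <= 1); last exact: cst_continuous.
  by apply: cc; exact: continuous_diff_quot.
- by apply: continuous_smeas; exact: cc.
- move=> X; have : u X *: diff_quot i F X t @[t --> (0 : R)^'] --> u X *: F' X.
    by apply: cvgZc; [exact: cvg_cst|exact: dF].
  by apply: cvg_near_eq; apply: filterS nt => t t1; rewrite /f t1.
move=> t X _; rewrite /f; case: ifP => t1.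
  rewrite rnormZ (le_trans _ (rnorm_diff_quot X dF bF' t1))// ler_piMl ?rnorm_ge0//.
have C0 : 0 <= C by have := le_trans (rnorm_ge0 _) (bF' 0); rewrite pmulr_lge0// wt_gt0.
by rewrite rnorm0 !mulr_ge0 ?exprn_ge0// ltW// wt_gt0.
Qed.

End decay.

(** * The symplectic Fourier transform *)

Lemma cts_cis (R : realType) (T : topologicalType) (f : T -> R) : continuous f ->
  continuous (fun t => cis (f t) : R[i]^o).
Proof. by move=> cf; apply: (cts_comp cf); apply: continuous_cis => t; exact: cvg_id. Qed.

Lemma cvg_cis_quot (R : realType) (s : R) :
  (((t^-1)%:C)%C * (cis (t * s) - 1) : R[i]^o) @[t --> (0 : R)^'] --> ('i * (s%:C)%C : R[i]^o).
Proof.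
have D (f : R -> R) (df : R) : is_derive (0 : R) (1 : R) f df -> t^-1 * (f t - f 0) @[t --> (0 : R)^'] --> df.
  move=> Df; have := @ex_derive _ _ _ _ _ _ _ Df; rewrite /derivable.
  have := @derive_val _ _ _ _ _ _ _ Df; rewrite /derive => <-.
  by under eq_fun do rewrite /= addr0 [_ *: 1]mulr1.
have Dc : is_derive (0 : R) (1 : R) (fun t => cos (t * s)) 0.
  by apply: is_derive_eq; rewrite mul0r sin0 oppr0 mul0r.
have Ds : is_derive (0 : R) (1 : R) (fun t => sin (t * s)) s.
  apply: is_derive_eq; rewrite mul0r cos0 /GRing.scale/= ?mul1r ?mulr1 ?mulr0 ?mul0r ?add0r ?addr0 ?mulr1 //.
have hc := D _ _ Dc; have hs := D _ _ Ds.
rewrite mul0r cos0 in hc; rewrite mul0r sin0 in hs.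
apply/cvg_complexP; split => /=.
  rewrite !mul0r !mul1r subrr; apply: cvg_trans hc; apply: near_eq_cvg; apply: nearW => t.
  by rewrite mul0r subr0.
rewrite mul0r mul1r add0r; apply: cvg_trans hs; apply: near_eq_cvg; apply: nearW => t.
by rewrite mul0r addr0.
Qed.

Section fourier.
Context {R : realType} {n : nat} {Omega : 'M[R]_(2 * n)}.
Hypothesis hOmega : symplectic Omega.
Local Notation Xi := 'rV[R]_(2 * n).
Local Notation sf := (sform Omega).
Local Notation mu := (dX Omega).
Local Notation m2 := (2 * (2 * n))%N.
Let hmu : haar mu := haar_dX Omega.
Let mE := (@measurable_cball R (2 * n)).
Let fE := (cball_lty hmu).
Let cE := (@cball_cover R (2 * n)).
Implicit Types (P : Type) (X Y Z U : Xi).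

Lemma continuous_sform_r Y : continuous (fun U => sf Y U).
Proof. by apply: continuous_sform2; [exact: cst_continuous|exact: cts_id]. Qed.

Lemma continuous_sform_l Y : continuous (fun U => sf U Y).
Proof. by apply: continuous_sform2; [exact: cts_id|exact: cst_continuous]. Qed.

Lemma continuous_Rscale (T : topologicalType) (c : R) (f : T -> R) : continuous f -> continuous (fun x => c * f x).
Proof. exact: (@cts_scale R R^o T c f). Qed.

Section transform.
Context {V : normedModType R[i]}.
Hypothesis cV : cplt V.

(** The constant c is -1 for modulations and 2 for the Rieffel product. The parameter p allows decay
    estimates that are uniform over a family of functions. *)
Definition FT P (c : R) (F : P -> Xi -> V) p Y : V := bint mu (fun U => cis (c * sf Y U) *: F p U).

Lemma bint_haar_lin (a : R[i]) (F G : Xi -> V) : good mu F -> good mu G ->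
  bint mu (fun x => a *: F x + G x) = a *: bint mu F + bint mu G.
Proof. exact: (bint_lin mE fE cE cV). Qed.

Lemma bint_haarB (F G : Xi -> V) : good mu F -> good mu G ->
  bint mu (fun x => F x - G x) = bint mu F - bint mu G.
Proof. exact: (bintB mE fE cE cV). Qed.

Lemma bint_haarZ (a : R[i]) (F : Xi -> V) : good mu F ->
  bint mu (fun x => a *: F x) = a *: bint mu F.
Proof. exact: (bintZ mE fE cE cV). Qed.

Lemma good_translate Y (F : Xi -> V) : good mu F -> good mu (fun X => F (X + Y)).
Proof.
move=> gF; have := good_affine hmu Y (oner_neq0 R) gF.
by congr good; apply/funext => X /=; rewrite scale1r.
Qed.

Lemma nice_scale (a : R[i]) (F : Xi -> V) : nice F -> nice (fun X => a *: F X).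
Proof.
move=> [cF [C bF]]; split; first exact: cts_scale.
by exists (rnorm (a : R[i]^o) * C) => X; rewrite rnormZ -mulrA ler_wpM2l// (rnorm_ge0 (_ : R[i]^o)).
Qed.

Lemma bint_haar_translate Y (F : Xi -> V) : good mu F -> bint mu (fun X => F (X + Y)) = bint mu F.
Proof.
move=> gF; have := @bint_affine R _ _ hmu 1 Y (oner_neq0 _) V F cV gF.
rewrite normr1 expr1n invr1 scale1r => <-; congr bint; apply/funext => X /=.
by rewrite scale1r.
Qed.

Lemma rnorm_cisZ t (v : V) : rnorm (cis t *: v) = rnorm v.
Proof. by rewrite rnormZ rnorm_cis mul1r. Qed.

Lemma nice_cis (c : R) Y (F : Xi -> V) : nice F -> nice (fun U => cis (c * sf Y U) *: F U).
Proof.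
move=> [cF [C bF]]; split; last by exists C => X; rewrite rnorm_cisZ.
by apply: continuousZc => //; apply: cts_cis; apply: continuous_Rscale; exact: continuous_sform_r.
Qed.

Lemma bd_nice P (F : P -> Xi -> V) p : bd m2 F -> nice (F p).
Proof. by move=> bF; split; [exact: bF.1|have [C h] := bd_wt bF; exists C]. Qed.

Lemma FT_cont P (c : R) (F : P -> Xi -> V) p : bd m2 F -> continuous (FT c F p).
Proof.
move=> bF; have [C hC] := bd_wt bF.
apply: (@bint_continuous R _ _ hmu V _ (fun Y U => cis (c * sf Y U) *: F p U) C) => //.
- by move=> Y; exact: (nice_cis c Y (bd_nice p bF)).1.
- move=> U; apply: continuousZc; last exact: cst_continuous.
  by apply: cts_cis; apply: continuous_Rscale; exact: continuous_sform_l.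
- by move=> Y U; rewrite rnorm_cisZ.
Qed.

(** No boundary terms arise: by translation invariance the difference quotient passes from the
    function to the character, and then t tends to 0. *)
Lemma FT_ibp P (c : R) i (F F' : P -> Xi -> V) p Y : (forall p, deriv_of i (F p) (F' p)) ->
  bd m2 F -> bd m2 F' ->
  FT c F' p Y = ('i * ((- (c * sf Y (delta_mx 0 i)))%:C)%C) *: FT c F p Y.
Proof.
move=> dF bF bF'; have [C hC] := bd_wt bF'; set s := c * _.
have nF := nice_cis c Y (bd_nice p bF).
pose u U : R[i]^o := cis (c * sf Y U).
have cu : continuous u by apply: cts_cis; apply: continuous_Rscale; exact: continuous_sform_r.
have u1 U : rnorm (u U) <= 1 by rewrite rnorm_cis.
have h1 := @cvg_bint_diff R _ mu V i (F p) (F' p) C u hmu cV cu u1 (bF.1 p) (bF'.1 p) (dF p) (hC p).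
have h2 : bint mu (fun U => u U *: diff_quot i (F p) U t) @[t --> (0 : R)^'] --> ('i * ((- s)%:C)%C) *: FT c F p Y.
  have h := cvgZc (@cvg_cis_quot R (- s)) (@cvg_cst _ (FT c F p Y) _ ((0 : R)^') _).
  apply: (cvg_near_eq _ (h _ _)); apply: nearW => t.
  pose G X := cis (t * - s) *: (cis (c * sf Y X) *: F p X).
  have gG : good mu G := nice_good hmu (nice_scale _ nF).
  have GE : (fun U => cis (c * sf Y U) *: F p (U + t *: delta_mx 0 i)) = (fun U => G (U + t *: delta_mx 0 i)).
    apply/funext => U; rewrite /G scalerA -cisD; congr (cis _ *: _).
    by rewrite sformDr sformZr /s; ring.
  have g2 : good mu (fun U => cis (c * sf Y U) *: F p (U + t *: delta_mx 0 i)).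
    by rewrite GE; exact: good_translate.
  have -> : (fun U => u U *: diff_quot i (F p) U t) =
      (fun U => ((t^-1)%:C)%C *: (cis (c * sf Y U) *: F p (U + t *: delta_mx 0 i) - cis (c * sf Y U) *: F p U)).
    by apply/funext => U; rewrite /diff_quot scalerA mulrC -scalerA scalerBr.
  have g1 := nice_good hmu nF.
  rewrite bint_haarZ; last exact: goodB.
  rewrite bint_haarB// -scalerA; congr (_ *: _).
  rewrite GE (bint_haar_translate _ gG).
  by rewrite bint_haarZ// scalerBl scale1r.
exact: cvg_uniq h1 h2.
Qed.

(** Each derivative yields a factor [Y, e_i]; by nondegeneracy these factors together control
    |Y|. *)
Lemma FT_decay P (c : R) k (F : P -> Xi -> V) : c != 0 -> Dc k m2 F ->
  exists C : R, forall p Y, (1 + `|Y|) ^+ k * rnorm (FT c F p Y) <= C.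
Proof.
move=> c0; elim: k F => [|k ih] F DF0.
  have [C hC] := bd_wt (Dc_bd DF0); exists (C * fine (\int[mu]_X (wt X)%:E)) => p Y.
  have [cF _] := nice_cis c Y (bd_nice p (Dc_bd DF0)).
  rewrite expr0 mul1r; apply: (bint_bound hmu cV); first exact: continuous_smeas.
  by move=> X; rewrite rnorm_cisZ.
have [C0 h0] := ih F (Dc_le (leqnSn k) (leqnn _) DF0).
have [bF hF] := DF0.
have /choice[Ci hCi] : forall i, exists C, forall p Y,
    (1 + `|Y|) ^+ k * (`|c * sf Y (delta_mx 0 i)| * rnorm (FT c F p Y)) <= C.
  move=> i; have [F' [dF DF']] := hF i; have [C hC] := ih F' DF'; exists C => p Y.
  have := hC p Y; rewrite (FT_ibp c p Y dF bF (Dc_bd DF')) rnormZ rnormcM rnorm_real normrN.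
  by rewrite (_ : rnorm ('i : R[i]^o) = 1) ?mul1r// rnormcE/= expr0n expr1n add0r sqrtr1.
have [K K0 hK] := sform_nondeg hOmega.
exists (C0 + K * (`|c|^-1 * \sum_i Ci i)) => p Y.
rewrite exprSr -mulrA mulrDl mul1r mulrDr; apply: lerD => //.
apply: (@le_trans _ _ ((1 + `|Y|) ^+ k * ((K * \sum_i `|sf Y (delta_mx 0 i)|) * rnorm (FT c F p Y)))).
  rewrite ler_wpM2l ?exprn_ge0 ?base_ge0// ler_wpM2r ?rnorm_ge0//; apply: hK => i.
  by rewrite (bigD1 i)//= lerDl sumr_ge0.
rewrite -mulrA mulrCA ler_wpM2l// mulr_suml mulr_sumr mulr_sumr; apply: ler_sum => i _.
rewrite ler_pdivlMl ?normr_gt0//; apply: le_trans (hCi i p Y).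
by rewrite normrM mulrCA -!mulrA.
Qed.

Lemma FT_deriv P (c : R) i (F : P -> Xi -> V) p : bd m2.+1 F ->
  deriv_of i (FT c F p) (FT c (fun p U => ((c * sf (delta_mx 0 i) U)%:C)%C *: ('i *: F p U)) p).
Proof.
move=> bF Y; have bF0 := bd_le (leqnSn _) bF.
pose lam U := c * sf (delta_mx 0 i) U.
have [C hC] : exists C : R, forall U, `|lam U| * rnorm (F p U) <= C * wt U.
  have [_ [C hC]] := bF; exists (`|c| * sform_bound (Omega := Omega) * `|delta_mx 0 i : Xi| * C) => U.
  rewrite /lam normrM -!mulrA ler_wpM2l//.
  apply: (@le_trans _ _ (sform_bound (Omega := Omega) * (`|delta_mx 0 i : Xi| * `|U|) * rnorm (F p U))).
    by rewrite ler_wpM2r ?rnorm_ge0// sform_le.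
  rewrite -!mulrA ler_wpM2l ?sform_bound_ge0// ler_wpM2l//.
  rewrite /wt ler_pdivlMr ?exprn_gt0 ?base_gt0//; apply: le_trans (hC p U).
  by rewrite exprS mulrAC ler_wpM2r ?rnorm_ge0// ler_wpM2r ?exprn_ge0 ?base_ge0// lerDr.
pose f t U := ((t^-1)%:C)%C *: (cis (c * sf (Y + t *: delta_mx 0 i) U) *: F p U - cis (c * sf Y U) *: F p U).
have fE' t U : f t U = (((t^-1)%:C)%C * (cis (t * lam U) - 1)) *: (cis (c * sf Y U) *: F p U).
  rewrite /f -scalerA; congr (_ *: _); rewrite scalerBl scale1r scalerA -cisD; congr (cis _ *: _ - _).
  by rewrite sformDl sformZl /lam; ring.
have cf t : continuous (f t).
  apply: cts_scale; apply: cts_sub; apply: (nice_cis c _ (bd_nice p bF0)).1.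
have g Z := nice_good hmu (nice_cis c Z (bd_nice p bF0)).
have -> : diff_quot i (FT c F p) Y = fun t => bint mu (f t).
  apply/funext => t; rewrite /diff_quot /f bint_haarZ; last exact: goodB.
  by rewrite bint_haarB.
apply: (@bint_cvg R _ _ hmu V _ _ _ f _ (2 * C)) => //.
- by move=> t _; exact: continuous_smeas.
- apply: continuous_smeas; apply: continuousZc.
    by apply: cts_cis; apply: continuous_Rscale; exact: continuous_sform_r.
  apply: continuousZc; first by apply: continuous_real_complex; apply: continuous_Rscale; exact: continuous_sform_r.
  by apply: continuousZc; [exact: cst_continuous|exact: bF.1].
- move=> U; under eq_fun do rewrite fE'.
  have -> : cis (c * sf Y U) *: (((lam U)%:C)%C *: ('i *: F p U)) = ('i * ((lam U)%:C)%C) *: (cis (c * sf Y U) *: F p U).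
    by rewrite !scalerA; congr (_ *: _); ring.
  exact: (cvgZc (@cvg_cis_quot R (lam U)) (@cvg_cst _ _ _ _ _)).
- move=> t U t0; rewrite fE' rnormZ rnorm_cisZ rnormcM rnorm_real normfV.
  rewrite -mulrA ler_pdivrMl ?normr_gt0//.
  apply: (@le_trans _ _ (2 * `|t * lam U| * rnorm (F p U))).
    by rewrite ler_wpM2r ?rnorm_ge0// -cis0 -[t * lam U in leRHS]subr0 ler_cisB.
  rewrite normrM; move: (hC U) (normr_ge0 t); set r := rnorm (F p U) => h2 h.
  move: h2; set l := `|lam U|; set w := wt U => h2.
  have -> : 2 * (`|t| * l) * r = (2 * `|t|) * (l * r) by ring.
  have -> : `|t| * (2 * C * w) = (2 * `|t|) * (C * w) by ring.
  by rewrite ler_wpM2l ?mulr_ge0.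
Qed.

(** Twice the dimension in powers of decay makes the integral converge, and each of the l
    derivatives brings down a linear factor that costs one more. *)
Lemma Dc_FT P (c : R) k l (F : P -> Xi -> V) : c != 0 -> Dc k (m2 + l) F -> Dc l k (FT c F).
Proof.
move=> c0; elim: l F => [|l ih] F DF0.
  rewrite addn0 in DF0; split => //; split; last exact: FT_decay.
  by move=> p; apply: FT_cont; exact: Dc_bd DF0.
have DF1 : Dc k m2 F := Dc_le (leqnn k) (leq_addr _ _) DF0.
split.
  by split; [move=> p; apply: FT_cont; exact: Dc_bd DF1|exact: FT_decay].
move=> i; exists (FT c (fun p U => ((c * sf (delta_mx 0 i) U)%:C)%C *: ('i *: F p U))); split.
  move=> p; apply: FT_deriv; apply: bd_le (Dc_bd DF0).
  by rewrite addnS ltnS leq_addr.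
apply: ih; apply: (@Dc_lam R _ (fun U => c * sf (delta_mx 0 i) U) (`|c| * (sform_bound (Omega := Omega) * `|delta_mx 0 i : Xi|))).
- by move=> X Y; rewrite sformDr mulrDr.
- by move=> a X; rewrite sformZr mulrCA.
- by move=> X; rewrite normrM -!mulrA ler_wpM2l// sform_le.
- by apply: continuous_Rscale; exact: continuous_sform_r.
rewrite -addnS; apply: (Dc_scale (d := 0) (F := fun _ _ => 'i)) => //; exact: Dc_cst.
Qed.

End transform.
End fourier.

(** * The Bochner integral of a nonnegative real function *)

Section real_integrand.
Context {R : realType} d (T : measurableType d) (mu : {measure set T -> \bar R}).
Variable E : nat -> set T.
Hypotheses (mE : forall k, measurable (E k)) (fE : forall k, (mu (E k) < +oo)%E)
  (cE : forall x, exists K, forall k, (K <= k)%N -> E k x).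

Lemma integral_Re_step (S : step_fun mu R[i]^o) :
  (\int[mu]_x (complex.Re (step_eval S x : R[i]))%:E = (complex.Re (step_int S : R[i]))%:E)%E.
Proof.
have reS I (r : seq I) (f : I -> R) (v : I -> R[i]) :
    complex.Re (\sum_(i <- r) ((f i)%:C)%C * v i) = \sum_(i <- r) f i * complex.Re (v i).
  elim: r => [|i r ih]; first by rewrite !big_nil.
  rewrite !big_cons -ih; case: (v i) => a b; case: (\sum_(_ <- _) _) => a' b' /=.
  by rewrite mul0r subr0.
have iA i : mu.-integrable setT (EFin \o \1_(step_set (s := S) i)).
  apply/integrableP; split; first by apply/measurable_EFinP; exact: measurable_indic (step_measurable i).
  under eq_integral do rewrite /= ger0_norm//.
  by rewrite integral_indic ?setIT//; [exact: step_finite|exact: step_measurable].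
have -> : (fun x => (complex.Re (step_eval S x : R[i]))%:E) =
    (fun x => \sum_(i <- index_enum 'I_(step_size S)) ((complex.Re (step_val i : R[i]))%:E * (EFin \o \1_(step_set (s := S) i)) x))%E.
  apply/funext => x; rewrite /step_eval [X in complex.Re X](_ : _ = \sum_(i <- index_enum 'I_(step_size S)) ((\1_(step_set (s := S) i) x : R)%:C)%C * (step_val i : R[i]))//.
  by rewrite reS -sumEFin; apply: eq_bigr => i _; rewrite /= -EFinM mulrC.
rewrite integral_sum//; last by move=> i; exact: integrableZl.
rewrite /step_int [X in complex.Re X](_ : _ = \sum_(i <- index_enum 'I_(step_size S)) ((fine (mu (step_set i)))%:C)%C * (step_val i : R[i]))//.
rewrite reS -sumEFin; apply: eq_bigr => i _.
rewrite integralZl// integral_indic ?setIT//; last exact: step_measurable.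
rewrite EFinM fineK; first by rewrite muleC.
by rewrite ge0_fin_numE//; exact: step_finite.
Qed.

Lemma smeas_real_complex (f : T -> R) : measurable_fun setT f -> smeas (fun x => ((f x)%:C)%C : R[i]^o).
Proof.
(* The line is viewed as the space of row vectors of length 1, where continuous functions are
   already known to be approximable. *)
move=> mf; have mg : measurable_fun setT (fun x => \row_(j < 1) f x).
  by apply: measurable_rVP => i; under eq_fun do rewrite mxE.
have h : smeas (fun X : 'rV[R]_1 => ((X 0 0)%:C)%C : R[i]^o).
  by apply: continuous_smeas; apply: continuous_real_complex => X; exact: coord_continuous.
have := smeas_precomp h mg; congr smeas; apply/funext => x /=; by rewrite mxE.
Qed.

(** The Bochner integral commutes with taking real parts, hence is real; it is then identified
    through the real parts of the step functions and dominated convergence. *)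
Lemma bint_real (f : T -> R) : measurable_fun setT f -> (forall x, 0 <= f x) ->
  (\int[mu]_x (f x)%:E < +oo)%E ->
  bint mu (fun x => ((f x)%:C)%C : R[i]^o) = ((fine (\int[mu]_x (f x)%:E))%:C)%C.
Proof.
move=> mf f0 iff; pose F x : R[i]^o := ((f x)%:C)%C.
have rF x : rnorm (F x) = f x by rewrite rnorm_real ger0_norm.
have mF : smeas F := smeas_real_complex mf.
have gF : good mu F by split => //; rewrite /inorm; under eq_integral do rewrite rF.
have cR := @cplt_complex R.
have realF : bint mu F = ((complex.Re (bint mu F : R[i]))%:C)%C.
  have := @bint_bounded R _ T mu R[i]^o R[i]^o E mE fE cE cR cR (fun z : R[i]^o => ((complex.Re (z : R[i]))%:C)%C : R[i]^o) 1 _ _ _ F gF.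
  move=> <- //.
  - by move=> x y; rewrite -(rmorphD (real_complex R)); case: x y => [a b] [c e].
  - by move=> t [a b]; rewrite /GRing.scale/=; apply/eqP; rewrite eq_complex /= !mul0r !mulr0 !subr0 ?addr0 ?eqxx.
  - by move=> x; rewrite rnorm_real mul1r ler_Re_rnorm.
have [S [aS cS bS]] := good_approx mE fE cE gF.
have /cvg_complexP[h1 _] := bint_approx cR mF aS.
have iF : mu.-integrable setT (EFin \o (fun x => 2 * f x)).
  have -> : EFin \o (fun x => 2 * f x) = (fun x => 2%:E * (EFin \o f) x)%E by apply/funext => x; rewrite /= EFinM.
  apply: integrableZl => //; apply/integrableP; split; first exact/measurable_EFinP.
  by under eq_integral do rewrite /= ger0_norm//.
have [||||_ _ h2] := @dominated_convergence _ T R mu setT measurableT (fun k x => (complex.Re (step_eval (S k) x : R[i]))%:E)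
    (fun x => (f x)%:E) (EFin \o (fun x => 2 * f x)) _ _ _ iF _.
- by move=> k; apply/measurable_EFinP; exact: fval_measurable (fval_comp (fun z : R[i]^o => complex.Re (z : R[i])) (fval_step (S k))).
- exact/measurable_EFinP.
- apply: aeW => x _; have /cvg_complexP[h _] := cS x; by apply/fine_cvgP; split; [exact: nearW|exact: h].
- apply: aeW => x k _; rewrite lee_fin (le_trans (ler_Re_rnorm _))//.
  by rewrite (le_trans (bS k x))// rF.
have h3 : complex.Re (step_int (S k) : R[i]) @[k --> \oo] --> fine (\int[mu]_x (f x)%:E)%E.
  suff /fine_cvgP[_ h] : (complex.Re (step_int (S k) : R[i]))%:E @[k --> \oo] --> (fine (\int[mu]_x (f x)%:E))%:E by exact: h.
  rewrite fineK; last by rewrite ge0_fin_numE//; apply: integral_ge0 => x _; rewrite lee_fin.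
  by apply: cvg_trans h2; apply: near_eq_cvg; apply: nearW => k /=; rewrite integral_Re_step.
rewrite realF; congr (_%:C)%C.
by apply: (cvg_unique (@norm_hausdorff R R^o) h1 h3).
Qed.

End real_integrand.

(** * Stability of integrable decay *)

Section nice_more.
Context {R : realType} {m : nat}.
Local Notation Xi := 'rV[R]_m.

Lemma wt_le1 (X : Xi) : wt X <= 1.
Proof. by rewrite invf_le1 ?exprn_gt0 ?base_gt0// exprn_ege1// wt_base. Qed.

Lemma wt_affine (a : R) (Y : Xi) : a != 0 -> exists2 K : R, 0 <= K & forall X, wt (a *: X + Y) <= K * wt X.
Proof.
move=> a0; exists ((1 + `|Y|) ^+ (2 * m) * (1 + `|a|^-1) ^+ (2 * m)).
  by rewrite mulr_ge0 ?exprn_ge0 ?base_ge0// addr_ge0// invr_ge0.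
move=> X; have := wt_peetre (a *: X + Y) (- Y); rewrite addrK normrN => /le_trans; apply.
rewrite -mulrA ler_wpM2l ?exprn_ge0 ?base_ge0//.
have q0 : 0 <= 1 + `|a|^-1 by rewrite addr_ge0// invr_ge0.
rewrite /wt ler_pdivlMr ?exprn_gt0 ?base_gt0// mulrC ler_pdivrMr ?exprn_gt0 ?base_gt0//.
rewrite -exprMn lerXn2r ?nnegrE ?mulr_ge0 ?base_ge0//.
rewrite normrZ mulrDl mul1r mulrDr mulr1 mulKf ?normr_eq0//.
have key (x y q : R) : 0 <= y -> 0 <= q -> 1 + x <= 1 + y + (q + x) by lra.
by apply: key; rewrite ?mulr_ge0 ?invr_ge0.
Qed.

Lemma nice_affine (V : normedModType R[i]) (F : Xi -> V) a Y : a != 0 -> nice F -> nice (fun X => F (a *: X + Y)).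
Proof.
move=> a0 [cF [C bF]]; split; first by apply: (cts_comp _ cF); exact: continuous_affine.
have C0 : 0 <= C by have := le_trans (rnorm_ge0 _) (bF 0); rewrite pmulr_lge0// wt_gt0.
have [K K0 hK] := wt_affine Y a0; exists (C * K) => X.
by rewrite (le_trans (bF _))// -mulrA ler_wpM2l.
Qed.

Lemma nice_bounded (V : normedModType R[i]) (F : Xi -> V) : nice F -> exists2 C : R, 0 <= C & forall X, rnorm (F X) <= C.
Proof.
move=> [cF [C bF]]; have C0 : 0 <= C by have := le_trans (rnorm_ge0 _) (bF 0); rewrite pmulr_lge0// wt_gt0.
by exists C => // X; rewrite (le_trans (bF X))// ler_piMr// wt_le1.
Qed.

Lemma nice_mul (V : normedModType R[i]) (u : Xi -> R[i]^o) (F : Xi -> V) C : continuous u ->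
  (forall X, rnorm (u X) <= C) -> nice F -> nice (fun X => u X *: F X).
Proof.
move=> cu bu [cF [D bF]]; split; first exact: continuousZc.
have C0 : 0 <= C by exact: le_trans (rnorm_ge0 _) (bu 0).
exists (C * D) => X; rewrite rnormZ -mulrA; apply: ler_pM; rewrite ?rnorm_ge0//.
Qed.

End nice_more.

(** * Fourier inversion *)

Section inversion.
Context {R : realType} {n : nat} {Omega : 'M[R]_(2 * n)}.
Hypothesis hOmega : symplectic Omega.
Local Notation Xi := 'rV[R]_(2 * n).
Local Notation sf := (sform Omega).
Local Notation mu := (dX Omega).
Let hmu : haar mu := haar_dX Omega.
Let cR := @cplt_complex R.
Local Notation ft c G := (@FT R n Omega _ unit c (fun=> G) tt).
Implicit Types (X Y Z U : Xi).

Lemma bint_haarZr (V : normedModType R[i]) (cV : cplt V) (g : Xi -> R[i]^o) (v : V) : good mu g ->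
  bint mu (fun U => g U *: v) = bint mu g *: v.
Proof.
move=> gg.
apply: (@bint_bounded R _ _ mu R[i]^o V _ measurable_cball (cball_lty hmu) (@cball_cover R _)
  cR cV (fun z => z *: v) (rnorm v)) => //.
- by move=> x y; rewrite scalerDl.
- by move=> t x; rewrite scalerA.
- by move=> x; rewrite rnormZ mulrC.
Qed.

Section regularization.
Variables (phi gam ph gh : Xi -> R[i]^o).
Hypotheses (nphi : nice phi) (ngam : nice gam) (gam0 : gam 0 = 1) (nhat : nice gh)
  (phE : forall Y, ft (-1) phi Y = ph Y) (ghE : forall Y, ft (-1) gam Y = gh Y).

(** The usual regularization, with [gam] in place of a Gaussian: by Fubini the integral over Y
    produces the transform of [gam] at (V - U)/e, and the substitution U -> - e U + V absorbs the
    Jacobian. *)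
Lemma reg_swap (e : R) V : 0 < e ->
  bint mu (fun Y => cis (sf Y V) *: (gam (e *: Y) *: ph Y)) =
  bint mu (fun U => gh U *: phi (- e *: U + V)).
Proof.
move=> e0; have en0 : e != 0 by rewrite gt_eqF.
have nge : nice (fun Y => gam (e *: Y)).
  by have := nice_affine 0 en0 ngam; congr nice; apply/funext => Y; rewrite addr0.
pose F Y U : R[i]^o := cis (sf Y V) *: (gam (e *: Y) *: (cis (-1 * sf Y U) *: phi U)).
have nc Y : nice (fun U => cis (-1 * sf Y U) *: phi U) by exact: nice_cis.
have E1 Y : cis (sf Y V) *: (gam (e *: Y) *: ph Y) = bint mu (F Y).
  rewrite -phE /FT -(bint_haarZ cR _ (nice_good hmu (nc Y))) -bint_haarZ//.
  exact: (nice_good hmu (nice_scale (gam (e *: Y)) (nc Y))).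
under eq_fun do rewrite E1.
have [_ [C1 h1]] := nge; have [cphi [C2 h2]] := nphi.
rewrite (@fubini_nice R _ _ hmu _ F (C1 * C2) cR); first last.
- move=> Y U; rewrite /F rnorm_cisZ rnormZ rnorm_cisZ.
  rewrite [leRHS](_ : _ = (C1 * wt Y) * (C2 * wt U)); last by ring.
  by apply: ler_pM => //; exact: (rnorm_ge0 (_ : R[i]^o)).
- move=> U; apply: continuousZc; first by apply: cts_cis; exact: continuous_sform_l.
  apply: continuousZc; first exact: nge.1.
  apply: continuousZc; last exact: cst_continuous.
  by apply: cts_cis; apply: continuous_Rscale; exact: continuous_sform_l.
- by move=> Y; do 2 apply: cts_scale; exact: (nc Y).1.
pose s := ((`|e| ^+ (2 * n))^-1%:C)%C : R[i].
pose H U : R[i]^o := gh ((- e^-1) *: U + e^-1 *: V) *: phi U.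
have E2 U : bint mu (F ^~ U) = s *: H U.
  pose G Y' : R[i]^o := cis (-1 * sf (e^-1 *: (V - U)) Y') *: gam Y'.
  have nG : nice G by exact: nice_cis.
  have -> : F ^~ U = fun Y => phi U *: (G \o (fun Y => e *: Y + 0)) Y.
    apply/funext => Y; rewrite /F /G /= addr0 /GRing.scale/=.
    rewrite (_ : -1 * sf (e^-1 *: (V - U)) (e *: Y) = sf Y V + -1 * sf Y U) ?cisD; first by ring.
    by rewrite sformZl sformZr mulKf// sformBl (sformC hOmega V Y) (sformC hOmega U Y); ring.
  have gG := nice_good hmu nG.
  rewrite bint_haarZ//; last exact: good_affine.
  rewrite (bint_affine hmu 0 en0 cR gG) -/s /H.
  rewrite (_ : - e^-1 *: U + e^-1 *: V = e^-1 *: (V - U)); last by rewrite scalerBr scaleNr addrC.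
  by rewrite -ghE /FT -/G /GRing.scale/= mulrCA [phi U * _]mulrC.
under eq_fun do rewrite E2.
have nH : nice H.
  have ei : - e^-1 != 0 by rewrite oppr_eq0 invr_eq0.
  have [C C0 hC] := nice_bounded nhat.
  apply: (nice_mul (C := C)) => //; first exact: (nice_affine _ ei nhat).1.
rewrite bint_haarZ//; last exact: nice_good.
have em : - e != 0 by rewrite oppr_eq0.
rewrite /s -normrN -(bint_affine hmu V em cR (nice_good hmu nH)); congr bint.
apply/funext => U; rewrite /H /=; congr (gh _ *: _).
by rewrite scalerDr scalerA mulrNN mulVf// scale1r -addrA -scalerDl addNr scale0r addr0.
Qed.

Lemma reg_lim V :
  bint mu (fun Y => cis (sf Y V) *: (gam (k.+1%:R^-1 *: Y) *: ph Y)) @[k --> \oo] -->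
  bint mu (fun U => gh U *: phi V).
Proof.
have ek k : 0 < k.+1%:R^-1 :> R by rewrite invr_gt0.
under eq_fun do rewrite reg_swap//.
have [C C0 hC] := nice_bounded nphi; have [cg [D hD]] := nhat.
apply: (bint_dct measurable_cball (cball_lty hmu) (@cball_cover R _) cR _ _ _ (integrable_wt hmu (D * C))).
- move=> k; apply: continuous_smeas; apply: continuousZc; first exact: cg.
  by apply: (cts_comp _ nphi.1); exact: continuous_affine.
- by apply: continuous_smeas; apply: continuousZc; [exact: cg|exact: cst_continuous].
- move=> U; apply: cvgZc; first exact: cvg_cst.
  have h : (- k.+1%:R^-1 : R) *: U + V @[k --> \oo] --> (0 : R) *: U + V.
    apply: cvgD; last exact: cvg_cst.
    apply: cvgZr_tmp; rewrite -[X in _ --> X]oppr0; apply: cvgN; exact: cvg_harmonic.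
  rewrite scale0r add0r in h.
  exact: (continuous_cvg _ (nphi.1 V) h).
- move=> k U; rewrite rnormZ [leRHS](_ : _ = (D * wt U) * C); last by ring.
  by apply: ler_pM => //; exact: (rnorm_ge0 (_ : R[i]^o)).
Qed.

(** The regularized integrals of a zero transform vanish, while their limit is a nonzero multiple of
    the function. *)
Lemma fourier_inj : bint mu (gh) != 0 -> (forall Y, ph Y = 0) -> forall V, phi V = 0.
Proof.
move=> k0 h V; have := @reg_lim V.
under eq_fun do under eq_fun do rewrite h !scaler0.
rewrite (bint0 measurable_cball (cball_lty hmu) (@cball_cover R _) cR) => h2.
have : bint mu (fun U => gh U *: phi V) = 0 by apply: cvg_uniq h2 _; exact: cvg_cst.
rewrite (bint_haarZr cR); last exact: nice_good.
by move/eqP; rewrite scaler_eq0 (negbTE k0) => /eqP.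
Qed.

Lemma fourier_inversion V : nice (ph) ->
  bint mu (fun Y => cis (sf Y V) *: ph Y) = bint mu (gh) *: phi V.
Proof.
move=> np; rewrite -(bint_haarZr cR); last exact: nice_good.
apply: cvg_uniq _ (@reg_lim V).
have [C C0 hC] := nice_bounded ngam; have [cp [D hD]] := np.
have cc : continuous (fun Y => cis (sf Y V) : R[i]^o) by apply: cts_cis; exact: continuous_sform_l.
apply: (bint_dct measurable_cball (cball_lty hmu) (@cball_cover R _) cR _ _ _ (integrable_wt hmu (C * D))).
- move=> k; apply: continuous_smeas; apply: continuousZc; first exact: cc.
  apply: continuousZc; last exact: cp.
  by apply: (cts_comp _ ngam.1); apply: cts_scale; exact: cts_id.
- by apply: continuous_smeas; apply: continuousZc; [exact: cc|exact: cp].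
- move=> Y; apply: cvgZc; first exact: cvg_cst.
  rewrite -[X in _ --> X]scale1r -gam0; apply: cvgZc; last exact: cvg_cst.
  have h : (k.+1%:R^-1 : R) *: Y @[k --> \oo] --> (0 : Xi).
    rewrite -(scale0r Y); apply: cvgZr_tmp; exact: cvg_harmonic.
  exact: (continuous_cvg _ (ngam.1 0) h).
- move=> k Y; rewrite rnorm_cisZ rnormZ -mulrA.
  by apply: ler_pM => //; exact: (rnorm_ge0 (_ : R[i]^o)).
Qed.

End regularization.
End inversion.

Section decay_more.
Context {R : realType} {m : nat}.
Local Notation Xi := 'rV[R]_m.
Implicit Types X Y : Xi.

Lemma wtN X : wt (- X) = wt X. Proof. by rewrite /wt normrN. Qed.

Lemma wt_sub X Y : wt (X - Y) * wt Y <= wt X.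
Proof.
rewrite -(ler_pM2r (exprn_gt0 (2 * m) (base_gt0 Y))) -mulrA {2}/wt mulVf ?mulr1; last first.
  by rewrite gt_eqF// exprn_gt0// base_gt0.
by have := wt_peetre (X - Y) Y; rewrite subrK mulrC.
Qed.

Lemma wt_add X Y : wt (X + Y) * wt Y <= wt X.
Proof. by have := wt_sub X (- Y); rewrite opprK wtN. Qed.

Lemma bd_wt2 P (V : normedModType R[i]) (F : P -> Xi -> V) : bd (2 * m + 2 * m) F ->
  exists2 C : R, 0 <= C & forall p X, rnorm (F p X) <= C * (wt X * wt X).
Proof.
move=> [_ [C h]]; exists `|C| => // p X.
rewrite /wt -invfM -exprD ler_pdivlMr ?exprn_gt0 ?base_gt0// mulrC.
by rewrite (le_trans (h p X))// ler_norm.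
Qed.

Lemma Dc_translate P (V : normedModType R[i]) k d (F : P -> Xi -> V) Y : Dc k d F ->
  Dc k d (fun p X => F p (X + Y)).
Proof.
have B (G : P -> Xi -> V) : bd d G -> bd d (fun p X => G p (X + Y)).
  move=> [cG [C h]]; split => [p|]; first exact: continuous_translate.
  exists ((1 + `|Y|) ^+ d * C) => p X.
  apply: (@le_trans _ _ ((1 + `|Y|) ^+ d * ((1 + `|X + Y|) ^+ d * rnorm (G p (X + Y))))).
    rewrite mulrA ler_wpM2r ?rnorm_ge0// -exprMn lerXn2r ?nnegrE ?mulr_ge0 ?base_ge0//.
    by have := peetre (X + Y) (- Y); rewrite addrK normrN mulrC.
  by rewrite ler_wpM2l ?exprn_ge0 ?base_ge0.
elim: k F => [|k ih] F /= [bF hF]; split; try exact: B; try by [].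
move=> i; have [F' [dF DF]] := hF i; exists (fun p X => F' p (X + Y)); split; last exact: ih.
move=> p X; apply: cvg_near_eq (dF p (X + Y)); apply: nearW => t.
by rewrite /diff_quot addrAC.
Qed.

Lemma Dc_cis P k (lam : Xi -> R) : (forall X Y, lam (X + Y) = lam X + lam Y) ->
  (forall a X, lam (a *: X) = a * lam X) -> continuous lam ->
  Dc k 0 (fun (_ : P) X => cis (lam X) : R[i]^o).
Proof.
move=> lD lZ cl.
have B : bd 0 (fun (_ : P) X => cis (lam X) : R[i]^o).
  split; first by move=> _; exact: cts_cis.
  by exists 1 => _ X; rewrite expr0 mul1r rnorm_cis.
elim: k => [|k ih]; split; try exact: B; try by [].
move=> i; exists (fun (_ : P) X => ('i * ((lam (delta_mx 0 i))%:C)%C : R[i]^o) *: (cis (lam X) : R[i]^o)); split.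
  move=> _ X; have h := cvgZc (@cvg_cis_quot R (lam (delta_mx 0 i))) (@cvg_cst _ (cis (lam X) : R[i]^o) _ ((0 : R)^') _).
  apply: (cvg_near_eq _ (h _ _)); apply: nearW => t.
  by rewrite /diff_quot lD lZ cisD /GRing.scale/= -mulrA mulrBl mul1r [cis (lam X) * _]mulrC.
exact: (Dc_scale (d := 0) (e := 0) (Dc_cst P k ('i * ((lam (delta_mx 0 i))%:C)%C : R[i]^o)) ih).
Qed.

(* Schwartz functions, with the derivatives existentially quantified. *)
Definition sch (V : normedModType R[i]) (F : Xi -> V) := forall k d, Dc k d (fun _ : unit => F).

Lemma schwartz_sch (V : normedModType R[i]) (F : Xi -> V) : schwartz F -> sch F.
Proof. by move=> sF k d; exact: Dc_schwartz. Qed.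

Lemma sch_nice (V : normedModType R[i]) (F : Xi -> V) : sch F -> nice F.
Proof. by move=> sF; have /Dc_bd bF := sF 0%N (2 * m)%N; split; [exact: bF.1 tt|have [C h] := bd_wt bF; exists C; exact: h tt]. Qed.

Lemma sch_wt2 (V : normedModType R[i]) (F : Xi -> V) : sch F ->
  exists2 C : R, 0 <= C & forall X, rnorm (F X) <= C * (wt X * wt X).
Proof. by move=> sF; have [C C0 h] := bd_wt2 (Dc_bd (sF 0%N _)); exists C => // X; exact: h tt X. Qed.

End decay_more.

(** * The window and its Fourier transform *)

Section window.
Context {R : realType} {n : nat} {Omega : 'M[R]_(2 * n)}.
Hypothesis hOmega : symplectic Omega.
Local Notation Xi := 'rV[R]_(2 * n).
Local Notation sf := (sform Omega).
Local Notation mu := (dX Omega).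
Let hmu : haar mu := haar_dX Omega.
Let cR := @cplt_complex R.
Local Notation ft c G := (@FT R n Omega _ unit c (fun=> G) tt).
Implicit Types (X Y Z U : Xi).

Lemma sch_FT (V : normedModType R[i]) (cV : cplt V) c (F : Xi -> V) : c != 0 -> sch F -> sch (ft c F).
Proof.
move=> c0 sF k d.
have := Dc_FT (Omega := Omega) hOmega cV (P := unit) (k := d) (l := k) c0 (sF d (2 * (2 * n) + k)%N).
by congr Dc; apply/funext => -[].
Qed.

Variable h : Xi -> R[i]^o.
Hypothesis hw : is_window Omega h.
Let sh : sch h. Proof. by case: hw => /schwartz_sch. Qed.

Lemma bint_conj (F : Xi -> R[i]^o) : good mu F -> bint mu (fun X => (F X)^* : R[i]^o) = (bint mu F)^*.
Proof.
move=> gF.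
apply: (@bint_bounded R _ _ mu R[i]^o R[i]^o _ measurable_cball (cball_lty hmu) (@cball_cover R _)
  cR cR (fun z => z^* : R[i]^o) 1) => //.
- by move=> x y; rewrite rmorphD.
- by move=> t x; rewrite /GRing.scale/= rmorphM/= conj_Creal ?complex_real.
- by move=> x; rewrite rnorm_conj mul1r.
Qed.

(** The integral over Z is the transform of the window at 2Y. Consequently h # h would vanish if
    that transform vanished almost everywhere. *)
Lemma sharp_ft X : sharp Omega h h X = 2 ^+ (2 * n) *:
  bint mu (fun Y => (h (X - Y) * cis (2 * sf Y X)) *: ft (-1) h (2 *: Y + 0)).
Proof.
rewrite /sharp; congr (_ *: bint _ _); apply/funext => Y.
pose G W : R[i]^o := (h (X - Y) * cis (2 * sf Y X)) *: (cis (-1 * sf (2 *: Y + 0) W) *: h W).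
have nc : nice (fun W => cis (-1 * sf (2 *: Y + 0) W) *: h W) by apply: nice_cis; exact: sch_nice.
have gG : good mu G by exact: (nice_good hmu (nice_scale _ nc)).
have n1 : (-1 : R) != 0 by rewrite oppr_eq0 oner_eq0.
have -> : (fun Z => cis (2 * sf Y Z) *: (h (X - Y) * h (X - Z) : R[i]^o)) = G \o (fun Z => -1 *: Z + X).
  apply/funext => Z; rewrite /G /= scaleN1r addr0 [- Z + X]addrC.
  rewrite (_ : 2 * sf Y Z = 2 * sf Y X + -1 * sf (2 *: Y) (X - Z)); last first.
    by rewrite sformZl sformBr; ring.
  by rewrite cisD /GRing.scale/=; ring.
rewrite (bint_affine hmu X n1 cR gG) normrN1 expr1n invr1 scale1r /G.
by rewrite bint_haarZ//; exact: nice_good.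
Qed.

Let hh := ft (-1) h.
Let sN1 : (-1 : R) != 0. Proof. by rewrite oppr_eq0 oner_eq0. Qed.

Lemma window_hat_sch : sch (ft (-1) h).
Proof. exact: sch_FT. Qed.

Lemma window_hat_ae : ~ {ae mu, forall Y, ft (-1) h Y = 0}.
Proof.
move=> h0; case: hw => _ hs _ hn; apply: hn; apply/funext => X; rewrite -hs sharp_ft.
have t0 : (2 : R) != 0 by rewrite pnatr_eq0.
rewrite (bint_ae (G := fun=> 0)).
  by rewrite (bint0 measurable_cball (cball_lty hmu) (@cball_cover R _) cR) scaler0.
have := ae_affine hmu 0 t0 h0; apply: filterS => Y ->.
by rewrite scaler0.
Qed.

(** The window itself serves as regularizer, once translated to a point [U0] where it does not
    vanish and divided by its value there. *)
Lemma window_fourier : exists k0 : R[i], [/\ k0 != 0,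
  forall V, bint mu (fun Y => cis (sf Y V) *: ft (-1) h Y) = k0 * h V &
  forall phi : Xi -> R[i]^o, nice phi -> (forall Y, ft (-1) phi Y = 0) -> forall V, phi V = 0].
Proof.
have nh := sch_nice sh; have nhh := sch_nice window_hat_sch.
have [U0 hU0] : exists U0, h U0 != 0.
  apply: contrapT => H; case: hw => _ _ _; apply; apply/funext => X; apply: contrapT => hX.
  by apply: H; exists X; apply/eqP.
pose c0 : R[i] := (h U0)^-1.
pose gam X : R[i]^o := c0 *: h (X + U0).
pose gh Y : R[i]^o := c0 *: (cis (sf Y U0) *: ft (-1) h Y).
have ngam : nice gam.
  apply: nice_scale; have := nice_affine U0 (oner_neq0 R) nh.
  by congr nice; apply/funext => X; rewrite scale1r.
have gam0 : gam 0 = 1 by rewrite /gam add0r /GRing.scale/= mulVf.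
have ngh : nice gh.
  apply: nice_scale; apply: (nice_mul (C := 1)) nhh.
    by apply: cts_cis; exact: continuous_sform_l.
  by move=> X; rewrite rnorm_cis.
have ghE Y : ft (-1) gam Y = gh Y.
  pose G X : R[i]^o := c0 *: (cis (sf Y U0) *: (cis (-1 * sf Y X) *: h X)).
  have nc : nice (fun X => cis (-1 * sf Y X) *: h X) by exact: nice_cis.
  have nc2 := nice_scale (cis (sf Y U0)) nc.
  have E : bint mu G = gh Y.
    by rewrite /G (bint_haarZ cR _ (nice_good hmu nc2)) (bint_haarZ cR _ (nice_good hmu nc)).
  rewrite -E -(bint_haar_translate cR U0 (nice_good hmu (nice_scale c0 nc2))); congr bint.
  apply/funext => U; rewrite /gam /GRing.scale/= sformDr mulrDr cisD.
  have : cis (sf Y U0) * cis (-1 * sf Y U0) = 1 by rewrite -cisD mulN1r subrr cis0.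
  move: (cis (sf Y U0)) (cis (-1 * sf Y U0)) => a b ab.
  by rewrite -[LHS]mul1r -ab; ring.
have inv V : bint mu (fun Y => cis (sf Y V) *: ft (-1) h Y) = bint mu gh *: h V.
  exact: (fourier_inversion hOmega nh ngam gam0 ngh (fun=> erefl) ghE).
(* By Fubini and inversion the integral of |h^|^2 is the constant times the integral of h^2. Reality
   of h enters in [E1]: it makes the conjugate of h^ an inverse transform of h. *)
have kn : bint mu gh != 0.
  apply/eqP => k0.
  pose q Y : R := rnorm (ft (-1) h Y) ^+ 2.
  have q0 Y : 0 <= q Y by rewrite exprn_ge0// rnorm_ge0.
  have E1 Y : ((q Y)%:C)%C = ft (-1) h Y *: bint mu (fun U => cis (sf Y U) *: h U : R[i]^o) :> R[i]^o.
    have -> : bint mu (fun U => cis (sf Y U) *: h U : R[i]^o) = (ft (-1) h Y)^*.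
      have nc := nice_cis (Omega := Omega) (-1) Y nh.
      rewrite /FT -(bint_conj (nice_good hmu nc)).
      congr bint; apply/funext => U; rewrite /GRing.scale/= rmorphM/= -cisN mulN1r opprK.
      by case: hw => _ _ ->.
    rewrite /q; move: (ft (-1) h Y) => z.
    rewrite [RHS](_ : _ = `|z : R[i]| ^+ 2); last by rewrite normCK.
    by rewrite (normr_rnorm (z : R[i]^o)) -rmorphXn.
  have nE Y : nice (fun U => cis (sf Y U) *: h U).
    by have := nice_cis (Omega := Omega) 1 Y nh; congr nice; apply/funext => U; rewrite mul1r.
  have Z0 : bint mu (fun Y => ((q Y)%:C)%C : R[i]^o) = 0.
    under eq_fun do rewrite E1 -(bint_haarZ cR _ (nice_good hmu (nE _))).
    have [ch [C1 hC1]] := nh; have [chh [C2 hC2]] := nhh.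
    rewrite (@fubini_nice R _ _ hmu _ (fun Y U => ft (-1) h Y *: (cis (sf Y U) *: h U)) (C2 * C1) cR).
    - rewrite -[RHS](bint0 measurable_cball (cball_lty hmu) (@cball_cover R _) cR); congr bint; apply/funext => U.
      have nf : nice (fun Y => cis (sf Y U) *: ft (-1) h Y).
        apply: (nice_mul (C := 1)) nhh; last by move=> X; rewrite rnorm_cis.
        by apply: cts_cis; exact: continuous_sform_l.
      have -> : (fun Y => ft (-1) h Y *: (cis (sf Y U) *: h U)) = (fun Y => h U *: (cis (sf Y U) *: ft (-1) h Y)).
        by apply/funext => Y; rewrite /GRing.scale/= mulrC -mulrA mulrCA.
      by rewrite (bint_haarZ cR _ (nice_good hmu nf)) inv k0 scale0r scaler0.
    - by move=> Y; apply: cts_scale; exact: (nE Y).1.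
    - move=> U; apply: continuousZc; first exact: chh.
      apply: continuousZc; last exact: cst_continuous.
      by apply: cts_cis; exact: continuous_sform_l.
    - move=> Y U; rewrite rnormZ rnorm_cisZ [leRHS](_ : _ = (C2 * wt Y) * (C1 * wt U)); last by ring.
      by apply: ler_pM; rewrite ?rnorm_ge0//; exact: (rnorm_ge0 (_ : R[i]^o)).
  have mq : measurable_fun setT q.
    by apply: measurable_funX; exact: (smeas_rnorm (continuous_smeas nhh.1)).
  have fq : (\int[mu]_X (q X)%:E < +oo)%E.
    have [C C0 hC] := nice_bounded nhh; have [_ [D hD]] := nhh.
    have /integrableP[_] := integrable_wt hmu (C * D).
    apply: le_lt_trans; apply: lint_le => X; rewrite ?lee_fin//=.
    rewrite (le_trans _ (ler_norm _))// /q expr2 -mulrA.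
    by apply: ler_pM; rewrite ?rnorm_ge0.
  have := bint_real measurable_cball (cball_lty hmu) (@cball_cover R _) mq q0 fq.
  rewrite Z0 => /esym/(congr1 (fun z : R[i] => complex.Re z)) /= /eqP.
  rewrite fine_eq0; last by rewrite ge0_fin_numE//; apply: integral_ge0 => X _; rewrite lee_fin.
  move=> /eqP iq0; apply: window_hat_ae.
  have : (\int[mu]_X `|(q X)%:E| = 0)%E.
    by rewrite -iq0; apply: eq_integral => X _; rewrite gee0_abs// lee_fin.
  move/(ae_eq_integral_abs mu measurableT) => /(_ (proj2 (measurable_EFinP _ _) mq)).
  apply: filterS => Y /(_ I) /= [] /eqP; rewrite sqrf_eq0 rnorm_eq0 => /eqP; exact.
exists (bint mu gh); split => //.
move=> phi np p0.
by apply: (fourier_inj hOmega (phi := phi) (gam := gam) (ph := fun=> 0) (gh := gh)).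
Qed.

Lemma window_hat_neq0 : exists Y, ft (-1) h Y != 0.
Proof.
apply: contrapT => H; apply: window_hat_ae; apply: aeW => Y; apply: contrapT => hY.
by apply: H; exists Y; apply/eqP.
Qed.

End window.

(** * The Rieffel product and the modulation map *)

Lemma Dc_reparam (R : realType) m (V : normedModType R[i]) P Q (phi : Q -> P) k d
    (F : P -> 'rV[R]_m -> V) : Dc k d F -> Dc k d (fun q => F (phi q)).
Proof.
have B (G : P -> 'rV[R]_m -> V) : bd d G -> bd d (fun q => G (phi q)).
  by move=> [cG [C h]]; split => [q|]; [exact: cG|exists C => q; exact: h].
elim: k F => [|k ih] F /= [bF hF]; split; try exact: B; try by [].
by move=> i; have [F' [dF DF]] := hF i; exists (fun q => F' (phi q)); split; [move=> q; exact: dF|exact: ih].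
Qed.

Section rieffel_identity.
Context {R : realType} {n : nat} {Omega : 'M[R]_(2 * n)}.
Hypothesis hOmega : symplectic Omega.
Local Notation Xi := 'rV[R]_(2 * n).
Local Notation sf := (sform Omega).
Local Notation mu := (dX Omega).
Local Notation ka := (kappa Omega).
Let hmu : haar mu := haar_dX Omega.
Let cR := @cplt_complex R.
Local Notation ft c G := (@FT R n Omega _ unit c (fun=> G) tt).
Context {A : cstarAlgebra R} {Theta : Xi -> A -> A}.
Hypothesis hTheta : is_action Theta.
Let cA : cplt A := @cplt_complete R A.
Implicit Types (X Y Z U W S : Xi) (a b f g : A).

Lemma act_lin X : linear (Theta X). Proof. by case: hTheta => /(_ X)[]. Qed.

Lemma act_mul X a b : Theta X (cmul a b) = cmul (Theta X a) (Theta X b).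
Proof. by case: hTheta => /(_ X)[]. Qed.

Lemma act_star X a : Theta X (cstar a) = cstar (Theta X a).
Proof. by case: hTheta => /(_ X)[]. Qed.

Lemma act0 a : Theta 0 a = a. Proof. by case: hTheta. Qed.

Lemma actD X Y a : Theta (X + Y) a = Theta X (Theta Y a). Proof. by case: hTheta. Qed.

Lemma act_cont a : continuous (Theta ^~ a). Proof. by case: hTheta. Qed.

Lemma rnorm_act X a : rnorm (Theta X a) = rnorm a.
Proof.
apply/le_anti; case: hTheta => hm _ _ _; rewrite (morphism_contractive (hm X))/=.
by rewrite -{1}[a]act0 -(addNr X) actD (morphism_contractive (hm _)).
Qed.

Lemma act_cont2 (T : topologicalType) (u : T -> Xi) (g : T -> A) : continuous u -> continuous g ->
  continuous (fun t => Theta (u t) (g t)).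
Proof.
move=> cu cg t0.
have h1 : rnorm (g t - g t0) @[t --> t0] --> (0 : R) by apply/cvg_rnorm0P; exact: cg.
have h2 : rnorm (Theta (u t) (g t0) - Theta (u t0) (g t0)) @[t --> t0] --> (0 : R).
  by apply/cvg_rnorm0P; exact: (cts_comp cu (@act_cont (g t0))).
apply: (cvg_squeeze_rnorm (g := fun t => rnorm (g t - g t0) + rnorm (Theta (u t) (g t0) - Theta (u t0) (g t0)))).
  move=> t; rewrite -(subrKA (Theta (u t) (g t0))) -(linB (act_lin _)).
  by rewrite (le_trans (rnormD _ _))// rnorm_act.
by rewrite -[X in _ --> X]addr0; exact: cvgD.
Qed.

Lemma cts_cmul (T : topologicalType) (F G : T -> A) : continuous F -> continuous G ->
  continuous (fun t => cmul (F t) (G t)).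
Proof. by move=> cF cG t; exact: (cvg_cmul (cF t) (cG t)). Qed.

Lemma cts_cstar (T : topologicalType) (F : T -> A) : continuous F -> continuous (fun t => cstar (F t)).
Proof. by move=> cF t; exact: (cvg_cstar (cF t)). Qed.

(** The derivatives of an orbit are orbits of their values at 0; since the action is isometric they
    are bounded. *)
Lemma pderivs_act f s X : smooth_vector Theta f ->
  pderivs s (Theta ^~ f) X = Theta X (pderivs s (Theta ^~ f) 0).
Proof.
move=> [c1 c2]; elim: s X => [|i s ih] X /=; first by rewrite act0.
have h0 := c2 s i 0; have hX := c2 s i X.
apply: (cvg_uniq hX).
have h : Theta X (diff_quot i (pderivs s (Theta ^~ f)) 0 t) @[t --> (0 : R)^'] --> Theta X (pderiv i (pderivs s (Theta ^~ f)) 0).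
  have cX : continuous (Theta X) by apply: (act_cont2 (u := fun=> X)); [exact: cst_continuous|exact: cts_id].
  exact: (continuous_cvg _ (cX _) h0).
apply: cvg_near_eq h; apply: nearW => t.
rewrite /diff_quot (linZ (act_lin X)) (linB (act_lin X)) add0r; congr (_ *: (_ - _)).
  by rewrite [in RHS]ih [in LHS]ih actD.
by rewrite -ih.
Qed.

(** The base point p of the orbit is the parameter: all bounds are uniform in it, which is used when
    p is the variable of L_f G. *)
Lemma Dc_act k f : smooth_vector Theta f -> Dc k 0 (fun p Y => Theta (p + Y) f).
Proof.
move=> sf_; suff H s : Dc k 0 (fun p Y => pderivs s (Theta ^~ f) (p + Y)) by exact: (H [::]).
have [c1 c2] := sf_.
have B s' : bd 0 (fun p Y => pderivs s' (Theta ^~ f) (p + Y)).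
  split; last by exists (rnorm (pderivs s' (Theta ^~ f) 0)) => p X; rewrite expr0 mul1r pderivs_act// rnorm_act.
  move=> p; apply: (cts_comp _ (c1 s')); apply: cts_add; [exact: cst_continuous|exact: cts_id].
elim: k s => [|k ih] s; split; try exact: B; try by [].
move=> i; exists (fun p Y => pderivs (i :: s) (Theta ^~ f) (p + Y)); split; last exact: ih.
move=> p X; apply: cvg_near_eq (c2 s i (p + X)); apply: nearW => t.
by rewrite /diff_quot addrA.
Qed.

Lemma bint_cmull a (G : Xi -> A) : good mu G -> bint mu (fun X => cmul a (G X)) = cmul a (bint mu G).
Proof.
move=> gG; apply: (@bint_bounded R _ _ mu A A _ measurable_cball (cball_lty hmu) (@cball_cover R _)
  cA cA (cmul a) (rnorm a)) => //.
- exact: cmulDr.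
- by move=> t x; rewrite cmulZr.
- by move=> x; exact: rnormM_le.
Qed.

Lemma nice_bint (V : normedModType R[i]) (F : Xi -> Xi -> V) (C : R) : cplt V ->
  (forall X, continuous (F X)) -> (forall Y, continuous (F ^~ Y)) ->
  (forall X Y, rnorm (F X Y) <= C * (wt X * wt Y)) -> nice (fun X => bint mu (F X)).
Proof.
move=> cV c1 c2 bF.
have C0 : 0 <= C by have := le_trans (rnorm_ge0 _) (bF 0 0); rewrite pmulr_lge0// mulr_gt0// wt_gt0.
split.
  apply: (@bint_continuous R _ _ hmu V _ F C) => // X Y.
  by rewrite (le_trans (bF _ _))// ler_wpM2l// ler_piMl ?wt_le1// ltW// wt_gt0.
exists (C * fine (\int[mu]_X (wt X)%:E)) => X; rewrite mulrAC; apply: (bint_bound hmu cV).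
  exact: continuous_smeas.
by move=> Y; rewrite -mulrA.
Qed.

Lemma cts_compG (T : topologicalType) (V : normedModType R[i]) (u : T -> Xi) (F : Xi -> V) :
  continuous F -> continuous u -> continuous (fun t => F (u t)).
Proof. by move=> cF cu; exact: (cts_comp cu cF). Qed.

Lemma cts_addl Z : continuous (fun Y : Xi => Z + Y).
Proof. by apply: cts_add; [exact: cst_continuous|exact: cts_id]. Qed.

Lemma cts_scalel (a : R) : continuous (fun Y : Xi => a *: Y).
Proof. by apply: cts_scale; exact: cts_id. Qed.

Lemma cts_cisf (T : topologicalType) (u v : T -> Xi) : continuous u -> continuous v ->
  continuous (fun t => cis (sf (u t) (v t)) : R[i]^o).
Proof. by move=> cu cv; apply: cts_cis; exact: continuous_sform2. Qed.

Let s2 : (2 : R) != 0. Proof. by rewrite pnatr_eq0. Qed.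
Let s2V : (2^-1 : R) != 0. Proof. by rewrite invr_eq0 pnatr_eq0. Qed.
Local Notation c4 := (2 ^+ (2 * n) : R[i]).
Local Notation half X := (2^-1 *: X).

Lemma half_split X : X = half X + half X.
Proof. by rewrite -scalerDl (_ : 2^-1 + 2^-1 = 1 :> R) ?scale1r//; field. Qed.

Section pointwise.
Variables (f : A) (h hh : Xi -> R[i]^o) (G G2 M L : Xi -> A) (k0 : R[i]).
Hypotheses (nh : nice h) (shh : sch hh) (sG : sch G) (nG2 : nice G2) (cM : continuous M) (cL : continuous L)
  (hhE : forall V, bint mu (fun Y => cis (sf Y V) *: hh Y) = k0 * h V)
  (G2E : forall S, G2 S = bint mu (fun U => cis (2 * sf S U) *: G U))
  (ME : forall Y, M Y = bint mu (fun U => (cis (- sf Y U) * h U) *: Theta U f))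
  (LE : forall X, L X = c4 *: bint mu (fun S => cis (2 * sf X S) *: cmul (Theta (X + S) f) (G2 S))).

Variable Z : Xi.
(** [LF] and [RF] are the integrands, in Y and W, of the two sides of the identity, W being the
    point at which f is translated. Integrated over Y they are proportional: [Kf] is the common
    factor, and [JF] unfolds [RF] by one more integral. *)
Let LF Y W := cis (sf Y (half Z - W)) *: (h (W - Z - half Y) *: cmul (Theta W f) (G (half (Z + Y)))).
Let Kf W := bint mu (fun U => cis (sf Z W) *: (cis (sf (2 *: W - Z) U) *: (h (W - U - half Z) *: G U))).
Let RF Y W := c4 *: (cis (sf Y (W - half Z)) *: (cis (sf Z W) *: (hh Y *: cmul (Theta W f) (G2 (W - half (Z + Y)))))).
Let JF W Y U := cis (sf Y (W - U - half Z)) *: (hh Y *: (cis (sf Z W) *: (cis (sf (2 *: W - Z) U) *: G U))).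

Ltac ct := lazymatch goal with
  | |- continuous (fun x => x) => exact: cts_id
  | |- continuous (fun _ => ?c) => exact: cst_continuous
  | |- continuous (fun x => cis (sform _ (@?u x) (@?v x))) => apply: (@cts_cisf _ u v); ct
  | |- continuous (fun x => @cmul _ _ (@?u x) (@?v x)) => apply: (@cts_cmul _ u v); ct
  | |- continuous (fun x => Theta (@?u x) (@?v x)) => apply: (@act_cont2 _ u v); ct
  | |- continuous (fun x => @GRing.add _ (@?u x) (@GRing.opp _ (@?v x))) => apply: (cts_sub (f := u) (g := v)); ct
  | |- continuous (fun x => @GRing.add _ (@?u x) (@?v x)) => apply: (cts_add (f := u) (g := v)); ct
  | |- continuous (fun x => @GRing.scale _ _ (@?a x) (@?v x)) =>
      first [apply: (continuousZc (u := a) (G := v)) | apply: cts_scale]; ct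
  | |- continuous (@GRing.add _ ?a) => exact: cts_addl
  | |- continuous (@GRing.scale _ _ ?a) => exact: cts_scalel
  | |- continuous (Theta ?a) => apply: (@act_cont2 _ (fun=> a) (fun x => x)); ct
  | |- continuous (@cmul _ _ ?a) => apply: (@cts_cmul _ (fun=> a) (fun x => x)); ct
  | |- continuous h => exact: nh.1
  | |- continuous hh => exact: (sch_nice shh).1
  | |- continuous G => exact: (sch_nice sG).1
  | |- continuous G2 => exact: nG2.1
  | |- continuous (fun x => h (@?u x)) => apply: (@cts_compG _ _ u h nh.1); ct
  | |- continuous (fun x => hh (@?u x)) => apply: (@cts_compG _ _ u hh (sch_nice shh).1); ct
  | |- continuous (fun x => G (@?u x)) => apply: (@cts_compG _ _ u G (sch_nice sG).1); ct
  | |- continuous (fun x => G2 (@?u x)) => apply: (@cts_compG _ _ u G2 nG2.1); ct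
  end.

Let c4E : (((`|2| ^+ (2 * n))^-1%:C)%C : R[i]) = c4^-1.
Proof. by rewrite ger0_norm// fmorphV rmorphXn rmorph_nat. Qed.

Let c40 : c4 != 0. Proof. by rewrite expf_neq0// pnatr_eq0. Qed.

Lemma LF_int Y : ka Y Z *: cmul (Theta (Z + half Y) (M Y)) (G (half (Z + Y))) = bint mu (LF Y).
Proof.
set g := G _; pose V := Z + half Y.
pose P U := (cis (- sf Y U) * h U) *: Theta U f.
have nP : nice P.
  have [ch [C hC]] := nh.
  have n1 : nice (fun U => h U *: Theta U f).
    split; first by ct.
    by exists (C * rnorm f) => U; rewrite rnormZ rnorm_act mulrAC ler_wpM2r ?rnorm_ge0.
  have := nice_cis (Omega := Omega) (-1) Y n1; congr nice.
  by apply/funext => U; rewrite /P scalerA mulN1r.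
pose La a := ka Y Z *: cmul (Theta V a) g.
have -> : ka Y Z *: cmul (Theta (Z + half Y) (M Y)) g = La (bint mu P) by rewrite ME.
have gP := nice_good hmu nP.
have LaD a b : La (a + b) = La a + La b by rewrite /La (linD (act_lin V)) cmulDl scalerDr.
have LaZ (t : R) a : La ((t%:C)%C *: a) = (t%:C)%C *: La a.
  by rewrite /La (linZ (act_lin V)) cmulZl !scalerA mulrC.
have Lab a : rnorm (La a) <= rnorm g * rnorm a.
  by rewrite /La rnormZ rnorm_cis mul1r (le_trans (rnormM_le _ _))// rnorm_act mulrC.
have mB := @measurable_cball R (2 * n).
rewrite -(bint_bounded mB (cball_lty hmu) (@cball_cover R _) cA cA LaD LaZ Lab gP).
have gL := good_bounded LaD LaZ Lab gP.
rewrite -(bint_haar_translate cA (- V) gL); congr bint; apply/funext => W.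
rewrite /= /La /P (linZ (act_lin V)) -actD addrCA subrr addr0 cmulZl /LF scalerA mulrA -scalerA.
rewrite -cisD; congr (cis _ *: (h _ *: _)); last by rewrite /V opprD addrA.
by rewrite /V !sformBr sformDr !sformZr (sformXX hOmega); field.
Qed.

(** The substitution Y = 2U - Z turns G((Z + Y)/2) into G(U); its Jacobian is exactly the factor
    2^{2n} of the Rieffel product. *)
Lemma LF_marg W : bint mu (LF ^~ W) = c4 *: cmul (Theta W f) (Kf W).
Proof.
have [C C0 hC] := nice_bounded nh.
have nG := sch_nice sG.
have nL : nice (LF ^~ W).
  have [_ [D hD]] := nice_affine (half Z) s2V nG.
  split; first by rewrite /LF; ct.
  exists (C * (rnorm f * D)) => Y; rewrite /LF rnorm_cisZ rnormZ -!mulrA; apply: ler_pM => //.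
  - exact: (rnorm_ge0 (_ : R[i]^o)).
  - exact: rnorm_ge0.
  rewrite (le_trans (rnormM_le _ _))// rnorm_act ler_wpM2l ?rnorm_ge0//.
  by rewrite scalerDr addrC.
have E := bint_affine hmu (- Z) s2 cA (nice_good hmu nL).
transitivity (c4 *: bint mu (LF ^~ W \o (fun X => 2 *: X - Z))).
  by rewrite E c4E scalerA (mulfV c40) scale1r.
congr (_ *: _).
rewrite /Kf -bint_cmull; last first.
  apply: (nice_good hmu); split; first by ct.
  have [_ [D hD]] := nG; exists (C * D) => U; rewrite !rnorm_cisZ rnormZ -mulrA.
  by apply: ler_pM; rewrite ?rnorm_ge0//; exact: (rnorm_ge0 (_ : R[i]^o)).
congr bint; apply/funext => U; rewrite /LF /=.
rewrite (_ : half (Z + (2 *: U - Z)) = U); last by rewrite addrCA subrr addr0 scalerA mulVf// scale1r.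
rewrite (_ : W - Z - half (2 *: U - Z) = W - U - half Z); last first.
  rewrite scalerBr scalerA mulVf// scale1r opprB {1}(half_split Z) opprD.
  by rewrite -!addrA addKr [- half Z + _]addrC.
rewrite !cmulZr [RHS]scalerA -cisD; congr (cis _ *: _).
rewrite !(sformBl, sformBr, sformNl, sformNr, sformZl, sformZr) (sformXX hOmega) (sformC hOmega W U) (sformC hOmega U Z).
by field.
Qed.

Lemma RF_int Y : (hh Y * ka Y Z) *: L (half (Z + Y)) = bint mu (RF Y).
Proof.
have [cG2 [C hC]] := nG2.
rewrite LE; set V := half (Z + Y).
pose P S := cis (2 * sf V S) *: cmul (Theta (V + S) f) (G2 S).
have nP : nice P.
  split; last first.
    exists (rnorm f * C) => S; rewrite /P rnorm_cisZ (le_trans (rnormM_le _ _))// rnorm_act -mulrA.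
    by rewrite ler_wpM2l ?rnorm_ge0.
  rewrite /P; apply: continuousZc; first by apply: cts_cis; apply: continuous_Rscale; exact: continuous_sform_r.
  by ct.
rewrite -/P [_ *: (c4 *: _)]scalerA mulrC -scalerA -(bint_haarZ cA _ (nice_good hmu nP)).
have nP2 := nice_scale (hh Y * ka Y Z) nP.
rewrite -(bint_haarZ cA _ (nice_good hmu nP2)) -(bint_haar_translate cA (- V) (nice_good hmu (nice_scale c4 nP2))).
congr bint; apply/funext => W; rewrite /RF /P; congr (_ *: _).
rewrite addrCA subrr addr0 [LHS]scalerA !scalerA; congr (_ *: cmul _ (G2 (_ - _))).
rewrite [LHS](_ : _ = hh Y * (ka Y Z * cis (2 * sf V (W - V)))); last by ring.
rewrite [RHS](_ : _ = hh Y * (cis (sf Y (W - half Z)) * cis (sf Z W))); last by ring.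
rewrite /kappa -!cisD; congr (_ * cis _).
rewrite /V !(sformBr, sformDl, sformDr, sformNl, sformNr, sformZl, sformZr).
have := sformXX hOmega Z; have := sformXX hOmega Y; have := sformC hOmega Z Y; lra.
Qed.

(** After the transform of G is unfolded and the order of Y and U exchanged, the integral over Y is
    an inversion formula and returns k0 h(W - U - Z/2). *)
Lemma RF_marg W : bint mu (RF ^~ W) = (k0 * c4) *: cmul (Theta W f) (Kf W).
Proof.
have nG := sch_nice sG; have nhh := sch_nice shh.
have [C1 C10 h1] := nice_bounded nG2; have [_ [D1 hD1]] := nhh; have [_ [D2 hD2]] := nG.
pose J Y := cis (sf Y (W - half Z)) *: (cis (sf Z W) *: (hh Y *: G2 (W - half (Z + Y)))).
have nJ : nice J.
  split; first by rewrite /J; ct.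
  exists (D1 * C1) => Y; rewrite /J !rnorm_cisZ rnormZ mulrAC.
  by apply: ler_pM; rewrite ?rnorm_ge0//; exact: (rnorm_ge0 (_ : R[i]^o)).
have E1 : RF ^~ W = fun Y => c4 *: cmul (Theta W f) (J Y).
  by apply/funext => Y; rewrite /RF /J !cmulZr.
have nc : nice (fun Y => cmul (Theta W f) (J Y)).
  split; first by apply: cts_cmul; [exact: cst_continuous|exact: nJ.1].
  have [_ [D hD]] := nJ; exists (rnorm f * D) => Y.
  by rewrite (le_trans (rnormM_le _ _))// rnorm_act -mulrA ler_wpM2l ?rnorm_ge0.
rewrite E1 (bint_haarZ cA _ (nice_good hmu nc)) (bint_cmull _ (nice_good hmu nJ)).
rewrite [k0 * _]mulrC -scalerA; congr (_ *: _); rewrite -cmulZr; congr cmul.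
have JE Y : J Y = bint mu (JF W Y).
  rewrite /J G2E.
  have n1 : nice (fun U => cis (2 * sf (W - half (Z + Y)) U) *: G U) by exact: nice_cis.
  rewrite -(bint_haarZ cA _ (nice_good hmu n1)).
  have n2 := nice_scale (hh Y) n1; rewrite -(bint_haarZ cA _ (nice_good hmu n2)).
  have n3 := nice_scale (cis (sf Z W)) n2; rewrite -(bint_haarZ cA _ (nice_good hmu n3)).
  congr bint; apply/funext => U; rewrite /JF !scalerA; congr (_ *: _).
  rewrite [LHS](_ : _ = hh Y * (cis (sf Y (W - half Z)) * cis (sf Z W) * cis (2 * sf (W - half (Z + Y)) U))); last by ring.
  rewrite [RHS](_ : _ = hh Y * (cis (sf Y (W - U - half Z)) * cis (sf Z W) * cis (sf (2 *: W - Z) U))); last by ring.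
  rewrite -!cisD; congr (_ * cis _).
  rewrite !(sformBr, sformBl, sformDl, sformDr, sformNl, sformNr, sformZl, sformZr).
  by field.
have FB : bint mu (fun Y => bint mu (JF W Y)) = bint mu (fun U => bint mu ((JF W) ^~ U)).
  apply: (@fubini_nice R _ _ hmu _ (JF W) (D1 * D2) cA).
  - by move=> Y; rewrite /JF; ct.
  - by move=> U; rewrite /JF; ct.
  - move=> Y U; rewrite /JF rnorm_cisZ rnormZ !rnorm_cisZ [leRHS](_ : _ = (D1 * wt Y) * (D2 * wt U)); last by ring.
    by apply: ler_pM; rewrite ?rnorm_ge0//; exact: (rnorm_ge0 (_ : R[i]^o)).
transitivity (bint mu (fun Y => bint mu (JF W Y))); first by congr bint; apply/funext.
transitivity (bint mu (fun U => bint mu ((JF W) ^~ U))); first exact: FB.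
rewrite /Kf -(bint_haarZ cA); last first.
    have [C C0 hC] := nice_bounded nh.
    apply: (nice_good hmu); split; first by ct.
    exists (C * D2) => U; rewrite !rnorm_cisZ rnormZ -mulrA.
    by apply: ler_pM; rewrite ?rnorm_ge0//; exact: (rnorm_ge0 (_ : R[i]^o)).
  congr bint; apply/funext => U.
  have n1 : nice (fun Y => cis (sf Y (W - U - half Z)) *: hh Y).
    apply: (nice_mul (C := 1)) nhh; first by ct.
    by move=> X; rewrite rnorm_cis.
  have := bint_haarZr cA (cis (sf Z W) *: (cis (sf (2 *: W - Z) U) *: G U)) (nice_good hmu n1).
  rewrite hhE => E; transitivity ((k0 * h (W - U - half Z)) *: (cis (sf Z W) *: (cis (sf (2 *: W - Z) U) *: G U))).
    by rewrite -E; congr bint; apply/funext => Y; rewrite /JF [LHS]scalerA.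
  by rewrite !scalerA; congr (_ *: _); ring.
Qed.

(** The window decays only in a difference W - V, up to a constant shift. Twice the decay of G is
    therefore used at V = (Z + Y)/2: one weight converts decay in W - V into decay in W, the other
    gives decay in Y. *)
Lemma LF_bound : exists C : R, forall Y W, rnorm (LF Y W) <= C * (wt Y * wt W).
Proof.
have [_ [C1 h1]] := nh; have [C2 C20 h2] := sch_wt2 sG.
have [K1 K10 hK1] := wt_affine (- half Z) (oner_neq0 R).
have [K2 K20 hK2] := wt_affine (half Z) s2V.
have C10 : 0 <= C1 by have := le_trans (rnorm_ge0 _) (h1 0); rewrite pmulr_lge0// wt_gt0.
exists (C1 * C2 * rnorm f * K1 * K2) => Y W; rewrite /LF rnorm_cisZ rnormZ.
set V := half (Z + Y).
have -> : W - Z - half Y = (1 *: W - half Z) - V.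
  by rewrite scale1r /V scalerDr {1}(half_split Z) !opprD !addrA.
apply: (@le_trans _ _ ((C1 * wt ((1 *: W - half Z) - V)) * (rnorm f * (C2 * (wt V * wt V))))).
  apply: ler_pM; [exact: (rnorm_ge0 (_ : R[i]^o))|exact: rnorm_ge0|exact: h1|].
  by rewrite (le_trans (rnormM_le _ _))// rnorm_act ler_wpM2l ?rnorm_ge0.
have := wt_sub (1 *: W - half Z) V; have := hK1 W.
have : wt V <= K2 * wt Y by rewrite /V scalerDr addrC hK2.
move: (wt_gt0 V) (wt_gt0 Y) (wt_gt0 W) (wt_gt0 (1 *: W - half Z)) (wt_gt0 (1 *: W - half Z - V)) (rnorm_ge0 f).
move: (wt _) (wt V) (wt Y) (wt W) (wt (1 *: W - half Z)) => a v y w b v0 y0 w0 b0 a0 f0 hv hb hab.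
have -> : C1 * a * (rnorm f * (C2 * (v * v))) = (C1 * C2 * rnorm f) * ((a * v) * v) by ring.
have -> : C1 * C2 * rnorm f * K1 * K2 * (y * w) = (C1 * C2 * rnorm f) * ((K1 * w) * (K2 * y)) by ring.
rewrite ler_wpM2l ?mulr_ge0//; apply: ler_pM => //; rewrite ?mulr_ge0 ?(ltW v0) ?(ltW a0)//.
exact: le_trans hab hb.
Qed.

Lemma RF_bound : exists C : R, forall Y W, rnorm (RF Y W) <= C * (wt Y * wt W).
Proof.
have [_ [C1 h1]] := nG2; have [C2 C20 h2] := sch_wt2 shh.
have [K K0 hK] := wt_affine (- Z) s2.
have C10 : 0 <= C1 by have := le_trans (rnorm_ge0 _) (h1 0); rewrite pmulr_lge0// wt_gt0.
have c0 := rnorm_ge0 (c4 : R[i]^o).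
exists (rnorm (c4 : R[i]^o) * rnorm f * C1 * C2 * K) => Y W; rewrite /RF rnormZ !rnorm_cisZ rnormZ.
set V := half (Z + Y).
have hv : wt Y <= K * wt V.
  by have := hK V; rewrite /V scalerA mulfV// scale1r addrC addKr.
apply: (@le_trans _ _ (rnorm (c4 : R[i]^o) * ((C2 * (wt Y * wt Y)) * (rnorm f * (C1 * wt (W - V)))))).
  rewrite ler_wpM2l//; apply: ler_pM; [exact: (rnorm_ge0 (_ : R[i]^o))|exact: rnorm_ge0|exact: h2|].
  by rewrite (le_trans (rnormM_le _ _))// rnorm_act ler_wpM2l ?rnorm_ge0.
have hav := wt_sub W V.
move: hv hav (wt_gt0 V) (wt_gt0 Y) (wt_gt0 W) (wt_gt0 (W - V)) (rnorm_ge0 f) c0.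
move: (wt (W - V)) (wt V) (wt Y) (wt W) (rnorm (c4 : R[i]^o)) => a v y w c hv hav v0 y0 w0 a0 f0 c0.
have -> : c * (C2 * (y * y) * (rnorm f * (C1 * a))) = (c * rnorm f * C1 * C2 * y) * (y * a) by ring.
have -> : c * rnorm f * C1 * C2 * K * (y * w) = (c * rnorm f * C1 * C2 * y) * (K * w) by ring.
rewrite ler_wpM2l ?mulr_ge0 ?(ltW y0)//; apply: (@le_trans _ _ (K * v * a)).
  by rewrite ler_wpM2r// ltW.
by rewrite -mulrA ler_wpM2l// mulrC.
Qed.

Lemma pointwise_identity :
  bint mu (fun Y => (hh Y * ka Y Z) *: L (half (Z + Y))) =
  k0 *: bint mu (fun Y => ka Y Z *: cmul (Theta (Z + half Y) (M Y)) (G (half (Z + Y)))).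
Proof.
under eq_fun do rewrite RF_int.
under [X in _ = _ *: bint _ X]eq_fun do rewrite LF_int.
have [C1 hC1] := LF_bound; have [C2 hC2] := RF_bound.
have cL1 Y : continuous (LF Y) by rewrite /LF; ct.
have cL2 W : continuous (LF ^~ W) by rewrite /LF; ct.
have cR1 Y : continuous (RF Y) by rewrite /RF; ct.
have cR2 W : continuous (RF ^~ W) by rewrite /RF; ct.
transitivity (bint mu (fun W => bint mu (RF ^~ W))).
  exact: (fubini_nice hmu cA cR1 cR2 hC2).
transitivity (k0 *: bint mu (fun W => bint mu (LF ^~ W))); last first.
  have F2 := fubini_nice hmu cA cL1 cL2 hC1.
  exact: (congr1 (fun v => k0 *: v) (esym F2)).
have nL : nice (fun W => bint mu (LF ^~ W)).
  apply: (@nice_bint A (fun W Y => LF Y W) C1 cA cL2 cL1) => X Y.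
  by rewrite [wt X * _]mulrC.
rewrite -(bint_haarZ cA _ (nice_good hmu nL)); congr bint; apply/funext => W.
by rewrite LF_marg RF_marg scalerA.
Qed.

End pointwise.
End rieffel_identity.

Lemma eq_bint (R : realType) d (T : measurableType d) (mu : {measure set T -> \bar R})
    (V : normedModType R[i]) (F G : T -> V) : (forall x, F x = G x) -> bint mu F = bint mu G.
Proof. by move=> FG; congr bint; apply/funext. Qed.

Lemma continuous_at_sq (R : realType) (T : topologicalType) (V W : normedModType R[i])
    (f : T -> V) (g : T -> W) (x0 : T) : g x0 = 0 -> {for x0, continuous g} ->
  (forall x, rnorm (f x - f x0) ^+ 2 <= rnorm (g x)) -> {for x0, continuous f}.
Proof.
move=> g0 cg fg; apply/cvg_rnormP => e e0; have e20 : 0 < e ^+ 2 by rewrite exprn_gt0.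
have /cvg_rnormP/(_ _ e20) := cg; apply: filterS => x; rewrite g0 subr0 => h.
by rewrite -(@ler_pXn2r _ 2)// ?nnegrE ?rnorm_ge0 ?(ltW e0)//; exact: le_trans (fg x) h.
Qed.

(** * The operators L_f and the frame vectors *)

Section rieffel_facts.
Context {R : realType} {n : nat} {Omega : 'M[R]_(2 * n)}.
Hypothesis hOmega : symplectic Omega.
Local Notation Xi := 'rV[R]_(2 * n).
Local Notation sf := (sform Omega).
Local Notation mu := (dX Omega).
Local Notation ka := (kappa Omega).
Let hmu : haar mu := haar_dX Omega.
Let cR := @cplt_complex R.
Let mB := @measurable_cball R (2 * n).
Let fB := cball_lty hmu.
Let cB := @cball_cover R (2 * n).
Local Notation ft c G := (@FT R n Omega _ unit c (fun=> G) tt).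
Context {A : cstarAlgebra R} {Theta : Xi -> A -> A}.
Hypothesis hTheta : is_action Theta.
Let cA : cplt A := @cplt_complete R A.
Implicit Types (X Y Z U W S : Xi) (a b f g : A).
Local Notation half X := (2^-1 *: X).
Local Notation c4 := (2 ^+ (2 * n) : R[i]).
Let s2 : (2 : R) != 0. Proof. by rewrite pnatr_eq0. Qed.
Let s2V : (2^-1 : R) != 0. Proof. by rewrite invr_eq0 pnatr_eq0. Qed.
Let sN1 : (-1 : R) != 0. Proof. by rewrite oppr_eq0 oner_eq0. Qed.

Lemma sch_modulation h f : smooth_vector Theta f -> sch h -> sch (modulation Omega Theta h f).
Proof.
move=> sf_ sh; have D : sch (fun U => h U *: Theta U f).
  move=> k d; have D1 : Dc k 0 (fun (_ : unit) U => Theta U f).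
    have := Dc_reparam (fun _ : unit => 0) (Dc_act hTheta k sf_).
    by congr Dc; apply/funext => -[]; apply/funext => U; rewrite add0r.
  by have := Dc_scale (sh k d) D1; rewrite addn0.
have -> : modulation Omega Theta h f = ft (-1) (fun U => h U *: Theta U f).
  apply/funext => Y; rewrite /FT /modulation; apply: (congr1 (bint mu)); apply/funext => U.
  by rewrite scalerA mulN1r.
exact: sch_FT.
Qed.

Section op.
Variables (f : A) (G : Xi -> A).
Hypotheses (hf : smooth_vector Theta f) (sG : sch G).

Let Q X S := cis (2 * sf X S) *: cmul (Theta (X + S) f) (ft 2 G S).
Let nG2 : nice (ft 2 G). Proof. by apply: sch_nice; exact: sch_FT. Qed.

Let cQ1 X : continuous (Q X).
Proof.
apply: continuousZc; first by apply: cts_cis; apply: continuous_Rscale; exact: continuous_sform_r.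
apply: cts_cmul; last exact: nG2.1.
by apply: (act_cont2 hTheta); [exact: cts_addl|exact: cst_continuous].
Qed.

Let cQ2 S : continuous (Q ^~ S).
Proof.
apply: continuousZc; first by apply: cts_cis; apply: continuous_Rscale; exact: continuous_sform_l.
apply: cts_cmul; last exact: cst_continuous.
apply: (act_cont2 hTheta); last exact: cst_continuous.
by apply: cts_add; [exact: cts_id|exact: cst_continuous].
Qed.

Let bQ : exists C : R, forall X S, rnorm (Q X S) <= C * wt S.
Proof.
have [_ [C hC]] := nG2; exists (rnorm f * C) => X S; rewrite rnorm_cisZ.
by rewrite (le_trans (rnormM_le _ _))// (rnorm_act hTheta) -mulrA ler_wpM2l ?rnorm_ge0.
Qed.

Let nQ X : nice (Q X). Proof. by split; [exact: cQ1|have [C h] := bQ; exists C]. Qed.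

(** The inner integral replaces G by its transform, which is rapidly decreasing, so that the outer
    integral converges absolutely. *)
Lemma rieffelE X : rieffel_op Omega Theta f G X = c4 *: bint mu (Q X).
Proof.
rewrite /rieffel_op; apply: (congr1 (fun v => _ *: v)); apply: eq_bint => Y.
pose P W := cis (2 * sf Y W) *: G W.
have nP : nice P := nice_cis 2 Y (sch_nice sG).
have nP2 := nice_scale (cis (2 * sf X Y)) nP.
have gP2 := nice_good hmu nP2.
have -> : (fun Z => cis (2 * sf Y Z) *: cmul (Theta (X + Y) f) (G (X + Z))) =
    (fun Z => cmul (Theta (X + Y) f) ((fun W => cis (2 * sf X Y) *: P W) (Z + X))).
  apply/funext => Z; rewrite -cmulZr /P scalerA -cisD [Z + X]addrC; congr (cmul _ (cis _ *: _)).
  by rewrite sformDr (sformC hOmega X Y); ring.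
rewrite (bint_cmull _ (good_translate X gP2)) (bint_haar_translate cA X gP2) (bint_haarZ cA _ (nice_good hmu nP)).
by rewrite cmulZr.
Qed.

(** L_f G at X is the transform, evaluated at X, of a function of S that itself depends on X. The
    decay estimate is uniform in that parameter and may be used on the diagonal. *)
Lemma rieffel_nice : nice (rieffel_op Omega Theta f G).
Proof.
have [C hC] := bQ.
have -> : rieffel_op Omega Theta f G = fun X => c4 *: bint mu (Q X) by apply/funext => X; exact: rieffelE.
apply: nice_scale; split; first exact: (bint_continuous hmu cA cQ1 cQ2 hC).
have D : Dc (2 * (2 * n)) (2 * (2 * n)) (fun X S => cmul (Theta (X + S) f) (ft 2 G S)).
  have D2 := Dc_reparam (fun _ : Xi => tt) (sch_FT hOmega cA s2 sG (2 * (2 * n))%N (2 * (2 * n))%N).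
  exact: (Dc_cmul (Dc_act hTheta _ hf) D2).
have [K hK] := FT_decay hOmega cA s2 D; exists K => X.
rewrite /wt ler_pdivlMr ?exprn_gt0 ?base_gt0// mulrC; exact: (hK X X).
Qed.

Let GX X U := cis (- sf X U) *: G (U + half X).

Lemma sch_twist X : sch (GX X).
Proof.
move=> k d.
have D1 : Dc k 0 (fun (_ : unit) U => cis (- sf X U) : R[i]^o).
  apply: Dc_cis.
  - by move=> U W; rewrite sformDr opprD.
  - by move=> t U; rewrite sformZr mulrN.
  - rewrite (_ : (fun U : Xi => - sf X U) = (fun U => -1 * sf X U)); last by apply/funext => U; rewrite mulN1r.
    by apply: continuous_Rscale; exact: continuous_sform_r.
exact: (Dc_scale D1 (Dc_translate (half X) (sG k d))).
Qed.

Lemma ft_twist X S : ft 2 (GX X) S = cis (- sf S X) *: ft 2 G (S - half X).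
Proof.
pose P U := cis (2 * sf (S - half X) U) *: G U.
have nP : nice P := nice_cis 2 _ (sch_nice sG).
have nP2 := nice_scale (cis (- sf S X)) nP.
rewrite -[RHS](bint_haarZ cA _ (nice_good hmu nP)).
rewrite -[RHS](bint_haar_translate cA (half X) (nice_good hmu nP2)); congr bint; apply/funext => U.
rewrite /GX /P !scalerA -!cisD; congr (cis _ *: _).
rewrite !(sformBl, sformBr, sformDl, sformDr, sformNl, sformNr, sformZl, sformZr).
have := sformXX hOmega X; lra.
Qed.

(** Modulating and translating G translates its transform, up to a phase; a change of variable in S
    undoes this, and the remaining phases agree because the form is alternating. *)
Lemma rieffel_twist X U0 : cis (- sf X U0) *: (c4 *: bint mu (Q (U0 + half X))) =
  c4 *: bint mu (fun S => cis (2 * sf U0 S) *: cmul (Theta (U0 + S) f) (ft 2 (GX X) S)).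
Proof.
have nQ2 := nice_scale (cis (- sf X U0)) (nQ (U0 + half X)).
rewrite scalerA mulrC -scalerA; congr (_ *: _).
rewrite -(bint_haarZ cA _ (nice_good hmu (nQ _))).
rewrite -[LHS](bint_haar_translate cA (- half X) (nice_good hmu nQ2)); congr bint; apply/funext => S.
rewrite ft_twist cmulZr /Q !scalerA -!cisD.
rewrite (_ : U0 + half X + (S - half X) = U0 + S); last by rewrite addrACA subrr addr0.
congr (cis _ *: _).
rewrite !(sformBl, sformBr, sformDl, sformDr, sformNl, sformNr, sformZl, sformZr).
have := sformXX hOmega X; have := sformC hOmega X S; have := sformC hOmega X U0; lra.
Qed.

End op.

Lemma rieffel_op_twist f G X U : smooth_vector Theta f -> sch G ->
  rieffel_op Omega Theta f (fun U => cis (- sf X U) *: G (U + half X)) U =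
  cis (- sf X U) *: rieffel_op Omega Theta f G (U + half X).
Proof.
by move=> hf sG; rewrite (rieffelE f (sch_twist sG X)) (rieffelE f sG) (rieffel_twist f sG).
Qed.

Section frame.
Variables (H : hilbertSpace R) (xi : (Xi -> A) -> H) (om : A -> R[i]^o).
Hypotheses (xiL : forall (a : R[i]) F G, nice F -> nice G -> xi (fun X => a *: F X + G X) = a *: xi F + xi G)
  (xip : forall F G, nice F -> nice G -> ip (xi F) (xi G) = om (bint mu (fun X => cmul (cstar (F X)) (G X))))
  (oml : linear om) (omb : forall a, rnorm (om a) <= rnorm a).
Let cH : cplt H := @cplt_complete R H.

Lemma nice_sub (V : normedModType R[i]) (F G : Xi -> V) : nice F -> nice G -> nice (fun X => F X - G X).
Proof.
move=> [cF [C hC]] [cG [D hD]]; split; first exact: cts_sub.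
by exists (C + D) => X; rewrite mulrDl (le_trans (rnormD _ _))// rnormN lerD.
Qed.

Lemma nice_star_mul (F G : Xi -> A) : nice F -> nice G -> nice (fun X => cmul (cstar (F X)) (G X)).
Proof.
move=> nF [cG [D hD]]; have [C C0 hC] := nice_bounded nF.
split; first by apply: cts_cmul => //; apply: cts_cstar; exact: nF.1.
exists (C * D) => X; rewrite (le_trans (rnormM_le _ _))// rnorm_star -mulrA.
by apply: ler_pM; rewrite ?rnorm_ge0.
Qed.

Lemma xiZ (a : R[i]) (F : Xi -> A) : nice F -> xi (fun X => a *: F X) = a *: xi F.
Proof.
move=> nF; have n0 : nice (fun _ : Xi => 0 : A).
  by split; [exact: cst_continuous|exists 0 => X; rewrite rnorm0 mul0r].
have x0 : xi (fun=> 0) = 0.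
  have E : (fun _ : Xi => -1 *: (0 : A) + 0) = (fun=> 0) by apply/funext => X; rewrite scaler0 addr0.
  by have := xiL (-1) n0 n0; rewrite E scaleN1r addNr.
by have := xiL a nF n0; rewrite x0 addr0 => <-; congr xi; apply/funext => X; rewrite addr0.
Qed.

Lemma xiB F G : nice F -> nice G -> xi (fun X => F X - G X) = xi F - xi G.
Proof.
move=> nF nG; have := xiL (-1) nG nF; rewrite scaleN1r addrC => <-; congr xi.
by apply/funext => X; rewrite scaleN1r addrC.
Qed.

Lemma xi_norm F : nice F -> rnorm (xi F) ^+ 2 <= rnorm (bint mu (fun X => cmul (cstar (F X)) (F X))).
Proof.
move=> nF; rewrite -Re_ip xip// (le_trans _ (omb _))//.
by rewrite (le_trans (ler_norm _))// ler_Re_rnorm.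
Qed.

Lemma bint_square (F : Xi -> A) (C : R) : nice F -> (forall X, rnorm (F X) <= C * wt X) ->
  rnorm (bint mu (fun X => cmul (cstar (F X)) (F X))) <= C ^+ 2 * fine (\int[mu]_X (wt X)%:E).
Proof.
move=> nF hC; have nn := nice_star_mul nF nF.
have C0 : 0 <= C by have := le_trans (rnorm_ge0 _) (hC 0); rewrite pmulr_lge0// wt_gt0.
apply: (bint_bound hmu cA); first exact: continuous_smeas nn.1.
move=> X; rewrite rnormC expr2 expr2 -mulrA; apply: ler_pM; rewrite ?rnorm_ge0//.
by rewrite (le_trans (hC X))// ler_piMr// wt_le1.
Qed.

Lemma xi_bound (F : Xi -> A) (C : R) : nice F -> (forall X, rnorm (F X) <= C * wt X) ->
  rnorm (xi F) <= C * Num.sqrt (fine (\int[mu]_X (wt X)%:E)).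
Proof.
move=> nF hC; have C0 : 0 <= C by have := le_trans (rnorm_ge0 _) (hC 0); rewrite pmulr_lge0// wt_gt0.
have i0 : 0 <= fine (\int[mu]_X (wt X)%:E).
  by apply: fine_ge0; apply: integral_ge0 => X _; rewrite lee_fin ltW// wt_gt0.
rewrite -(@ler_pXn2r _ 2)// ?nnegrE ?mulr_ge0 ?rnorm_ge0 ?sqrtr_ge0//.
rewrite exprMn sqr_sqrtr//; exact: le_trans (xi_norm nF) (bint_square nF hC).
Qed.

Section family.
Variables (F : Xi -> Xi -> A) (C : R).
Hypotheses (c1 : forall Y, continuous (F Y)) (c2 : forall Z, continuous (F ^~ Z))
  (bF : forall Y Z, rnorm (F Y Z) <= C * (wt Y * wt Z)).

Let C0 : 0 <= C.
Proof. by have := le_trans (rnorm_ge0 _) (bF 0 0); rewrite pmulr_lge0// mulr_gt0// wt_gt0. Qed.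

Lemma family_nice Y : nice (F Y).
Proof. by split => //; exists (C * wt Y) => X; rewrite -mulrA. Qed.

(** The squared distance from [xi (F Y)] to [xi (F Y0)] is at most the norm of an integral that is
    continuous in Y and vanishes at [Y0]. *)
Lemma xi_nice : nice (fun Y => xi (F Y)).
Proof.
split; last first.
  exists (C * Num.sqrt (fine (\int[mu]_X (wt X)%:E))) => Y; rewrite mulrAC.
  by apply: xi_bound; [exact: family_nice|move=> Z; rewrite -mulrA].
move=> Y0; pose D Y Z := F Y Z - F Y0 Z.
have nD Y : nice (D Y) by apply: nice_sub; exact: family_nice.
have bD Y Z : rnorm (D Y Z) <= (2 * C) * wt Z.
  rewrite mulrDl mul1r mulrDl (le_trans (rnormD _ _))// rnormN lerD//.
    by rewrite (le_trans (bF _ _))// ler_wpM2l// ler_piMl ?wt_le1// ltW// wt_gt0.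
  by rewrite (le_trans (bF _ _))// ler_wpM2l// ler_piMl ?wt_le1// ltW// wt_gt0.
have cc : continuous (fun Y => bint mu (fun Z => cmul (cstar (D Y Z)) (D Y Z))).
  apply: (bint_continuous hmu cA (C := (2 * C) * (2 * C))).
  - by move=> Y; apply: cts_cmul; [apply: cts_cstar|]; exact: (nD Y).1.
  - move=> Z; have cD : continuous (D ^~ Z) by apply: cts_sub; [exact: c2|exact: cst_continuous].
    by apply: cts_cmul => //; exact: cts_cstar.
  - move=> Y Z; rewrite rnormC expr2 -mulrA; apply: ler_pM; rewrite ?rnorm_ge0//.
    by rewrite (le_trans (bD _ _))// ler_piMr ?wt_le1// mulr_ge0.
apply: (continuous_at_sq _ (cc Y0)) => [|Y].
  rewrite -[RHS](bint0 mB fB cB cA); congr bint; apply/funext => Z.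
  by rewrite /D subrr cmul0r.
rewrite -xiB; [|exact: family_nice|exact: family_nice].
exact: (xi_norm (nD Y)).
Qed.

(** The interchange of [xi] with an integral is obtained only after pairing with a frame vector,
    where it reduces to Fubini in [A]; this weak form suffices. *)
Lemma xi_bint G : nice G -> ip (xi G) (bint mu (fun Y => xi (F Y))) =
  om (bint mu (fun Z => cmul (cstar (G Z)) (bint mu (F ^~ Z)))).
Proof.
move=> nG; have [D D0 hD] := nice_bounded nG.
have ipL : forall x y, ip (xi G) (x + y) = ip (xi G) x + ip (xi G) y by move=> x y; exact: ipDr.
have ipZ : forall (t : R) x, ip (xi G) ((t%:C)%C *: x) = (t%:C)%C *: (ip (xi G) x : R[i]^o) by move=> t x; exact: ipZr.
have ipB : forall x, rnorm (ip (xi G) x : R[i]^o) <= rnorm (xi G) * rnorm x by move=> x; exact: ip_CS.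
rewrite -(@bint_bounded R _ _ mu H R[i]^o _ mB fB cB cH cR (fun x => ip (xi G) x : R[i]^o) _ ipL ipZ ipB _ (nice_good hmu xi_nice)).
have FE : (fun x => ip (xi G) x : R[i]^o) \o (fun Y => xi (F Y)) = (fun Y => om (bint mu (fun Z => cmul (cstar (G Z)) (F Y Z)))).
  by apply/funext => Y; apply: xip => //; exact: family_nice.
rewrite FE.
pose K Y Z := cmul (cstar (G Z)) (F Y Z).
have k1 Y : continuous (K Y).
  by apply: cts_cmul => //; apply: cts_cstar; exact: nG.1.
have k2 Z : continuous (K ^~ Z) by apply: cts_cmul => //; exact: cst_continuous.
have k3 Y Z : rnorm (K Y Z) <= (D * C) * (wt Y * wt Z).
  rewrite (le_trans (rnormM_le _ _))// rnorm_star -mulrA.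
  by apply: ler_pM; rewrite ?rnorm_ge0.
have nK := nice_bint (Omega := Omega) cA k1 k2 k3.
have omD : forall x y, om (x + y) = om x + om y := linD oml.
have omZ : forall (t : R) x, om ((t%:C)%C *: x) = (t%:C)%C *: om x by move=> t x; rewrite (linZ oml).
have omB : forall x, rnorm (om x) <= 1 * rnorm x by move=> x; rewrite mul1r.
have E := @bint_bounded R _ _ mu A R[i]^o _ mB fB cB cA cR om 1 omD omZ omB _ (nice_good hmu nK).
transitivity (om (bint mu (fun Y => bint mu (K Y)))); first exact: E.
congr om; transitivity (bint mu (fun Z => bint mu (K ^~ Z))); first exact: (fubini_nice hmu cA k1 k2 k3).
congr bint; apply/funext => Z; rewrite /K bint_cmull//.
apply: (nice_good hmu); split => //.
by exists (C * wt Z) => Y; rewrite -mulrA [wt Z * _]mulrC.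
Qed.

End family.
End frame.
End rieffel_facts.

Lemma cts_conj (R : realType) (T : topologicalType) (u : T -> R[i]^o) : continuous u ->
  continuous (fun x => (u x)^* : R[i]^o).
Proof.
move=> cu x; apply: (cvg_squeeze_rnorm (g := fun y => rnorm (u y - u x))).
  by move=> y; rewrite -rmorphB rnorm_conj.
by apply/cvg_rnorm0P; exact: cu.
Qed.

Lemma cts_ip (R : realType) (H : hilbertSpace R) (T : topologicalType) (u : T -> H) (x : H) :
  continuous u -> continuous (fun t => ip (u t) x : R[i]^o).
Proof.
move=> cu t; apply: (cvg_squeeze_rnorm (g := fun y => rnorm (u y - u t) * rnorm x)).
  by move=> y; rewrite -ipBl ip_CS.
by rewrite -[X in _ --> X](mul0r (rnorm x)); apply: cvgMl; apply/cvg_rnorm0P; exact: cu.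
Qed.

(** * From the vanishing of M to the vanishing of the limit *)

Section core.
Context {R : realType} {n : nat} {Omega : 'M[R]_(2 * n)}.
Hypothesis hOmega : symplectic Omega.
Local Notation Xi := 'rV[R]_(2 * n).
Local Notation sf := (sform Omega).
Local Notation mu := (dX Omega).
Local Notation ka := (kappa Omega).
Let hmu : haar mu := haar_dX Omega.
Let cR := @cplt_complex R.
Let mB := @measurable_cball R (2 * n).
Let fB := cball_lty hmu.
Let cB := @cball_cover R (2 * n).
Local Notation ft c G := (@FT R n Omega _ unit c (fun=> G) tt).
Context {A : cstarAlgebra R} {Theta : Xi -> A -> A}.
Hypothesis hTheta : is_action Theta.
Let cA : cplt A := @cplt_complete R A.
Implicit Types (X Y Z U W S : Xi) (a b f g : A).
Local Notation half X := (2^-1 *: X).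
Let s2 : (2 : R) != 0. Proof. by rewrite pnatr_eq0. Qed.
Let s2V : (2^-1 : R) != 0. Proof. by rewrite invr_eq0 pnatr_eq0. Qed.

Variables (H : hilbertSpace R) (xi : (Xi -> A) -> H) (om : A -> R[i]^o).
Hypotheses (xiL : forall (a : R[i]) F G, nice F -> nice G -> xi (fun X => a *: F X + G X) = a *: xi F + xi G)
  (xip : forall F G, nice F -> nice G -> ip (xi F) (xi G) = om (bint mu (fun X => cmul (cstar (F X)) (G X))))
  (oml : linear om) (omb : forall a, rnorm (om a) <= rnorm a).
Let cH : cplt H := @cplt_complete R H.

Variables (h hh : Xi -> R[i]^o) (k0 : R[i]).
Hypotheses (sh : sch h) (shh : sch hh)
  (hhE : forall V, bint mu (fun Y => cis (sf Y V) *: hh Y) = k0 * h V)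
  (inj : forall phi : Xi -> R[i]^o, nice phi ->
     (forall X, bint mu (fun Y => cis (-1 * sf X Y) *: phi Y) = 0) -> forall V, phi V = 0)
  (hh0 : exists Y, hh Y != 0).
Variable P : (Xi -> A) -> H -> H.
Hypothesis PE : forall F G, sch F -> nice G -> P F (xi G) =
  bint mu (fun Y => xi (fun Z => ka Y Z *: cmul (Theta (Z + half Y) (F Y)) (G (Z + Y)))).

Local Notation Mf f := (modulation Omega Theta h f).
Local Notation Lf f G := (rieffel_op Omega Theta f G).

Lemma ka_cont1 Y : continuous (fun Z => ka Y Z : R[i]^o).
Proof.
have -> : (fun Z => ka Y Z : R[i]^o) = (fun Z => cis ((- 2^-1) * sf Y Z) : R[i]^o).
  by apply/funext => Z; rewrite /kappa mulNr mulrC.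
by apply: cts_cis; apply: continuous_Rscale; exact: continuous_sform_r.
Qed.

Lemma ka_cont2 Z : continuous (fun Y => ka Y Z : R[i]^o).
Proof.
have -> : (fun Y => ka Y Z : R[i]^o) = (fun Y => cis ((- 2^-1) * sf Y Z) : R[i]^o).
  by apply/funext => Y; rewrite /kappa mulNr mulrC.
by apply: cts_cis; apply: continuous_Rscale; exact: continuous_sform_l.
Qed.

Lemma cts_half_add Y : continuous (fun Z => half (Z + Y)).
Proof. by apply: cts_scale; apply: cts_add; [exact: cts_id|exact: cst_continuous]. Qed.

Lemma cts_half_add' Z : continuous (fun Y => half (Z + Y)).
Proof. by apply: cts_scale; exact: cts_addl. Qed.

Lemma nice_half (V : normedModType R[i]) (F : Xi -> V) : nice F -> nice (fun Z => F (half Z)).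
Proof.
by move=> nF; have := nice_affine 0 s2V nF; congr nice; apply/funext => Z; rewrite addr0.
Qed.

Lemma nice_half_add (V : normedModType R[i]) (F : Xi -> V) Y : nice F -> nice (fun Z => F (half (Z + Y))).
Proof.
move=> nF; have -> : (fun Z => F (half (Z + Y))) = (fun Z => F (half Z + half Y)).
  by apply/funext => Z; rewrite scalerDr.
exact: nice_affine.
Qed.

Lemma prod_bound (C1 C2 : R) : 0 <= C1 -> 0 <= C2 -> exists K : R, forall (a b : R) Y Z,
  0 <= a -> 0 <= b -> a <= C1 * (wt Y * wt Y) -> b <= C2 * wt (half (Z + Y)) ->
  a * b <= K * (wt Y * wt Z).
Proof.
move=> C10 C20; have [K K0 hK] := wt_affine (0 : Xi) s2V; exists (C1 * C2 * K) => a b Y Z a0 b0 ha hb.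
have h1 : wt (half (Z + Y)) <= K * wt (Z + Y) by have := hK (Z + Y); rewrite addr0.
have h2 := wt_add Z Y.
apply: (@le_trans _ _ ((C1 * (wt Y * wt Y)) * (C2 * wt (half (Z + Y))))); first exact: ler_pM.
move: h1 h2 (wt_gt0 Y) (wt_gt0 Z); move: (wt (half _)) (wt (Z + Y)) (wt Y) (wt Z) => p q y z h1 h2 y0 z0.
have -> : C1 * (y * y) * (C2 * p) = (C1 * C2 * y) * (y * p) by ring.
have -> : C1 * C2 * K * (y * z) = (C1 * C2 * y) * (K * z) by ring.
rewrite ler_wpM2l ?mulr_ge0 ?(ltW y0)//; apply: (@le_trans _ _ (y * (K * q))).
  by rewrite ler_wpM2l// ltW.
by rewrite mulrCA ler_wpM2l// mulrC.
Qed.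

Lemma nice_wt (V : normedModType R[i]) (F : Xi -> V) : nice F ->
  exists2 C : R, 0 <= C & forall X, rnorm (F X) <= C * wt X.
Proof.
move=> [_ [C hC]]; exists C => //.
by have := le_trans (rnorm_ge0 _) (hC 0); rewrite pmulr_lge0// wt_gt0.
Qed.

Section one.
Variables (f : A) (G : Xi -> A).
Hypotheses (hf : smooth_vector Theta f) (sG : sch G).

Let F1 Y Z := ka Y Z *: cmul (Theta (Z + half Y) (Mf f Y)) (G (half (Z + Y))).
Let F2 Y Z := (hh Y * ka Y Z) *: Lf f G (half (Z + Y)).
Let nM := sch_modulation hOmega hTheta hf sh.
Let nL : nice (Lf f G) := rieffel_nice hOmega hTheta hf sG.

Let F1_family : exists C : R, [/\ forall Y, continuous (F1 Y), forall Z, continuous (F1 ^~ Z) &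
  forall Y Z, rnorm (F1 Y Z) <= C * (wt Y * wt Z)].
Proof.
have [C1 C10 h1] := sch_wt2 nM; have [C2 C20 h2] := nice_wt (sch_nice sG).
have [K hK] := prod_bound C10 C20; exists K; split.
- move=> Y; apply: continuousZc; first exact: ka_cont1.
  apply: cts_cmul; last by apply: (cts_compG (sch_nice sG).1); exact: cts_half_add.
  apply: (act_cont2 hTheta); last exact: cst_continuous.
  by apply: cts_add; [exact: cts_id|exact: cst_continuous].
- move=> Z; apply: continuousZc; first exact: ka_cont2.
  apply: cts_cmul; last by apply: (cts_compG (sch_nice sG).1); exact: cts_half_add'.
  apply: (act_cont2 hTheta); last exact: (sch_nice nM).1.
  by apply: cts_add; [exact: cst_continuous|exact: cts_scalel].
move=> Y Z; rewrite /F1 rnormZ rnorm_cis mul1r (le_trans (rnormM_le _ _))// (rnorm_act hTheta).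
by apply: hK; rewrite ?rnorm_ge0.
Qed.

Let F2_family : exists C : R, [/\ forall Y, continuous (F2 Y), forall Z, continuous (F2 ^~ Z) &
  forall Y Z, rnorm (F2 Y Z) <= C * (wt Y * wt Z)].
Proof.
have [C1 C10 h1] := sch_wt2 shh; have [C2 C20 h2] := nice_wt nL.
have [K hK] := prod_bound C10 C20; exists K.
have E Y Z : F2 Y Z = hh Y *: (ka Y Z *: Lf f G (half (Z + Y))) by rewrite scalerA.
split.
- move=> Y; have -> : F2 Y = (fun Z => hh Y *: (ka Y Z *: Lf f G (half (Z + Y)))) by apply/funext.
  apply: cts_scale; apply: continuousZc; first exact: ka_cont1.
  by apply: (cts_compG nL.1); exact: cts_half_add.
- move=> Z; have -> : F2 ^~ Z = (fun Y => hh Y *: (ka Y Z *: Lf f G (half (Z + Y)))) by apply/funext => Y.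
  apply: continuousZc; first exact: (sch_nice shh).1.
  apply: continuousZc; first exact: ka_cont2.
  by apply: (cts_compG nL.1); exact: cts_half_add'.
move=> Y Z; rewrite E rnormZ rnormZ rnorm_cis mul1r.
by apply: hK; rewrite ?rnorm_ge0//; exact: (rnorm_ge0 (_ : R[i]^o)).
Qed.

Lemma weak_identity G' : nice G' ->
  k0 * ip (xi G') (P (Mf f) (xi (fun Z => G (half Z)))) =
  bint mu (fun Y => ip (xi G') (xi (fun Z => (hh Y * ka Y Z) *: Lf f G (half (Z + Y)))) : R[i]^o).
Proof.
move=> nG'; have [C1 [a1 b1 d1]] := F1_family; have [C2 [a2 b2 d2]] := F2_family.
have n2 := xi_nice xiL xip omb a2 b2 d2.
have ipL : forall x y, ip (xi G') (x + y) = ip (xi G') x + ip (xi G') y by move=> x y; exact: ipDr.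
have ipZ : forall (t : R) x, ip (xi G') ((t%:C)%C *: x) = (t%:C)%C *: (ip (xi G') x : R[i]^o) by move=> t x; exact: ipZr.
have ipB : forall x, rnorm (ip (xi G') x : R[i]^o) <= rnorm (xi G') * rnorm x by move=> x; exact: ip_CS.
have E := @bint_bounded R _ _ mu H R[i]^o _ mB fB cB cH cR (fun x => ip (xi G') x : R[i]^o) _ ipL ipZ ipB _ (nice_good hmu n2).
apply: etrans (esym E).
rewrite (PE nM (nice_half (sch_nice sG))).
have e1 := xi_bint xiL xip oml omb a1 b1 d1 nG'.
have e2 := xi_bint xiL xip oml omb a2 b2 d2 nG'.
apply: etrans (esym e2); apply: (etrans (congr1 (fun z => k0 * z) e1)).
have b1' Z Y : rnorm (F1 Y Z) <= C1 * (wt Z * wt Y) by rewrite [wt Z * _]mulrC.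
have nb : nice (fun Z => bint mu (F1 ^~ Z)).
  exact: (nice_bint (Omega := Omega) (F := fun Z Y => F1 Y Z) cA b1 a1 b1').
have nc := nice_star_mul nG' nb.
transitivity (om (k0 *: bint mu (fun Z => cmul (cstar (G' Z)) (bint mu (F1 ^~ Z))))); first by rewrite (linZ oml).
apply: (congr1 om); rewrite -(bint_haarZ cA _ (nice_good hmu nc)); apply: eq_bint => Z.
rewrite -cmulZr; apply: (congr1 (cmul _)); apply: esym.
have nG2 : nice (ft 2 G) := sch_nice (sch_FT hOmega cA s2 sG).
exact: (@pointwise_identity R n Omega hOmega A Theta hTheta f h hh G (ft 2 G) (Mf f) (Lf f G) k0
  (sch_nice sh) shh sG nG2 hhE (fun=> erefl) (fun=> erefl) (rieffelE hOmega f sG) Z).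
Qed.

End one.

(** The projective translation by which a covariant representation acts on frame vectors. *)
Definition tw X (G : Xi -> A) Z := ka X Z *: G (Z + X).
Definition psiL f G Z := Lf f G (half Z).

Lemma nice_tw X G : nice G -> nice (tw X G).
Proof.
move=> nG; apply: (nice_mul (C := 1)); first exact: ka_cont1.
  by move=> Z; rewrite rnorm_cis.
by have := nice_affine X (oner_neq0 R) nG; congr nice; apply/funext => Z; rewrite scale1r.
Qed.

Section adjoint_family.
Variable G : Xi -> A.
Hypothesis nG : nice G.

(** The conjugate of [hh Y] times [tw (- Y) G]: pairing with it amounts to pairing [G] with the
    vector twisted by [tw Y] and multiplied by [hh Y]. *)
Definition F3 Y Z := (hh Y)^* *: (ka (- Y) Z *: G (Z - Y)).

Lemma F3_family : exists C : R, [/\ forall Y, continuous (F3 Y), forall Z, continuous (F3 ^~ Z) &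
  forall Y Z, rnorm (F3 Y Z) <= C * (wt Y * wt Z)].
Proof.
have [C1 C10 h1] := sch_wt2 shh; have [C2 C20 h2] := nice_wt nG.
exists (C1 * C2); split.
- move=> Y; apply: cts_scale; apply: continuousZc; first exact: ka_cont1.
  by apply: (cts_compG nG.1); apply: cts_sub; [exact: cts_id|exact: cst_continuous].
- move=> Z; apply: continuousZc.
    by apply: cts_conj; exact: (sch_nice shh).1.
  apply: continuousZc.
    have -> : (fun Y => ka (- Y) Z : R[i]^o) = (fun Y => cis (2^-1 * sf Y Z) : R[i]^o).
      by apply/funext => Y; rewrite /kappa sformNl mulNr opprK mulrC.
    by apply: cts_cis; apply: continuous_Rscale; exact: continuous_sform_l.
  by apply: (cts_compG nG.1); apply: cts_sub; [exact: cst_continuous|exact: cts_id].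
move=> Y Z; rewrite /F3 rnormZ rnormZ rnorm_cis mul1r rnorm_conj.
apply: (@le_trans _ _ ((C1 * (wt Y * wt Y)) * (C2 * wt (Z - Y)))).
  by apply: ler_pM; rewrite ?rnorm_ge0//; exact: (rnorm_ge0 (_ : R[i]^o)).
have := wt_sub Z Y; move: (wt_gt0 Y); move: (wt Y) (wt (Z - Y)) (wt Z) => y q z y0 hq.
have -> : C1 * (y * y) * (C2 * q) = (C1 * C2 * y) * (q * y) by ring.
have -> : C1 * C2 * (y * z) = (C1 * C2 * y) * z by ring.
by rewrite ler_wpM2l ?mulr_ge0 ?(ltW y0).
Qed.

End adjoint_family.

(** Modulating G and twisting G' by the same X leaves the pairings unchanged except for the
    character e^{-i[X,Y]}; the right-hand side becomes a Fourier transform in Y. *)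
Lemma twisted_identity f G G' X : smooth_vector Theta f -> sch G -> nice G' ->
  k0 * ip (xi (tw X G')) (P (Mf f) (xi (fun Z => ka X Z *: G (half (Z + X))))) =
  bint mu (fun Y => cis (-1 * sf X Y) *: (ip (xi (F3 G' Y)) (xi (psiL f G)) : R[i]^o)).
Proof.
move=> hf sG nG'.
have sX := sch_twist sG X (Omega := Omega).
have nT := nice_tw X nG'.
have E0 := weak_identity hf sX nT.
have -> : (fun Z => ka X Z *: G (half (Z + X))) = (fun Z => cis (- sf X (half Z)) *: G (half Z + half X)).
  by apply/funext => Z; rewrite scalerDr sformZr /kappa [_ / 2]mulrC.
rewrite E0; apply: (@eq_bint R _ _ mu R[i]^o) => Y.
have nL : nice (Lf f G) := rieffel_nice hOmega hTheta hf sG.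
have nP : nice (psiL f G) by exact: nice_half.
have [C3 [a3 b3 d3]] := F3_family nG'.
have n3 : nice (F3 G' Y) := family_nice a3 d3 Y.
have -> : (fun Z => (hh Y * ka Y Z) *: Lf f (fun U => cis (- sf X U) *: G (U + half X)) (half (Z + Y))) =
    (fun Z => (hh Y * (ka Y Z * cis (- sf X (half (Z + Y))))) *: Lf f G (half (Z + (Y + X)))).
  apply/funext => Z; rewrite (rieffel_op_twist hOmega hTheta X _ hf sG) scalerA -mulrA.
  by rewrite -scalerDr -addrA.
have nK : nice (fun Z => (hh Y * (ka Y Z * cis (- sf X (half (Z + Y))))) *: Lf f G (half (Z + (Y + X)))).
  have -> : (fun Z => (hh Y * (ka Y Z * cis (- sf X (half (Z + Y))))) *: Lf f G (half (Z + (Y + X)))) =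
      (fun Z => hh Y *: (ka Y Z *: ((cis (sf (- X) (half (Z + Y))) : R[i]^o) *: Lf f G (half (Z + (Y + X)))))).
    by apply/funext => Z; rewrite !scalerA mulrA sformNl.
  apply: nice_scale; apply: (nice_mul (C := 1)); first exact: ka_cont1.
    by move=> Z; rewrite rnorm_cis.
  apply: (nice_mul (C := 1)).
  - by apply: cts_cisf; [exact: cst_continuous|exact: cts_half_add].
  - by move=> Z; rewrite rnorm_cis.
  exact: (nice_half_add (Y + X) nL).
rewrite xip// xip//.
have nb := nice_star_mul n3 nP.
have nb2 := nice_scale (cis (-1 * sf X Y)) nb.
rewrite -(linZ oml); apply: (congr1 om).
rewrite -(bint_haarZ cA _ (nice_good hmu nb)) -[RHS](bint_haar_translate cA (Y + X) (nice_good hmu nb2)).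
apply: eq_bint => Z.
rewrite /tw /F3 /psiL; move: (Lf f G (half (Z + (Y + X)))) => v.
rewrite !cstarZ !cmulZl !cmulZr !scalerA conjCK.
rewrite (_ : Z + (Y + X) - Y = Z + X); last by rewrite -addrA [Y + X]addrC addrK.
apply: (congr1 (fun c => c *: _)).
rewrite /kappa -!cisN.
rewrite [LHS](_ : _ = hh Y * (cis (- - (sf X Z / 2)) * cis (- (sf Y Z / 2)) * cis (- sf X (half (Z + Y))))); last by ring.
rewrite [RHS](_ : _ = hh Y * (cis (-1 * sf X Y) * cis (- - (sf (- Y) (Z + (Y + X)) / 2)))); last by ring.
rewrite -!cisD; congr (_ * cis _).
rewrite !(sformDl, sformDr, sformNl, sformNr, sformZl, sformZr).
have := sformXX hOmega Y; have := sformC hOmega X Y; lra.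
Qed.

(** The Fourier transforms of the previous identity tend both to 0 and to the transform of Y |-> <F3
    G' Y, eta>, which therefore vanishes for every G'. *)
Lemma core_limit (F : nat -> A) G (eta : H) : (forall l, smooth_vector Theta (F l)) -> sch G ->
  (forall x, P (Mf (F l)) x @[l --> \oo] --> (0 : H)) ->
  xi (psiL (F l) G) @[l --> \oo] --> eta -> eta = 0.
Proof.
move=> hF sG hP heta.
have [B hB] : exists B : R, forall l, rnorm (xi (psiL (F l) G)) <= B.
  have /cvg_seq_rnormP/(_ _ ltr01)[K hK] := heta.
  exists (\sum_(l < K) rnorm (xi (psiL (F l) G)) + (rnorm eta + 1)) => l.
  have s0 : 0 <= \sum_(l < K) rnorm (xi (psiL (F l) G)) by apply: sumr_ge0 => i _; exact: rnorm_ge0.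
  have [lK|Kl] := ltnP l K.
    rewrite (bigD1 (Ordinal lK))//= -addrA lerDl addr_ge0 ?addr_ge0 ?rnorm_ge0//.
    by apply: sumr_ge0 => i _; exact: rnorm_ge0.
  rewrite -[leLHS]add0r lerD// -(subrK eta (xi _)) (le_trans (rnormD _ _))// addrC lerD2l.
  exact: hK.
have nP l : nice (psiL (F l) G) by apply: nice_half; exact: rieffel_nice.
have key G' : nice G' -> forall Y, ip (xi (F3 G' Y)) eta = 0.
  move=> nG'; have [C3 [a3 b3 d3]] := F3_family nG'.
  have n3 := xi_nice xiL xip omb a3 b3 d3.
  have [c3 _] := n3; have [D D0 hD] := nice_wt n3.
  have B0 : 0 <= B by exact: le_trans (rnorm_ge0 _) (hB 0%N).
  have cip x : continuous (fun Y => ip (xi (F3 G' Y)) x : R[i]^o).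
    by apply: cts_ip; exact: c3.
  have nphi x : nice (fun Y => ip (xi (F3 G' Y)) x : R[i]^o).
    split; first exact: cip.
    by exists (D * rnorm x) => Y; rewrite (le_trans (ip_CS _ _))// mulrAC ler_wpM2r ?rnorm_ge0.
  apply: (inj (nphi eta)) => X.
  have cX : continuous (fun Y => cis (-1 * sf X Y) : R[i]^o).
    by apply: cts_cis; apply: continuous_Rscale; exact: continuous_sform_r.
  have l1 : bint mu (fun Y => cis (-1 * sf X Y) *: (ip (xi (F3 G' Y)) (xi (psiL (F l) G)) : R[i]^o)) @[l --> \oo] -->
      bint mu (fun Y => cis (-1 * sf X Y) *: (ip (xi (F3 G' Y)) eta : R[i]^o)).
    apply: (bint_dct mB fB cB cR _ _ _ (integrable_wt hmu (D * B))).
    - by move=> l; apply: continuous_smeas; apply: continuousZc; [exact: cX|exact: cip].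
    - by apply: continuous_smeas; apply: continuousZc; [exact: cX|exact: cip].
    - by move=> Y; apply: cvgZc; [exact: cvg_cst|exact: cvg_ip].
    - move=> l Y; rewrite rnorm_cisZ (le_trans (ip_CS _ _))// mulrAC.
      by apply: ler_pM; rewrite ?rnorm_ge0.
  apply: (cvg_uniq l1).
  have -> : (fun l => bint mu (fun Y => cis (-1 * sf X Y) *: (ip (xi (F3 G' Y)) (xi (psiL (F l) G)) : R[i]^o))) =
      (fun l => k0 *: (ip (xi (tw X G')) (P (Mf (F l)) (xi (fun Z => ka X Z *: G (half (Z + X))))) : R[i]^o)).
    by apply/funext => l; rewrite -(twisted_identity X (hF l) sG nG').
  rewrite -(scaler0 _ k0); apply: cvgZc; first exact: cvg_cst.
  rewrite -(ip0r (xi (tw X G'))); apply: cvg_ip; exact: hP.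
have [Y0 hY0] := hh0.
(* For G' equal to a term of the sequence twisted by [tw Y0], the family [F3] at [Y0] undoes the
   twist up to the nonzero factor conj(hh Y0). *)
have orth k : ip (xi (psiL (F k) G)) eta = 0.
  have := key (tw Y0 (psiL (F k) G)) (nice_tw _ (nP k)) Y0.
  have -> : F3 (tw Y0 (psiL (F k) G)) Y0 = (fun Z => (hh Y0)^* *: psiL (F k) G Z).
    apply/funext => Z; rewrite /F3 /tw subrK; congr (_ *: _).
    rewrite scalerA /kappa -cisD (_ : _ + _ = 0) ?cis0 ?scale1r//.
    by rewrite sformNl sformBr (sformXX hOmega) subr0 mulNr opprK subrr.
  rewrite (xiZ xiL)// ipZl conjCK => /eqP; rewrite mulf_eq0 (negbTE hY0) => /eqP; exact.
apply/eqP; rewrite -rnorm_eq0 -sqrf_eq0 -Re_ip; apply/eqP.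
have : (ip eta (xi (psiL (F l) G)) : R[i]^o) @[l --> \oo] --> (ip eta eta : R[i]^o) by exact: cvg_ip.
under eq_fun do rewrite ip_conj orth conjC0.
move=> h0; have -> : ip eta eta = 0 by apply: (cvg_uniq h0); exact: cvg_cst.
by [].
Qed.

End core.

Section smooth_linear.
Context {R : realType} {m : nat} {V : normedModType R[i]}.
Implicit Types F G : 'rV[R]_m -> V.

Lemma pderivs_lin (a : R[i]) F G s : smooth F -> smooth G ->
  pderivs s (fun X => a *: F X + G X) = (fun X => a *: pderivs s F X + pderivs s G X).
Proof.
move=> [_ dF] [_ dG]; elim: s => [//|i s ih] /=; rewrite ih; apply/funext => X.
have h : diff_quot i (fun X => a *: pderivs s F X + pderivs s G X) X t @[t --> (0 : R)^'] -->
    a *: pderiv i (pderivs s F) X + pderiv i (pderivs s G) X.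
  have h1 := cvgD (cvgZc (@cvg_cst _ (a : R[i]^o) _ ((0 : R)^') _) (dF s i X)) (dG s i X).
  apply: (cvg_near_eq _ (h1 _ _ _)); apply: nearW => t.
  rewrite /diff_quot scalerA mulrC -scalerA -scalerDr; congr (_ *: _).
  by rewrite scalerBr addrACA -opprD.
exact: (cvg_lim (@norm_hausdorff _ V) h).
Qed.

Lemma smooth_lin (a : R[i]) F G : smooth F -> smooth G -> smooth (fun X => a *: F X + G X).
Proof.
move=> hF hG; split => [s|s i X]; rewrite pderivs_lin//.
  by apply: cts_add; [apply: cts_scale; exact: hF.1|exact: hG.1].
have h1 := cvgD (cvgZc (@cvg_cst _ (a : R[i]^o) _ ((0 : R)^') _) (hF.2 s i X)) (hG.2 s i X).
apply/cvg_ex; eexists; apply: (cvg_near_eq _ (h1 _ _ _)); apply: nearW => t.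
rewrite /diff_quot scalerA mulrC -scalerA -scalerDr; congr (_ *: _).
by rewrite scalerBr addrACA -opprD.
Qed.

End smooth_linear.

(** * Joint injectivity and the norm formula for a frame *)

Section injectivity.
Context {R : realType} {n : nat} {Omega : 'M[R]_(2 * n)}.
Hypothesis hOmega : symplectic Omega.
Local Notation Xi := 'rV[R]_(2 * n).
Local Notation sf := (sform Omega).
Local Notation mu := (dX Omega).
Local Notation ka := (kappa Omega).
Let hmu : haar mu := haar_dX Omega.
Let mB := @measurable_cball R (2 * n).
Let fB := cball_lty hmu.
Let cB := @cball_cover R (2 * n).
Local Notation ft c G := (@FT R n Omega _ unit c (fun=> G) tt).
Context {A : cstarAlgebra R} {Theta : Xi -> A -> A}.
Hypothesis hTheta : is_action Theta.
Let cA : cplt A := @cplt_complete R A.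
Implicit Types (X Y Z U W S : Xi) (a f g : A).
Local Notation half X := (2^-1 *: X).
Local Notation Lf f G := (rieffel_op Omega Theta f G).
Let s2 : (2 : R) != 0. Proof. by rewrite pnatr_eq0. Qed.
Let s2V : (2^-1 : R) != 0. Proof. by rewrite invr_eq0 pnatr_eq0. Qed.

Lemma smooth_vectorB f g : smooth_vector Theta f -> smooth_vector Theta g -> smooth_vector Theta (f - g).
Proof.
move=> hf hg; have := smooth_lin (-1) hg hf; rewrite /smooth_vector; congr smooth; apply/funext => X.
by rewrite scaleN1r addrC (linB (act_lin hTheta X)).
Qed.

Lemma rieffel_opB f g G X : sch G -> Lf (f - g) G X = Lf f G X - Lf g G X.
Proof.
move=> sG; rewrite !(rieffelE hOmega _ sG) -scalerBr; congr (_ *: _).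
have nG2 : nice (ft 2 G) by apply: sch_nice; exact: sch_FT.
have nQ a : nice (fun S => cis (2 * sf X S) *: cmul (Theta (X + S) a) (ft 2 G S)).
  split.
    apply: continuousZc; first by apply: cts_cis; apply: continuous_Rscale; exact: continuous_sform_r.
    apply: cts_cmul; last exact: nG2.1.
    by apply: (act_cont2 hTheta); [exact: cts_addl|exact: cst_continuous].
  have [_ [C hC]] := nG2; exists (rnorm a * C) => S; rewrite rnorm_cisZ.
  by rewrite (le_trans (rnormM_le _ _))// (rnorm_act hTheta) -mulrA ler_wpM2l ?rnorm_ge0.
rewrite -(bint_haarB cA (nice_good hmu (nQ f)) (nice_good hmu (nQ g))).
apply: (@eq_bint R _ _ mu A) => S.
by rewrite (linB (act_lin hTheta _)) cmulBl scalerBr.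
Qed.

Lemma module_norm_ge0 G : 0 <= module_norm Omega (A := A) G.
Proof. exact: sqrtr_ge0. Qed.

Lemma module_norm_sq G : module_norm Omega (A := A) G ^+ 2 = rnorm (bint mu (fun X => cmul (cstar (G X)) (G X))).
Proof. by rewrite sqr_sqrtr// rnorm_ge0. Qed.

Let sc : R := (`|2^-1 : R| ^+ (2 * n))^-1.
Let sc0 : 0 < sc. Proof. by rewrite invr_gt0 exprn_gt0// normr_gt0. Qed.

Lemma module_norm_psiL f G : smooth_vector Theta f -> sch G ->
  rnorm (bint mu (fun X => cmul (cstar (psiL (Omega := Omega) (Theta := Theta) f G X)) (psiL (Omega := Omega) (Theta := Theta) f G X))) =
  sc * module_norm Omega (Lf f G) ^+ 2.
Proof.
move=> hf sG; have nL := rieffel_nice hOmega hTheta hf sG; have nn := nice_star_mul nL nL.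
have E := bint_affine hmu 0 s2V cA (nice_good hmu nn).
rewrite module_norm_sq; have : rnorm (bint mu ((fun X => cmul (cstar (Lf f G X)) (Lf f G X)) \o (fun X => half X + 0))) =
  sc * rnorm (bint mu (fun X => cmul (cstar (Lf f G X)) (Lf f G X))).
  apply: (etrans (congr1 (@rnorm R A) E)); rewrite rnormZr; apply: (congr1 (fun z => z * _)).
  exact: (ger0_norm (ltW sc0)).
move=> <-; apply: (congr1 (@rnorm R A)); apply: (@eq_bint R _ _ mu A) => X.
by rewrite /psiL /= addr0.
Qed.

Variables (B : cstarAlgebra R) (iota : A -> B).
Hypothesis hB : is_rieffel_algebra Omega Theta iota.

Lemma iotaB f g : smooth_vector Theta f -> smooth_vector Theta g -> iota (f - g) = iota f - iota g.
Proof.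
move=> hf hg; case: hB => /(_ (-1) g f hg hf) + _ _ _ _.
by rewrite !scaleN1r addrC => ->; rewrite addrC.
Qed.

Lemma module_norm_le f G : smooth_vector Theta f -> schwartz G -> module_norm Omega G <= 1 ->
  module_norm Omega (Lf f G) <= rnorm (iota f).
Proof.
move=> hf sG G1; rewrite -lee_fin; case: hB => _ _ _ /(_ f hf) -> _.
by apply: ereal_sup_ubound; exists G.
Qed.

Lemma smooth_approx (b : B) : exists f : nat -> A, (forall l, smooth_vector Theta (f l)) /\
  iota (f l) @[l --> \oo] --> b.
Proof.
have cl : closure (iota @` smooth_vector Theta) b by case: hB => _ _ _ _ ->.
have H l : exists f, smooth_vector Theta f /\ rnorm (iota f - b) <= l.+1%:R^-1.
  have l0 : 0 < (l.+1%:R^-1 : R) by rewrite invr_gt0.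
  have : nbhs b [set y | rnorm (y - b) <= l.+1%:R^-1].
    have /cvg_rnormP := @cvg_id _ (nbhs b); exact.
  by move=> /cl[_ [[f hf <-] h]]; exists f.
have [f hf] := choice H; exists f; split; first by move=> l; have [] := hf l.
apply: (cvg_squeeze_rnorm (g := fun l => l.+1%:R^-1)); first by move=> l; have [] := hf l.
exact: cvg_harmonic.
Qed.

Variables (C : cstarAlgebra R) (j : (Xi -> A) -> C).
Variables (h : Xi -> R[i]^o) (M : B -> C).
Hypotheses (hw : is_window Omega h) (hM : is_modulation_map Omega Theta iota j h M).

Variables (I : Type) (H : I -> hilbertSpace R) (xi : forall i, (Xi -> A) -> H i) (om : I -> A -> R[i]^o)
  (psi : forall i, C -> H i -> H i).
Hypotheses (xiL : forall i (a : R[i]) F G, nice F -> nice G ->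
     @xi i (fun X => a *: F X + G X) = a *: @xi i F + @xi i G)
  (xip : forall i F G, nice F -> nice G ->
     ip (@xi i F) (@xi i G) = om i (bint mu (fun X => cmul (cstar (F X)) (G X))))
  (oml : forall i, linear (om i)) (omb : forall i a, rnorm (om i a) <= rnorm a)
  (hpsi : forall i, is_star_rep (@psi i))
  (psiE : forall i F G, sch F -> nice G -> @psi i (j F) (@xi i G) =
     bint mu (fun Y => @xi i (fun Z => ka Y Z *: cmul (Theta (Z + half Y) (F Y)) (G (Z + Y)))))
  (det : forall F (t : R), nice F -> 0 <= t -> (forall i, rnorm (@xi i F) ^+ 2 <= t) ->
     rnorm (bint mu (fun X => cmul (cstar (F X)) (F X))) <= t).

(** The frame vectors of L_{f_l} G form a Cauchy sequence, their limit vanishes, and the supremum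
    over G returns the Rieffel norm of f_l. *)
Lemma modulation_injective (b : B) : (forall i x, @psi i (M b) x = 0) -> b = 0.
Proof.
move=> hb; have [f [hf fb]] := smooth_approx b.
have sh : sch h by case: hw => /schwartz_sch.
have shh := window_hat_sch hOmega hw.
have [k0 [k00 inv inj]] := window_fourier hOmega hw.
have hh0 := window_hat_neq0 hw.
have [hM1 hM2] := hM; have Mc := morphism_contractive hM1; have [Ml _ _] := hM1.
have nP l G : sch G -> nice (psiL (Omega := Omega) (Theta := Theta) (f l) G).
  by move=> sG; apply: nice_half; exact: rieffel_nice.
have Pz i x : @psi i (j (modulation Omega Theta h (f l))) x @[l --> \oo] --> (0 : H i).
  have fb0 : rnorm (iota (f l) - b) @[l --> \oo] --> (0 : R) by apply/cvg_rnorm0P.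
  apply: (cvg_squeeze_rnorm (g := fun l => rnorm (iota (f l) - b) * rnorm x)).
    move=> l; rewrite -hM2// subr0.
    have -> : @psi i (M (iota (f l))) x = @psi i (M (iota (f l) - b)) x.
      by rewrite (linB Ml) (repB (hpsi i)) hb subr0.
    by rewrite (le_trans (rep_contractive (hpsi i) _ _))// ler_wpM2r ?rnorm_ge0.
  by rewrite -[X in _ --> X](mul0r (rnorm x)); exact: cvgMl.
have sqc r : (Num.sqrt sc * r) ^+ 2 = sc * r ^+ 2 by rewrite exprMn sqr_sqrtr// ltW.
(* The Rieffel norm of f_k - f_l controls L_{f_k} G - L_{f_l} G; the number [sc] is the Jacobian of
   the halving in [psiL]. *)
have xd i k l G : schwartz G -> module_norm Omega G <= 1 ->
    rnorm (@xi i (psiL (Omega := Omega) (Theta := Theta) (f k) G) - @xi i (psiL (Omega := Omega) (Theta := Theta) (f l) G)) <=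
    Num.sqrt sc * rnorm (iota (f k) - iota (f l)).
  move=> sG G1; have sG' := schwartz_sch sG.
  have hd := smooth_vectorB (hf k) (hf l).
  have nd : nice (psiL (Omega := Omega) (Theta := Theta) (f k - f l) G) by apply: nice_half; exact: rieffel_nice.
  rewrite -(xiB (@xiL i) (nP k G sG') (nP l G sG')).
  have -> : (fun X => psiL (Omega := Omega) (Theta := Theta) (f k) G X - psiL (Omega := Omega) (Theta := Theta) (f l) G X) =
      psiL (Omega := Omega) (Theta := Theta) (f k - f l) G.
    by apply/funext => X; rewrite /psiL rieffel_opB.
  rewrite -(@ler_pXn2r _ 2)// ?nnegrE ?mulr_ge0 ?rnorm_ge0 ?sqrtr_ge0//.
  apply: (le_trans (xi_norm (@xip i) (@omb i) nd)).
  rewrite (module_norm_psiL hd sG') sqc; apply: ler_wpM2l; first exact: ltW sc0.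
  rewrite -(iotaB (hf k) (hf l)); apply: lerXn2r; rewrite ?nnegrE ?rnorm_ge0 ?module_norm_ge0//.
  exact: module_norm_le.
have fbP := fb; move/cvg_seq_rnormP : fbP => fbP.
have ib k l : rnorm (iota (f k) - iota (f l)) <= rnorm (iota (f k) - b) + rnorm (iota (f l) - b).
  by rewrite -(subrKA b) (le_trans (rnormD _ _))// [rnorm (b - _)]rnormB.
have xz i G : schwartz G -> module_norm Omega G <= 1 ->
    @xi i (psiL (Omega := Omega) (Theta := Theta) (f l) G) @[l --> \oo] --> (0 : H i).
  move=> sG G1; have sG' := schwartz_sch sG.
  have /cvg_ex[eta heta] : cvg (@xi i (psiL (Omega := Omega) (Theta := Theta) (f l) G) @[l --> \oo]).
    apply: cauchy_seq_cvg => e e0.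
    have q0 : 0 < Num.sqrt sc by rewrite sqrtr_gt0.
    have e1 : 0 < e / 2 / Num.sqrt sc by rewrite !divr_gt0.
    have [K hK] := fbP _ e1; exists K => k l kK lK; apply: (le_trans (xd i k l G sG G1)).
    rewrite mulrC -ler_pdivlMr//; apply: (le_trans (ib k l)).
    have := lerD (hK _ kK) (hK _ lK).
    have -> : e / 2 / Num.sqrt sc + e / 2 / Num.sqrt sc = e / Num.sqrt sc by rewrite -mulrDl -splitr.
    exact.
  have e0 := core_limit hOmega hTheta (@xiL i) (@xip i) (@oml i) (@omb i) sh shh inv inj hh0
    (P := fun F => @psi i (j F)) (@psiE i) hf sG' (Pz i) heta.
  by rewrite -e0.
(* For each G, [det] reduces the module norm of L_{f_k} G to the frame vectors; these are compared
   with those of f_l for l tending to infinity, which tend to 0, so only the distance from f_k to b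
   is left. *)
have bound k : rnorm (iota (f k)) <= rnorm (iota (f k) - b).
  rewrite -lee_fin; case: hB => _ _ _ /(_ _ (hf k)) -> _; apply: ge_ereal_sup => _ [G [sG G1] <-].
  rewrite lee_fin -(@ler_pXn2r _ 2)// ?nnegrE ?rnorm_ge0 ?module_norm_ge0//.
  rewrite -(ler_pM2l sc0) -module_norm_psiL//; last exact: schwartz_sch.
  apply: det; [by apply: nP; exact: schwartz_sch|by rewrite mulr_ge0 ?exprn_ge0 ?rnorm_ge0 ?(ltW sc0)|].
  move=> i; rewrite -sqc.
  rewrite lerXn2r ?nnegrE ?mulr_ge0 ?rnorm_ge0 ?sqrtr_ge0//.
  apply/ler_addgt0Pr => e e0.
  have e20 : 0 < e / 2 by rewrite divr_gt0.
  have q0 : 0 < Num.sqrt sc by rewrite sqrtr_gt0.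
  have e1 : 0 < e / 2 / Num.sqrt sc by rewrite divr_gt0.
  have /cvg_seq_rnormP/(_ _ e20)[K1 hK1] := xz i G sG G1.
  have [K2 hK2] := fbP _ e1; pose l := maxn K1 K2.
  have h1 := hK1 l (leq_maxl _ _); have h2 := hK2 l (leq_maxr _ _).
  rewrite subr0 in h1.
  rewrite -(subrK (@xi i (psiL (Omega := Omega) (Theta := Theta) (f l) G)) (@xi i _)) (le_trans (rnormD _ _))//.
  apply: (le_trans (lerD (xd i k l G sG G1) h1)).
  apply: (@le_trans _ _ (Num.sqrt sc * (rnorm (iota (f k) - b) + e / 2 / Num.sqrt sc) + e / 2)).
    by rewrite lerD2r ler_wpM2l ?(ltW q0)// (le_trans (ib k l))// lerD2l.
  rewrite mulrDr [Num.sqrt sc * (e / 2 / _)]mulrC divfK ?gt_eqF// -addrA -splitr.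
  exact: lexx.
have : iota (f l) @[l --> \oo] --> (0 : B).
  apply: (cvg_squeeze_rnorm (g := fun l => rnorm (iota (f l) - b))); first by move=> l; rewrite subr0.
  exact/cvg_rnorm0P.
exact: cvg_uniq fb.
Qed.

Lemma modulation_isometric (b : B) (t : R) : 0 <= t ->
  (forall i x, rnorm (@psi i (M b) x) <= t * rnorm x) -> rnorm b <= t.
Proof.
move=> t0 bt; have [[Ml Mm Ms] _] := hM.
apply: (@rep_isometric_family R B I H (fun i b => @psi i (M b))) => //; last exact: modulation_injective.
move=> i; have [p1 p2 p3 p4] := hpsi i; split.
- by move=> c; exact: p1.
- by move=> a c d x; rewrite Ml p2.
- by move=> c d x; rewrite Mm p3.
- by move=> c; rewrite Ms; exact: p4.
Qed.

End injectivity.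

Section opnorm.
Context {R : realType} {H : hilbertSpace R}.

Lemma opnorm_le (S : H -> H) (t : R) : (forall x, rnorm (S x) <= t * rnorm x) -> 0 <= t -> (opnorm S <= t%:E)%E.
Proof.
move=> h t0; apply: ge_ereal_sup => _ [x x1 <-]; rewrite lee_fin (le_trans (h x))//.
by rewrite ler_piMr.
Qed.

Lemma opnorm_ge (S : H -> H) (t : R) : linear S -> (opnorm S <= t%:E)%E -> forall x, rnorm (S x) <= t * rnorm x.
Proof.
move=> lS h x; have [->|x0] := eqVneq x 0; first by rewrite (lin0 lS) !rnorm0 mulr0.
have xp : 0 < rnorm x by rewrite lt_def rnorm_eq0 x0 rnorm_ge0.
have : ((rnorm (S (((rnorm x)^-1%:C)%C *: x)))%:E <= t%:E)%E.
  apply: le_trans h; apply: ereal_sup_ubound; eexists; last reflexivity.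
  by rewrite /= rnormZr ger0_norm ?invr_ge0 ?rnorm_ge0// mulVf ?gt_eqF.
by rewrite (linZ lS) rnormZr ger0_norm ?invr_ge0 ?rnorm_ge0// lee_fin mulrC ler_pdivrMr.
Qed.

Lemma opnorm_ge0 (S : H -> H) : (0 <= opnorm S)%E.
Proof.
apply: (@le_trans _ _ (rnorm (S 0))%:E); first by rewrite lee_fin rnorm_ge0.
by apply: ereal_sup_ubound; exists 0 => //=; rewrite rnorm0.
Qed.

End opnorm.

(** * The representation induced by a faithful representation *)

Section induced.
Context {R : realType} {n : nat} {Omega : 'M[R]_(2 * n)}.
Hypothesis hOmega : symplectic Omega.
Local Notation Xi := 'rV[R]_(2 * n).
Local Notation mu := (dX Omega).
Local Notation ka := (kappa Omega).
Let hmu : haar mu := haar_dX Omega.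
Let cR := @cplt_complex R.
Let mB := @measurable_cball R (2 * n).
Let fB := cball_lty hmu.
Let cB := @cball_cover R (2 * n).
Local Notation half X := (2^-1 *: X).
Context {A : cstarAlgebra R} {Theta : Xi -> A -> A}.
Hypothesis hTheta : is_action Theta.
Let cA : cplt A := @cplt_complete R A.

Lemma nice_square_integrable (K : hilbertSpace R) (Phi : Xi -> K) : nice Phi -> square_integrable Omega Phi.
Proof.
move=> nP; have [S [aS _ _]] := good_approx mB fB cB (nice_good hmu nP).
split; first by exists S; case: aS.
have [C C0 hC] := nice_bounded nP; have [_ [D hD]] := nP.
have /integrableP[_] := integrable_wt hmu (C * D).
apply: le_lt_trans; apply: lint_le => X; rewrite ?lee_fin ?exprn_ge0 ?rnorm_ge0//=.
rewrite (le_trans _ (ler_norm _))// expr2 -mulrA.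
by apply: ler_pM; rewrite ?rnorm_ge0.
Qed.

Lemma sch_L1 (F : Xi -> A) : sch F -> bochner_integrable mu F.
Proof. by move=> sF; apply: (good_integrable mB fB cB); apply: nice_good => //; exact: sch_nice. Qed.

Variables (K : hilbertSpace R) (rho : A -> K -> K).
Hypotheses (hrho : is_star_rep rho) (rho_inj : injective rho).
Variables (H : hilbertSpace R) (cls : (Xi -> K) -> H) (r : A -> H -> H) (T : Xi -> H -> H).
Hypotheses (hL2 : is_L2 Omega cls) (hind : is_induced Omega Theta cls rho r T).

Lemma rep_nice (F : Xi -> A) v : nice F -> nice (fun X => rho (F X) v).
Proof.
move=> [cF [C hC]]; split.
  apply: (@cts_comp _ _ _ _ _ (fun a => rho a v) cF) => a.
  apply: (cvg_squeeze_rnorm (g := fun b => rnorm (b - a) * rnorm v)).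
    by move=> b; rewrite -(repB hrho) rep_contractive.
  by rewrite -[X in _ --> X](mul0r (rnorm v)); apply: cvgMl; apply/cvg_rnorm0P; exact: cvg_id.
exists (C * rnorm v) => X; rewrite (le_trans (rep_contractive hrho _ _))// mulrAC.
by rewrite ler_wpM2r ?rnorm_ge0.
Qed.

Definition ind_xi (v : K) (F : Xi -> A) : H := cls (fun X => rho (F X) v).
Definition ind_om (v w : K) (a : A) : R[i]^o := ip v (rho a w).

Lemma ind_xiL v (a : R[i]) F G : nice F -> nice G ->
  ind_xi v (fun X => a *: F X + G X) = a *: ind_xi v F + ind_xi v G.
Proof.
move=> nF nG; case: hL2 => + _ _.
move=> /(_ a _ _ (nice_square_integrable (rep_nice v nF)) (nice_square_integrable (rep_nice v nG))) <-.
by congr cls; apply/funext => X; rewrite (repD hrho) (repZ hrho).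
Qed.

Lemma ind_oml v w : linear (ind_om v w).
Proof. by move=> a f g; rewrite /ind_om (repD hrho) (repZ hrho) ipDr ipZr. Qed.

Lemma ind_omb v w a : rnorm (ind_om v w a) <= rnorm v * rnorm w * rnorm a.
Proof.
rewrite (le_trans (ip_CS _ _))// -mulrA ler_wpM2l ?rnorm_ge0// mulrC.
exact: rep_contractive.
Qed.

Lemma ind_xip v w F G : nice F -> nice G ->
  ip (ind_xi v F) (ind_xi w G) = ind_om v w (bint mu (fun X => cmul (cstar (F X)) (G X))).
Proof.
move=> nF nG; case: hL2 => _ + _.
move=> /(_ _ _ (nice_square_integrable (rep_nice v nF)) (nice_square_integrable (rep_nice w nG))) ->.
have nn := nice_star_mul nF nG.
have oD : forall x y, ind_om v w (x + y) = ind_om v w x + ind_om v w y := linD (ind_oml v w).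
have oZ : forall (t : R) x, ind_om v w ((t%:C)%C *: x) = (t%:C)%C *: ind_om v w x by move=> t x; rewrite (linZ (ind_oml v w)).
have E := @bint_bounded R _ _ mu A R[i]^o _ mB fB cB cA cR _ _ oD oZ (ind_omb v w) _ (nice_good hmu nn).
apply: etrans E; apply: (@eq_bint R _ _ mu R[i]^o) => X.
by rewrite /ind_om /= (repM hrho) (rep_adj' hrho).
Qed.

Variables (C : cstarAlgebra R) (j : (Xi -> A) -> C) (psi : C -> H -> H).
Hypothesis hint : is_integrated_form Omega Theta j r T psi.

Lemma ind_psiE v F G : sch F -> nice G -> psi (j F) (ind_xi v G) =
  bint mu (fun Y => ind_xi v (fun Z => ka Y Z *: cmul (Theta (Z + half Y) (F Y)) (G (Z + Y)))).
Proof.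
move=> sF nG; case: hint => _ /(_ F _ (sch_L1 sF)) ->.
apply: (@eq_bint R _ _ mu H) => Y; rewrite /ind_xi.
have nP := rep_nice v nG.
have [_ ->] := hind (nice_square_integrable nP).
have nP2 : nice (fun X => ka Y X *: rho (G (X + Y)) v).
  have -> : (fun X => ka Y X *: rho (G (X + Y)) v) = (fun X => rho (tw (Omega := Omega) Y G X) v).
    by apply/funext => X; rewrite /tw (repZ hrho).
  exact: rep_nice (nice_tw Y nG).
have [-> _] := hind (nice_square_integrable nP2).
congr cls; apply/funext => Z.
by rewrite (actD hTheta) (repZ hrho) (repM hrho) (linZ (rep_lin hrho _)).
Qed.

(** Set b to be the integral of F^* F. The matrix coefficient <y, rho(b) x> is the product of two
    frame vectors, hence at most t |x| |y|; a faithful representation being isometric, |b| <= t. *)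
Lemma ind_det F (t : R) : nice F -> 0 <= t ->
  (forall v, rnorm v <= 1 -> rnorm (ind_xi v F) ^+ 2 <= t) ->
  rnorm (bint mu (fun X => cmul (cstar (F X)) (F X))) <= t.
Proof.
move=> nF t0 ht.
have xb v : rnorm (ind_xi v F) <= Num.sqrt t * rnorm v.
  have [->|v0] := eqVneq v 0.
    rewrite rnorm0 mulr0.
    have E : ip (ind_xi 0 F) (ind_xi 0 F) = 0 by rewrite ind_xip// /ind_om ip0l.
    by move: E; rewrite ip_rnorm => /(congr1 (fun z : R[i] => complex.Re z)) /= /eqP; rewrite sqrf_eq0 => /eqP ->; rewrite lexx.
  have vp : 0 < rnorm v by rewrite lt_def rnorm_eq0 v0 rnorm_ge0.
  pose w := ((rnorm v)^-1%:C)%C *: v.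
  have w1 : rnorm w <= 1 by rewrite rnormZr ger0_norm ?invr_ge0 ?rnorm_ge0// mulVf ?gt_eqF.
  have vw : v = ((rnorm v)%:C)%C *: w by rewrite /w scalerA -(rmorphM (real_complex R)) mulfV ?gt_eqF// scale1r.
  (* Homogeneity in v is derived from the inner product formula, [rho] being linear in its vector
     argument. *)
  have E : rnorm (ind_xi v F) = rnorm v * rnorm (ind_xi w F).
    apply/eqP; rewrite -(@eqrXn2 _ 2)// ?mulr_ge0 ?rnorm_ge0// exprMn -(Re_ip (ind_xi v F)) -(Re_ip (ind_xi w F)) !ind_xip// {1 2}vw /ind_om.
    by rewrite (linZ (rep_lin hrho _)) ipZr ipZl mulrA conj_Creal ?complex_real// -(rmorphM (real_complex R)) -expr2; apply/eqP; case: (ip _ _) => x y /=; rewrite mul0r subr0.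
  rewrite E mulrC ler_wpM2r ?rnorm_ge0// -[leLHS]ger0_norm ?rnorm_ge0// -sqrtr_sqr ler_wsqrtr//.
  exact: ht.
apply: (rep_isometric hrho) => //.
  move=> a ha; apply: rho_inj; apply/funext => x.
  by rewrite ha (rep0 hrho).
move=> x; apply: rnorm_le_ip; first by rewrite mulr_ge0 ?rnorm_ge0.
move=> y; have := ind_xip y x nF nF; rewrite /ind_om => <-.
apply: (le_trans (ip_CS _ _)); apply: (le_trans (ler_pM (rnorm_ge0 _) (rnorm_ge0 _) (xb y) (xb x))).
by rewrite mulrACA -expr2 sqr_sqrtr// [rnorm y * _]mulrC mulrA.
Qed.

Variables (B : cstarAlgebra R) (iota : A -> B).
Hypothesis hB : is_rieffel_algebra Omega Theta iota.

Theorem induced_isometric (h : Xi -> R[i]^o) (M : B -> C) :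
  is_window Omega h -> is_modulation_map Omega Theta iota j h M ->
  forall f : B, (rnorm f)%:E = opnorm (psi (M f)).
Proof.
move=> hw hM f; have [hM1 _] := hM; have Mc := morphism_contractive hM1.
have [hpsi _] := hint.
have le1 : (opnorm (psi (M f)) <= (rnorm f)%:E)%E.
  apply: opnorm_le; last exact: rnorm_ge0.
  by move=> x; rewrite (le_trans (rep_contractive hpsi _ _))// ler_wpM2r ?rnorm_ge0.
apply/le_anti; rewrite le1 andbT.
have fin : opnorm (psi (M f)) \is a fin_num.
  by rewrite ge0_fin_numE ?opnorm_ge0//; apply: le_lt_trans le1 _; exact: ltry.
rewrite -(fineK fin) lee_fin.
(* The unit ball as index set makes the functionals <v, rho(a) v> contractive, as a frame
   requires. *)
pose I := {v : K | rnorm v <= 1}.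
apply: (@modulation_isometric R n Omega hOmega A Theta hTheta B iota hB C j h M hw hM I (fun=> H)
  (fun v => ind_xi (projT1 v)) (fun v => ind_om (projT1 v) (projT1 v)) (fun=> psi)).
- by move=> v a F G; exact: ind_xiL.
- by move=> v F G; exact: ind_xip.
- by move=> v; exact: ind_oml.
- move=> [v v1] a /=; rewrite (le_trans (ind_omb _ _ _))// ler_piMl ?rnorm_ge0//.
  by rewrite mulr_ile1 ?rnorm_ge0.
- by [].
- by move=> v F G; exact: ind_psiE.
- by move=> F t nF t0 ht; apply: ind_det => // v v1; exact: (ht (exist _ v v1)).
- by apply: fine_ge0; exact: opnorm_ge0.
move=> _ x; apply: opnorm_ge; last by rewrite fineK.
exact: rep_lin.
Qed.

End induced.

(** * States *)

Section hahn_banach.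
Context {R : realType} {V : lmodType R[i]}.
Local Notation "t %:K" := ((t%:C)%C : R[i]) (at level 2, format "t %:K").
Variables (S : V -> R -> Prop) (b : V) (beta : R).
Hypotheses (SD : forall x y s t, S x s -> S y t -> S (x + y) (s + t))
  (SZ : forall (a : R) x t, 0 < a -> S x t -> S (a%:K *: x) (a * t))
  (S00 : S 0 0) (Sex : forall x, exists t, S x t)
  (Sb : forall (a t : R), S (a%:K *: b) t -> a * beta <= t).

Let graph (G : set (V * R)) :=
  [/\ forall (a : R) x s y t, G (x, s) -> G (y, t) -> G (a%:K *: x + y, a * s + t),
      forall x s t, G (x, s) -> S x t -> s <= t &
      forall p, G p -> G (b, beta)].

Let graph_extend (G : set (V * R)) (x0 : V) : graph G -> G (b, beta) ->
  exists2 G', graph G' & G `<=` G' /\ exists s, G' (x0, s).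
Proof.
move=> [gl gd gb] Gb.
have G0 : G (0, 0).
  by have := gl (-1) _ _ _ _ Gb Gb; rewrite rmorphN1 scaleN1r mulN1r !addNr.
have gz (a : R) x s : G (x, s) -> G (a%:K *: x, a * s).
  by move=> /(gl a)/(_ G0); rewrite !addr0.
(* Domination forces the value at [x0] to be at least every u - t with S (x - x0) t and at most
   every t - u with S (x + x0) t; the supremum of the lower bounds is chosen. *)
pose Y := [set z | exists x u t, [/\ G (x, u), S (x - x0) t & z = u - t]].
have Yub x' u' t' : G (x', u') -> S (x' + x0) t' -> ubound Y (t' - u').
  move=> g' s' _ [x [u [t [g s ->]]]].
  have := gd _ _ (t + t') (gl 1 _ _ _ _ g g'); rewrite scale1r mul1r.
  have -> : x + x' = (x - x0) + (x' + x0) by rewrite addrACA addNr addr0.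
  by move=> /(_ (SD s s')); lra.
have Yn : Y !=set0.
  by have [t ht] := Sex (0 - x0); exists (0 - t), 0, 0, t.
have Yb : has_ubound Y.
  by have [t ht] := Sex (0 + x0); exists (t - 0); exact: (Yub 0).
pose al := sup Y.
exists [set p | exists x u (c : R), G (x, u) /\ p = (x + c%:K *: x0, u + c * al)]; last first.
  split; last by exists al; exists 0, 0, 1; rewrite scale1r mul1r !add0r.
  by move=> [x u] g; exists x, u, 0; rewrite scale0r mul0r !addr0.
split.
- move=> a _ _ _ _ [x [u [c [g [-> ->]]]]] [y [v [d [g' [-> ->]]]]].
  exists (a%:K *: x + y), (a * u + v), (a * c + d); split; first exact: gl.
  rewrite rmorphD rmorphM scalerDl scalerDr scalerA; congr pair; first by rewrite addrACA.
  by ring.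
- move=> _ _ s [x [u [c [g [-> ->]]]]] hs.
  have [c0|c0|c0] := ltgtP c 0; last first.
  + by move: hs; rewrite c0 scale0r mul0r !addr0; exact: gd.
  + have ci : 0 < c^-1 by rewrite invr_gt0.
    have := SZ ci hs; rewrite scalerDr scalerA -(rmorphM (real_complex R)) mulVf ?gt_eqF// scale1r.
    move=> /(Yub _ _ _ (gz c^-1 _ _ g)) /(ge_sup Yn); rewrite -/al -mulrBr.
    by rewrite mulrC ler_pdivlMr//; lra.
  + pose e := - c; have e0 : 0 < e by rewrite oppr_gt0.
    have ei : 0 < e^-1 by rewrite invr_gt0.
    have : Y (e^-1 * u - e^-1 * s).
      exists (e^-1%:K *: x), (e^-1 * u), (e^-1 * s); split => //; first exact: gz.
      have := SZ ei hs; rewrite scalerDr scalerA -(rmorphM (real_complex R)).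
      by rewrite -[c]opprK -/e mulrN mulVf ?gt_eqF// rmorphN1 scaleN1r.
    move=> /(ub_le_sup Yb); rewrite -/al -mulrBr mulrC ler_pdivrMr// /e.
    by lra.
- move=> _ _; exists b, beta, 0; split => //.
  by rewrite scale0r mul0r !addr0.
Qed.

(** The relation [S x t] stands for p(x) <= t with p sublinear; stating it as a relation avoids
    constructing p as an infimum. *)
Lemma hahn_banach : exists phi : V -> R,
  [/\ forall (a : R) x y, phi (a%:K *: x + y) = a * phi x + phi y,
      phi b = beta & forall x t, S x t -> phi x <= t].
Proof.
have [|G [gG mG]] := @Zorn_bigcup (V * R)%type graph.
  move=> F Fg Ft; split.
  - move=> a x s y t [G1 F1 g1] [G2 F2 g2].
    have [l|l] := Ft _ _ F1 F2; [exists G2 => //|exists G1 => //].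
      by have [h _ _] := Fg _ F2; apply: h => //; exact: l.
    by have [h _ _] := Fg _ F1; apply: h => //; exact: l.
  - by move=> x s t [G1 F1 g1]; have [_ h _] := Fg _ F1; exact: h.
  - by move=> p [G1 F1 g1]; exists G1 => //; have [_ _ h] := Fg _ F1; exact: (h p).
have Gb : G (b, beta).
  apply: contrapT => nb.
  have G0 : forall p, ~ G p by move=> p; case: gG => _ _ h /h.
  (* A maximal graph cannot be empty, because the line spanned by b carries a graph. *)
  apply: (mG [set p | exists a : R, p = (a%:K *: b, a * beta)]).
    split; first by move=> p /G0.
    by move=> /(_ (0%:K *: b, 0 * beta)) h; apply: (G0 (0%:K *: b, 0 * beta)); apply: h; exists 0.
  split.
  - move=> a _ _ _ _ [c [-> ->]] [d [-> ->]]; exists (a * c + d).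
    by rewrite rmorphD rmorphM scalerDl scalerA; congr pair; ring.
  - by move=> _ _ t [c [-> ->]]; exact: Sb.
  - by move=> _ _; exists 1; rewrite scale1r mul1r.
have Gt x : exists s, G (x, s).
  have [G' gG' [GG' [s Gs]]] := graph_extend x gG Gb.
  apply: contrapT => /forallNP nx; apply: (mG G') => //; split => //.
  by move=> /(_ _ Gs); exact: nx.
have [gl gd _] := gG.
have Gu x s t : G (x, s) -> G (x, t) -> s = t.
  have le u v : G (x, u) -> G (x, v) -> u <= v.
    move=> gu gv; have := gl (-1) _ _ _ _ gv gu.
    rewrite rmorphN1 scaleN1r addNr => /gd/(_ S00); by lra.
  by move=> gs gt; apply/le_anti; rewrite !le.
have /choice[phi hphi] : forall x, exists s, G (x, s) by [].
exists phi; split.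
- by move=> a x y; apply: (Gu _ _ _ (hphi _)); exact: gl.
- exact: (Gu _ _ _ (hphi _)).
- by move=> x t; exact: gd.
Qed.

End hahn_banach.

Section states.
Context {R : realType} {A : cstarAlgebra R}.
Local Notation rs t := (ucst (t%:C)%C : unz A).
Local Notation "t %:K" := ((t%:C)%C : R[i]) (at level 2, format "t %:K").

(** Normalization is relaxed to contractivity: the zero functional qualifies, so that states exist
    even when the algebra is zero. *)
Definition state (om : A -> R[i]^o) := [/\ linear om, forall a, rnorm (om a) <= rnorm a,
  forall a, om (cstar a) = (om a : R[i])^* &
  forall a, 0 <= (om (cmul (cstar a) a) : R[i])].

Let re (a : A) : A := (2^-1)%:K *: (a + cstar a).

Let reD a c : re (a + c) = re a + re c.
Proof. by rewrite /re cstarD addrACA scalerDr. Qed.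
Let reZ (t : R) a : re (t%:K *: a) = t%:K *: re a.
Proof. by rewrite /re cstarZ conj_Creal ?complex_real// -scalerDr !scalerA mulrC. Qed.
Let re_self a : cstar a = a -> re a = a.
Proof.
move=> e; rewrite /re e scalerDr -scalerDl -rmorphD/=.
by have -> : 2^-1 + 2^-1 = 1 :> R by [field]; rewrite scale1r.
Qed.
Let re_i a : cstar a = a -> re ('i *: a) = 0.
Proof. by move=> e; rewrite /re cstarZ e conjCi scaleNr subrr scaler0. Qed.
Let re_star a : cstar (re a) = re a.
Proof. by rewrite /re cstarZ conj_Creal ?complex_real// cstarD cstarK addrC. Qed.
Let re_le a : rnorm (re a) <= rnorm a.
Proof.
rewrite /re rnormZr ger0_norm ?invr_ge0//.
have := rnormD a (cstar a); rewrite rnorm_star; lra.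
Qed.

(** The dominating gauge does two things at once: it is at most the norm, which yields
    contractivity, and it vanishes on - a^* a, which yields positivity. *)
Lemma state_ex (b : A) : pos (uin b) -> exists2 om : A -> R[i]^o, state om & om b = (rnorm b)%:K.
Proof.
move=> pb; have bs : cstar b = b by apply: uin_inj; rewrite -ustar_uin; case: pb.
have p0 : pos (uin (0 : A)) by have := @pos_cst R A 0 (lexx 0); rewrite rs0.
(* [S a t]: the positive part of the real part of [a] has norm at most [t]. *)
pose S (a : A) (t : R) := 0 <= t /\ pos (rs t - uin (re a)).
have Snorm a : S a (rnorm a).
  split; first exact: rnorm_ge0.
  by apply: pos_of_nb; [rewrite ustar_uin re_star|rewrite nb_uin].
have [|||||phi [phiL phib phiS]] := @hahn_banach R A S b (rnorm b).
- move=> x y s t [s0 ps] [t0 pt]; split; first exact: addr_ge0.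
  by rewrite rsD reD uinD opprD addrACA; exact: posD.
- move=> a x t a0 [t0 pt]; split; first by rewrite mulr_ge0// ltW.
  by rewrite rsM reZ uinZ -scalerBr; apply: posZ => //; exact: ltW.
- by split => //; rewrite re_self ?cstar0// rs0 add0r -uinN oppr0.
- by move=> x; exists (rnorm x).
- move=> a t [t0]; rewrite reZ re_self// => pt.
  have [a0|a0] := leP a 0; first by apply: le_trans t0; exact: mulr_le0_ge0 a0 (rnorm_ge0 _).
  have : nb (uin (a%:K *: b)) t.
    by apply: pos_le => //; rewrite uinZ; apply: posZ => //; exact: ltW.
  by rewrite nb_uin rnormZr gtr0_norm.
have phi0 : phi 0 = 0 by have := phiL 1 0 0; rewrite scale1r mul1r addr0; lra.
have phiD x y : phi (x + y) = phi x + phi y by have := phiL 1 x y; rewrite scale1r mul1r.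
have phiZ (t : R) x : phi (t%:K *: x) = t * phi x by have := phiL t x 0; rewrite phi0 !addr0.
have phiN x : phi (- x) = - phi x by rewrite -mulN1r -phiZ rmorphN1 scaleN1r.
pose om (a : A) : R[i]^o := (phi a +i* (- phi ('i *: a)))%C.
have oml : linear om.
  move=> [p q] x y; apply/eqP; rewrite eq_complex/= /om.
  have E (z : A) : (p +i* q)%C *: z = p%:K *: z + q%:K *: ('i *: z).
    by rewrite scalerA -scalerDl; congr (_ *: _); apply/eqP; rewrite eq_complex/=; apply/andP; split; apply/eqP; ring.
  have -> : 'i *: ((p +i* q)%C *: x + y) = p%:K *: ('i *: x) - q%:K *: x + 'i *: y.
    rewrite scalerDr E scalerDr !scalerA; congr (_ *: _ + _ + _); first exact: mulrC.
    by rewrite mulrAC -expr2 sqrCi mulN1r scaleNr.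
  rewrite E !phiD phiN !phiZ.
  by apply/andP; split; apply/eqP; ring.
(* For self-adjoint a the real part of i a is 0, so the gauge vanishes at both i a and - i a; hence
   [om] is real on self-adjoint elements. *)
have sa a : cstar a = a -> phi ('i *: a) = 0.
  move=> e; have S0 z : re z = 0 -> phi z <= 0.
    by move=> r0; apply: phiS; split => //; rewrite r0 rs0 add0r -uinN oppr0.
  have h1 := S0 _ (re_i e).
  have : phi (- ('i *: a)) <= 0 by apply: S0; rewrite -scalerN re_i// cstarN e.
  by rewrite phiN => h2; lra.
exists om; last by rewrite /om sa// phib oppr0.
split=> // a.
- have [->|z0] := eqVneq (rnorm (om a)) 0; first exact: rnorm_ge0.
    have zp : 0 < rnorm (om a) by rewrite lt_def z0 rnorm_ge0.
    (* The phase that turns [om a] into its modulus, so that the bound for the real functional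
       applies to [u *: a]. *)
    pose u : R[i] := ((rnorm (om a))^-1)%:K * (om a : R[i])^*.
    have u1 : rnorm (u : R[i]^o) = 1.
      by rewrite rnormcM rnorm_real rnorm_conj ger0_norm ?invr_ge0 ?rnorm_ge0// mulVf.
    have ua : om (u *: a) = (rnorm (om a))%:K.
      rewrite (linZ oml) /u -[LHS]mulrA [_^* * _]mulrC -normCK (normr_rnorm (om a)) -rmorphXn -(rmorphM (real_complex R)).
      by rewrite expr2 mulrA mulVf// mul1r.
    have : phi (u *: a) <= rnorm (u *: a) by apply: phiS; exact: Snorm.
    by rewrite rnormZ u1 mul1r; move/(congr1 (fun z : R[i] => complex.Re z)): ua => /= ->.
- have ds c : phi (cstar c) = phi c.
      apply/eqP; rewrite -subr_eq0 -phiN -phiD.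
      have -> : cstar c - c = 'i *: ('i *: (c - cstar c)).
        by rewrite scalerA -expr2 sqrCi scaleN1r opprB.
      by apply/eqP/sa; rewrite cstarZ conjCi cstarB cstarK -[in RHS]opprB scalerN scaleNr.
    have -> : (om a : R[i])^* = (phi a +i* phi ('i *: a))%C by apply/eqP; rewrite eq_complex/= opprK !eqxx.
    by rewrite /om ds; congr (_ +i* _)%C; rewrite -[in RHS]ds cstarZ conjCi scaleNr phiN.
- have e : cstar (cmul (cstar a) a) = cmul (cstar a) a by rewrite cstarM cstarK.
  rewrite /om sa// oppr0 lecE/= eqxx/= -oppr_le0 -phiN; apply: phiS; split => //.
  rewrite re_self ?cstarN ?e// rs0 add0r -uinN opprK; exact: pos_cstar_mul.
Qed.

End states.

(** * Completion of a pre-Hilbert space *)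

(* The vectors are the elements of [pre_dom]; the form is extended by 0 in its
   first argument. *)
Record prehilbert (R : realType) := PreHilbert {
  pre_sort : lmodType R[i];
  pre_dom : set pre_sort;
  pre_form : pre_sort -> pre_sort -> R[i];
  pre_dom0 : pre_dom 0;
  pre_domL : forall a x y, pre_dom x -> pre_dom y -> pre_dom (a *: x + y);
  pre_formL : forall a x x' y, pre_dom x -> pre_dom x' ->
    pre_form y (a *: x + x') = a * pre_form y x + pre_form y x';
  pre_formC : forall x y, pre_dom x -> pre_dom y -> pre_form y x = (pre_form x y)^*;
  pre_form_ge0 : forall x, pre_dom x -> 0 <= pre_form x x;
  pre_form_off : forall x y, ~ pre_dom y -> pre_form y x = 0 }.

Lemma rnorm1 (R : realType) : rnorm (1 : R[i]^o) = 1.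
Proof. by rewrite -[1]/((1%:C)%C) rnorm_real normr1. Qed.

Section kernel.
Context {R : realType} (P : prehilbert R).
Local Notation E := (pre_sort P).
Local Notation D := (@pre_dom R P).
Local Notation k := (@pre_form R P).
Implicit Types (x y z : E) (u v w : E -> R[i]^o).

Lemma pre_domZ a x : D x -> D (a *: x).
Proof. by move=> dx; rewrite -[a *: x]addr0; apply: pre_domL => //; exact: pre_dom0. Qed.
Lemma pre_domB x y : D x -> D y -> D (x - y).
Proof. by move=> dx dy; rewrite addrC -scaleN1r; exact: pre_domL. Qed.
Lemma pre_form0 y : k y 0 = 0.
Proof. by have := pre_formL 1 y (pre_dom0 P) (pre_dom0 P); rewrite scale1r addr0 mul1r => /eqP; rewrite -subr_eq subrr eq_sym => /eqP. Qed.
Lemma pre_formZ a x y : D x -> k y (a *: x) = a * k y x.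
Proof. by move=> dx; rewrite -[a *: x]addr0 pre_formL// ?pre_form0 ?addr0//; exact: pre_dom0. Qed.
Lemma pre_formB x x' y : D x -> D x' -> k y (x - x') = k y x - k y x'.
Proof. by move=> dx dx'; rewrite addrC -scaleN1r pre_formL// mulN1r addrC. Qed.
Lemma pre_formLl a x x' y : D x -> D x' -> D y -> k (a *: x + x') y = a^* * k x y + k x' y.
Proof.
move=> dx dx' dy; rewrite pre_formC//; last exact: pre_domL.
by rewrite pre_formL// rmorphD rmorphM/= -!pre_formC.
Qed.

Definition pre_norm y : R := Num.sqrt (complex.Re (k y y)).
Local Notation q := pre_norm.

Lemma pre_norm_ge0 y : 0 <= q y. Proof. exact: sqrtr_ge0. Qed.

Lemma pre_norm_sq y : D y -> k y y = ((q y ^+ 2)%:C)%C.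
Proof.
move=> dy; have := pre_form_ge0 dy; rewrite lecE/= => /andP[/eqP i0 r0].
by rewrite sqr_sqrtr//; case: (k y y) i0 => a b /= ->.
Qed.

Lemma pre_norm_sqL (a : R[i]) x y : D x -> D y ->
  q (a *: x + y) ^+ 2 = q y ^+ 2 + 2 * complex.Re (a * k y x) + rnorm (a : R[i]^o) ^+ 2 * q x ^+ 2.
Proof.
move=> dx dy; have dz : D (a *: x + y) by exact: pre_domL.
have -> : q (a *: x + y) ^+ 2 = complex.Re (k (a *: x + y) (a *: x + y)) by rewrite pre_norm_sq.
rewrite pre_formL// !pre_formLl// mulrDr mulrA -normCK normr_rnorm !pre_norm_sq//.
rewrite (pre_formC dy dx) -rmorphM -!rmorphXn -rmorphM !raddfD/= addrC.
by case: (a * k y x) => c d /=; ring.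
Qed.

Lemma pre_CS x y : D x -> rnorm (k y x : R[i]^o) <= q y * q x.
Proof.
move=> dx; have [dy|dy] := pselect (D y); last first.
  by rewrite pre_form_off// rnorm0 mulr_ge0 ?pre_norm_ge0.
rewrite -(@ler_pXn2r _ 2)// ?nnegrE ?mulr_ge0 ?rnorm_ge0 ?pre_norm_ge0//.
rewrite exprMn; apply: disc_le; rewrite ?sqr_ge0// => t.
by rewrite -pre_norm_sqL ?sqr_ge0.
Qed.

Lemma pre_normL (a : R[i]) x y : D x -> D y -> q (a *: x + y) <= rnorm (a : R[i]^o) * q x + q y.
Proof.
move=> dx dy; rewrite -(@ler_pXn2r _ 2)// ?nnegrE ?addr_ge0 ?mulr_ge0 ?rnorm_ge0 ?pre_norm_ge0//.
rewrite pre_norm_sqL//.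
have : complex.Re (a * k y x) <= rnorm (a : R[i]^o) * (q y * q x).
  rewrite (le_trans (ler_norm _))// (le_trans (ler_Re_rnorm _))// rnormcM ler_wpM2l ?rnorm_ge0//.
  exact: pre_CS.
by rewrite sqrrD exprMn; lra.
Qed.

Definition app u x (e : R) := D x /\ forall y, rnorm (u y - k y x : R[i]^o) <= e * q y.
(* The vectors of the completion are represented by the antilinear functionals
   [u = fun y => <y, u>], which are the limits of the [fun y => k y x], uniformly
   with respect to the seminorm. *)
Definition in_hil u := forall e, 0 < e -> exists x, app u x e.

Lemma app_lin (a : R[i]) u v x y e e' : app u x e -> app v y e' ->
  app (a *: u + v) (a *: x + y) (rnorm (a : R[i]^o) * e + e').
Proof.
move=> [dx hx] [dy hy]; split; first exact: pre_domL.
move=> z; rewrite pre_formL//.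
have -> : (a *: u + v) z - (a * k z x + k z y) = a *: (u z - k z x : R[i]^o) + (v z - k z y).
  by rewrite scalerBr opprD addrACA.
rewrite (le_trans (rnormD _ _))// mulrDl lerD// rnormZ -mulrA.
by rewrite ler_wpM2l ?rnorm_ge0.
Qed.

Lemma app_le u x e e' : e <= e' -> app u x e -> app u x e'.
Proof. by move=> ee [dx hx]; split => // y; rewrite (le_trans (hx y))// ler_wpM2r ?pre_norm_ge0. Qed.

(** Both approximations are tested on the vector x - y itself, and one factor q (x - y) is divided
    out. *)
Lemma app_dist u x y e e' : 0 <= e -> 0 <= e' -> app u x e -> app u y e' -> q (x - y) <= e + e'.
Proof.
move=> e0 e0' [dx hx] [dy hy]; have dz := pre_domB dx dy.
have [->|z0] := eqVneq (q (x - y)) 0; first exact: addr_ge0.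
have zp : 0 < q (x - y) by rewrite lt_def z0 pre_norm_ge0.
rewrite -(ler_pM2r zp) -expr2.
have -> : q (x - y) ^+ 2 = rnorm (k (x - y) (x - y) : R[i]^o) by rewrite pre_norm_sq// rnorm_real ger0_norm ?sqr_ge0.
rewrite pre_formB// mulrDl.
set z := x - y; have -> : k z x - k z y = (u z - k z y) - (u z - k z x) by ring.
by rewrite (le_trans (rnormD _ _))// rnormN addrC lerD.
Qed.

Lemma app_form x : D x -> app (fun y => k y x) x 0.
Proof. by move=> dx; split => // y; rewrite subrr rnorm0 mul0r. Qed.

Lemma in_hil_form x : D x -> in_hil (fun y => k y x).
Proof. by move=> dx e e0; exists x; apply: app_le (app_form dx); exact: ltW. Qed.

Lemma in_hil_off u y : in_hil u -> ~ D y -> u y = 0.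
Proof.
move=> hu dy; have [x [dx]] := hu 1 ltr01.
move=> /(_ y); rewrite pre_form_off// /q pre_form_off// sqrtr0 mulr0 subr0 => h.
by apply/eqP; rewrite -rnorm_eq0 eq_le h rnorm_ge0.
Qed.

(** The restriction e <= 1 allows quadratic error terms to be absorbed into a linear one. *)
Lemma small_eq0 (z : R[i]) (C : R) : (forall e, 0 < e -> e <= 1 -> rnorm (z : R[i]^o) <= e * C) -> z = 0.
Proof.
move=> h; apply/eqP; rewrite -(@rnorm_eq0 R R[i]^o); apply: contrapT => /negP n0.
have n1 : 0 < rnorm (z : R[i]^o) by rewrite lt_def n0 rnorm_ge0.
have C1 : 0 < C by have := h 1 ltr01 (lexx _); rewrite mul1r; exact: lt_le_trans.
pose e := Num.min 1 (rnorm (z : R[i]^o) / (2 * C)).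
have e0 : 0 < e by rewrite lt_min ltr01 divr_gt0// mulr_gt0.
have := h e e0; rewrite ge_min lexx => /(_ isT).
have : e * (2 * C) <= rnorm (z : R[i]^o).
  by rewrite -ler_pdivlMr ?mulr_gt0// ge_min lexx orbT.
lra.
Qed.

Lemma in_hilL u (a : R[i]) x y : in_hil u -> D x -> D y -> u (a *: x + y) = a^* * u x + u y.
Proof.
move=> hu dx dy; apply/eqP; rewrite -subr_eq0; apply/eqP.
apply: (small_eq0 (C := q (a *: x + y) + (rnorm (a^* : R[i]^o) * q x + q y))) => e e0 _.
have [z [dz hz]] := hu e e0.
have -> : u (a *: x + y) - (a^* * u x + u y) = (u (a *: x + y) - k (a *: x + y) z)
    - (a^* * (u x - k x z) + (u y - k y z)) by rewrite pre_formLl//; ring.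
rewrite (le_trans (rnormD (_ : R[i]^o) _))// rnormN [leRHS]mulrDr lerD//.
rewrite (le_trans (rnormD (_ : R[i]^o) _))// [leRHS]mulrDr lerD// rnormcM mulrCA ler_wpM2l ?rnorm_ge0//.
Qed.

Lemma in_hil_submod : GRing.submod_closed [pred u : E -> R[i]^o | `[< in_hil u >]].
Proof.
split.
  apply/asboolP => e e0; exists 0; split; first exact: pre_dom0.
  move=> y; rewrite pre_form0 subr0 [leLHS](_ : _ = 0); last exact: rnorm0.
  by apply: mulr_ge0; [exact: ltW|exact: pre_norm_ge0].
move=> a u v /asboolP hu /asboolP hv; apply/asboolP => e e0.
pose t := rnorm (a : R[i]^o) + 1.
have t0 : 0 < t by rewrite ltr_wpDl ?rnorm_ge0.
have [x hx] := hu (e / t) (divr_gt0 e0 t0); have [y hy] := hv (e / t) (divr_gt0 e0 t0).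
exists (a *: x + y); apply: app_le (app_lin a hx hy).
by rewrite -[X in _ + X]mul1r -mulrDl -/t mulrC divfK ?gt_eqF.
Qed.

End kernel.

(** A sequence is drawn from members of the filter of radius 1/(k + 1); its limit is the limit of
    the filter. *)
Lemma cplt_cauchy (R : realType) (V : normedModType R[i]) : cplt V ->
  forall F : set_system V, ProperFilter F -> cauchy F -> cvg F.
Proof.
move=> cV F FF /cauchyP cF.
have rb (x y : V) (e : R) : ball x ((e%:C)%C : R[i]) y -> rnorm (x - y) < e.
  by rewrite -ball_normE /ball_ /= normr_rnorm ltcR.
have iv k : 0 < (k.+1%:R^-1 : R) by rewrite invr_gt0.
have /choice[u hu] : forall k : nat, exists x, F (ball x (((k.+1%:R^-1 : R)%:C)%C : R[i])).
  by move=> k; apply: cF; rewrite ltcR.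
have d k m : rnorm (u k - u m) <= k.+1%:R^-1 + m.+1%:R^-1.
  have [z [zk zm]] := filter_ex (filterI (hu k) (hu m)).
  have -> : u k - u m = (u k - z) - (u m - z) by rewrite opprB addrA subrK.
  by rewrite (le_trans (rnormD _ _))// rnormN lerD// ltW// rb.
have small (e : R) : 0 < e -> exists K, forall k, (K <= k)%N -> (k.+1%:R^-1 : R) <= e.
  move=> e0; exists (Num.truncn e^-1) => k Kk.
  rewrite -[e]invrK lef_pV2 ?posrE ?invr_gt0//.
  apply: ltW; apply: (lt_le_trans (truncnS_gt _)); by rewrite ler_nat.
have [e e0|l hl] := cV u.
  have [K hK] := small (e / 2) (divr_gt0 e0 (ltr0Sn _ 1)); exists K => k m Kk Km.
  by rewrite (le_trans (d k m))// [e]splitr lerD// hK.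
apply/cvg_ex; exists l; apply/(@cvg_rnormP R V V F _ id l) => e e0.
have e2 : 0 < e / 2 by rewrite divr_gt0.
have [K hK] := small _ e2; have /cvg_seq_rnormP /(_ _ e2)[L hL] := hl.
pose m := maxn K L.
apply: filterS (hu m) => z zm.
have -> : z - l = - (u m - z) + (u m - l) by rewrite opprB addrA subrK.
rewrite (le_trans (rnormD _ _))// rnormN [e]splitr lerD//; last by apply: hL; rewrite leq_maxr.
by apply: le_trans (hK m _); [apply: ltW; exact: rb|rewrite leq_maxl].
Qed.

Section hil.
Context {R : realType} (P : prehilbert R).
Local Notation E := (pre_sort P).
Local Notation D := (@pre_dom R P).
Local Notation k := (@pre_form R P).
Local Notation q := (@pre_norm R P).

Definition hil_pred : {pred E -> R[i]^o} := [pred u | `[< in_hil u >]].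
HB.instance Definition _ := GRing.isSubmodClosed.Build _ _ hil_pred (@in_hil_submod R P).
Record hil := Hil { hil_val :> E -> R[i]^o; hil_mem : hil_val \in hil_pred }.
HB.instance Definition _ := [isSub of hil for hil_val].
HB.instance Definition _ := [Choice of hil by <:].
HB.instance Definition _ := [SubChoice_isSubLmodule of hil by <:].

Lemma hilP (u : hil) : in_hil u. Proof. exact/asboolP/(hil_mem u). Qed.
Lemma hil_ext (u v : hil) : (forall y, D y -> u y = v y) -> u = v.
Proof.
move=> h; apply: val_inj; apply/funext => y /=; have [/h//|dy] := pselect (D y).
by rewrite (in_hil_off (hilP u) dy) (in_hil_off (hilP v) dy).
Qed.
Definition to_hil (u : E -> R[i]^o) : hil := insubd (0 : hil) u.
Lemma to_hilE u : in_hil u -> to_hil u = u :> (E -> R[i]^o).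
Proof. by move=> hu; rewrite /to_hil (@insubdK _ _ hil 0 u)//; exact/asboolP. Qed.

Definition hnorm (u : hil) : R := sup [set rnorm (u y : R[i]^o) | y in [set y | D y /\ q y <= 1]].

(** The upper bound is Cauchy-Schwarz; for the lower bound the functional is tested on x divided by
    q(x). *)
Lemma hnorm_app (u : hil) x e : 0 <= e -> app u x e -> `|hnorm u - q x| <= e.
Proof.
move=> e0 ux; have [dx hx] := ux; rewrite ler_distl.
have ub : ubound [set rnorm (u y : R[i]^o) | y in [set y | D y /\ q y <= 1]] (q x + e).
  move=> _ [y [dy qy] <-]; have -> : u y = k y x + (u y - k y x) by rewrite addrC subrK.
  rewrite (le_trans (rnormD (_ : R[i]^o) _))// lerD//.
    by rewrite (le_trans (pre_CS y dx))// ler_piMl ?pre_norm_ge0.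
  by rewrite (le_trans (hx y))// ler_piMr.
have ne : [set rnorm (u y : R[i]^o) | y in [set y | D y /\ q y <= 1]] !=set0.
  exists (rnorm (u 0 : R[i]^o)); exists 0 => //; split; first exact: pre_dom0.
  by rewrite /pre_norm pre_form0 sqrtr0.
rewrite ge_sup// andbT lerBlDr.
have [q0|q0] := eqVneq (q x) 0.
  rewrite q0; apply: addr_ge0 => //; case: ne => z hz.
  by apply: le_trans (ub_le_sup _ hz); [case: hz => y _ <-; exact: rnorm_ge0|exists (q x + e)].
have qp : 0 < q x by rewrite lt_def q0 pre_norm_ge0.
pose y := (((q x)^-1)%:C)%C *: x.
have dy : D y by exact: pre_domZ.
have qy : q y <= 1.
  have := pre_normL (((q x)^-1)%:C)%C dx (pre_dom0 P).
  rewrite addr0 [q 0](_ : _ = 0) ?addr0; last by rewrite /pre_norm pre_form0 sqrtr0.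
  by rewrite rnorm_real ger0_norm ?invr_ge0 ?pre_norm_ge0// mulVf.
have : rnorm (u y : R[i]^o) <= hnorm u by apply: ub_le_sup; [exists (q x + e)|exists y].
move=> h; rewrite -lerBlDr; apply: le_trans h.
have -> : q x = rnorm (k y x : R[i]^o).
  rewrite (pre_formC dx dy) /y pre_formZ// pre_norm_sq// -rmorphM rnorm_conj rnorm_real ger0_norm ?mulr_ge0 ?invr_ge0 ?sqr_ge0 ?pre_norm_ge0//.
  by rewrite expr2 mulrA mulVf// mul1r.
rewrite lerBlDr -lerBlDl (le_trans (ler_rnormB (_ : R[i]^o) _))// rnormB (le_trans (hx y))// ler_piMr//.
Qed.

Lemma hnorm_ge0 u : 0 <= hnorm u.
Proof.
apply/ler_addgt0Pr => e e0; have [x ux] := hilP u e0.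
have := hnorm_app (ltW e0) ux; rewrite ler_distl => /andP[h _].
by have := pre_norm_ge0 x; lra.
Qed.

Lemma hil_le (u : hil) y : rnorm (u y : R[i]^o) <= hnorm u * q y.
Proof.
apply/ler_addgt0Pr => d d0; pose e := d / (2 * (q y + 1)).
have qy := pre_norm_ge0 y.
have e0 : 0 < e by rewrite divr_gt0// mulr_gt0// ltr_wpDl.
have [x ux] := hilP u e0; have [dx hx] := ux.
have := hnorm_app (ltW e0) ux; rewrite ler_distl => /andP[h _].
have -> : u y = k y x + (u y - k y x) by rewrite addrC subrK.
rewrite (le_trans (rnormD (_ : R[i]^o) _))//.
apply: (@le_trans _ _ (q y * (hnorm u + e) + e * q y)).
  by apply: lerD => //; rewrite (le_trans (pre_CS y dx))// ler_wpM2l//; lra.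
have : e * (2 * (q y + 1)) = d by rewrite /e divfK// gt_eqF// mulr_gt0// ltr_wpDl.
by nra.
Qed.

Lemma hnormD u v : hnorm (u + v) <= hnorm u + hnorm v.
Proof.
apply/ler_addgt0Pr => d d0; pose e := d / 4; have e0 : 0 < e by rewrite divr_gt0.
have [x ux] := hilP u e0; have [y vy] := hilP v e0.
have uv : app (u + v : hil) (1 *: x + y) (1 * e + e).
  by have := app_lin 1 ux vy; rewrite scale1r -[in rnorm _ * _]/((1%:C)%C) rnorm_real normr1.
have := hnorm_app (_ : 0 <= 1 * e + e) uv; rewrite mul1r => /(_ (addr_ge0 (ltW e0) (ltW e0))).
have := hnorm_app (ltW e0) ux; have := hnorm_app (ltW e0) vy.
have := pre_normL 1 ux.1 vy.1; rewrite -[in rnorm _ * _]/((1%:C)%C) rnorm_real normr1 mul1r.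
rewrite !ler_distl /e => h1 /andP[h2 h3] /andP[h4 h5] /andP[h6 h7]; lra.
Qed.

Lemma hnormZ (a : R[i]) u : hnorm (a *: u) = rnorm (a : R[i]^o) * hnorm u.
Proof.
have le b v : hnorm (b *: v) <= rnorm (b : R[i]^o) * hnorm v.
  rewrite ge_sup//.
    exists (rnorm ((b *: v) 0 : R[i]^o)); exists 0 => //; split; first exact: pre_dom0.
    by rewrite /pre_norm pre_form0 sqrtr0.
  move=> _ [y [dy qy] <-]; rewrite [X in rnorm X](_ : _ = b *: (v y)) // rnormZ ler_wpM2l ?rnorm_ge0//.
  by rewrite (le_trans (hil_le v y))// ler_piMr ?hnorm_ge0.
have [->|a0] := eqVneq a 0.
  rewrite rnorm0 mul0r; apply/le_anti; rewrite hnorm_ge0 andbT.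
  by have := le 0 u; rewrite rnorm0 mul0r.
apply/le_anti; rewrite le/=.
have := le a^-1 (a *: u); rewrite scalerA mulVf// scale1r.
move=> /(ler_wpM2l (rnorm_ge0 (a : R[i]^o))); rewrite mulrA -rnormcM mulfV//.
by rewrite rnorm1 mul1r.
Qed.

Lemma hnorm_eq0 u : hnorm u = 0 -> u = 0.
Proof.
move=> h; apply: hil_ext => y _; apply/eqP; rewrite -(@rnorm_eq0 R R[i]^o).
by have := hil_le u y; rewrite h mul0r eq_le rnorm_ge0 andbT.
Qed.

Let hnormc (u : hil) : R[i] := ((hnorm u)%:C)%C.
Let hnormcD u v : hnormc (u + v) <= hnormc u + hnormc v.
Proof. by rewrite -rmorphD lecR; exact: hnormD. Qed.
Let hnormcZ (a : R[i]) u : hnormc (a *: u) = `|a| * hnormc u.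
Proof. by rewrite /hnormc hnormZ rmorphM (normr_rnorm (a : R[i]^o)). Qed.
Let hnormc0 u : hnormc u = 0 -> u = 0.
Proof. by case=> /hnorm_eq0. Qed.

HB.instance Definition _ := Lmodule_isNormed.Build R[i] hil hnormcD hnormcZ hnormc0.

Lemma hil_rnorm (u : hil) : rnorm u = hnorm u. Proof. by []. Qed.

(** Pointwise limits of functionals exist; convergence is uniform relative to the seminorm, so the
    limit is again approximable by vectors. *)
Lemma hil_complete (F : set_system hil) : ProperFilter F -> cauchy F -> cvg F.
Proof.
move=> FF cF; apply: cplt_cauchy => //.
move=> u cu; have pt y : exists l : R[i]^o, u n y @[n --> \oo] --> l.
  apply: cauchy_complex_cvg => e e0; pose d := e / (q y + 1).
  have qy := pre_norm_ge0 y; have qy1 : 0 < q y + 1 by rewrite ltr_wpDl.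
  have [K hK] := cu d (divr_gt0 e0 qy1); exists K => a b Ka Kb.
  rewrite [X in rnorm X](_ : _ = (u a - u b) y)//.
  rewrite (le_trans (hil_le _ _))//; apply: (@le_trans _ _ (d * q y)).
    by rewrite ler_wpM2r//; exact: hK.
  have : d * (q y + 1) = e by rewrite divfK ?gt_eqF.
  by have := divr_gt0 e0 qy1; rewrite -/d; nra.
have /choice[l hl] := pt.
have close e : 0 < e -> exists K, forall n, (K <= n)%N -> forall y, rnorm (l y - u n y : R[i]^o) <= e * q y.
  move=> e0; have [K hK] := cu e e0; exists K => n Kn y.
  apply: (@rnorm_cvg_le R R[i]^o _ \oo _ (fun m => u m y - u n y)).
    exists K => // m Km; rewrite [X in rnorm X](_ : _ = (u m - u n) y)//.
    by rewrite (le_trans (hil_le _ _))// ler_wpM2r ?pre_norm_ge0//; exact: hK.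
  by apply: cvgB; [exact: hl|exact: cvg_cst].
have il : in_hil l.
  move=> e e0; have e2 : 0 < e / 2 by rewrite divr_gt0.
  have [K hK] := close _ e2; have [x [dx hx]] := hilP (u K) e2; exists x; split => // y.
  have -> : l y - k y x = (l y - u K y) + (u K y - k y x) by rewrite addrA subrK.
  rewrite (le_trans (rnormD (_ : R[i]^o) _))// [e]splitr mulrDl lerD//; exact: hK.
exists (to_hil l); apply/cvg_seq_rnormP => e e0; have [K hK] := close _ e0; exists K => n Kn.
rewrite hil_rnorm ge_sup//.
  exists (rnorm ((u n - to_hil l) 0 : R[i]^o)); exists 0 => //; split; first exact: pre_dom0.
  by rewrite /pre_norm pre_form0 sqrtr0.
move=> _ [y [dy qy] <-]; rewrite [X in rnorm X](_ : _ = u n y - to_hil l y)// to_hilE//.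
by rewrite (@rnormB R R[i]^o) (le_trans (hK _ Kn y))// ler_piMr// ltW.
Qed.

HB.instance Definition _ := Uniform_isComplete.Build hil hil_complete.

End hil.

Section inner.
Context {R : realType} (P : prehilbert R).
Local Notation E := (pre_sort P).
Local Notation D := (@pre_dom R P).
Local Notation k := (@pre_form R P).
Local Notation q := (@pre_norm R P).
Local Notation H := (hil P).
Implicit Types (u v w : H) (x y : E).

Let val_le v x y : D x -> D y -> rnorm (v x - v y : R[i]^o) <= hnorm v * q (x - y).
Proof.
move=> dx dy; rewrite (_ : v x - v y = v (x - y)); first exact: hil_le.
by rewrite [x - y]addrC -scaleN1r (in_hilL _ (hilP v))// rmorphN1 mulN1r addrC.
Qed.

(** The element v is the functional x |-> <x, v>, so <u, v> must be within e |v| of [v x] whenever x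
    approximates u within e. *)
Definition hip_spec u v (z : R[i]) := forall x e, 0 <= e -> app u x e ->
  rnorm (z - v x : R[i]^o) <= e * hnorm v.

Lemma hip_ex u v : exists z, hip_spec u v z.
Proof.
have iv (j : nat) : 0 < (j.+1%:R^-1 : R) by rewrite invr_gt0.
have /choice[s hs] : forall j : nat, exists x, app u x (j.+1%:R^-1) by move=> j; exact: (hilP u).
have n0 := hnorm_ge0 v.
have small (e : R) : 0 < e -> exists K, forall j, (K <= j)%N -> (j.+1%:R^-1 : R) <= e.
  move=> e0; exists (Num.truncn e^-1) => j Kj.
  rewrite -[e]invrK lef_pV2 ?posrE ?invr_gt0//.
  by apply: ltW; apply: (lt_le_trans (truncnS_gt _)); rewrite ler_nat.
have [e e0|z hz] := @cauchy_complex_cvg R (fun j => v (s j)).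
  pose d := e / (2 * (hnorm v + 1)).
  have d0 : 0 < d by rewrite divr_gt0// mulr_gt0// ltr_wpDl.
  have de : d * (2 * (hnorm v + 1)) = e by rewrite divfK// gt_eqF// mulr_gt0// ltr_wpDl.
  have [K hK] := small d d0; exists K => a b Ka Kb.
  rewrite (le_trans (val_le v (hs a).1 (hs b).1))//.
  have h2 : q (s a - s b) <= 2 * d.
    apply: le_trans (app_dist (ltW (iv a)) (ltW (iv b)) (hs a) (hs b)) _.
    by rewrite mulr_natl mulr2n lerD// hK.
  by apply: le_trans (ler_wpM2l n0 h2) _; lra.
exists z => x e e0 ux; apply/ler_addgt0Pr => t t0.
pose d := t / (2 * (hnorm v + 1)).
have d0 : 0 < d by rewrite divr_gt0// mulr_gt0// ltr_wpDl.
have de : d * (2 * (hnorm v + 1)) = t by rewrite divfK// gt_eqF// mulr_gt0// ltr_wpDl.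
have [K hK] := small d d0.
have /(cvg_seq_rnormP (V := R[i]^o)) /(_ (t / 2)) := hz.
rewrite divr_gt0// => /(_ isT)[L hL]; pose j := maxn K L.
have -> : z - v x = - (v (s j) - z) + (v (s j) - v x) by ring.
rewrite (le_trans (rnormD (_ : R[i]^o) _))// (@rnormN R R[i]^o).
have h1 := hL j (leq_maxr _ _).
have h2 : q (s j - x) <= d + e.
  apply: le_trans (app_dist (ltW (iv j)) e0 (hs j) ux) _.
  by rewrite lerD2r hK// leq_maxl.
have := le_trans (val_le v (hs j).1 ux.1) (ler_wpM2l n0 h2); lra.
Qed.

Definition hip u v : R[i] := xget 0 [set z | hip_spec u v z].

Lemma hipP u v : hip_spec u v (hip u v).
Proof. by have [z hz] := hip_ex u v; exact: (xgetPex 0 (ex_intro _ z hz)). Qed.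

Lemma hip_char u v z (C : R) :
  (forall e, 0 < e -> e <= 1 -> exists2 x, app u x e & rnorm (z - v x : R[i]^o) <= e * C) ->
  hip u v = z.
Proof.
move=> h; apply/eqP; rewrite -subr_eq0; apply/eqP; apply: (small_eq0 (C := hnorm v + C)) => e e0 e1.
have [x ux hx] := h e e0 e1; have hp := hipP _ (ltW e0) ux.
have -> : hip u v - z = (hip u v - v x) - (z - v x) by ring.
by rewrite (le_trans (rnormD (_ : R[i]^o) _))// (@rnormN R R[i]^o) mulrDr lerD.
Qed.

Lemma hipD u v w : hip u (v + w) = hip u v + hip u w.
Proof.
apply: (@hip_char _ _ _ (hnorm v + hnorm w)) => e e0 _.
have [x ux] := hilP u e0; exists x => //.
rewrite [X in rnorm X](_ : _ = (hip u v - v x) + (hip u w - w x)); last by rewrite opprD addrACA.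
by rewrite (le_trans (rnormD (_ : R[i]^o) _))// mulrDr lerD//; exact: (hipP _ (ltW e0) ux).
Qed.

Lemma hipZ a u v : hip u (a *: v) = a * hip u v.
Proof.
apply: (@hip_char _ _ _ (rnorm (a : R[i]^o) * hnorm v)) => e e0 _.
have [x ux] := hilP u e0; exists x => //.
rewrite [X in rnorm X](_ : _ = a * (hip u v - v x)); last by rewrite mulrBr.
by rewrite rnormcM mulrCA ler_wpM2l ?rnorm_ge0//; exact: (hipP _ (ltW e0) ux).
Qed.

Let hip_form u v x y e : 0 <= e -> e <= 1 -> app u x e -> app v y e ->
  rnorm (hip u v - k x y : R[i]^o) <= e * (hnorm u + hnorm v + 1).
Proof.
move=> e0 e1 ux vy; have h := hipP v e0 ux; have [dy hy] := vy.
have := hnorm_app e0 ux; rewrite ler_distl => /andP[hn _].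
have -> : hip u v - k x y = (hip u v - v x) + (v x - k x y) by ring.
rewrite (le_trans (rnormD (_ : R[i]^o) _))//.
by have := hy x; have := hnorm_ge0 u; have := pre_norm_ge0 x; nra.
Qed.

Lemma hip_conj u v : hip v u = (hip u v)^*.
Proof.
apply/eqP; rewrite -subr_eq0; apply/eqP.
apply: (small_eq0 (C := 2 * (hnorm u + hnorm v + 1))) => e e0 e1.
have [x ux] := hilP u e0; have [y vy] := hilP v e0.
have h1 := hip_form (ltW e0) e1 ux vy; have h2 := hip_form (ltW e0) e1 vy ux.
have -> : hip v u - (hip u v)^* = (hip v u - k y x) - (hip u v - k x y)^*.
  by rewrite (pre_formC ux.1 vy.1) rmorphB /=; ring.
rewrite (le_trans (rnormD (_ : R[i]^o) _))// (@rnormN R R[i]^o) rnorm_conj.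
by move: h2; rewrite [hnorm v + _]addrC; lra.
Qed.

Lemma hip_norm u : hip u u = `|u| ^+ 2.
Proof.
rewrite normr_rnorm hil_rnorm -rmorphXn; apply/eqP; rewrite -subr_eq0; apply/eqP.
apply: (small_eq0 (C := (hnorm u + hnorm u + 1) + (2 * hnorm u + 1))) => e e0 e1.
have [x ux] := hilP u e0.
have h1 := hip_form (ltW e0) e1 ux ux.
have -> : hip u u - ((hnorm u ^+ 2)%:C)%C = (hip u u - k x x) + (((q x ^+ 2 - hnorm u ^+ 2) : R)%:C)%C.
  by rewrite rmorphB (pre_norm_sq ux.1); ring.
rewrite (le_trans (rnormD (_ : R[i]^o) _))// mulrDr lerD// rnorm_real.
have := hnorm_app (ltW e0) ux; rewrite ler_distl => /andP[h4 h5].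
have h2 := hnorm_ge0 u; have h3 := pre_norm_ge0 x.
rewrite ler_distl; apply/andP; split; last by nra.
by have [he|he] := leP e (hnorm u); nra.
Qed.

Definition hilbert : hilbertSpace R := @HilbertSpace R H hip hipD hipZ hip_conj hip_norm.

Definition hvec x : hilbert := to_hil (fun y => k y x).

Lemma hvecE x y : D x -> (hvec x : H) y = k y x.
Proof. by move=> dx; rewrite /hvec to_hilE//; exact: in_hil_form. Qed.

Lemma ip_hvec x (v : hilbert) : D x -> ip (hvec x) v = (v : H) x.
Proof.
move=> dx; have ux : app (hvec x : H) x 0 by split => // y; rewrite hvecE// subrr rnorm0 mul0r.
have := hipP v (lexx 0) ux; rewrite mul0r => h; apply/eqP.
by rewrite -subr_eq0 -(@rnorm_eq0 R R[i]^o) eq_le rnorm_ge0 andbT.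
Qed.

Lemma hvecL a x y : D x -> D y -> hvec (a *: x + y) = a *: hvec x + hvec y.
Proof.
move=> dx dy; apply: hil_ext => z dz; rewrite hvecE; last exact: pre_domL.
by rewrite pre_formL// [RHS](_ : _ = a * (hvec x : H) z + (hvec y : H) z)// !hvecE.
Qed.

Lemma hvec_dense (u : hilbert) e : 0 < e -> exists2 x, D x & rnorm (u - hvec x) <= e.
Proof.
move=> e0; have [x [dx hx]] := hilP (u : H) e0; exists x => //.
rewrite [leLHS]hil_rnorm ge_sup//.
  exists (rnorm ((u - hvec x : H) 0 : R[i]^o)); exists 0 => //; split; first exact: pre_dom0.
  by rewrite /pre_norm pre_form0 sqrtr0.
move=> _ [y [dy qy] <-]; rewrite [X in rnorm X](_ : _ = (u : H) y - (hvec x : H) y)// hvecE//.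
by rewrite (le_trans (hx y))// ler_piMr// ltW.
Qed.

(* [S] is the restriction of the adjoint of [hop S] to the dense subspace. *)
Definition hop (S : E -> E) (u : hilbert) : hilbert :=
  to_hil (fun y => if `[< D y >] then (u : H) (S y) else 0).

Definition is_op (S S' : E -> E) := [/\ forall x, D x -> D (S x), forall x, D x -> D (S' x),
  forall x y, D x -> D y -> k (S y) x = k y (S' x) &
  exists2 C : R, 0 <= C & forall y, D y -> q (S y) <= C * q y].

Section op.
Variables S S' : E -> E.
Hypothesis hS : is_op S S'.

Lemma hop_val (u : hilbert) y : D y -> (hop S u : H) y = (u : H) (S y).
Proof.
move=> dy; rewrite /hop to_hilE; first by rewrite asboolT.
have [hd hd' hk [C C0 hC]] := hS.
move=> e e0; have C1 : 0 < C + 1 by rewrite ltr_wpDl.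
have [x [dx hx]] := hilP (u : H) (divr_gt0 e0 C1); exists (S' x); split; first exact: hd'.
move=> z; case: asboolP => dz; last first.
  rewrite pre_form_off// subr0 [leLHS](_ : _ = 0); last exact: rnorm0.
  by rewrite mulr_ge0 ?pre_norm_ge0// ltW.
rewrite -hk// (le_trans (hx _))// (le_trans (y := e / (C + 1) * (C * q z)))//.
  by rewrite ler_wpM2l ?hC// ltW// divr_gt0.
have : e / (C + 1) * (C + 1) = e by rewrite divfK ?gt_eqF.
have : 0 < e / (C + 1) by rewrite divr_gt0.
by have := pre_norm_ge0 z; nra.
Qed.

Lemma hop_lin : linear (hop S).
Proof.
move=> a u v; apply: hil_ext => y dy; rewrite hop_val//.
by rewrite [RHS](_ : _ = a * (hop S u : H) y + (hop S v : H) y)// !hop_val.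
Qed.

Lemma hop_le (C : R) : (forall y, D y -> q (S y) <= C * q y) -> 0 <= C ->
  forall u, rnorm (hop S u) <= C * rnorm u.
Proof.
move=> hC C0 u; rewrite hil_rnorm ge_sup//.
  exists (rnorm ((hop S u : H) 0 : R[i]^o)); exists 0 => //; split; first exact: pre_dom0.
  by rewrite /pre_norm pre_form0 sqrtr0.
move=> _ [y [dy qy] <-]; rewrite hop_val// (le_trans (hil_le _ _))// mulrC ler_wpM2r ?hnorm_ge0//.
by rewrite (le_trans (hC y dy))// ler_piMr.
Qed.

Lemma hop_bounded : bounded_operator (hop S).
Proof.
split; first exact: hop_lin.
have [_ _ _ [C C0 hC]] := hS.
apply: (real_bounded_continuous (C := C)).
- exact: (linD hop_lin).
- by move=> t x; exact: (linZ hop_lin).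
- exact: hop_le.
Qed.

Lemma hop_hvec x : D x -> hop S (hvec x) = hvec (S' x).
Proof.
move=> dx; have [hd hd' hk _] := hS; apply: hil_ext => y dy.
rewrite hop_val// !hvecE//; [exact: hk|exact: hd'].
Qed.

End op.

(** On the dense vectors [hvec x] the relation is the definition of [hop]; both operators being
    bounded, it extends. *)
Lemma hop_adj S S' : is_op S S' -> is_op S' S -> is_adjoint (hop S') (hop S).
Proof.
move=> hS hS' u v; apply/eqP; rewrite -subr_eq0; apply/eqP.
have [hd _ _ [C C0 hC]] := hS; have [_ _ _ [C' C0' hC']] := hS'.
have b1 := hop_le hS hC C0; have b2 := hop_le hS' hC' C0'.
apply: (small_eq0 (C := (C' + C) * rnorm v)) => e e0 _.
have [x dx hx] := hvec_dense u e0.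
have -> : ip (hop S' u) v - ip u (hop S v) = ip (hop S' (u - hvec x)) v - ip (u - hvec x) (hop S v).
  rewrite (linB (hop_lin hS')) !ipBl (hop_hvec hS')// !ip_hvec//; last exact: hd.
  by rewrite (hop_val hS)// opprB addrA subrK.
rewrite (le_trans (rnormD (_ : R[i]^o) _))// (@rnormN R R[i]^o) mulrDl mulrDr.
apply: lerD; apply: le_trans (ip_CS _ _) _.
  apply: le_trans (ler_wpM2r (rnorm_ge0 v) (b2 _)) _.
  by rewrite mulrA ler_wpM2r ?rnorm_ge0// mulrC ler_wpM2r.
by apply: ler_pM; rewrite ?rnorm_ge0//; exact: b1.
Qed.

End inner.

(** * The covariant representation of a state *)

Lemma cvg_complex_ge0 (R : realType) (u : nat -> R[i]) (l : R[i]) :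
  (forall j, 0 <= u j) -> (u j : R[i]^o) @[j --> \oo] --> (l : R[i]^o) -> 0 <= l.
Proof.
move=> u0 /(cvg_seq_rnormP (V := R[i]^o)) hl.
have h (e : R) : 0 < e -> `|complex.Im l| <= e /\ - e <= complex.Re l.
  move=> e0; have [K hK] := hl e e0; have hd := hK K (leqnn _); have := u0 K.
  rewrite lecE => /andP[/eqP i0 r0].
  have := le_trans (ler_Im_rnorm _) hd; have := le_trans (ler_Re_rnorm _) hd.
  rewrite !raddfB/= i0 sub0r normrN ler_distl => /andP[_ h1] h2; split => //.
  by move: r0 h1 => /=; lra.
have i0 : complex.Im l = 0.
  apply/eqP; rewrite -normr_le0; apply/ler_addgt0Pr => e /h[h1 _]; by rewrite add0r.
rewrite lecE i0 eqxx/=; apply/ler_addgt0Pr => e /h[_ h2]; lra.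
Qed.

Section state_rep.
Context {R : realType} {n : nat} {Omega : 'M[R]_(2 * n)}.
Hypothesis hOmega : symplectic Omega.
Local Notation Xi := 'rV[R]_(2 * n).
Local Notation sf := (sform Omega).
Local Notation mu := (dX Omega).
Local Notation ka := (kappa Omega).
Local Notation tw := (tw (Omega := Omega)).
Let hmu : haar mu := haar_dX Omega.
Let cR := @cplt_complex R.
Let mB := @measurable_cball R (2 * n).
Let fB := cball_lty hmu.
Let cB := @cball_cover R (2 * n).
Context {A : cstarAlgebra R} {Theta : Xi -> A -> A}.
Hypothesis hTheta : is_action Theta.
Let cA : cplt A := @cplt_complete R A.

Variable om : A -> R[i]^o.
Hypothesis hom : state om.

Let oml : linear om. Proof. by case: hom. Qed.
Let omb a : rnorm (om a) <= rnorm a. Proof. by case: hom. Qed.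

(** Riemann sums with nonnegative coefficients reduce positivity under the integral to positivity of
    the functional on each c^* c. *)
Lemma state_bint_ge0 (F : Xi -> A) : nice F -> (forall X, exists c, F X = cmul (cstar c) c) ->
  0 <= (om (bint mu F) : R[i]).
Proof.
move=> nF hF; have [N [a [y [a0 [hr _]]]]] := riemann hmu.
have h := hr A F cA nF.
apply: (@cvg_complex_ge0 _ (fun j => om (\sum_i ((a j i)%:C)%C *: F (y j i)))).
  move=> j; rewrite (lin_sum oml) sumr_ge0// => i _.
  have [c ->] := hF (y j i); rewrite (linZ oml) mulr_ge0 ?lecR//.
  by case: hom.
apply: (@cvg_squeeze_rnorm R R[i]^o _ \oo _ _ _ (fun j => rnorm (\sum_i ((a j i)%:C)%C *: F (y j i) - bint mu F))).
  by move=> j; rewrite -(linB oml).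
exact/cvg_rnorm0P.
Qed.

Definition ker_form (y x : Xi -> A) : R[i] :=
  if `[< nice y >] then om (bint mu (fun X => cmul (cstar (y X)) (x X))) else 0.

Let nice_lin (a : R[i]) (x y : Xi -> A) : nice x -> nice y -> nice (a *: x + y).
Proof.
move=> nx ny; have := nice_sub ny (nice_scale (- a) nx).
by rewrite [X in nice X](_ : _ = a *: x + y)//; apply/funext => X; rewrite scaleNr opprK addrC.
Qed.

Let nice0 : nice (0 : Xi -> A).
Proof. by split; [exact: cst_continuous|exists 0 => X; rewrite mul0r [leLHS]rnorm0]. Qed.

Let ker_formE y x : nice y -> ker_form y x = om (bint mu (fun X => cmul (cstar (y X)) (x X))).
Proof. by move=> ny; rewrite /ker_form asboolT. Qed.

Let ker_formL a x x' y : nice x -> nice x' ->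
  ker_form y (a *: x + x') = a * ker_form y x + ker_form y x'.
Proof.
move=> nx nx'; have [ny|ny] := pselect (nice y); last by rewrite /ker_form asboolF// mulr0 addr0.
rewrite !ker_formE// -[a * _]/(a *: (om _ : R[i]^o)) -(linZ oml) -(linD oml); congr om.
have E := bint_haar_lin cA a (nice_good hmu (nice_star_mul ny nx)) (nice_good hmu (nice_star_mul ny nx')).
by apply: etrans E; apply: eq_bint => X; rewrite cmulDr cmulZr.
Qed.

Let ker_formC x y : nice x -> nice y -> ker_form y x = (ker_form x y)^*.
Proof.
move=> nx ny; have [_ _ hs _] := hom; rewrite (ker_formE _ ny) (ker_formE _ nx) -hs; congr om.
have -> : cstar (bint mu (fun X => cmul (cstar (x X)) (y X))) = bint mu (fun X => cstar (cmul (cstar (x X)) (y X))).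
  have LZ : forall (t : R) (a : A), cstar ((t%:C)%C *: a) = (t%:C)%C *: cstar a.
    by move=> t a; rewrite cstarZ conj_Creal ?complex_real.
  have LC : forall a : A, rnorm (cstar a) <= 1 * rnorm a by move=> a; rewrite rnorm_star mul1r.
  exact/esym/(bint_bounded mB fB cB cA cA (@cstarD R A) LZ LC (nice_good hmu (nice_star_mul nx ny))).
by apply: eq_bint => X; rewrite cstarM cstarK.
Qed.

Let ker_form_ge0 x : nice x -> 0 <= ker_form x x.
Proof.
move=> nx; rewrite ker_formE//; apply: state_bint_ge0; first exact: nice_star_mul.
by move=> X; exists (x X).
Qed.

Let ker_form_off x y : ~ nice y -> ker_form y x = 0.
Proof. by move=> ny; rewrite /ker_form asboolF. Qed.

Definition state_pre : prehilbert R := @PreHilbert R (Xi -> A) (@nice R (2 * n) A) ker_form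
  nice0 nice_lin ker_formL ker_formC ker_form_ge0 ker_form_off.
Local Notation P := state_pre.
Local Notation H := (hilbert P).
Local Notation q := (@pre_norm R P).

Lemma state_formE (y x : Xi -> A) : nice y -> @pre_form R P y x = om (bint mu (fun X => cmul (cstar (y X)) (x X))).
Proof. exact: ker_formE. Qed.

Lemma state_norm_sq (F : Xi -> A) : nice F ->
  ((q F ^+ 2)%:C)%C = om (bint mu (fun X => cmul (cstar (F X)) (F X))) :> R[i].
Proof. by move=> nF; exact: etrans (esym (@pre_norm_sq R P F nF)) (state_formE _ nF). Qed.

Lemma state_norm_le (F G : Xi -> A) (t : R) : 0 <= t -> nice F -> nice G ->
  (forall X, exists c, (t%:C)%C *: cmul (cstar (F X)) (F X) - cmul (cstar (G X)) (G X) = cmul (cstar c) c) ->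
  (q G : R) <= Num.sqrt t * q F.
Proof.
move=> t0 nF nG h.
have red (a b : R) (y z : R[i]) : 0 <= a -> 0 <= b -> ((b ^+ 2)%:C)%C = y -> ((a ^+ 2)%:C)%C = z ->
    z <= (t%:C)%C * y -> a <= Num.sqrt t * b.
  move=> a0 b0 <- <-; rewrite -rmorphM lecR => hab.
  by rewrite -(@ler_pXn2r _ 2)// ?nnegrE ?mulr_ge0 ?sqrtr_ge0// exprMn sqr_sqrtr.
apply: (red _ _ _ _ (pre_norm_ge0 _) (pre_norm_ge0 _) (state_norm_sq nF) (state_norm_sq nG)).
rewrite -[_ * om _]/(_ *: (om _ : R[i]^o)) -(linZ oml) -subr_ge0 -(linB oml).
have nFF := nice_star_mul nF nF; have nGG := nice_star_mul nG nG.
have E := bint_haarZ cA (t%:C)%C (nice_good hmu nFF).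
have nS := nice_scale (t%:C)%C nFF.
have E2 := bint_haarB cA (nice_good hmu nS) (nice_good hmu nGG).
have <- : bint mu (fun X => (t%:C)%C *: cmul (cstar (F X)) (F X) - cmul (cstar (G X)) (G X)) =
   (t%:C)%C *: bint mu (fun X => cmul (cstar (F X)) (F X)) - bint mu (fun X => cmul (cstar (G X)) (G X)).
  by apply: etrans E2 _; congr (_ - _); exact: E.
by apply: state_bint_ge0; first exact: nice_sub.
Qed.

Definition rS (f : A) (F : Xi -> A) (X : Xi) : A := cmul (Theta X f) (F X).

Lemma nice_rS f F : nice F -> nice (rS f F).
Proof.
move=> [cF [C hC]]; split.
  apply: (cts_cmul _ cF); exact: act_cont.
exists (rnorm f * C) => X; rewrite (le_trans (rnormM_le _ _))// (rnorm_act hTheta) -mulrA.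
by rewrite ler_wpM2l ?rnorm_ge0.
Qed.

(** With a = Theta_X(f) and g a square root of |f|^2 - a^* a in the unitization, |f|^2 F^* F - F^*
    a^* a F is (g F)^* multiplied by g F, pointwise. *)
Lemma rS_le f F : nice F -> (q (rS f F) : R) <= rnorm f * q F.
Proof.
move=> nF; rewrite -[rnorm f]ger0_norm ?rnorm_ge0// -sqrtr_sqr.
apply: state_norm_le; rewrite ?sqr_ge0//; first exact: nice_rS.
move=> X; pose a := Theta X f.
have [g [gs gg _ _]] : exists g : unz A, [/\ ustar g = g, g * g = ucst (((rnorm f ^+ 2)%:C)%C) - uin (cmul (cstar a) a), pos g &
    forall z, z * (ucst (((rnorm f ^+ 2)%:C)%C) - uin (cmul (cstar a) a)) = (ucst (((rnorm f ^+ 2)%:C)%C) - uin (cmul (cstar a) a)) * z -> z * g = g * z].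
  apply: pos_sqrt; apply: pos_of_nb; first by rewrite ustar_uin cstarM cstarK.
  by rewrite nb_uin rnormC (rnorm_act hTheta).
exists (uact g (F X)); rewrite uact_star gs gg /uact /rS/= cstarM.
rewrite cmulDr; apply/eqP; rewrite eq_sym; apply/eqP; congr (_ + _).
  rewrite subr0 [_%:A](_ : _ = ((rnorm f ^+ 2)%:C)%C) ?cmulZr//; exact: mulr1.
by rewrite scaler0 add0r cmulNl cmulNr !cmulA.
Qed.

Lemma is_op_rS f : is_op (P := P) (rS (cstar f)) (rS f).
Proof.
split; [exact: nice_rS|exact: nice_rS| |].
  move=> x y dx dy; rewrite (state_formE _ dy) (state_formE _ (nice_rS (cstar f) dy)).
  apply: (congr1 om); apply: (@eq_bint R _ _ mu A) => X.
  by rewrite /rS cstarM (act_star hTheta) cstarK cmulA.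
by exists (rnorm (cstar f)); [exact: rnorm_ge0|move=> y; exact: rS_le].
Qed.

Lemma kaE X Y : ka X Y = cis (- 2^-1 * sf X Y).
Proof. by rewrite /kappa mulNr mulrC. Qed.

Lemma ka_conj X Y : (ka X Y)^* = ka Y X.
Proof. by rewrite !kaE -cisN (sformC hOmega X Y) mulrN opprK. Qed.

Lemma twM X Y (F : Xi -> A) Z : tw X (tw Y F) Z = ka Y X *: tw (X + Y) F Z.
Proof.
rewrite /tw scalerA scalerA -addrA; congr (_ *: _); rewrite !kaE -!cisD; congr cis.
by rewrite sformDr sformDl; ring.
Qed.

Lemma tw0 (F : Xi -> A) Z : tw 0 F Z = F Z.
Proof. by rewrite /tw kaE -(scale0r (0 : Xi)) sformZl mul0r mulr0 cis0 scale1r scale0r addr0. Qed.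

Lemma twNK X (F : Xi -> A) Z : tw (- X) (tw X F) Z = F Z.
Proof. by rewrite twM addNr tw0 kaE sformNr (sformXX hOmega) oppr0 mulr0 cis0 scale1r. Qed.

Lemma is_op_tw X : is_op (P := P) (tw (- X)) (tw X).
Proof.
have key Y (x y : Xi -> A) : nice x -> nice y ->
    @pre_form R P (tw (- Y) y) x = @pre_form R P y (tw Y x).
  move=> nx ny; have nT : nice (tw (- Y) y) by exact: nice_tw.
  rewrite (state_formE _ ny) (state_formE _ nT); apply: (congr1 om).
  have E := bint_haar_translate cA Y (nice_good hmu (nice_star_mul nT nx)).
  apply: etrans (esym E) _; apply: (@eq_bint R _ _ mu A) => Z.
  rewrite /tw addrK cstarZ cmulZl cmulZr; congr (_ *: _).
  by rewrite ka_conj !kaE sformDl sformNr sformNr (sformXX hOmega) (sformC hOmega Z Y); congr cis; ring.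
split; [by move=> x; exact: nice_tw|by move=> x; exact: nice_tw|by move=> x y; exact: key|].
exists 1 => // y ny; rewrite mul1r.
suff -> : q (tw (- X) y) = q y by [].
apply: (congr1 (fun z => Num.sqrt (complex.Re z))).
have nT : nice (tw (- X) y) by exact: nice_tw.
apply: etrans (key X _ _ nT ny) _; apply: (congr1 (@pre_form R P y)).
by apply/funext => Z; have := twNK (- X) y Z; rewrite opprK.
Qed.

(** Since [hop] precomposes functionals, it acts on vectors by the adjoint; this accounts for the
    [cstar] here and for the sign in [state_T]. *)
Definition state_rep f (u : H) : H := hop (P := P) (rS (cstar f)) u.
Definition state_T X (u : H) : H := hop (P := P) (tw (- X)) u.

Let hv := @hvec R P.
Let repE f (u : H) (y : Xi -> A) : nice y -> (state_rep f u : hil P) y = (u : hil P) (rS (cstar f) y).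
Proof. by move=> ny; exact: (hop_val (is_op_rS f) u ny). Qed.
Let TE X (u : H) (y : Xi -> A) : nice y -> (state_T X u : hil P) y = (u : hil P) (tw (- X) y).
Proof. by move=> ny; exact: (hop_val (is_op_tw X) u ny). Qed.

Let is_op_rS' f : is_op (P := P) (rS f) (rS (cstar f)).
Proof. by have := is_op_rS (cstar f); rewrite cstarK. Qed.
Let is_op_tw' X : is_op (P := P) (tw X) (tw (- X)).
Proof. by have := is_op_tw (- X); rewrite opprK. Qed.

Lemma state_rep_hvec f (F : Xi -> A) : nice F -> state_rep f (hv F) = hv (rS f F).
Proof. by move=> nF; exact: (hop_hvec (is_op_rS f) nF). Qed.
Lemma state_T_hvec X (F : Xi -> A) : nice F -> state_T X (hv F) = hv (tw X F).
Proof. by move=> nF; exact: (hop_hvec (is_op_tw X) nF). Qed.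

Let hil_lin (u : H) (a : R[i]) (x y z : Xi -> A) : nice x -> nice y -> (forall X, z X = a *: x X + y X) ->
  (u : hil P) z = a^* * (u : hil P) x + (u : hil P) y.
Proof.
move=> nx ny hz; rewrite -(in_hilL a (hilP (u : hil P)) nx ny).
by apply: (congr1 (u : hil P)); apply/funext => X; exact: hz.
Qed.

Let hil_ext' (u v : H) : (forall y : Xi -> A, nice y -> (u : hil P) y = (v : hil P) y) -> u = v.
Proof. by move=> h; apply: (@hil_ext R P u v) => y; exact: h. Qed.

Lemma state_rep_star : is_star_rep state_rep.
Proof.
split.
- by move=> f; exact: (hop_bounded (is_op_rS f)).
- move=> a f g u; apply: hil_ext' => y ny.
  apply: etrans (repE _ _ ny) _.
  apply: etrans (@hil_lin u (a^*) (rS (cstar f) y) (rS (cstar g) y) _ (nice_rS _ ny) (nice_rS _ ny) _) _.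
    by move=> X; rewrite /rS cstarD cstarZ (linD (act_lin hTheta X)) (linZ (act_lin hTheta X)) cmulDl cmulZl.
  by rewrite conjCK -(repE f u ny) -(repE g u ny).
- move=> f g u; apply: hil_ext' => y ny.
  apply: etrans (repE _ _ ny) _; apply: etrans (esym (etrans (repE _ _ ny) (repE _ _ (nice_rS _ ny)))).
  apply: (congr1 (u : hil P)); apply/funext => X.
  by rewrite /rS cstarM (act_mul hTheta) cmulA.
- move=> f; rewrite /is_adjoint /state_rep cstarK; exact: (hop_adj (is_op_rS f) (is_op_rS' f)).
Qed.

Lemma state_T_mul X Y (u : H) : state_T X (state_T Y u) = ka Y X *: state_T (X + Y) u.
Proof.
apply: hil_ext' => y ny; have nX : nice (tw (- X) y) by exact: nice_tw.
apply: etrans (etrans (TE _ _ ny) (TE _ _ nX)) _.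
have n2 : nice (tw (- (X + Y)) y) by exact: nice_tw.
apply: etrans (@hil_lin u (ka X Y) (tw (- (X + Y)) y) 0 _ n2 nice0 _) _.
  move=> Z; rewrite twM -opprD [Y + X]addrC addr0; congr (_ *: _).
  by rewrite !kaE sformNl sformNr opprK.
have -> : (u : hil P) 0 = 0.
  have := @hil_lin u 1 0 0 0 nice0 nice0; rewrite conjC1 mul1r => /(_ (fun X => esym (etrans (addr0 _) (scaler0 _ _)))).
  by move/eqP; rewrite -subr_eq subrr eq_sym => /eqP.
by rewrite addr0 ka_conj -(TE (X + Y) u ny).
Qed.

Let T0 (u : H) : state_T 0 u = u.
Proof.
apply: hil_ext' => y ny; apply: etrans (TE _ _ ny) _.
by apply: (congr1 (u : hil P)); apply/funext => Z; rewrite oppr0 tw0.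
Qed.

Let TNK X (u : H) : state_T (- X) (state_T X u) = u.
Proof. by rewrite state_T_mul addNr T0 kaE sformNr (sformXX hOmega) oppr0 mulr0 cis0 scale1r. Qed.

Let T_lin X : linear (state_T X). Proof. exact: (hop_lin (is_op_tw X)). Qed.

Let T_ip X (u v : H) : ip (state_T X u) (state_T X v) = ip u v.
Proof.
have h := hop_adj (is_op_tw (- X)) (is_op_tw' (- X)).
have E (w : H) : hop (P := P) (tw (- X)) w = state_T X w by [].
by rewrite -{1}E h -[hop _ _]/(state_T (- X) (state_T X v)) TNK.
Qed.

Lemma state_T_unitary X : unitary_operator (state_T X).
Proof.
split; [exact: T_lin|exact: T_ip|].
by move=> y; exists (state_T (- X) y); have := TNK (- X) y; rewrite opprK.
Qed.

Let T_norm X (u : H) : rnorm (state_T X u) = rnorm u.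
Proof. by apply/eqP; rewrite -(@eqrXn2 _ 2)// ?rnorm_ge0// -!Re_ip T_ip. Qed.

Lemma state_covariant Y g (u : H) : state_T Y (state_rep g (state_T (- Y) u)) = state_rep (Theta Y g) u.
Proof.
apply: hil_ext' => y ny; have nX : nice (tw (- Y) y) by exact: nice_tw.
apply: etrans (etrans (TE _ _ ny) (etrans (repE _ _ nX) (TE _ _ (nice_rS _ nX)))) _.
apply: etrans (esym (repE _ _ ny)); apply: (congr1 (u : hil P)); apply/funext => Z.
have := twNK (- Y) (rS (Theta Y (cstar g)) y) Z; rewrite -(act_star hTheta) opprK => <-.
rewrite /tw /rS; congr (_ *: _); rewrite cmulZr; congr (_ *: cmul _ _).
by rewrite -(actD hTheta) addrNK.
Qed.

End state_rep.

Lemma cts_dense (R : realType) (P : topologicalType) (V : normedModType R[i]) (S : P -> V -> V) (D : set V) :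
  (forall p x y, rnorm (S p x - S p y) <= rnorm (x - y)) ->
  (forall x e, 0 < e -> exists2 y, D y & rnorm (x - y) <= e) ->
  (forall y, D y -> continuous (S ^~ y)) -> forall x, continuous (S ^~ x).
Proof.
move=> hS hD hc x p; apply/cvg_rnormP => e e0.
have e3 : 0 < e / 3 by rewrite divr_gt0.
have [y Dy xy] := hD x _ e3.
have /cvg_rnormP /(_ _ e3) := hc y Dy p; apply: filterS => p' hp.
have -> : S p' x - S p x = (S p' x - S p' y) + (S p' y - S p y) + (S p y - S p x).
  by rewrite !addrA subrK subrK.
have h1 := hS p' x y; have h2 := hS p y x; have h3 := rnormB x y.
rewrite (le_trans (rnormD _ _))// (le_trans (lerD (rnormD _ _) (lexx _)))//.
lra.
Qed.

Lemma closure_rnorm (R : realType) (V : normedModType R[i]) (S : set V) (x : V) :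
  (forall e, 0 < e -> exists2 y, S y & rnorm (x - y) <= e) -> closure S x.
Proof.
move=> h B /nbhs_ballP[d /= d0 hd].
have d1 : 0 < complex.Re d by move: d0; rewrite ltcE => /andP[].
have dE : d = ((complex.Re d)%:C)%C by rewrite RRe_real// gtr0_real.
have [y Sy xy] := h (complex.Re d / 2) (divr_gt0 d1 (ltr0Sn _ 1)).
exists y; split => //; apply: hd; rewrite -ball_normE /ball_/= normr_rnorm dE ltcR.
by apply: le_lt_trans xy _; rewrite ltr_pdivrMr// ltr_pMr// ltr1n.
Qed.

(** * Continuity and nondegeneracy for a state *)

Section state_rep2.
Context {R : realType} {n : nat} {Omega : 'M[R]_(2 * n)}.
Hypothesis hOmega : symplectic Omega.
Local Notation Xi := 'rV[R]_(2 * n).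
Local Notation sf := (sform Omega).
Local Notation mu := (dX Omega).
Local Notation ka := (kappa Omega).
Local Notation tw := (tw (Omega := Omega)).
Let hmu : haar mu := haar_dX Omega.
Let cR := @cplt_complex R.
Let mB := @measurable_cball R (2 * n).
Let fB := cball_lty hmu.
Let cB := @cball_cover R (2 * n).
Context {A : cstarAlgebra R} {Theta : Xi -> A -> A}.
Hypothesis hTheta : is_action Theta.
Let cA : cplt A := @cplt_complete R A.

(** An approximate unit for the finitely many values of a step function close to g; the remainder is
    not enlarged, because v |-> v - a v is a contraction. *)
Lemma approx_unit_nice (g : Xi -> A) (e : R) : nice g -> 0 < e -> exists a : A,
  (forall v, rnorm (v - cmul a v) <= rnorm v) /\
  (\int[mu]_X (rnorm (g X - cmul a (g X)))%:E <= e%:E)%E.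
Proof.
move=> ng e0; have e2 : 0 < e / 2 by rewrite divr_gt0.
have [S [[_ hS] _ _]] := good_approx mB fB cB (nice_good hmu ng).
have [K hK] : exists K, (inorm mu (g \- step_eval (S K)) <= (e / 2)%:E)%E.
  move: hS => /fine_cvgP[[K1 _ h3] /cvgrPdist_le/(_ _ e2)[K2 _ h4]]; exists (maxn K1 K2).
  have := h4 _ (leq_maxr K1 K2); rewrite /= sub0r normrN ger0_norm ?fine_ge0 ?inorm_ge0// => h5.
  have := h3 _ (leq_maxl K1 K2) => h6.
  by rewrite -[X in (X <= _)%E]fineK ?lee_fin.
(* [s1] has the same sets with all values 1: its integral M bounds the error accumulated over the
   sets, which fixes the tolerance [d]. *)
pose s := S K; pose s1 : step_fun mu R[i]^o := @StepFun _ _ _ mu R[i]^o (step_size s) (@step_set _ _ _ _ _ s) (fun=> 1) (@step_measurable _ _ _ _ _ s) (@step_finite _ _ _ _ _ s).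
have [fin1 _] := step_int_le s1.
pose M := fine (inorm mu (step_eval s1)).
have M0 : 0 <= M by apply: fine_ge0; exact: inorm_ge0.
have ME : inorm mu (step_eval s1) = M%:E by rewrite fineK// ge0_fin_numE// inorm_ge0.
pose d := e / (2 * (M + 1)); have d0 : 0 < d by rewrite divr_gt0// mulr_gt0// ltr_wpDl.
have [a [ha hb]] := approx_unit [seq step_val (s := s) i | i <- enum 'I_(step_size s)] d0.
exists a; split => //.
have zid (V : zmodType) (x y z w : V) : x - z = (x - y - (z - w)) + (y - w).
  by rewrite opprB addrAC [(x - y) + _]addrA subrK addrA subrK.
have gs := good_step s; have ng' := nice_good hmu ng.
have pt X : rnorm (g X - cmul a (g X)) <= rnorm ((g \- step_eval s) X) + rnorm (d%:C%C *: step_eval s1 X).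
  have -> : g X - cmul a (g X) = ((g \- step_eval s) X - cmul a ((g \- step_eval s) X)) +
      (step_eval s X - cmul a (step_eval s X)).
    by rewrite /= cmulBr; exact: zid.
  rewrite (le_trans (rnormD _ _))// lerD//.
  have lc : linear (cmul a) by move=> c x y; rewrite cmulDr cmulZr.
  rewrite /step_eval (lin_sum lc) -sumrB (le_trans (rnorm_sum _ _ _))// rnormZr gtr0_norm//.
  have -> : rnorm (\sum_(i < step_size s) ((\1_(step_set (s := s) i) X : R)%:C)%C *: (1 : R[i]^o)) =
      \sum_(i < step_size s) (\1_(step_set (s := s) i) X : R).
    rewrite (eq_bigr (fun i => ((\1_(step_set (s := s) i) X : R)%:C)%C : R[i]^o)); last by move=> i _; exact: mulr1.
    by rewrite -rmorph_sum rnorm_real ger0_norm// sumr_ge0.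
  rewrite mulr_sumr ler_sum// => i _; rewrite cmulZr -scalerBr rnormZr ger0_norm// mulrC ler_wpM2r//.
  by apply: hb; apply/mapP; exists i; rewrite ?mem_enum.
have m1 : smeas (g \- step_eval s) by apply: smeasB; [case: ng'|case: gs].
have m2 : smeas (fun X => d%:C%C *: step_eval s1 X) by apply: smeasZ; exact: smeas_step.
apply: (@le_trans _ _ (inorm mu (g \- step_eval s) + inorm mu (fun X => d%:C%C *: step_eval s1 X))%E).
  rewrite /inorm -ge0_integralD//; [|by move=> x _; rewrite lee_fin rnorm_ge0|exact: smeas_ernorm
     |by move=> x _; rewrite lee_fin rnorm_ge0|exact: smeas_ernorm].
  by apply: lint_le => X; rewrite ?lee_fin ?rnorm_ge0//; exact: pt.
rewrite inormZ; last exact: smeas_step.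
rewrite ME rnorm_real gtr0_norm// -EFinM [e]splitr EFinD leeD//.
rewrite lee_fin; have : d * (2 * (M + 1)) = e by rewrite divfK// gt_eqF// mulr_gt0// ltr_wpDl.
lra.
Qed.

Variable om : A -> R[i]^o.
Hypothesis hom : state om.
Local Notation P := (state_pre (Omega := Omega) hom).
Local Notation H := (hilbert P).
Local Notation hv := (@hvec R P).
Let oml : linear om. Proof. by case: hom. Qed.
Let omb a : rnorm (om a) <= rnorm a. Proof. by case: hom. Qed.

Lemma state_hvecL (a : R[i]) (F G : Xi -> A) : nice F -> nice G ->
  hv (fun X => a *: F X + G X) = a *: hv F + hv G.
Proof. by move=> nF nG; exact: (@hvecL R P a F G nF nG). Qed.

Lemma state_ip_hvec (F G : Xi -> A) : nice F -> nice G ->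
  ip (hv F) (hv G) = om (bint mu (fun X => cmul (cstar (F X)) (G X))).
Proof.
move=> nF nG; apply: etrans (@ip_hvec R P F (hv G) nF) _.
by apply: etrans (@hvecE R P G F nG) _; exact: state_formE.
Qed.

Let xi_norm' := xi_norm (xi := hv) state_ip_hvec omb.

Lemma state_hvec_sub (F G : Xi -> A) : nice F -> nice G ->
  rnorm (hv F - hv G) ^+ 2 <= rnorm (bint mu (fun X => cmul (cstar (F X - G X)) (F X - G X))).
Proof.
move=> nF nG; have nD := nice_sub nF nG; have := xi_norm' nD.
suff -> : hv (fun X => F X - G X) = hv F - hv G by [].
exact: (xiB state_hvecL nF nG).
Qed.

Let hv_dense (u : H) e : 0 < e -> exists2 v, [set hv F | F in @nice R (2 * n) A] v & rnorm (u - v) <= e.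
Proof. by move=> e0; have [F nF hF] := @hvec_dense R P u e e0; exists (hv F) => //; exists F. Qed.

Lemma state_T_cont (u : H) : continuous ((state_T (Omega := Omega) (hom := hom)) ^~ u).
Proof.
have lT X : linear (state_T (Omega := Omega) (hom := hom) X) by case: (state_T_unitary hOmega hom X).
have nT (X : Xi) v : rnorm (state_T (Omega := Omega) (hom := hom) X v) = rnorm v.
  have [_ h _] := state_T_unitary hOmega hom X.
  by apply/eqP; rewrite -(@eqrXn2 _ 2)// ?rnorm_ge0// -!Re_ip h.
move: u; apply: (@cts_dense R Xi H (state_T (Omega := Omega) (hom := hom)) [set hv F | F in @nice R (2 * n) A]).
- by move=> X x y; rewrite -(linB (lT X)) nT.
- exact: hv_dense.
move=> _ [F nF <-] X0.
have nt X : nice (tw X F) by exact: nice_tw.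
have [C C0 hC] := nice_wt nF.
pose K X Z := cmul (cstar (tw X F Z - tw X0 F Z)) (tw X F Z - tw X0 F Z).
have nK X : nice (K X) by apply: nice_star_mul; exact: nice_sub.
apply: (continuous_at_sq (g := fun X => bint mu (K X))).
- rewrite (_ : K X0 = fun=> 0); first exact: bint0.
  by apply/funext => Z; rewrite /K subrr cmul0r.
(* Domination is needed only near [X0]: on the ball of radius 1 translations have length at most
   |X0| + 1, and Peetre's inequality gives the constant. *)
- pose r := 1 + (`|X0| + 1); pose C2 := C * r ^+ (2 * (2 * n)).
  have r0 : 0 < r by have := normr_ge0 X0; rewrite /r; lra.
  have C20 : 0 <= C2 by rewrite mulr_ge0// exprn_ge0// ltW.
  apply: (@bint_cont_at R _ mu hmu A Xi (ball X0 1) X0 K ((C2 + C2) * (C2 + C2)) cA).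
  + exact: nbhsx_ballx.
  + by move=> X _; apply: continuous_smeas; case: (nK X).
  + move=> Z; apply: cts_cmul.
      apply: cts_cstar; apply: cts_sub; last exact: cst_continuous.
      apply: continuousZc; first exact: ka_cont2.
      by apply: (cts_compG nF.1); exact: cts_addl.
    apply: cts_sub; last exact: cst_continuous.
    apply: continuousZc; first exact: ka_cont2.
    by apply: (cts_compG nF.1); exact: cts_addl.
  + move=> X Z hX; have b Y : `|Y| <= `|X0| + 1 -> rnorm (tw Y F Z) <= C2 * wt Z.
      move=> hY; rewrite rnormZ rnorm_cis mul1r (le_trans (hC _))// /C2 -mulrA ler_wpM2l//.
      have := wt_peetre (Z + Y) (- Y); rewrite addrK normrN => h; apply: le_trans h _.
      by rewrite ler_wpM2r ?(ltW (wt_gt0 _))// lerXn2r ?nnegrE ?addr_ge0 ?(ltW r0)//; rewrite /r lerD2l.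
    have hX' : `|X| <= `|X0| + 1.
      have := ler_normB X0 (X0 - X); rewrite subKr => h; apply: le_trans h _; rewrite lerD2l ltW//.
      by move: hX; rewrite -ball_normE.
    have b1 : rnorm (tw X F Z - tw X0 F Z) <= (C2 + C2) * wt Z.
      rewrite (le_trans (rnormD _ _))// rnormN mulrDl lerD//; first exact: b.
      by apply: b; rewrite lerDl.
    rewrite (le_trans (rnormM_le _ _))// rnorm_star -mulrA.
    apply: le_trans (ler_pM (rnorm_ge0 _) (rnorm_ge0 _) b1 b1) _.
    have w1 := wt_le1 Z; have w0 := wt_gt0 Z.
    rewrite -mulrA ler_wpM2l ?addr_ge0// mulrCA ler_wpM2l ?addr_ge0// ler_piMr// ltW//.
- move=> X; rewrite !state_T_hvec//; exact: state_hvec_sub.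
Qed.

(** Writing F(X) = Theta_X(g(X)) turns the action of a on F into Theta_X(a g(X)); an approximate
    unit for g thus approximates F, the action being isometric. *)
Lemma state_rep_nondegenerate : nondegenerate (state_rep (Omega := Omega) (Theta := Theta) (hom := hom)).
Proof.
rewrite /nondegenerate; apply/seteqP; split => // u _; apply: closure_rnorm => e e0.
have e2 : 0 < e / 2 by rewrite divr_gt0.
have [_ [F nF <-] hF] := hv_dense u e2.
pose g X := Theta (- X) (F X).
have ng : nice g.
  split; last by have [_ [C hC]] := nF; exists C => X; rewrite (rnorm_act hTheta).
  apply: (act_cont2 hTheta); last by case: nF.
  rewrite [X in continuous X](_ : _ = (fun X : Xi => (-1) *: X)); first exact: cts_scalel.
  by apply/funext => X; rewrite scaleN1r.
have [C C0 hC] := nice_bounded ng.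
have d0 : 0 < (e / 2) ^+ 2 / (C + 1) by rewrite divr_gt0 ?exprn_gt0// ltr_wpDl.
have [a [ha hI]] := approx_unit_nice ng d0.
exists (state_rep (Omega := Omega) (Theta := Theta) (hom := hom) a (hv F)); first by exists [:: (a, hv F)] => //; rewrite big_seq1.
rewrite state_rep_hvec//.
have -> : u - hv (rS (Theta := Theta) a F) = (u - hv F) + (hv F - hv (rS (Theta := Theta) a F)) by rewrite addrA subrK.
rewrite [e]splitr; apply: le_trans (rnormD _ _) _; apply: lerD; first exact: hF.
have nR : nice (rS (Theta := Theta) a F) by exact: nice_rS.
rewrite -(@ler_pXn2r _ 2)// ?nnegrE ?rnorm_ge0 ?(ltW e2)//.
apply: le_trans (state_hvec_sub nF nR) _.
set c := fun X => cmul _ _.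
have nc : nice c by apply: nice_star_mul; exact: nice_sub.
rewrite -lee_fin; apply: le_trans (bint_le mB fB cB cA (nice_good hmu nc)) _.
have cE X : F X - rS (Theta := Theta) a F X = Theta X (g X - cmul a (g X)).
  rewrite (linB (act_lin hTheta X)) (act_mul hTheta) /g -!(actD hTheta) subrr.
  by rewrite !(act0 hTheta).
have sg : smeas (fun X => g X - cmul a (g X)).
  apply: continuous_smeas; apply: cts_sub; first by case: ng.
  by apply: cts_cmul; [exact: cst_continuous|case: ng].
apply: (@le_trans _ _ (inorm mu (fun X => C%:C%C *: (g X - cmul a (g X))))).
  apply: inorm_le => X; rewrite /c rnormC cE (rnorm_act hTheta) rnormZr ger0_norm// expr2.
  by rewrite ler_wpM2r ?rnorm_ge0// (le_trans (ha _)).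
rewrite inormZ// rnorm_real ger0_norm//.
apply: (@le_trans _ _ (C%:E * ((e / 2) ^+ 2 / (C + 1))%:E)%E).
  by apply: lee_pmul => //; exact: inorm_ge0.
rewrite -EFinM lee_fin mulrCA ler_piMr ?sqr_ge0// ler_pdivrMr ?mul1r ?lerDl//.
by rewrite ltr_wpDl.
Qed.

Theorem state_is_covariant : is_covariant Omega Theta (state_rep (Omega := Omega) (Theta := Theta) (hom := hom)) (state_T (Omega := Omega) (hom := hom)).
Proof.
split.
- split; [exact: state_rep_star|exact: state_rep_nondegenerate].
- exact: state_T_unitary.
- exact: state_T_cont.
- exact: state_T_mul.
- exact: state_covariant.
Qed.

End state_rep2.

(** * Fubini's theorem for the Bochner integral *)

Section pointwise_limit.
Context {R : realType} d (T : measurableType d) {V : normedModType R[i]}.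

Lemma measurable_rnorm_cvg (F_ : nat -> T -> V) (F G : T -> V) : (forall k, smeas (F_ k)) ->
  (forall x, F_ k x @[k --> \oo] --> F x) -> smeas G -> measurable_fun setT (fun x => rnorm (F x - G x)).
Proof.
move=> sF cF sG; apply: (@measurable_fun_cvg _ T R setT (fun k x => rnorm (F_ k x - G x))).
  by move=> k; exact: smeas_rnorm (smeasB (sF k) sG).
by move=> x _; apply: cvg_rnorm; apply: cvgB; [exact: cF|exact: cvg_cst].
Qed.

(* The nearest point among the first values taken by the approximants. *)
Lemma smeas_lim (F_ : nat -> T -> V) (F : T -> V) : (forall k, smeas (F_ k)) ->
  (forall x, F_ k x @[k --> \oo] --> F x) -> smeas F.
Proof.
move=> sF cF.
have /choice[s hs] : forall k, exists s : nat -> T -> V, (forall j, fval (s j)) /\ forall x, s j x @[j --> \oo] --> F_ k x by [].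
have /choice[L hL] : forall kj : nat * nat, exists l : seq V, forall x, exists i, s kj.1 kj.2 x = nth 0 l i.
  move=> [k j]; have [I [p [v [_ E]]]] := (hs k).1 j; exists (map v (enum I)) => x.
  exists (index (p x) (enum I)); rewrite /= E /= (nth_map (p x)) ?index_mem ?mem_enum//.
  by rewrite nth_index ?mem_enum.
pose dn (m : nat) : V := if unpickle m is Some (k, j, i) then nth 0 (L (k, j)) i else 0.
have dn_dense x e : 0 < e -> exists m, rnorm (F x - dn m) <= e.
  move=> e0; have e2 : 0 < e / 2 by rewrite divr_gt0.
  have /cvg_seq_rnormP/(_ _ e2)[k0 hk] := cF x.
  have /cvg_seq_rnormP/(_ _ e2)[j0 hj] := (hs k0).2 x.
  have [i hi] := hL (k0, j0) x; exists (pickle (k0, j0, i)); rewrite /dn pickleK -hi /=.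
  have -> : F x - s k0 j0 x = - (F_ k0 x - F x) - (s k0 j0 x - F_ k0 x) by rewrite !opprB addrA subrK.
  by rewrite (le_trans (rnormD _ _))// !rnormN [e]splitr lerD// ?hk ?hj.
pose rn := fix rn (m : nat) (x : T) : V :=
  if m is m'.+1 then if rnorm (F x - dn m) < rnorm (F x - rn m' x) then dn m else rn m' x else dn 0%N.
have rn_fval m : fval (rn m).
  elim: m => [|m ih] /=; first exact: fval_cst.
  apply: (@fval_comp2 _ _ _ _ _ (fun (b : bool) (v : V) => if b then dn m.+1 else v)) => //.
  have H (b : T -> bool) : measurable [set x | b x] -> fval b.
    by move=> /fval_set; congr fval; apply/funext => x /=; exact: asboolb.
  apply: H.
  have := @measurable_fun_ltr _ _ _ setT (fun x : T => rnorm (F x - dn m.+1)) (fun x => rnorm (F x - rn m x)).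
  move=> /(_ _ _ measurableT [set true]); rewrite setTI; apply => //.
    by apply: (measurable_rnorm_cvg sF cF); apply: fval_smeas; exact: fval_cst.
  by apply: (measurable_rnorm_cvg sF cF); exact: fval_smeas.
have rn_le m i x : (i <= m)%N -> rnorm (F x - rn m x) <= rnorm (F x - dn i).
  elim: m i => [|m ih] i; first by rewrite leqn0 => /eqP ->.
  rewrite leq_eqVlt => /predU1P[->|]; rewrite /=; case: ltP => //.
    by move=> h /ih h2; exact: le_trans (ltW h) h2.
  by move=> _ /ih.
exists rn; split => // x; apply/cvg_seq_rnormP => e e0.
have [i hi] := dn_dense x e e0; exists i => k ik.
by rewrite rnormB; apply: le_trans (rn_le k i x ik) hi.
Qed.

End pointwise_limit.

Section fubini.
Context {R : realType} d (T : measurableType d) (mu : {sigma_finite_measure set T -> \bar R}).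
Context {V : normedModType R[i]}.
Hypothesis cV : cplt V.
Variable E : nat -> set T.
Hypotheses (mE : forall k, measurable (E k)) (fE : forall k, (mu (E k) < +oo)%E)
  (cE : forall x, exists K, forall k, (K <= k)%N -> E k x).
Let cR := @cplt_complex R.
Local Notation flip K := (fun Y X => K X Y).
Implicit Type K : T -> T -> V.

(** Integrability is required of all slices, not of almost all: [bint] is 0 on a non-integrable
    slice, which would spoil pointwise linearity. *)
Definition pgood K := [/\ smeas (fun p : T * T => K p.1 p.2), forall X, (inorm mu (K X) < +oo)%E,
  forall Y, (inorm mu (K ^~ Y) < +oo)%E & (\int[mu]_X inorm mu (K X) < +oo)%E].

Let pair_l (X : T) : measurable_fun setT (fun Y : T => (X, Y)).
Proof. by apply: measurable_fun_pair; [exact: measurable_cst|exact: measurable_id]. Qed.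
Let pair_r (Y : T) : measurable_fun setT (fun X : T => (X, Y)).
Proof. by apply: measurable_fun_pair; [exact: measurable_id|exact: measurable_cst]. Qed.

Let smeas_l K X : smeas (fun p : T * T => K p.1 p.2) -> smeas (K X).
Proof. by move=> h; exact: (smeas_precomp h (pair_l X)). Qed.
Let smeas_r K Y : smeas (fun p : T * T => K p.1 p.2) -> smeas (K ^~ Y).
Proof. by move=> h; exact: (smeas_precomp h (pair_r Y)). Qed.

Lemma tonelli (f : T * T -> \bar R) : measurable_fun setT f -> (forall z, 0 <= f z)%E ->
  (\int[mu]_X \int[mu]_Y f (X, Y) = \int[mu]_Y \int[mu]_X f (X, Y))%E.
Proof. by move=> mf f0; exact: etrans (esym (fubini_tonelli1 (m1 := mu) (m2 := mu) f mf f0)) (fubini_tonelli2 (m1 := mu) (m2 := mu) f mf f0). Qed.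

Let meas_inorm K : smeas (fun p : T * T => K p.1 p.2) -> measurable_fun setT (fun X => inorm mu (K X)).
Proof.
move=> h; apply: (measurable_fun_fubini_tonelli_F (m2 := mu) _ (smeas_ernorm h)).
by move=> z; rewrite lee_fin rnorm_ge0.
Qed.

Let tonelli_inorm K : smeas (fun p : T * T => K p.1 p.2) ->
  (\int[mu]_X inorm mu (K X) = \int[mu]_Y inorm mu (K ^~ Y))%E.
Proof.
by move=> h; apply: (tonelli (smeas_ernorm h)) => z; rewrite lee_fin rnorm_ge0.
Qed.

Let pgood_flip K : pgood K -> pgood (flip K).
Proof.
move=> [h1 h2 h3 h4]; split => //; last by rewrite -tonelli_inorm.
apply: (smeas_precomp h1 (g := fun p : T * T => (p.2, p.1))).
exact: measurable_fun_pair measurable_snd measurable_fst.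
Qed.

Let pgood_le K K' : smeas (fun p : T * T => K' p.1 p.2) -> (forall X Y, rnorm (K' X Y) <= rnorm (K X Y)) ->
  pgood K -> pgood K'.
Proof.
move=> s le [h1 h2 h3 h4]; split => //.
- by move=> X; apply: le_lt_trans (h2 X); exact: inorm_le.
- by move=> Y; apply: le_lt_trans (h3 Y); exact: inorm_le.
- apply: le_lt_trans h4; apply: lint_le => X; first exact: inorm_ge0.
  exact: inorm_le.
Qed.

Let pgood_lin (a : R[i]) K K' : pgood K -> pgood K' -> pgood (fun X Y => a *: K X Y + K' X Y).
Proof.
move=> [h1 h2 h3 h4] [k1 k2 k3 k4].
have gl X : good mu (fun Y => a *: K X Y + K' X Y).
  by apply: good_lin; split => //; exact: smeas_l.
have gr Y : good mu (fun X => a *: K X Y + K' X Y).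
  by apply: good_lin; split => //; exact: smeas_r.
split.
- exact: (smeas_lin a h1 k1).
- by move=> X; case: (gl X).
- by move=> Y; case: (gr Y).
apply: (@le_lt_trans _ _ (\int[mu]_X ((rnorm (a : R[i]^o))%:E * inorm mu (K X) + inorm mu (K' X)))%E).
  apply: lint_le => X; first exact: inorm_ge0.
  rewrite -inormZ; last exact: smeas_l.
  by apply: inormD; [apply: smeasZ; exact: smeas_l|exact: smeas_l].
rewrite ge0_integralD//; first last.
- exact: meas_inorm.
- by move=> X _; exact: inorm_ge0.
- by apply: measurable_funeM; exact: meas_inorm.
- by move=> X _; rewrite mule_ge0 ?lee_fin ?rnorm_ge0 ?inorm_ge0.
rewrite ge0_integralZl//; [|exact: meas_inorm|by move=> X _; exact: inorm_ge0|by rewrite lee_fin rnorm_ge0].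
by rewrite lte_add_pinfty// lte_mul_pinfty// lee_fin rnorm_ge0.
Qed.

Let Q K := [/\ smeas (fun X => bint mu (K X)), smeas (fun Y => bint mu (K ^~ Y)) &
  bint mu (fun X => bint mu (K X)) = bint mu (fun Y => bint mu (K ^~ Y))].

Let good_l K X : pgood K -> good mu (K X).
Proof. by move=> [h1 h2 _ _]; split => //; exact: smeas_l. Qed.
Let good_r K Y : pgood K -> good mu (K ^~ Y).
Proof. by move=> [h1 _ h2 _]; split => //; exact: smeas_r. Qed.

Let outer_good K : pgood K -> smeas (fun X => bint mu (K X)) -> good mu (fun X => bint mu (K X)).
Proof.
move=> pK s; split => //; case: (pK) => _ _ _; apply: le_lt_trans; apply: lint_le => X.
  by rewrite lee_fin rnorm_ge0.
exact: (bint_le mE fE cE cV (good_l X pK)).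
Qed.

Let Q_lin (a : R[i]) K K' : pgood K -> pgood K' -> Q K -> Q K' -> Q (fun X Y => a *: K X Y + K' X Y).
Proof.
move=> pK pK' [q1 q2 q3] [r1 r2 r3].
have E1 : (fun X => bint mu (fun Y => a *: K X Y + K' X Y)) = (fun X => a *: bint mu (K X) + bint mu (K' X)).
  by apply/funext => X; exact: (bint_lin mE fE cE cV a (good_l X pK) (good_l X pK')).
have E2 : (fun Y => bint mu (fun X => a *: K X Y + K' X Y)) = (fun Y => a *: bint mu (K ^~ Y) + bint mu (K' ^~ Y)).
  by apply/funext => Y; exact: (bint_lin mE fE cE cV a (good_r Y pK) (good_r Y pK')).
rewrite /Q E1 E2; split; [exact: smeas_lin|exact: smeas_lin|].
have e1 := bint_lin mE fE cE cV a (outer_good pK q1) (outer_good pK' r1).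
have e2 := bint_lin mE fE cE cV a (outer_good (pgood_flip pK) q2) (outer_good (pgood_flip pK') r2).
by apply: etrans e1 _; apply: etrans (esym e2); rewrite q3 r3.
Qed.

Let bint_vec (f : T -> R) (w : V) : measurable_fun setT f -> (forall x, 0 <= f x) ->
  (\int[mu]_x (f x)%:E < +oo)%E ->
  bint mu (fun x => ((f x)%:C)%C *: w) = ((fine (\int[mu]_x (f x)%:E))%:C)%C *: w.
Proof.
move=> mf f0 fi; have e := bint_real mE fE cE mf f0 fi.
rewrite -e; have gf : good mu (fun x => ((f x)%:C)%C : R[i]^o).
  split; first exact: smeas_real_complex.
  by rewrite /inorm; under eq_integral do rewrite rnorm_real ger0_norm//.
have LD : forall x y : R[i]^o, (x + y) *: w = x *: w + y *: w by move=> x y; exact: scalerDl.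
have LZ : forall (t : R) (x : R[i]^o), (((t%:C)%C *: x) : R[i]^o) *: w = (t%:C)%C *: (x *: w) by move=> t x; rewrite scalerA.
have LC : forall x : R[i]^o, rnorm (x *: w) <= rnorm w * rnorm x by move=> x; rewrite rnormZ mulrC.
exact: (bint_bounded mE fE cE cR cV LD LZ LC gf).
Qed.

Let Q_real (f : T * T -> R) (w : V) : measurable_fun setT f -> (forall z, 0 <= f z) ->
  (forall X, \int[mu]_Y (f (X, Y))%:E < +oo)%E -> (forall Y, \int[mu]_X (f (X, Y))%:E < +oo)%E ->
  (\int[mu]_X \int[mu]_Y (f (X, Y))%:E < +oo)%E -> Q (fun X Y => ((f (X, Y))%:C)%C *: w).
Proof.
move=> mf f0 fl fr ft.
have mfe : measurable_fun setT (EFin \o f) by exact/measurable_EFinP.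
have mfe0 z : (0 <= (EFin \o f) z)%E by rewrite lee_fin.
pose F X := fine (\int[mu]_Y (f (X, Y))%:E); pose G Y := fine (\int[mu]_X (f (X, Y))%:E).
have i0 X : (0 <= \int[mu]_Y (f (X, Y))%:E)%E by apply: integral_ge0 => y _; rewrite lee_fin.
have j0 Y : (0 <= \int[mu]_X (f (X, Y))%:E)%E by apply: integral_ge0 => y _; rewrite lee_fin.
have FE : (fun X => (F X)%:E) = (fun X => \int[mu]_Y (f (X, Y))%:E)%E.
  by apply/funext => X; rewrite fineK// ge0_fin_numE.
have GE : (fun Y => (G Y)%:E) = (fun Y => \int[mu]_X (f (X, Y))%:E)%E.
  by apply/funext => Y; rewrite fineK// ge0_fin_numE.
have mF : measurable_fun setT F.
  by apply/measurable_EFinP; rewrite [X in measurable_fun _ X]FE; exact: (measurable_fun_fubini_tonelli_F (m2 := mu) _ mfe mfe0).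
have mG : measurable_fun setT G.
  by apply/measurable_EFinP; rewrite [X in measurable_fun _ X]GE; exact: (measurable_fun_fubini_tonelli_G (m1 := mu) _ mfe mfe0).
have E1 : (fun X => bint mu (fun Y => ((f (X, Y))%:C)%C *: w)) = (fun X => ((F X)%:C)%C *: w).
  by apply/funext => X; apply: bint_vec => //; exact: (measurableT_comp mf (pair_l X)).
have E2 : (fun Y => bint mu (fun X => ((f (X, Y))%:C)%C *: w)) = (fun X => ((G X)%:C)%C *: w).
  by apply/funext => Y; apply: bint_vec => //; exact: (measurableT_comp mf (pair_r Y)).
have sv (g : T -> R) : measurable_fun setT g -> smeas (fun x => ((g x)%:C)%C *: w).
  move=> mg; apply: (smeas_continuous (L := fun z : R[i]^o => z *: w) _ (smeas_real_complex mg)).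
  apply: (real_bounded_continuous (C := rnorm w)).
  - by move=> x y; exact: scalerDl.
  - by move=> t x; rewrite scalerA.
  - by move=> x; rewrite rnormZ mulrC.
rewrite /Q E1 E2; split; [exact: sv|exact: sv|].
have F0 X : 0 <= F X by exact: fine_ge0.
have G0 X : 0 <= G X by exact: fine_ge0.
have TE : (\int[mu]_X (F X)%:E = \int[mu]_X (G X)%:E)%E.
  by rewrite FE GE; exact: (tonelli mfe mfe0).
have h1 : (\int[mu]_X (F X)%:E < +oo)%E by rewrite FE.
have h2 : (\int[mu]_X (G X)%:E < +oo)%E by rewrite -TE.
have e1 := @bint_vec F w mF F0 h1; have e2 := @bint_vec G w mG G0 h2.
by apply: etrans e1 _; apply: etrans (esym e2); rewrite TE.
Qed.

Let Q_fval (S : T * T -> V) : fval S -> pgood (fun X Y => S (X, Y)) -> Q (fun X Y => S (X, Y)).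
Proof.
move=> [I [p [v [mp SE]]]] pS.
pose f i (z : T * T) : R := \1_(p @^-1` [set i]) z.
pose term i X Y : V := ((f i (X, Y))%:C)%C *: v i.
have mf i : measurable_fun setT (f i) by exact: measurable_indic.
have f0 i z : 0 <= f i z by rewrite /f indicE ler0n.
have fpE i z : f i z = (p z == i)%:R.
  rewrite /f indicE; have -> : (z \in p @^-1` [set i]) = (p z == i); last by [].
  by apply/idP/eqP => [/set_mem//|h]; exact/mem_set.
have vle i X Y : rnorm (v i) * f i (X, Y) <= rnorm (S (X, Y)).
  by rewrite fpE SE /=; case: eqP => [->|_]; rewrite ?mulr1 ?mulr0 ?rnorm_ge0.
have smt i : smeas (fun z : T * T => ((f i z)%:C)%C *: v i).
  apply: (smeas_continuous (L := fun z : R[i]^o => z *: v i) _ (smeas_real_complex (mf i))).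
  apply: (real_bounded_continuous (C := rnorm (v i))).
  - by move=> x y; exact: scalerDl.
  - by move=> t x; rewrite scalerA.
  - by move=> x; rewrite rnormZ mulrC.
have pt i : pgood (term i).
  apply: (pgood_le _ _ pS); first by have := smt i; congr smeas; apply/funext => -[].
  by move=> X Y; rewrite /term rnormZr ger0_norm// mulrC.
(* For a nonzero value, integrability of S forces that of the indicator of its level set; the level
   set of the value 0 may be too large and is left out of the sum. *)
have qt i : v i != 0 -> Q (term i).
  move=> v0; have vp : 0 < rnorm (v i) by rewrite lt_def rnorm_eq0 v0 rnorm_ge0.
  have fin (g : T -> R) : measurable_fun setT g -> (forall x, 0 <= g x) -> (inorm mu (fun x => ((g x)%:C)%C *: v i) < +oo)%E ->
      (\int[mu]_x (g x)%:E < +oo)%E.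
    move=> mg g0; rewrite /inorm; under eq_integral do rewrite rnormZr ger0_norm// mulrC EFinM.
    rewrite ge0_integralZl//; [|exact/measurable_EFinP|by move=> x _; rewrite lee_fin|by rewrite lee_fin rnorm_ge0].
    rewrite !ltey; apply: contra => /eqP ->; by rewrite gt0_muley ?lte_fin.
  have [h1 h2 h3 h4] := pt i.
  have mX X : measurable_fun setT (fun Y => f i (X, Y)) by exact: (measurableT_comp (mf i) (pair_l X)).
  have mY Y : measurable_fun setT (fun X => f i (X, Y)) by exact: (measurableT_comp (mf i) (pair_r Y)).
  have fl X : (\int[mu]_Y (f i (X, Y))%:E < +oo)%E by apply: fin => //; exact: h2.
  have fr Y : (\int[mu]_X (f i (X, Y))%:E < +oo)%E by apply: fin => //; exact: h3.
  apply: Q_real => //.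
  have e X : inorm mu (term i X) = ((rnorm (v i))%:E * \int[mu]_Y (f i (X, Y))%:E)%E.
    rewrite /inorm; under eq_integral do rewrite rnormZr ger0_norm// mulrC EFinM.
    by rewrite ge0_integralZl//; [exact/measurable_EFinP|move=> x _; rewrite lee_fin|rewrite lee_fin rnorm_ge0].
  move: h4; under eq_integral do rewrite e.
  rewrite ge0_integralZl//; first last.
  - by rewrite lee_fin rnorm_ge0.
  - by move=> X _; apply: integral_ge0 => Y _; rewrite lee_fin.
  - by apply: (measurable_fun_fubini_tonelli_F (m2 := mu) (EFin \o f i)); [exact/measurable_EFinP|move=> z; rewrite lee_fin].
  by rewrite !ltey; apply: contra => /eqP ->; rewrite gt0_muley ?lte_fin.
have key (r : seq I) : pgood (fun X Y => \sum_(i <- r | v i != 0) term i X Y) /\ Q (fun X Y => \sum_(i <- r | v i != 0) term i X Y).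
  elim: r => [|i r [ih1 ih2]].
    have -> : (fun X Y => \sum_(i <- [::] | v i != 0) term i X Y) = (fun _ _ => 0).
      by apply/funext => X; apply/funext => Y; rewrite big_nil.
    split; first by apply: (pgood_le _ _ pS); [apply: fval_smeas; exact: fval_cst|move=> X Y; rewrite rnorm0 rnorm_ge0].
    by split; [exact: fval_smeas (fval_cst _)|exact: fval_smeas (fval_cst _)|].
  have [v0|v0] := eqVneq (v i) 0.
    have -> : (fun X Y => \sum_(i <- i :: r | v i != 0) term i X Y) = (fun X Y => \sum_(i <- r | v i != 0) term i X Y) by apply/funext => X; apply/funext => Y; rewrite big_cons v0 eqxx.
    by [].
  have -> : (fun X Y => \sum_(i <- i :: r | v i != 0) term i X Y) = (fun X Y => 1 *: term i X Y + \sum_(i <- r | v i != 0) term i X Y).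
    by apply/funext => X; apply/funext => Y; rewrite big_cons v0 scale1r.
  by split; [exact: (pgood_lin 1 (pt i) ih1)|exact: (Q_lin 1 (pt i) ih1 (qt i v0) ih2)].
have [_] := key (index_enum I).
suff -> : (fun X Y => \sum_(i <- index_enum I | v i != 0) term i X Y) = (fun X Y => S (X, Y)) by [].
apply/funext => X; apply/funext => Y; rewrite SE /=; have [v0|v0] := eqVneq (v (p (X, Y))) 0.
  rewrite v0 big1// => i vi; rewrite /term fpE; case: eqP => [e|_]; last by rewrite scale0r.
  by rewrite -e v0 eqxx in vi.
rewrite (bigD1 (p (X, Y)))//= /term fpE eqxx scale1r big1 ?addr0// => i /andP[_ ni].
by rewrite /term fpE eq_sym (negbTE ni) scale0r.
Qed.

(** Step functions on the product, dominated by 2|K|, are passed to the limit by dominated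
    convergence in each slice and then in each outer integral. *)
Let Q_all K : pgood K -> Q K.
Proof.
move=> pK; have [sK _ _ tK] := pK.
have mE2 k : measurable (E k `*` E k) by exact: measurableX.
have fE2 k : ((mu \x mu) (E k `*` E k) < +oo)%E.
  rewrite product_measure1E; [|exact: mE|exact: mE].
  by rewrite lte_mul_pinfty ?measure_ge0 ?ge0_fin_numE ?fE.
have cE2 (z : T * T) : exists N, forall k, (N <= k)%N -> (E k `*` E k) z.
  have [K1 h1] := cE z.1; have [K2 h2] := cE z.2; exists (maxn K1 K2) => k.
  by rewrite geq_max => /andP[k1 k2]; split; [exact: h1|exact: h2].
have gK : good (mu \x mu)%E (fun p => K p.1 p.2).
  split => //; rewrite /inorm (fubini_tonelli1 (m1 := mu) (m2 := mu) _ (smeas_ernorm sK))//.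
  by move=> z; rewrite lee_fin rnorm_ge0.
have [S [_ cS bS]] := good_approx mE2 fE2 cE2 gK.
(* Doubling K expresses the domination 2|K| as the norm of a kernel of the same kind. *)
pose K2 X Y := 1 *: K X Y + K X Y; have pK2 : pgood K2 by exact: pgood_lin.
have K2E X Y : rnorm (K2 X Y) = 2 * rnorm (K X Y).
  rewrite /K2; have -> : 1 *: K X Y + K X Y = (2%:C)%C *: K X Y.
    by rewrite [(2%:C)%C](_ : _ = 1 + 1) ?scalerDl ?scale1r// rmorphD.
  by rewrite rnormZr ger0_norm.
pose Kk k X Y := step_eval (S k) (X, Y).
have le k X Y : rnorm (Kk k X Y) <= rnorm (K2 X Y) by rewrite K2E; exact: (bS k (X, Y)).
have sk k : smeas (fun p : T * T => Kk k p.1 p.2).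
  by have := fval_smeas (fval_step (S k)); congr smeas; apply/funext => -[].
have pk k : pgood (Kk k) by apply: (pgood_le _ _ pK2).
have qk k : Q (Kk k) := Q_fval (fval_step (S k)) (pk k).
have c1 X : bint mu (Kk k X) @[k --> \oo] --> bint mu (K X).
  apply: (bint_dct mE fE cE cV (g := fun Y => rnorm (K2 X Y))).
  - by move=> k; case: (good_l X (pk k)).
  - by case: (good_l X pK).
  - by move=> Y; exact: (cS (X, Y)).
  - exact: integrable_rnorm (good_l X pK2).
  - by move=> k Y.
have c2 Y : bint mu ((Kk k) ^~ Y) @[k --> \oo] --> bint mu (K ^~ Y).
  apply: (bint_dct mE fE cE cV (g := fun X => rnorm (K2 X Y))).
  - by move=> k; case: (good_r Y (pk k)).
  - by case: (good_r Y pK).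
  - by move=> X; exact: (cS (X, Y)).
  - exact: integrable_rnorm (good_r Y pK2).
  - by move=> k X.
have s1 : smeas (fun X => bint mu (K X)).
  have h k : smeas (fun X => bint mu (Kk k X)) by have [h _ _] := qk k; exact: h.
  exact: (smeas_lim h c1).
have s2 : smeas (fun Y => bint mu (K ^~ Y)).
  have h k : smeas (fun Y => bint mu ((Kk k) ^~ Y)) by have [_ h _] := qk k; exact: h.
  exact: (smeas_lim h c2).
split; [exact: s1|exact: s2|].
have int (L : T -> T -> V) : pgood L -> mu.-integrable setT (EFin \o (fun X => fine (inorm mu (L X)))).
  move=> [l1 l2 l3 l4].
  have FE : EFin \o (fun X => fine (inorm mu (L X))) = (fun X => inorm mu (L X)).
    by apply/funext => X; rewrite /= fineK// ge0_fin_numE// inorm_ge0.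
  rewrite FE; apply/integrableP; split; first exact: meas_inorm.
  by under eq_integral do rewrite gee0_abs ?inorm_ge0//.
have bd2 (L L2 : T -> T -> V) X : pgood L -> pgood L2 -> (forall X Y, rnorm (L X Y) <= rnorm (L2 X Y)) ->
    rnorm (bint mu (L X)) <= fine (inorm mu (L2 X)).
  move=> pL pL2 h; have [_ l2 _ _] := pL2; rewrite -lee_fin fineK ?ge0_fin_numE ?inorm_ge0//.
  apply: le_trans (bint_le mE fE cE cV (good_l X pL)) _; exact: inorm_le.
have e1 : bint mu (fun X => bint mu (Kk k X)) @[k --> \oo] --> bint mu (fun X => bint mu (K X)).
  apply: (bint_dct mE fE cE cV (g := fun X => fine (inorm mu (K2 X)))).
  - by move=> k; have [h _ _] := qk k; exact: h.
  - exact: s1.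
  - exact: c1.
  - exact: int.
  - by move=> k X; exact: (bd2 _ _ X (pk k) pK2 (le k)).
have e2 : bint mu (fun Y => bint mu ((Kk k) ^~ Y)) @[k --> \oo] --> bint mu (fun Y => bint mu (K ^~ Y)).
  apply: (bint_dct mE fE cE cV (g := fun Y => fine (inorm mu (K2 ^~ Y)))).
  - by move=> k; have [_ h _] := qk k; exact: h.
  - exact: s2.
  - exact: c2.
  - exact: (int _ (pgood_flip pK2)).
  - by move=> k Y; exact: (bd2 (flip (Kk k)) (flip K2) Y (pgood_flip (pk k)) (pgood_flip pK2) (fun X Y => le k Y X)).
have ee : (fun k => bint mu (fun X => bint mu (Kk k X))) = (fun k => bint mu (fun Y => bint mu ((Kk k) ^~ Y))).
  by apply/funext => k; have [_ _ h] := qk k; exact: h.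
by move: e1; rewrite ee => e1; exact: cvg_uniq e1 e2.
Qed.

Lemma ae_inorm_fin (L : T -> T -> V) : smeas (fun p : T * T => L p.1 p.2) -> (\int[mu]_X inorm mu (L X) < +oo)%E ->
  {ae mu, forall X, inorm mu (L X) != +oo%E}.
Proof.
move=> sL tL; have iL : mu.-integrable setT (fun X => inorm mu (L X)).
  apply/integrableP; split; first exact: meas_inorm.
  by under eq_integral do rewrite gee0_abs ?inorm_ge0//.
have := integrable_ae measurableT iL; apply: filterS => X /(_ I).
by rewrite ge0_fin_numE ?inorm_ge0// lt_neqAle => /andP[].
Qed.

(** The kernel is set to 0 on the slices of infinite norm in either direction. These form null sets,
    so neither iterated integral changes, and all remaining slices are integrable. *)
Theorem fubini_bint K : smeas (fun p : T * T => K p.1 p.2) -> (\int[mu]_X inorm mu (K X) < +oo)%E ->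
  bochner_integrable mu (fun X => bint mu (K X)) /\
  bint mu (fun X => bint mu (K X)) = bint mu (fun Y => bint mu (K ^~ Y)).
Proof.
move=> sK tK; pose g X := inorm mu (K X); pose h Y := inorm mu (K ^~ Y).
have sF : smeas (fun p : T * T => K p.2 p.1).
  apply: (smeas_precomp sK (g := fun p : T * T => (p.2, p.1))).
  exact: measurable_fun_pair measurable_snd measurable_fst.
have aeg : {ae mu, forall X, g X != +oo%E} := ae_inorm_fin sK tK.
have aeh : {ae mu, forall Y, h Y != +oo%E}.
  by apply: (@ae_inorm_fin (flip K)) => //; rewrite -tonelli_inorm.
pose K' X Y := if (g X != +oo%E) && (h Y != +oo%E) then K X Y else 0.
have mg : measurable_fun setT g by exact: meas_inorm.
have mh : measurable_fun setT h by exact: (meas_inorm sF).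
have fb (f : T -> \bar R) : measurable_fun setT f -> fval (fun X => f X != +oo%E).
  move=> mf; have m1 : measurable (~` (f @^-1` [set +oo%E])).
    by apply: measurableC; rewrite -[X in measurable X]setTI; exact: mf.
  have := fval_set m1; congr fval; apply/funext => X /=.
  by apply/asboolP/idP => [/eqP//|/eqP].
have sK' : smeas (fun p : T * T => K' p.1 p.2).
  have [s [fs cs]] := sK.
  have f2 : fval (fun p : T * T => (g p.1 != +oo%E) && (h p.2 != +oo%E)).
    apply: (fval_comp2 andb).
      exact: (fval_precomp (fb _ mg) measurable_fst).
    exact: (fval_precomp (fb _ mh) measurable_snd).
  exists (fun k p => if (g p.1 != +oo%E) && (h p.2 != +oo%E) then s k p else 0); split.
    by move=> k; exact: (fval_comp2 (fun (b : bool) v => if b then v else 0) f2 (fs k)).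
  by move=> p; rewrite /K'; case: ifP => _; [exact: cs|exact: cvg_cst].
have leK X Y : rnorm (K' X Y) <= rnorm (K X Y).
  by rewrite /K'; case: ifP => // _; rewrite rnorm0 rnorm_ge0.
have z0 (F : T -> V) : (forall x, F x = 0) -> (inorm mu F < +oo)%E.
  by move=> F0; rewrite /inorm integral0_eq// => x _; rewrite F0 rnorm0.
have pK' : pgood K'.
  split => //.
  - move=> X; have [gX|gX] := eqVneq (g X) +oo%E; first by apply: z0 => Y; rewrite /K' gX eqxx.
    by apply: (@le_lt_trans _ _ (g X)); [exact: inorm_le|rewrite ltey].
  - move=> Y; have [hY|hY] := eqVneq (h Y) +oo%E; first by apply: z0 => X; rewrite /K' hY eqxx andbF.
    by apply: (@le_lt_trans _ _ (h Y)); [exact: inorm_le|rewrite ltey].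
  - apply: le_lt_trans tK; apply: lint_le => X; first exact: inorm_ge0.
    exact: inorm_le.
have [s' _ q] := Q_all pK'.
have aeK : {ae mu, forall X, bint mu (K' X) = bint mu (K X)}.
  move: aeg; apply: filterS => X gX; apply: bint_ae.
  by move: aeh; apply: filterS => Y hY; rewrite /K' gX hY.
split.
  have [S hS] := good_integrable mE fE cE (outer_good pK' s').
  by exists S; exact: approx_ae aeK hS.
rewrite -(bint_ae aeK) q; apply: bint_ae; move: aeh; apply: filterS => Y hY; apply: bint_ae.
by move: aeg; apply: filterS => X gX; rewrite /K' gX hY.
Qed.

End fubini.

(** * The integrated form of a covariant representation *)

Lemma cvg_seq_cts (S T : topologicalType) (f : S -> T) (u : nat -> S) (x : S) : continuous f ->
  u k @[k --> \oo] --> x -> f (u k) @[k --> \oo] --> f x.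
Proof. by move=> cf ux; apply: continuous_cvg; [exact: cf|exact: ux]. Qed.

Lemma cvg_pair_seq (S T : topologicalType) (u : nat -> S) (v : nat -> T) (x : S) (y : T) :
  u k @[k --> \oo] --> x -> v k @[k --> \oo] --> y -> (u k, v k) @[k --> \oo] --> (x, y).
Proof. by move=> ux vy; exact: (cvg_pair ux vy). Qed.

Section smeas_operations.
Context {R : realType} d (T : measurableType d).

Lemma smeas_op (U V W : normedModType R[i]) (h : U -> V -> W) (F : T -> U) (G : T -> V) :
  (forall (u : nat -> U) (v : nat -> V) x y, u k @[k --> \oo] --> x -> v k @[k --> \oo] --> y ->
     h (u k) (v k) @[k --> \oo] --> h x y) ->
  smeas F -> smeas G -> smeas (fun p => h (F p) (G p)).
Proof.
move=> ch [s [fs cs]] [t [ft ct]]; exists (fun k p => h (s k p) (t k p)); split.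
  by move=> k; exact: fval_comp2.
by move=> p; exact: ch.
Qed.

Lemma smeas_opX m (V W : normedModType R[i]) (h : 'rV[R]_m -> V -> W) (u : T -> 'rV[R]_m) (G : T -> V) :
  (forall (a : nat -> 'rV[R]_m) (v : nat -> V) (x : 'rV[R]_m) y, a k @[k --> \oo] --> x -> v k @[k --> \oo] --> y ->
     h (a k) (v k) @[k --> \oo] --> h x y) ->
  measurable_fun setT u -> smeas G -> smeas (fun p => h (u p) (G p)).
Proof.
move=> ch mu [t [ft ct]]; exists (fun k p => h (rnd k (u p)) (t k p)); split.
  move=> k; have f1 : fval (fun p => rnd k (u p)) := fval_precomp (@fval_rnd R m k) mu.
  exact: (fval_comp2 h f1 (ft k)).
by move=> p; apply: ch; [exact: cvg_rnd|exact: ct].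
Qed.

End smeas_operations.

Lemma bochner_ae (R : realType) d (T : measurableType d) (mu : {measure set T -> \bar R})
    (V : normedModType R[i]) (F G : T -> V) :
  {ae mu, forall x, F x = G x} -> bochner_integrable mu F -> bochner_integrable mu G.
Proof. by move=> h [S hS]; exists S; exact: approx_ae h hS. Qed.

Lemma measurable_sub_rV (R : realType) m :
  measurable_fun setT (fun p : 'rV[R]_m * 'rV[R]_m => p.1 - p.2).
Proof.
apply: measurable_rVP => i.
rewrite (_ : (fun _ => _) = (fun p : 'rV[R]_m * 'rV[R]_m => p.1 ord0 i - p.2 ord0 i)); last by apply/funext => p; rewrite !mxE.
apply: measurable_funB.
  exact: (measurableT_comp (measurable_coord_rV i) measurable_fst).
exact: (measurableT_comp (measurable_coord_rV i) measurable_snd).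
Qed.

Lemma dX_sigma_finite (R : realType) n (Omega : 'M[R]_(2 * n)) : sigma_finite setT (dX Omega).
Proof.
exists (@cball R (2 * n)).
  by apply/seteqP; split => // X _; have [K hK] := cball_cover X; exists K => //; exact: hK.
by move=> k; split; [exact: measurable_cball|exact: cball_lty (haar_dX Omega) k].
Qed.

Definition dXs (R : realType) n (Omega : 'M[R]_(2 * n)) : {sigma_finite_measure set 'rV[R]_(2 * n) -> \bar R} :=
  HB.pack_for {sigma_finite_measure set 'rV[R]_(2 * n) -> \bar R} (dX Omega : set 'rV[R]_(2 * n) -> \bar R)
    (Measure.class (dX Omega))
    (@Measure_isSigmaFinite.Build _ _ _ (dX Omega) (dX_sigma_finite Omega)).

Section integrated_form.
Context {R : realType} {n : nat} {Omega : 'M[R]_(2 * n)}.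
Hypothesis hOmega : symplectic Omega.
Local Notation Xi := 'rV[R]_(2 * n).
Local Notation mu := (dX Omega).
Local Notation ka := (kappa Omega).
Local Notation half X := (2^-1 *: X).
Let hmu : haar mu := haar_dX Omega.
Let cR := @cplt_complex R.
Let mB := @measurable_cball R (2 * n).
Let fB := cball_lty hmu.
Let cB := @cball_cover R (2 * n).
Context {A : cstarAlgebra R} {Theta : Xi -> A -> A}.
Hypothesis hTheta : is_action Theta.
Let cA : cplt A := @cplt_complete R A.
Local Notation L1 := (@bochner_integrable R _ Xi mu A).

Lemma L1_lin (a : R[i]) F G : L1 F -> L1 G -> L1 (fun X => a *: F X + G X).
Proof.
move=> /integrable_good[F' gF eF] /integrable_good[G' gG eG].
have := good_integrable mB fB cB (good_lin a gF gG); apply: bochner_ae.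
by move: eF; apply: filterS2 eG => X -> ->.
Qed.

Let N1 : (-1 : R) != 0. Proof. by rewrite oppr_eq0 oner_neq0. Qed.

Lemma good_opp (V : normedModType R[i]) (F : Xi -> V) : good mu F -> good mu (fun X => F (- X)).
Proof.
move=> gF; have := good_affine hmu 0 N1 gF; congr good; apply/funext => X /=.
by rewrite scaleN1r addr0.
Qed.

Lemma bint_opp (V : normedModType R[i]) (F : Xi -> V) : cplt V -> good mu F ->
  bint mu (fun X => F (- X)) = bint mu F.
Proof.
move=> cV gF; have := bint_affine hmu 0 N1 cV gF.
rewrite normrN1 expr1n invr1 scale1r => <-; apply: eq_bint => X /=.
by rewrite scaleN1r addr0.
Qed.

Lemma good_star (F : Xi -> A) : good mu F -> good mu (conv_star F).
Proof.
move=> gF; have LZ : forall (t : R) (a : A), cstar ((t%:C)%C *: a) = (t%:C)%C *: cstar a.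
  by move=> t a; rewrite cstarZ conj_Creal ?complex_real.
have LC : forall a : A, rnorm (cstar a) <= 1 * rnorm a by move=> a; rewrite rnorm_star mul1r.
exact: (good_bounded (@cstarD R A) LZ LC (good_opp gF)).
Qed.

Lemma L1_star F : L1 F -> L1 (conv_star F).
Proof.
move=> /integrable_good[G gG eG]; have := good_integrable mB fB cB (good_star gG); apply: bochner_ae.
have := ae_affine hmu 0 N1 eG; apply: filterS => X; rewrite /conv_star scaleN1r addr0.
by move=> ->.
Qed.

Lemma act_cvg (u : nat -> Xi) (a : nat -> A) (X : Xi) b : u k @[k --> \oo] --> X -> a k @[k --> \oo] --> b ->
  Theta (u k) (a k) @[k --> \oo] --> Theta X b.
Proof.
move=> uX ab.
have h1 : Theta (u k) b @[k --> \oo] --> Theta X b.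
  have c : continuous (Theta ^~ b) by exact: act_cont.
  exact: (cvg_seq_cts c uX).
apply: (@cvg_squeeze_rnorm R A _ \oo _ _ _ (fun k => rnorm (a k - b) + rnorm (Theta (u k) b - Theta X b))).
  move=> k; have -> : Theta (u k) (a k) - Theta X b = Theta (u k) (a k - b) + (Theta (u k) b - Theta X b).
    by rewrite (linB (act_lin hTheta _)) addrA subrK.
  by rewrite (le_trans (rnormD _ _))// (rnorm_act hTheta).
rewrite -[X in _ --> X](addr0 0); apply: cvgD; exact/cvg_rnorm0P.
Qed.

Lemma measurable_half : measurable_fun setT (fun X : Xi => half X).
Proof.
have := measurable_affine_rV (2^-1 : R) (0 : Xi); congr measurable_fun.
by apply/funext => X; rewrite addr0.
Qed.

Section covariant.
Variables (H : hilbertSpace R) (r : A -> H -> H) (TT : Xi -> H -> H).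
Hypothesis hcov : is_covariant Omega Theta r TT.
Let cH : cplt H := @cplt_complete R H.

Let hr : is_star_rep r. Proof. by case: hcov => -[]. Qed.
Let T_lin X : linear (TT X). Proof. by case: hcov => _ /(_ X)[]. Qed.
Let T_ip X x y : ip (TT X x) (TT X y) = ip x y. Proof. by case: hcov => _ /(_ X)[]. Qed.
Let T_norm X x : rnorm (TT X x) = rnorm x.
Proof. by apply/eqP; rewrite -(@eqrXn2 _ 2)// ?rnorm_ge0// -!Re_ip T_ip. Qed.
Let T_mul X Y x : TT X (TT Y x) = ka Y X *: TT (X + Y) x. Proof. by case: hcov. Qed.
Let ka0 X Y : sform Omega X Y = 0 -> ka X Y = 1.
Proof. by move=> h; rewrite /kappa h mul0r oppr0 cis0. Qed.
Let T0 x : TT 0 x = x.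
Proof.
apply/eqP; rewrite -subr_eq0 -rnorm_eq0 -(T_norm 0) (linB (T_lin 0)) T_mul ka0; last exact: sformXX.
by rewrite scale1r addr0 subrr rnorm0.
Qed.
Let TNK X x : TT (- X) (TT X x) = x.
Proof. by rewrite T_mul ka0 ?addNr ?scale1r ?T0// sformNr (sformXX hOmega) oppr0. Qed.
Let T_cov Y g v : TT Y (r g v) = r (Theta Y g) (TT Y v).
Proof. by case: hcov => _ _ _ _ /(_ Y g (TT Y v)); rewrite TNK. Qed.
Let T_adj X x y : ip (TT X x) y = ip x (TT (- X) y).
Proof. by rewrite -(T_ip (- X)) TNK. Qed.

Let T_cvg (u : nat -> Xi) (v : nat -> H) (X : Xi) x : u k @[k --> \oo] --> X -> v k @[k --> \oo] --> x ->
  TT (u k) (v k) @[k --> \oo] --> TT X x.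
Proof.
move=> uX vx.
have h1 : TT (u k) x @[k --> \oo] --> TT X x.
  by case: hcov => _ _ /(_ x) c _ _; exact: (cvg_seq_cts c uX).
apply: (@cvg_squeeze_rnorm R H _ \oo _ _ _ (fun k => rnorm (v k - x) + rnorm (TT (u k) x - TT X x))).
  move=> k; have -> : TT (u k) (v k) - TT X x = TT (u k) (v k - x) + (TT (u k) x - TT X x).
    by rewrite (linB (T_lin _)) addrA subrK.
  by rewrite (le_trans (rnormD _ _))// T_norm.
rewrite -[X in _ --> X](addr0 0); apply: cvgD; exact/cvg_rnorm0P.
Qed.

Let r_cvg (a : nat -> A) (v : nat -> H) b x : a k @[k --> \oo] --> b -> v k @[k --> \oo] --> x ->
  r (a k) (v k) @[k --> \oo] --> r b x.
Proof.
move=> ab vx.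
apply: (@cvg_squeeze_rnorm R H _ \oo _ _ _ (fun k => rnorm (a k - b) * rnorm (v k) + rnorm b * rnorm (v k - x))).
  move=> k; have -> : r (a k) (v k) - r b x = r (a k - b) (v k) + r b (v k - x).
    by rewrite (repB hr) (linB (rep_lin hr _)) addrA subrK.
  by rewrite (le_trans (rnormD _ _))// lerD// (rep_contractive hr).
rewrite -[X in _ --> X](addr0 0); apply: cvgD.
  by rewrite -[X in _ --> X](mul0r (rnorm x)); apply: cvgM; [exact/cvg_rnorm0P|exact: cvg_rnorm].
by rewrite -[X in _ --> X](mulr0 (rnorm b)); apply: cvgMr; exact/cvg_rnorm0P.
Qed.

Definition intg (a : A) (X : Xi) (x : H) : H := r (Theta (half X) a) (TT X x).

Lemma intg_smeas d (T : measurableType d) (F : T -> A) (u : T -> Xi) (v : T -> H) :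
  smeas F -> measurable_fun setT u -> smeas v -> smeas (fun p => intg (F p) (u p) (v p)).
Proof.
move=> sF mu' sv; apply: (smeas_op r_cvg).
  apply: (smeas_opX act_cvg) => //; exact: measurableT_comp measurable_half mu'.
exact: (smeas_opX T_cvg).
Qed.

Lemma intg_le a X x : rnorm (intg a X x) <= rnorm a * rnorm x.
Proof. by rewrite (le_trans (rep_contractive hr _ _))// (rnorm_act hTheta) T_norm. Qed.

Lemma intgL (c : R[i]) a X x y : intg a X (c *: x + y) = c *: intg a X x + intg a X y.
Proof. by rewrite /intg T_lin (rep_lin hr). Qed.

Lemma intgLa (c : R[i]) a b X x : intg (c *: a + b) X x = c *: intg a X x + intg b X x.
Proof. by rewrite /intg (act_lin hTheta) (repD hr) (repZ hr). Qed.

Lemma intg_good F x : good mu F -> good mu (fun X => intg (F X) X x).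
Proof.
move=> gF; have [sF iF] := gF; split.
  apply: (intg_smeas (u := fun X => X) sF); [exact: measurable_id|exact: fval_smeas (fval_cst x)].
apply: (@le_lt_trans _ _ (inorm mu (fun X => ((rnorm x)%:C)%C *: F X))).
  by apply: inorm_le => X; rewrite rnormZr ger0_norm ?rnorm_ge0// mulrC intg_le.
by rewrite inormZ// lte_mul_pinfty// lee_fin rnorm_ge0.
Qed.

Definition intform (F : Xi -> A) (x : H) : H := bint mu (fun X => intg (F X) X x).

Lemma intform_ae F G : {ae mu, forall X, F X = G X} -> intform F = intform G.
Proof. by move=> h; apply/funext => x; apply: bint_ae; apply: filterS h => X ->. Qed.

Let intform_lin_good F : good mu F -> linear (intform F).
Proof.
move=> gF a x y; apply: etrans (bint_haar_lin cH a (intg_good x gF) (intg_good y gF)).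
by apply: (@eq_bint R _ _ mu H) => X; exact: intgL.
Qed.

Let intform_bd_good F x : good mu F -> rnorm (intform F x) <= fine (inorm mu F) * rnorm x.
Proof.
move=> gF; have [sF fF] := gF; rewrite -lee_fin EFinM fineK ?ge0_fin_numE ?inorm_ge0//.
apply: le_trans (bint_le mB fB cB cH (intg_good x gF)) _.
rewrite muleC -[rnorm x]ger0_norm ?rnorm_ge0// -(@rnorm_real R) -inormZ//.
by apply: inorm_le => X; rewrite rnormZr ger0_norm ?rnorm_ge0// mulrC intg_le.
Qed.

Lemma intform_bounded F : L1 F -> bounded_operator (intform F).
Proof.
move=> /integrable_good[G gG eG]; rewrite (intform_ae eG); have lG := intform_lin_good gG; split => //.
apply: (real_bounded_continuous (C := fine (inorm mu G))).
- exact: (linD lG).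
- by move=> t x; exact: (linZ lG).
- by move=> x; exact: intform_bd_good.
Qed.

Lemma intform_linF (a : R[i]) F G x : L1 F -> L1 G ->
  intform (fun X => a *: F X + G X) x = a *: intform F x + intform G x.
Proof.
move=> /integrable_good[F' gF eF] /integrable_good[G' gG eG].
rewrite (intform_ae eF) (intform_ae eG) (@intform_ae _ (fun X => a *: F' X + G' X)); last first.
  by move: eF; apply: filterS2 eG => X -> ->.
apply: etrans (bint_haar_lin cH a (intg_good x gF) (intg_good x gG)).
by apply: (@eq_bint R _ _ mu H) => X; exact: intgLa.
Qed.

Lemma intform_adj F : L1 F -> is_adjoint (intform (conv_star F)) (intform F).
Proof.
move=> /integrable_good[G gG eG]; rewrite (intform_ae eG) (@intform_ae (conv_star F) (conv_star G)); last first.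
  by have := ae_affine hmu 0 N1 eG; apply: filterS => X; rewrite /conv_star scaleN1r addr0 => ->.
move=> x y.
have ipL (z : H) (Phi : Xi -> H) : good mu Phi -> good mu (fun X => ip z (Phi X) : R[i]^o) /\
    bint mu (fun X => ip z (Phi X) : R[i]^o) = ip z (bint mu Phi).
  move=> gP; have zD : forall u v, (ip z (u + v) : R[i]^o) = ip z u + ip z v by move=> u v; exact: ipDr.
  have zZ : forall (t : R) u, (ip z ((t%:C)%C *: u) : R[i]^o) = (t%:C)%C *: (ip z u : R[i]^o) by move=> t u; exact: ipZr.
  have zb : forall u, rnorm (ip z u : R[i]^o) <= rnorm z * rnorm u by move=> u; exact: ip_CS.
  split; first exact: (good_bounded zD zZ zb gP).
  exact: (@bint_bounded R _ _ mu H R[i]^o _ mB fB cB cH cR _ _ zD zZ zb _ gP).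
have [g1 e1] := ipL y _ (intg_good x (good_star gG)).
have [g2 e2] := ipL x _ (intg_good y gG).
rewrite ip_conj -[ip y (intform _ x)]e1 -[ip x (intform G y)]e2.
apply: etrans (bint_opp cR g2).
have cD : forall u v : R[i]^o, ((u + v)^* : R[i]^o) = u^* + v^* by move=> u v; exact: rmorphD.
have cZ : forall (t : R) (u : R[i]^o), (((t%:C)%C *: u)^* : R[i]^o) = (t%:C)%C *: (u^* : R[i]^o).
  by move=> t u; rewrite [LHS]rmorphM/= conj_Creal ?complex_real.
have cC : forall u : R[i]^o, rnorm (u^* : R[i]^o) <= 1 * rnorm u by move=> u; rewrite rnorm_conj mul1r.
apply: etrans (esym (@bint_bounded R _ _ mu R[i]^o R[i]^o _ mB fB cB cR cR _ _ cD cZ cC _ g1)) _.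
apply: (@eq_bint R _ _ mu R[i]^o) => X /=.
rewrite -ip_conj /intg /conv_star (act_star hTheta) (rep_adj hr) T_adj T_cov -(actD hTheta).
by rewrite scalerN; congr (ip x (r (Theta _ _) _)); rewrite {1}(half_split X) opprD addrNK.
Qed.

Lemma conv_ae F F' G G' : {ae mu, forall X, F X = F' X} -> {ae mu, forall X, G X = G' X} ->
  conv Omega Theta F G = conv Omega Theta F' G'.
Proof.
move=> eF eG; apply/funext => X; rewrite /conv; apply: bint_ae.
have := ae_affine hmu X N1 eG; move: eF; apply: filterS2 => Y -> h.
have -> : X - Y = -1 *: Y + X by rewrite scaleN1r addrC.
by rewrite h.
Qed.

Let convK (F G : Xi -> A) X Y := ka X Y *: cmul (Theta (half (Y - X)) (F Y)) (Theta (half Y) (G (X - Y))).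

Let sub_meas : measurable_fun setT (fun p : Xi * Xi => p.1 - p.2) := @measurable_sub_rV R (2 * n).

(** Tonelli's theorem and translation invariance bound the double integral by c |F|_1 |G|_1, as for
    an ordinary convolution. *)
Let prod_fin (F G : Xi -> A) (W : normedModType R[i]) (K : Xi -> Xi -> W) (c : R) : good mu F -> good mu G ->
  0 <= c -> (forall X Y, rnorm (K X Y) <= c * (rnorm (F Y) * rnorm (G (X - Y)))) ->
  (\int[mu]_X inorm mu (K X) < +oo)%E.
Proof.
move=> gF gG c0 hK; have [sF fF] := gF; have [sG fG] := gG.
pose f (p : Xi * Xi) := (c * (rnorm (F p.2) * rnorm (G (p.1 - p.2))))%:E.
have f0 p : (0 <= f p)%E by rewrite lee_fin !mulr_ge0 ?rnorm_ge0.
have mf : measurable_fun setT f.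
  apply/measurable_EFinP; apply: measurable_funM; first exact: measurable_cst.
  apply: measurable_funM; first exact: (smeas_rnorm (smeas_precomp sF measurable_snd)).
  exact: (smeas_rnorm (smeas_precomp sG sub_meas)).
apply: (@le_lt_trans _ _ (\int[mu]_X \int[mu]_Y f (X, Y))%E).
  apply: lint_le => X; first exact: inorm_ge0.
  by apply: lint_le => Y; rewrite lee_fin ?rnorm_ge0//; exact: hK.
rewrite (tonelli (dXs Omega) mf f0).
have fGn : inorm mu G = (fine (inorm mu G))%:E by rewrite fineK// ge0_fin_numE// inorm_ge0.
have E Y : (\int[mu]_X f (X, Y))%E = (rnorm (((c * fine (inorm mu G))%:C)%C *: F Y))%:E.
  have tr := integral_affine hmu (- Y) (oner_neq0 R) (smeas_ernorm sG) (fun x => _ : (0 <= (rnorm (G x))%:E)%E).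
  rewrite /f /=; under eq_integral do rewrite mulrA EFinM.
  rewrite ge0_integralZl//; first last.
  - by rewrite lee_fin mulr_ge0 ?rnorm_ge0.
  - by move=> X _; rewrite lee_fin rnorm_ge0.
  - have mY : measurable_fun setT (fun X : Xi => X - Y).
      by have := measurable_affine_rV 1 (- Y); congr measurable_fun; apply/funext => X; rewrite scale1r.
    exact: (smeas_ernorm (smeas_precomp sG mY)).
  have -> : (\int[mu]_X (rnorm (G (X - Y)))%:E = inorm mu G)%E.
    rewrite /inorm; have := tr (fun x => _); rewrite normr1 expr1n invr1 mul1e => <-; last by move=> x; rewrite lee_fin rnorm_ge0.
    by apply: eq_integral => X _; rewrite scale1r.
  by rewrite rnormZr ger0_norm ?mulr_ge0 ?fine_ge0 ?inorm_ge0// fGn -EFinM mulrAC.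
under eq_integral do rewrite E.
by rewrite -/(inorm mu _) inormZ// lte_mul_pinfty// lee_fin rnorm_ge0.
Qed.

Let ka_smeas : smeas (fun p : Xi * Xi => ka p.1 p.2 : R[i]^o).
Proof.
exists (fun k p => ka (rnd k p.1) (rnd k p.2)); split.
  move=> k; have f1 : fval (fun p : Xi * Xi => rnd k p.1) := fval_precomp (@fval_rnd R _ k) measurable_fst.
  have f2 : fval (fun p : Xi * Xi => rnd k p.2) := fval_precomp (@fval_rnd R _ k) measurable_snd.
  exact: (fval_comp2 (fun X Y => ka X Y : R[i]^o) f1 f2).
move=> [X Y]; have cf : continuous (fun q : Xi * Xi => cis (- (sform Omega q.1 q.2 / 2)) : R[i]^o).
  apply: cts_cis => q; apply: cvgN; apply: cvgMl; apply: continuous_sform2.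
    by move=> z; exact: cvg_fst.
  by move=> z; exact: cvg_snd.
have := cvg_seq_cts (u := fun k => (rnd k X, rnd k Y)) (x := (X, Y)) cf; apply.
by apply: cvg_pair_seq; exact: cvg_rnd.
Qed.

Let convK_smeas F G : smeas F -> smeas G -> smeas (fun p : Xi * Xi => convK F G p.1 p.2).
Proof.
move=> sF sG.
have m1 : measurable_fun setT (fun p : Xi * Xi => half (p.2 - p.1)).
  apply: (measurableT_comp measurable_half); apply: (measurableT_comp sub_meas (g := fun p : Xi * Xi => (p.2, p.1))).
  exact: measurable_fun_pair measurable_snd measurable_fst.
have m2 : measurable_fun setT (fun p : Xi * Xi => half p.2) := measurableT_comp measurable_half measurable_snd.
have s1 := smeas_opX act_cvg m1 (smeas_precomp sF measurable_snd).
have s2 := smeas_opX act_cvg m2 (smeas_precomp sG sub_meas).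
have s3 : smeas (fun p : Xi * Xi => cmul (Theta (half (p.2 - p.1)) (F p.2)) (Theta (half p.2) (G (p.1 - p.2)))).
  by apply: (smeas_op _ s1 s2) => u v x y; exact: cvg_cmul.
by apply: (smeas_op (h := fun (z : R[i]^o) (a : A) => z *: a) _ ka_smeas s3) => u v x y; exact: cvgZc.
Qed.

Let convK_le F G X Y : rnorm (convK F G X Y) <= 1 * (rnorm (F Y) * rnorm (G (X - Y))).
Proof. by rewrite rnormZ rnorm_cis !mul1r (le_trans (rnormM_le _ _))// !(rnorm_act hTheta). Qed.

Lemma L1_conv F G : L1 F -> L1 G -> L1 (conv Omega Theta F G).
Proof.
move=> /integrable_good[F' gF eF] /integrable_good[G' gG eG]; rewrite (conv_ae eF eG).
have [sF _] := gF; have [sG _] := gG.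
have tK := prod_fin gF gG ler01 (convK_le F' G').
by have [h _] := fubini_bint (mu := dXs Omega) cA mB fB cB (convK_smeas sF sG) tK.
Qed.

(** Both sides are iterated integrals of the same kernel, in opposite orders; the inner variable is
    translated by Y to recover the integrated form of the second function. *)
Lemma intform_conv F G x : L1 F -> L1 G -> intform (conv Omega Theta F G) x = intform F (intform G x).
Proof.
move=> /integrable_good[F' gF eF] /integrable_good[G' gG eG].
rewrite (conv_ae eF eG) (intform_ae eF) (intform_ae eG) => {F G eF eG}.
have [sF _] := gF; have [sG _] := gG.
pose L X Y := intg (F' Y) Y (intg (G' (X - Y)) (X - Y) x).
have tK := prod_fin gF gG ler01 (convK_le F' G').
have sL : smeas (fun p : Xi * Xi => L p.1 p.2).
  have s0 : smeas (fun X => intg (G' X) X x).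
    by apply: (intg_smeas (u := fun X => X) sG); [exact: measurable_id|exact: fval_smeas (fval_cst x)].
  have s1 := smeas_precomp s0 sub_meas.
  exact: (intg_smeas (smeas_precomp sF measurable_snd) measurable_snd s1).
have tL : (\int[mu]_X inorm mu (L X) < +oo)%E.
  apply: (prod_fin gF gG (rnorm_ge0 x)) => X Y.
  rewrite (le_trans (intg_le _ _ _))// mulrCA ler_wpM2l ?rnorm_ge0// mulrC.
  exact: intg_le.
have [_ fub] := fubini_bint (mu := dXs Omega) cH mB fB cB sL tL.
(* Covariance moves T(Y) past the second operator, T(Y) T(X - Y) = kappa(X - Y, Y) T(X), and kappa(X
   - Y, Y) = kappa(X, Y) because the form is alternating; the half-translations then match. *)
have ptw X Y : intg (convK F' G' X Y) X x = L X Y.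
  have XE : Y + (X - Y) = X by rewrite addrC subrK.
  rewrite /L /intg T_cov T_mul XE (linZ (rep_lin hr _)) (linZ (rep_lin hr _)).
  rewrite /convK (linZ (act_lin hTheta _)) (repZ hr) (act_mul hTheta) (repM hr) -!(actD hTheta).
  have -> : half X + half (Y - X) = half Y by rewrite -scalerDr addrC subrK.
  have -> : half X + half Y = Y + half (X - Y).
    by rewrite {2}(half_split Y) scalerBr addrCA -!addrA [half Y + _]addrCA subrr addr0 addrC.
  by congr (_ *: _); rewrite /kappa sformBl (sformXX hOmega) subr0.
have e1 : intform (conv Omega Theta F' G') x = bint mu (fun X => bint mu (L X)).
  apply: bint_ae; have := ae_inorm_fin (mu := dXs Omega) (convK_smeas sF sG) tK; apply: filterS => X fX.
  have gX : good mu (convK F' G' X).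
    split; last by rewrite ltey.
    apply: (smeas_precomp (convK_smeas sF sG) (g := fun Y => (X, Y))).
    by apply: measurable_fun_pair; [exact: measurable_cst|exact: measurable_id].
  have lX : linear (fun a => intg a X x) by move=> c a b; exact: intgLa.
  have LZ : forall (t : R) a, intg ((t%:C)%C *: a) X x = (t%:C)%C *: intg a X x by move=> t a; exact: (linZ lX).
  have LC : forall a, rnorm (intg a X x) <= rnorm x * rnorm a by move=> a; rewrite mulrC intg_le.
  apply: etrans (esym (bint_bounded mB fB cB cA cH (linD lX) LZ LC gX)) _.
  by apply: (@eq_bint R _ _ mu H) => Y; exact: ptw.
rewrite e1; apply: etrans fub _; apply: (@eq_bint R _ _ mu H) => Y.
have gg := intg_good x gG.
have lY : linear (intg (F' Y) Y) by move=> c u v; exact: intgL.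
have LZ : forall (t : R) u, intg (F' Y) Y ((t%:C)%C *: u) = (t%:C)%C *: intg (F' Y) Y u by move=> t u; exact: (linZ lY).
have gt := good_translate (- Y) gg.
apply: etrans (bint_bounded mB fB cB cH cH (linD lY) LZ (intg_le (F' Y) Y) gt) _.
by apply: (congr1 (intg (F' Y) Y)); exact: (bint_haar_translate cH (- Y) gg).
Qed.

Lemma intform_rep : L1_rep Omega Theta intform.
Proof.
split.
- exact: intform_bounded.
- by move=> F G _ _; exact: intform_ae.
- exact: intform_linF.
- exact: intform_conv.
- exact: intform_adj.
Qed.

End covariant.
End integrated_form.

Lemma small_eq0V (R : realType) (V : normedModType R[i]) (v : V) (M : R) :
  (forall e, 0 < e -> e <= 1 -> rnorm v <= e * M) -> v = 0.
Proof.
move=> h; apply/eqP; rewrite -rnorm_eq0; apply/eqP.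
suff : ((rnorm v)%:C)%C = 0 :> R[i] by case.
by apply: (@small_eq0 R _ M) => e e0 e1; rewrite rnorm_real ger0_norm ?rnorm_ge0// h.
Qed.

(** * Extension of the integrated form to the enveloping algebra *)

Section extension.
Context {R : realType} {n : nat} {Omega : 'M[R]_(2 * n)}.
Hypothesis hOmega : symplectic Omega.
Local Notation Xi := 'rV[R]_(2 * n).
Local Notation mu := (dX Omega).
Context {A : cstarAlgebra R} {Theta : Xi -> A -> A}.
Hypothesis hTheta : is_action Theta.
Local Notation L1 := (@bochner_integrable R _ Xi mu A).
Variables (C : cstarAlgebra R) (j : (Xi -> A) -> C).
Hypothesis hC : is_crossed_product Omega Theta j.
Variables (H : hilbertSpace R) (r : A -> H -> H) (TT : Xi -> H -> H).
Hypothesis hcov : is_covariant Omega Theta r TT.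
Local Notation phi := (@intform R n Omega A Theta H r TT).
Let hphi : L1_rep Omega Theta phi := intform_rep hOmega hTheta hcov.
Let cH : cplt H := @cplt_complete R H.

Let phi_lin F : L1 F -> linear (phi F). Proof. by move=> lF; case: hphi => /(_ F lF)[]. Qed.

Let phi_le F x : L1 F -> rnorm (phi F x) <= rnorm (j F) * rnorm x.
Proof.
move=> lF; apply: (opnorm_ge (phi_lin lF)); case: hC => _ /(_ F lF) -> _.
by apply: ereal_sup_ubound; exists H, phi.
Qed.

Let phi_dist F G x : L1 F -> L1 G -> rnorm (phi F x - phi G x) <= rnorm (j F - j G) * rnorm x.
Proof.
move=> lF lG; case: hphi => _ _ h _ _; case: hC => -[_ hj _ _] _ _.
have := phi_le x (L1_lin (-1) lG lF); rewrite h// hj// !scaleN1r.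
by rewrite addrC [- j G + _]addrC.
Qed.

Let dens c e : 0 < e -> exists2 F, L1 F & rnorm (j F - c) <= e.
Proof.
move=> e0; have : closure (j @` L1) c by case: hC => _ _ ->.
have e1 : 0 < ((e%:C)%C : R[i]) by rewrite ltcR.
move=> /(_ _ (nbhsx_ballx c _ e1))[_ [[F lF <-]]].
rewrite -ball_normE /ball_/= normr_rnorm ltcR => h; exists F => //.
by rewrite rnormB ltW.
Qed.

(** The extension as an explicit estimate: every integrable function whose image is within e of c
    acts within e of S. Each algebraic identity then follows by one approximation. *)
Let ext_spec c (S : H -> H) := forall F e, L1 F -> rnorm (j F - c) <= e ->
  forall x, rnorm (phi F x - S x) <= e * rnorm x.

Let ext_ex c : exists S, ext_spec c S.
Proof.
have iv (k : nat) : 0 < (k.+1%:R^-1 : R) by rewrite invr_gt0.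
have /choice[F hF] : forall k : nat, exists F, L1 F /\ rnorm (j F - c) <= k.+1%:R^-1.
  by move=> k; have [F lF h] := dens c (iv k); exists F.
have small (e : R) : 0 < e -> exists K, forall k, (K <= k)%N -> (k.+1%:R^-1 : R) <= e.
  move=> e0; exists (Num.truncn e^-1) => k Kk.
  rewrite -[e]invrK lef_pV2 ?posrE ?invr_gt0//.
  by apply: ltW; apply: (lt_le_trans (truncnS_gt _)); rewrite ler_nat.
have nF G (k : nat) : rnorm (j G - j (F k)) <= rnorm (j G - c) + k.+1%:R^-1.
  have -> : j G - j (F k) = (j G - c) - (j (F k) - c) by rewrite opprB addrA subrK.
  by rewrite (le_trans (rnormD _ _))// rnormN lerD2l; case: (hF k).
have /choice[S hS] : forall x : H, exists l : H, phi (F k) x @[k --> \oo] --> l.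
  move=> x; apply: cH => e e0; pose d := e / (2 * (rnorm x + 1)).
  have x1 : 0 < rnorm x + 1 by rewrite ltr_wpDl ?rnorm_ge0.
  have d0 : 0 < d by rewrite divr_gt0// mulr_gt0.
  have de : d * (2 * (rnorm x + 1)) = e by rewrite divfK// gt_eqF// mulr_gt0.
  have [K hK] := small d d0; exists K => k m Kk Km.
  apply: le_trans (phi_dist x (hF k).1 (hF m).1) _.
  have h2 : rnorm (j (F k) - j (F m)) <= 2 * d.
    apply: le_trans (nF _ m) _; rewrite mulr_natl mulr2n lerD// ?hK//.
    by apply: le_trans (hF k).2 _; exact: hK.
  apply: le_trans (ler_wpM2r (rnorm_ge0 x) h2) _; lra.
exists S => G e lG hG x; apply/ler_addgt0Pr => t t0; pose d := t / (rnorm x + 1).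
have x1 : 0 < rnorm x + 1 by rewrite ltr_wpDl ?rnorm_ge0.
have d0 : 0 < d by rewrite divr_gt0.
have de : d * (rnorm x + 1) = t by rewrite divfK// gt_eqF.
have [K hK] := small d d0.
apply: (@rnorm_cvg_le R H _ \oo _ (fun k => phi G x - phi (F k) x)).
  exists K => // k Kk; apply: le_trans (phi_dist x lG (hF k).1) _.
  have h2 : rnorm (j G - j (F k)) <= e + d by apply: le_trans (nF _ k) _; rewrite lerD// hK.
  apply: le_trans (ler_wpM2r (rnorm_ge0 x) h2) _; lra.
by apply: cvgB; [exact: cvg_cst|exact: hS].
Qed.

(** The integrated form is one of the representations in the supremum defining the enveloping norm,
    so it is contractive for that norm. Linearity, products and adjoints are carried over within an
    error proportional to e. *)
Theorem integrated_form_ex : exists psi : C -> H -> H, is_integrated_form Omega Theta j r TT psi.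
Proof.
have /choice[psi hpsi] := ext_ex; exists psi.
case: (hC) => -[_ jL jM jS] _ _; case: (hphi) => _ _ pL pM pA.
have bd c x : rnorm (psi c x) <= (rnorm c + 2) * rnorm x.
  have [F lF hF] := dens c ltr01; have h := hpsi c F 1 lF hF x.
  have -> : psi c x = phi F x - (phi F x - psi c x) by rewrite subKr.
  rewrite (le_trans (rnormD _ _))// rnormN.
  have h1 := phi_le x lF.
  have h2 : rnorm (j F) <= rnorm c + 1 by have := ler_rnormB (j F) c; lra.
  have := ler_wpM2r (rnorm_ge0 x) h2; lra.
have zid (V : zmodType) (s p q u w : V) : s - (u + w) = - (p + q - s) + (p - u) + (q - w).
  by rewrite opprB -addrA [(p - u) + _]addrACA -opprD addrA subrK.
have zid2 (V : zmodType) (s t p q : V) : s - t = - (p - s) + ((p - q) + (q - t)).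
  by rewrite opprB !addrA !subrK.
have lin c : linear (psi c).
  move=> a x y; apply/eqP; rewrite -subr_eq0; apply/eqP.
  apply: (small_eq0V (M := rnorm (a *: x + y) + rnorm (a : R[i]^o) * rnorm x + rnorm y)) => e e0 _.
  have [F lF hF] := dens c e0; have h := hpsi c F e lF hF.
  have -> : psi c (a *: x + y) - (a *: psi c x + psi c y) =
      - (phi F (a *: x + y) - psi c (a *: x + y)) + a *: (phi F x - psi c x) + (phi F y - psi c y).
    by rewrite (phi_lin lF) scalerBr; exact: zid.
  rewrite (le_trans (rnormD _ _))// [leRHS]mulrDr lerD// (le_trans (rnormD _ _))// [leRHS]mulrDr lerD//; first by rewrite rnormN.
  by rewrite rnormZ mulrCA ler_wpM2l ?rnorm_ge0.
split; last first.
  move=> G x lG; have := hpsi (j G) G 0 lG; rewrite subrr rnorm0 => /(_ (lexx _) x).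
  by rewrite mul0r => h; apply/eqP; rewrite eq_sym -subr_eq0 -rnorm_eq0 eq_le h rnorm_ge0.
split.
- move=> c; split; first exact: lin.
  apply: (real_bounded_continuous (C := rnorm c + 2)).
  + exact: (linD (lin c)).
  + by move=> t x; exact: (linZ (lin c)).
  + exact: bd.
- move=> a c d x; apply/eqP; rewrite -subr_eq0; apply/eqP.
  apply: (small_eq0V (M := (rnorm (a : R[i]^o) + 1) * rnorm x + (rnorm (a : R[i]^o) * rnorm x + rnorm x))) => e e0 _.
  have [F lF hF] := dens c e0; have [G lG hG] := dens d e0.
  have hK : rnorm (j (fun X => a *: F X + G X) - (a *: c + d)) <= (rnorm (a : R[i]^o) + 1) * e.
    rewrite jL// opprD addrACA -scalerBr (le_trans (rnormD _ _))// rnormZ mulrDl mul1r lerD//.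
    by rewrite ler_wpM2l ?rnorm_ge0.
  have h1 := hpsi _ _ _ (L1_lin a lF lG) hK x; have h2 := hpsi c F e lF hF x; have h3 := hpsi d G e lG hG x.
  have -> : psi (a *: c + d) x - (a *: psi c x + psi d x) =
      - (phi (fun X => a *: F X + G X) x - psi (a *: c + d) x) + (a *: (phi F x - psi c x) + (phi G x - psi d x)).
    by rewrite pL// scalerBr [RHS]addrA; exact: zid.
  rewrite (le_trans (rnormD _ _))// [leRHS]mulrDr lerD//; first by rewrite rnormN mulrA [e * _]mulrC.
  rewrite (le_trans (rnormD _ _))// [leRHS]mulrDr lerD//.
  by rewrite rnormZ mulrCA ler_wpM2l ?rnorm_ge0.
- move=> c d x; apply/eqP; rewrite -subr_eq0; apply/eqP.
  (* Products are not uniformly continuous; taking e <= 1 bounds the approximants by |c| + 1 and |d|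
     + 1, which keeps the error linear in e. *)
  apply: (small_eq0V (M := (rnorm d + 1 + rnorm c) * rnorm x + ((rnorm c + 1) * rnorm x + rnorm (psi d x)))) => e e0 e1.
  have [F lF hF] := dens c e0; have [G lG hG] := dens d e0.
  have nF : rnorm (j F) <= rnorm c + 1 by have := ler_rnormB (j F) c; lra.
  have nG : rnorm (j G) <= rnorm d + 1 by have := ler_rnormB (j G) d; lra.
  have hK : rnorm (j (conv Omega Theta F G) - cmul c d) <= e * (rnorm d + 1 + rnorm c).
    rewrite jM//; have -> : cmul (j F) (j G) - cmul c d = cmul (j F - c) (j G) + cmul c (j G - d).
      by rewrite cmulBl cmulBr addrA subrK.
    rewrite (le_trans (rnormD _ _))// mulrDr lerD// (le_trans (rnormM_le _ _))//.
      by apply: ler_pM; rewrite ?rnorm_ge0.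
    by rewrite mulrC ler_wpM2r ?rnorm_ge0.
  have h1 := hpsi _ _ _ (L1_conv hTheta lF lG) hK x; have h2 := hpsi c F e lF hF (psi d x); have h3 := hpsi d G e lG hG x.
  have -> : psi (cmul c d) x - psi c (psi d x) =
      - (phi (conv Omega Theta F G) x - psi (cmul c d) x) + (phi F (phi G x - psi d x) + (phi F (psi d x) - psi c (psi d x))).
    by rewrite (pM _ _ _ lF lG) (linB (phi_lin lF)); exact: zid2.
  rewrite (le_trans (rnormD _ _))// [leRHS]mulrDr lerD//; first by rewrite rnormN mulrA.
  rewrite (le_trans (rnormD _ _))// [leRHS]mulrDr lerD//.
  apply: le_trans (phi_le _ lF) _; rewrite mulrCA; apply: ler_pM; rewrite ?rnorm_ge0//.
- move=> c x y; apply/eqP; rewrite -subr_eq0; apply/eqP.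
  apply: (@small_eq0 R _ (rnorm x * rnorm y + rnorm x * rnorm y)) => e e0 _.
  have [F lF hF] := dens c e0.
  have hK : rnorm (j (conv_star F) - cstar c) <= e by rewrite jS// -cstarB rnorm_star.
  have h1 := hpsi _ _ _ (L1_star lF) hK x; have h2 := hpsi c F e lF hF y.
  have -> : ip (psi (cstar c) x) y - ip x (psi c y) =
     - ip (phi (conv_star F) x - psi (cstar c) x) y + ip x (phi F y - psi c y).
    by rewrite ipBl ipBr (pA _ lF) opprB addrA subrK.
  rewrite (le_trans (rnormD (_ : R[i]^o) _))// [leRHS]mulrDr lerD//.
    rewrite (@rnormN R R[i]^o) (le_trans (ip_CS _ _))// mulrA ler_wpM2r ?rnorm_ge0//.
  by rewrite (le_trans (ip_CS _ _))// mulrCA ler_wpM2l ?rnorm_ge0.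
Qed.

End extension.

(** Riemann sums with nonnegative coefficients are positive, and the limit stays in the cone,
    because a single norm bound can serve as the witness s for all the sums. *)
Lemma pos_bint (R : realType) m (mu : {measure set 'rV[R]_m -> \bar R}) (A : cstarAlgebra R) (F : 'rV[R]_m -> A) :
  haar mu -> nice F -> (forall X, exists c, F X = cmul (cstar c) c) -> pos (uin (bint mu F)).
Proof.
move=> hmu nF hF; have cA : cplt A := @cplt_complete R A.
have [N [a [y [a0 [hr _]]]]] := riemann hmu.
pose b k := \sum_i ((a k i)%:C)%C *: F (y k i).
have bc : b k @[k --> \oo] --> bint mu F by exact: hr.
have p0 : pos (uin (0 : A)) by have := @pos_cst R A 0 (lexx 0); rewrite rs0.
have pb k : pos (uin (b k)).
  rewrite /b; elim/big_ind: _ => //; first by move=> x z px pz; rewrite uinD; exact: posD.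
  by move=> i _; rewrite uinZ; apply: posZ => //; have [c ->] := hF (y k i); exact: pos_cstar_mul.
have sb k : cstar (b k) = b k by apply: uin_inj; rewrite -ustar_uin; case: (pb k).
pose t := rnorm (bint mu F) + 1.
have /cvg_seq_rnormP hb := bc.
have [K hK] := hb 1 ltr01.
have bt k : rnorm (b (K + k)%N) <= t.
  have -> : b (K + k)%N = bint mu F + (b (K + k)%N - bint mu F) by rewrite addrC subrK.
  by rewrite (le_trans (rnormD _ _))// lerD2l hK// leq_addr.
split.
  rewrite ustar_uin; congr uin; apply: (@cvg_uniq R A _ \oo _ b) => //.
  have -> : b = (fun k => cstar (b k)) by apply/funext => k; rewrite sb.
  exact: cvg_cstar.
exists t; first by rewrite addr_ge0 ?rnorm_ge0.
(* The shift by K keeps only the sums of norm at most t, for which t minus the sum has norm at most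
   t. *)
apply: (@ucv_nb R A (fun k => ucst ((t%:C)%C) - uin (b (K + k)%N))).
  by move=> k; apply: pos_nb; [exact: pb|rewrite nb_uin].
move=> e e0; have [L hL] := hb e e0; exists L => k Lk.
rewrite opprB addrC addrA subrK -uinN -uinD nb_uin rnormB hL//.
by rewrite (leq_trans Lk)// leq_addl.
Qed.

(** * Both norm formulas *)

Theorem proposition3p2 (R : realType) (n : nat) (Omega : 'M[R]_(2 * n))
    (hOmega : symplectic Omega)
    (A : cstarAlgebra R) (Theta : 'rV[R]_(2 * n) -> A -> A)
    (hTheta : is_action Theta)
    (B : cstarAlgebra R) (iota : A -> B)
    (hB : is_rieffel_algebra Omega Theta iota)
    (C : cstarAlgebra R) (j : ('rV[R]_(2 * n) -> A) -> C)
    (hC : is_crossed_product Omega Theta j) :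
  (forall (h : 'rV[R]_(2 * n) -> R[i]^o) (M : B -> C),
     is_window Omega h -> is_modulation_map Omega Theta iota j h M ->
     forall f : B,
       (rnorm f)%:E =
       ereal_sup [set x | exists (H : hilbertSpace R) (r : A -> H -> H)
                            (T : 'rV[R]_(2 * n) -> H -> H) (psi : C -> H -> H),
                            [/\ is_covariant Omega Theta r T,
                                is_integrated_form Omega Theta j r T psi &
                                x = opnorm (psi (M f))]]) /\
  (forall (K : hilbertSpace R) (rho : A -> K -> K),
     is_representation rho -> injective rho ->
     forall (H : hilbertSpace R) (cls : ('rV[R]_(2 * n) -> K) -> H)
       (r : A -> H -> H) (T : 'rV[R]_(2 * n) -> H -> H) (psi : C -> H -> H),
     is_L2 Omega cls -> is_induced Omega Theta cls rho r T ->
     is_integrated_form Omega Theta j r T psi ->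
     forall (h : 'rV[R]_(2 * n) -> R[i]^o) (M : B -> C),
     is_window Omega h -> is_modulation_map Omega Theta iota j h M ->
     forall f : B, (rnorm f)%:E = opnorm (psi (M f))).
Proof.
split; last first.
  move=> K rho [hrho _] inj H cls r T psi hL2 hind hint h M hw hM f.
  exact: (induced_isometric hOmega hTheta hrho inj hL2 hind hint hB hw hM).
move=> h M hw hM f; set S := [set x | _].
have [hM1 _] := hM; have Mc := morphism_contractive hM1.
have ub : ubound S (rnorm f)%:E.
  move=> _ [H [r [T [psi [_ [hpsi _] ->]]]]].
  apply: opnorm_le; last exact: rnorm_ge0.
  by move=> x; rewrite (le_trans (rep_contractive hpsi _ _))// ler_wpM2r ?rnorm_ge0.
have p0 : pos (uin (0 : A)) by have := @pos_cst R A 0 (lexx 0); rewrite rs0.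
pose I := {om : A -> R[i]^o | state om}.
pose P (i : I) := state_pre (Omega := Omega) (projT2 i).
pose rep (i : I) := state_rep (Omega := Omega) (Theta := Theta) (hom := projT2 i).
pose TT (i : I) := state_T (Omega := Omega) (hom := projT2 i).
have cov (i : I) : is_covariant Omega Theta (rep i) (TT i) := state_is_covariant hOmega hTheta (projT2 i).
have ex (i : I) := cid (integrated_form_ex hOmega hTheta hC (cov i)).
pose psi (i : I) := projT1 (ex i).
have hpsi (i : I) : is_integrated_form Omega Theta j (rep i) (TT i) (psi i) := projT2 (ex i).
have memS (i : I) : S (opnorm (psi i (M f))) 
  by exists (hilbert (P i)), (rep i), (TT i), (psi i); split; [exact: cov|exact: hpsi|].
(* A state exists even over the element 0, so the supremum is taken over a nonempty set and is
   nonnegative. *)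
have [om0 hom0 _] := state_ex p0; pose i0 : I := exist _ om0 hom0.
have sup0 : (0 <= ereal_sup S)%E by apply: le_trans (opnorm_ge0 _) (ereal_sup_ubound (memS i0)).
have le1 : (ereal_sup S <= (rnorm f)%:E)%E by apply: ge_ereal_sup.
apply/le_anti; rewrite le1 andbT.
have fin : ereal_sup S \is a fin_num by rewrite ge0_fin_numE//; apply: le_lt_trans le1 _; exact: ltry.
rewrite -(fineK fin) lee_fin.
apply: (@modulation_isometric R n Omega hOmega A Theta hTheta B iota hB C j h M hw hM I
  (fun i => hilbert (P i)) (fun i => @hvec R (P i)) (fun i => projT1 i) psi).
- by move=> i a F G; exact: state_hvecL.
- by move=> i F G; exact: state_ip_hvec.
- by move=> [om []].
- by move=> [om []].
- by move=> i; case: (hpsi i).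
- move=> i F G sF nG; case: (hpsi i) => _ /(_ F _ (sch_L1 sF)) ->.
  apply: (@eq_bint R _ _ (dX Omega) (hilbert (P i))) => Y.
  have nT : nice (tw (Omega := Omega) Y G) by exact: nice_tw.
  have eT : TT i Y (@hvec R (P i) G) = @hvec R (P i) (tw (Omega := Omega) Y G) by exact: state_T_hvec.
  have eR : rep i (Theta (2^-1 *: Y) (F Y)) (@hvec R (P i) (tw (Omega := Omega) Y G)) =
      @hvec R (P i) (rS (Theta := Theta) (Theta (2^-1 *: Y) (F Y)) (tw (Omega := Omega) Y G)) by exact: state_rep_hvec.
  apply: etrans (congr1 (rep i _) eT) _; apply: etrans eR _.
  apply: (congr1 (@hvec R (P i))); apply/funext => Z.
  by rewrite /rS /tw cmulZr (actD hTheta).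
(* The integral b of F^* F is positive, so some state attains its norm there; for that state the
   squared norm of the vector of F equals |b|. *)
- move=> F t nF t0 ht; set b := bint _ _.
  have pb : pos (uin b).
    by apply: pos_bint; [exact: haar_dX|exact: nice_star_mul|move=> X; exists (F X)].
  have [om hom omb] := state_ex pb; pose i : I := exist _ om hom.
  apply: le_trans (ht i); rewrite -Re_ip.
  have E := @state_ip_hvec R n Omega A (projT1 i) (projT2 i) F F nF nF.
  have omb' : projT1 i b = (rnorm b)%:C%C := omb.
  by rewrite [X in complex.Re X]E -/b omb'.
- exact: fine_ge0.
move=> i x; apply: opnorm_ge; first by case: (hpsi i) => hs _; exact: (rep_lin hs).
by rewrite fineK; [apply: ereal_sup_ubound; exact: memS|exact: fin].
Qed.
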